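(* Let $u(n)$ denote the number of unimodal sequences of size $n$ (with a distinguished peak, as defined in the context). Define the real constants $$A:=\frac{1}{8\cdot 3^{3/4}},\qquad B:=\frac{\pi}{144\cdot 3^{1/4}}-\frac{5\cdot 3^{3/4}}{128\pi},$$ $$C:=\frac{105\cdot 3^{1/4}}{4096\pi^{2}}+\frac{13\pi^{2}}{6912\cdot 3^{3/4}}-\frac{35}{768\cdot 3^{3/4}},$$ $$D:=-\frac{91\pi}{12288\cdot 3^{1/4}}+\frac{105\cdot 3^{3/4}}{8192\pi}+\frac{7\pi^{3}}{23328\cdot 3^{1/4}}+\frac{315\cdot 3^{3/4}}{65536\pi^{3}},$$ $$E:=\frac{7441\pi^{4}}{35831808\cdot 3^{3/4}}-\frac{77\pi^{2}}{13824\cdot 3^{3/4}}+\frac{5005}{131072\cdot 3^{3/4}}-\frac{1155\cdot 3^{1/4}}{131072\pi^{2}}+\frac{31185\cdot 3^{1/4}}{4194304\pi^{4}}.$$ Then for every integer $n\ge 100\,000$, $$u(n)=\frac{e^{2\pi\sqrt{n/3}}}{n^{5/4}}\left(A+\frac{B}{\sqrt n}+\frac{C}{n}+\frac{D}{n^{3/2}}+\frac{E}{n^{2}}+O_{\le 478}\left(\frac{1}{n^{5/2}}\right)\right).$$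
   Context: For an integer $n\ge 1$, $u(n)$ is the number of unimodal sequences of size $n$, i.e. the number of choices of $r,s\in\mathbb{N}_0=\{0,1,2,\dots\}$ and positive integers $a_1,\dots,a_r,c,b_1,\dots,b_s$ with $$1\le a_1\le\dots\le a_r\le c\ge b_s\ge\dots\ge b_1\ge 1,\qquad \sum_{j=1}^r a_j+c+\sum_{j=1}^s b_j=n.$$ The peak $c$ is distinguished (the data $(a_1,\dots,a_r;c;b_1,\dots,b_s)$ is counted, not just the underlying sequence). Equivalently, with $u(0):=1$, $\sum_{n\ge0}u(n)q^n=\sum_{n\ge 0}\frac{q^n}{(q;q)_n^2}$, where $(q;q)_n=\prod_{j=1}^n(1-q^j)$. Notation: $f(n)=O_{\le c}(g(n))$ means $|f(n)|\le c|g(n)|$ (for every $n$ in the stated range). *)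

(* Defs.v *)
From mathcomp Require Import all_boot finmap.
From mathcomp Require Import boolp classical_sets functions cardinality.
From Stdlib Require Import Reals.

Set Implicit Arguments.
Unset Strict Implicit.
Unset Printing Implicit Defensive.

(* [(a, c, b)] stands for [(a_1, ..., a_r; c; b_1, ..., b_s)]: both sequences
   are listed in increasing order, so [b] is read towards the peak [c] and the
   two [path] conditions are [1 <= a_1 <= ... <= a_r <= c] and
   [1 <= b_1 <= ... <= b_s <= c]. *)
Definition unimodal (n : nat) (t : seq nat * nat * seq nat) : bool :=
  let: (a, c, b) := t in
  [&& path leq 1 (rcons a c), path leq 1 (rcons b c)
    & sumn a + c + sumn b == n].

Definition unimodal_set (n : nat) : set (seq nat * nat * seq nat) :=
  [set t | unimodal n t]%classic.

Lemma sumn_bound (s : seq nat) (n : nat) :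
  all (leq 1) s -> sumn s <= n -> size s <= n /\ all (gtn n.+1) s.
Proof.
elim: s n => [|x s IHs] n //= /andP[x0 s0] le_n.
have [le_s all_s] := IHs _ s0 (leqnn (sumn s)).
split; first by apply: leq_trans le_n; rewrite -add1n leq_add.
apply/andP; split; first by rewrite ltnS (leq_trans _ le_n) ?leq_addr.
apply: sub_all all_s => y /=; rewrite !ltnS => /leq_trans; apply.
by apply: leq_trans le_n; exact: leq_addl.
Qed.

Lemma path_leq_all (c : nat) (s : seq nat) :
  path leq 1 (rcons s c) -> all (leq 1) s.
Proof.
by rewrite path_sortedE; [rewrite all_rcons => /andP[/andP[]] | exact: leq_trans].
Qed.

(* [fset_set] is [fset0] on infinite sets: this lemma shows that [u] below is
   the genuine cardinality. *)
Lemma finite_unimodal_set (n : nat) : finite_set (unimodal_set n).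
Proof.
pose T := ({bseq n of 'I_n.+1} * 'I_n.+1 * {bseq n of 'I_n.+1})%type.
pose f (t : T) : seq nat * nat * seq nat :=
  (map val (bseqval t.1.1), val t.1.2, map val (bseqval t.2)).
have ext (s : seq nat) : all (leq 1) s -> sumn s <= n ->
    exists b : {bseq n of 'I_n.+1}, map val (bseqval b) = s.
  move=> s0 /(sumn_bound s0)[szs alls].
  have szp : size (map (@inord n) s) <= n by rewrite size_map.
  exists (Bseq szp) => /=; rewrite -map_comp map_id_in // => x xs /=.
  by rewrite inordK //; exact: (allP alls).
apply: (@sub_finite_set _ _ (f @` [set: T])%classic); last first.
  exact/finite_image/finite_finset.
move=> [[a c] b] /and3P[/path_leq_all pa /path_leq_all pb /eqP en].
have [||ba <-] := ext a => //.
  by rewrite -en -addnA leq_addr.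
have [||bb <-] := ext b => //.
  by rewrite -en leq_addl.
have cn : c < n.+1 by rewrite ltnS -en -addnA addnCA leq_addr.
by exists (ba, Ordinal cn, bb).
Qed.

Definition u (n : nat) : nat := #|` fset_set (unimodal_set n)|%fset.

Local Open Scope R_scope.

(* [f = O_{<= c}(g)] at a given argument. *)
Definition O_le (c f g : R) : Prop := Rabs f <= c * Rabs g.

Definition coefA : R := 1 / (8 * Rpower 3 (3 / 4)).

Definition coefB : R :=
  PI / (144 * Rpower 3 (1 / 4)) - 5 * Rpower 3 (3 / 4) / (128 * PI).

Definition coefC : R :=
  105 * Rpower 3 (1 / 4) / (4096 * PI ^ 2)
  + 13 * PI ^ 2 / (6912 * Rpower 3 (3 / 4))
  - 35 / (768 * Rpower 3 (3 / 4)).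

Definition coefD : R :=
  - (91 * PI / (12288 * Rpower 3 (1 / 4)))
  + 105 * Rpower 3 (3 / 4) / (8192 * PI)
  + 7 * PI ^ 3 / (23328 * Rpower 3 (1 / 4))
  + 315 * Rpower 3 (3 / 4) / (65536 * PI ^ 3).

Definition coefE : R :=
  7441 * PI ^ 4 / (35831808 * Rpower 3 (3 / 4))
  - 77 * PI ^ 2 / (13824 * Rpower 3 (3 / 4))
  + 5005 / (131072 * Rpower 3 (3 / 4))
  - 1155 * Rpower 3 (1 / 4) / (131072 * PI ^ 2)
  + 31185 * Rpower 3 (1 / 4) / (4194304 * PI ^ 4).

(* Main.v *)
(** Heine's transformation gives [sum u(n) q^n = psi(q) / (q;q)_oo^2] with the false theta function
    [psi(q) = sum (-1)^k q^(k(k+1)/2)].  For [q = e^(-tau)] near [1], Boole summation expands [psi] in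
    powers of [tau], and the modular transformation of [1 / (q;q)_oo^2] (obtained by integrating that
    of the Eisenstein series of weight two) produces the factor [e^(pi^2 / (3 tau))].  The resulting
    main term is, up to a bounded error, the generating function of an explicit combination [vtot]
    of Bessel-type coefficients.  The difference of the two generating functions is small on the
    circle of radius [e^(-pi / sqrt (3 n))], on the major arc by the expansions and on the minor arc
    by comparing the moduli of the first factors, so [u(n)] is close to [vtot n].  Laplace's method
    for the integral of [I_1] and [I_2], and the three-term recurrence for higher orders, expand [vtot n]. *)
Require Import Defs.
From Stdlib Require Import ZArith Reals Lra Lia ssreflect ssrfun.
From Coquelicot Require Import Coquelicot.
Local Open Scope R_scope.

(** Cauchy's formula is applied only to the difference of two generating functions. No contour
    integral is evaluated: absolute values suffice, because the coefficients of the comparison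
    function are known in closed form. The radius [al] solves [n al = kap / al] with
    [kap = pi^2 / 3], which is the critical point of [kap / tau + n tau]. The two arcs meet at
    [|Im tau| = 3/4 Re tau], where [|tau| = 5/4 Re tau]. For [n >= 100000] one gets [al <= 0.00576],
    hence [|tau| <= 0.0072] on the major arc, and [z = 2 kap / al >= 1000] in the Bessel expansions.
    Apart from the exponential factor, the major-arc error has order [|tau|^6] and its weight lies
    in a window of width about [al^(3/2)]; the resulting [al^(15/2)] is [n^(-5/4) n^(-5/2)] up to a
    constant. In units of the error term this contributes at most 400 and the Bessel expansions at
    most 1, within the 478 allowed. The obstacle on the modular side is that the lattice sum of
    weight two converges only conditionally. Its two summations are exchanged after subtracting a
    telescoping series, which leaves an absolutely convergent remainder. *)

Lemma Ceq (a b : C) : Re a = Re b -> Im a = Im b -> a = b.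
Proof. by case: a => x y; case: b => x' y' /= -> ->. Qed.

Lemma Re_mult (a b : C) : Re (a * b) = Re a * Re b - Im a * Im b.
Proof. by case: a => x y; case: b. Qed.

Lemma Im_mult (a b : C) : Im (a * b) = Re a * Im b + Im a * Re b.
Proof. by case: a => x y; case: b. Qed.

Lemma Re_plus (a b : C) : Re (a + b) = Re a + Re b.
Proof. by []. Qed.

Lemma Im_plus (a b : C) : Im (a + b) = Im a + Im b.
Proof. by []. Qed.

(** Rotating [a] by [Cconj a / |a|] makes it the real number [|a|]. In this way bounds for real
    functions and series carry over to complex ones without losing a constant. *)
Lemma Cmod_Re_le (a : C) (M : R) :
  (forall w, Cmod w = 1 -> Re (w * a) <= M) -> 0 <= M -> Cmod a <= M.
Proof.
move=> H HM.
have [E|N] := Req_dec (Cmod a) 0; first by rewrite E.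
have P : 0 < Cmod a by have := Cmod_ge_0 a; lra.
have Hm2 : Cmod a * Cmod a = Re a * Re a + Im a * Im a.
  by rewrite /Cmod sqrt_sqrt /Re /Im; [ring | nra].
have := H (Cconj a * RtoC (/ Cmod a))%C.
rewrite Cmod_mult Cmod_conj Cmod_R Rabs_pos_eq; last by left; apply: Rinv_0_lt_compat.
move=> /(_ ltac:(by field)).
suff -> : Re (Cconj a * RtoC (/ Cmod a) * a) = Cmod a by [].
rewrite !Re_mult !Im_mult /=.
transitivity (/ Cmod a * (Re a * Re a + Im a * Im a)); first by rewrite /Re /Im; ring.
by rewrite -Hm2; field.
Qed.

Lemma Re_le_Cmod (a : C) : Re a <= Cmod a.
Proof. by apply: Rle_trans (Rle_abs _) (re_le_Cmod a). Qed.

Lemma im_le_Cmod (a : C) : Rabs (Im a) <= Cmod a.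
Proof. by apply: Rle_trans (Rmax_r _ _) (Rmax_Cmod a). Qed.

Lemma Cmod_sqr (a : C) : Cmod a ^ 2 = Re a ^ 2 + Im a ^ 2.
Proof. by rewrite /Cmod pow2_sqrt /Re /Im; nra. Qed.

Lemma Cmod_Re_Im (a : C) : Cmod a <= Rabs (Re a) + Rabs (Im a).
Proof.
have H := Cmod_sqr a; have H0 := Cmod_ge_0 a.
have := Rabs_pos (Re a); have := Rabs_pos (Im a).
rewrite -(pow2_abs (Re a)) -(pow2_abs (Im a)) in H; nra.
Qed.

(** At [a = 0] both sides are 0, since the real and the complex inverse both send 0 to 0. *)
Lemma Cmod_inv' (a : C) : Cmod (/ a) = / Cmod a.
Proof.
have [->|N] := Ceq_dec a 0; last by apply: Cmod_inv.
suff -> : (/ 0 = 0)%C by rewrite Cmod_0 Rinv_0.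
by apply: Ceq; rewrite /Cinv /= /Rdiv; ring.
Qed.

Lemma Cmod_minus_ge (a b : C) : Cmod a - Cmod b <= Cmod (a - b).
Proof.
have := Cmod_triangle (a - b) b.
have -> : (a - b + b = a)%C by ring.
lra.
Qed.

Lemma Cmod_minus_le (a b : C) : Cmod (a - b) <= Cmod a + Cmod b.
Proof. by have := Cmod_triangle a (- b); rewrite Cmod_opp. Qed.

Lemma Re_pos_neq0 (a : C) : 0 < Re a -> a <> 0%C.
Proof. by move=> H E; move: H; rewrite E /=; lra. Qed.

Lemma Re_pos_Cmod (a : C) : 0 < Re a -> 0 < Cmod a.
Proof. by move=> H; apply: Rlt_le_trans H (Re_le_Cmod a). Qed.

(** * Limits of complex sequences *)

Definition Clim (u : nat -> C) (l : C) : Prop :=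
  is_lim_seq (fun n => Re (u n)) (Re l) /\ is_lim_seq (fun n => Im (u n)) (Im l).

Lemma is_lim_seq_sub0 (u : nat -> R) (l : R) :
  is_lim_seq u l <-> is_lim_seq (fun n => Rabs (u n - l)) 0.
Proof.
split=> H.
- apply/(is_lim_seq_abs_0 (fun n => u n - l)).
  have := is_lim_seq_minus' _ _ _ _ H (is_lim_seq_const l).
  by rewrite Rminus_diag.
- have /(is_lim_seq_abs_0 (fun n => u n - l)) H0 := H.
  have := is_lim_seq_plus' _ _ _ _ H0 (is_lim_seq_const l).
  by rewrite Rplus_0_l; apply: is_lim_seq_ext => n; ring.
Qed.

Lemma Clim_Cmod (u : nat -> C) (l : C) :
  Clim u l <-> is_lim_seq (fun n => Cmod (u n - l)) 0.
Proof.
split.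
- case=> Hr Hi.
  apply: (is_lim_seq_le_le (fun=> 0) _ (fun n => Rabs (Re (u n) - Re l) + Rabs (Im (u n) - Im l))).
  + by move=> n; split; [exact: Cmod_ge_0 | exact: (Cmod_Re_Im (u n - l))].
  + exact: is_lim_seq_const.
  + have := is_lim_seq_plus' _ _ _ _ (proj1 (is_lim_seq_sub0 _ _) Hr) (proj1 (is_lim_seq_sub0 _ _) Hi).
    by rewrite Rplus_0_l.
- move=> H; split; apply/is_lim_seq_sub0;
    apply: (is_lim_seq_le_le (fun=> 0) _ _ _ _ (is_lim_seq_const 0) H) => n;
    split; try exact: Rabs_pos.
  + exact: (re_le_Cmod (u n - l)).
  + exact: (im_le_Cmod (u n - l)).
Qed.

Lemma Clim_const (c : C) : Clim (fun=> c) c.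
Proof. by split; apply: is_lim_seq_const. Qed.

Lemma Clim_ext (u v : nat -> C) (l : C) : (forall n, u n = v n) -> Clim u l -> Clim v l.
Proof.
by move=> E [Hr Hi]; split; [apply: is_lim_seq_ext Hr | apply: is_lim_seq_ext Hi] => n; rewrite E.
Qed.

Lemma Clim_ext_loc (u v : nat -> C) (l : C) (N : nat) :
  (forall n, (N <= n)%nat -> u n = v n) -> Clim u l -> Clim v l.
Proof.
move=> E [Hr Hi]; split; [apply: is_lim_seq_ext_loc Hr | apply: is_lim_seq_ext_loc Hi];
  by exists N => n Hn; rewrite E.
Qed.

Lemma Clim_plus (u v : nat -> C) (l m : C) :
  Clim u l -> Clim v m -> Clim (fun n => u n + v n)%C (l + m)%C.
Proof. by move=> [Hr Hi] [Kr Ki]; split; rewrite /=; apply: is_lim_seq_plus'. Qed.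

Lemma Clim_opp (u : nat -> C) (l : C) : Clim u l -> Clim (fun n => - u n)%C (- l)%C.
Proof.
by move=> [Hr Hi]; split; [exact: (proj1 (is_lim_seq_opp _ (Finite _)) Hr) | exact: (proj1 (is_lim_seq_opp _ (Finite _)) Hi)].
Qed.

Lemma Clim_minus (u v : nat -> C) (l m : C) :
  Clim u l -> Clim v m -> Clim (fun n => u n - v n)%C (l - m)%C.
Proof. by move=> H K; apply: Clim_plus => //; apply: Clim_opp. Qed.

Lemma Clim_mult (u v : nat -> C) (l m : C) :
  Clim u l -> Clim v m -> Clim (fun n => u n * v n)%C (l * m)%C.
Proof.
move=> [Hr Hi] [Kr Ki]; split.
- apply: (is_lim_seq_ext (fun n => Re (u n) * Re (v n) - Im (u n) * Im (v n))).
    by move=> n; rewrite Re_mult.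
  by rewrite Re_mult; apply: is_lim_seq_minus'; apply: is_lim_seq_mult'.
- apply: (is_lim_seq_ext (fun n => Re (u n) * Im (v n) + Im (u n) * Re (v n))).
    by move=> n; rewrite Im_mult.
  by rewrite Im_mult; apply: is_lim_seq_plus'; apply: is_lim_seq_mult'.
Qed.

Lemma Clim_RtoC (u : nat -> R) (l : R) : is_lim_seq u l -> Clim (fun n => RtoC (u n)) l.
Proof. by move=> H; split => //=; apply: is_lim_seq_const. Qed.

Lemma Clim_unique (u : nat -> C) (l m : C) : Clim u l -> Clim u m -> l = m.
Proof.
move=> [Hr Hi] [Kr Ki]; apply: Ceq.
- by have := is_lim_seq_unique _ _ Hr; rewrite (is_lim_seq_unique _ _ Kr) => -[->].
- by have := is_lim_seq_unique _ _ Hi; rewrite (is_lim_seq_unique _ _ Ki) => -[->].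
Qed.

Lemma Clim_squeeze (u : nat -> C) (l : C) (b : nat -> R) :
  (forall n, Cmod (u n - l) <= b n) -> is_lim_seq b 0 -> Clim u l.
Proof.
move=> H Hb; apply/Clim_Cmod.
apply: (is_lim_seq_le_le (fun=> 0) _ b) => //; last exact: is_lim_seq_const.
by move=> n; split => //; exact: Cmod_ge_0.
Qed.

Lemma Clim_Cmod_lim (u : nat -> C) (l : C) : Clim u l -> is_lim_seq (fun n => Cmod (u n)) (Cmod l).
Proof.
move=> /Clim_Cmod H.
apply/is_lim_seq_sub0.
apply: (is_lim_seq_le_le (fun=> 0) _ _ _ _ (is_lim_seq_const 0) H) => n.
split; first exact: Rabs_pos.
have := Cmod_minus_ge (u n) l; have := Cmod_minus_ge l (u n).
have -> : Cmod (l - u n) = Cmod (u n - l) by rewrite -Cmod_opp; congr Cmod; ring.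
by move=> H1 H2; apply: Rabs_le; lra.
Qed.

Lemma Clim_inv (u : nat -> C) (l : C) : l <> 0%C -> Clim u l -> Clim (fun n => / u n)%C (/ l)%C.
Proof.
move=> L0 H.
have P : 0 < Cmod l by apply/Cmod_gt_0.
have Hm := Clim_Cmod_lim u l H.
have [N HN] : eventually (fun n => Cmod l / 2 < Cmod (u n)).
  apply: (Hm (fun y => Cmod l / 2 < y)).
  exists (mkposreal (Cmod l / 2) ltac:(lra)) => y /=.
  by rewrite /ball /= /AbsRing_ball /abs /minus /plus /opp /=; move/Rabs_def2; lra.
apply/Clim_Cmod.
apply: (is_lim_seq_le_le_loc (fun=> 0) _ (fun n => (2 / Cmod l ^ 2) * Cmod (u n - l))).
- exists N => n Hn; split; first exact: Cmod_ge_0.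
  have Pu := HN n Hn.
  have U0 : u n <> 0%C by apply/Cmod_gt_0; lra.
  have -> : (/ u n - / l = - ((u n - l) * (/ u n * / l)))%C by field.
  rewrite Cmod_opp !Cmod_mult !Cmod_inv' (Rmult_comm (2 / _)).
  apply: Rmult_le_compat_l; first exact: Cmod_ge_0.
  rewrite -Rinv_mult.
  have -> : 2 / Cmod l ^ 2 = / (Cmod l / 2 * Cmod l) by field; lra.
  apply: Rinv_le_contravar; first by apply: Rmult_lt_0_compat; lra.
  by apply: Rmult_le_compat_r; lra.
- exact: is_lim_seq_const.
- rewrite -(Rmult_0_r (2 / Cmod l ^ 2)).
  by apply: is_lim_seq_mult'; [exact: is_lim_seq_const | apply/Clim_Cmod].
Qed.

(** * Absolutely convergent complex series *)

(** Sums over the indices below [n], so that the empty sum is available as the base of inductions;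
    [sum_n f n] has one term more. *)
Fixpoint rsum (f : nat -> R) (n : nat) : R :=
  match n with O => 0 | S k => rsum f k + f k end.

Fixpoint csum (f : nat -> C) (n : nat) : C :=
  match n with O => 0%C | S k => (csum f k + f k)%C end.

Lemma rsum_S (f : nat -> R) (n : nat) : rsum f (S n) = rsum f n + f n.
Proof. by []. Qed.

Lemma csum_S (f : nat -> C) (n : nat) : csum f (S n) = (csum f n + f n)%C.
Proof. by []. Qed.

Definition asum (a : nat -> C) : Prop := ex_series (fun n => Cmod (a n)).

Definition CSer (a : nat -> C) : C :=
  (Series (fun n => Re (a n)), Series (fun n => Im (a n))).

Lemma rsum_sum_n (f : nat -> R) (n : nat) : rsum f (S n) = sum_n f n.
Proof.
elim: n => [|n IH]; first by rewrite sum_O /= Rplus_0_l.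
by rewrite sum_Sn -IH.
Qed.

Lemma rsum_ext (f g : nat -> R) (n : nat) :
  (forall i, (i < n)%nat -> f i = g i) -> rsum f n = rsum g n.
Proof.
elim: n => [//|n IH] H /=; rewrite (H n); last by lia.
by rewrite IH // => i Hi; apply: H; lia.
Qed.

Lemma rsum_le (f g : nat -> R) (n : nat) :
  (forall i, (i < n)%nat -> f i <= g i) -> rsum f n <= rsum g n.
Proof.
elim: n => [|n IH] H /=; first lra.
by apply: Rplus_le_compat; [apply: IH => i Hi; apply: H; lia | apply: H; lia].
Qed.

Lemma rsum_ge0 (f : nat -> R) (n : nat) : (forall i, 0 <= f i) -> 0 <= rsum f n.
Proof. by move=> H; elim: n => [|n IH] /=; [lra | have := H n; lra]. Qed.

Lemma rsum_incr (f : nat -> R) (n m : nat) :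
  (forall i, 0 <= f i) -> (n <= m)%nat -> rsum f n <= rsum f m.
Proof.
move=> H; elim=> [|m' _ IH] /=; first lra.
by have := H m'; lra.
Qed.

Lemma is_series_rsum (a : nat -> R) (l : R) : is_series a l <-> is_lim_seq (rsum a) l.
Proof.
split => H.
- apply/is_lim_seq_incr_1; apply: (is_lim_seq_ext (sum_n a)) => [n|]; first by rewrite rsum_sum_n.
  exact: H.
- change (is_lim_seq (sum_n a) l); apply: (is_lim_seq_ext (fun n => rsum a (S n))).
    by move=> n; rewrite rsum_sum_n.
  by move/is_lim_seq_incr_1: H.
Qed.

Lemma Series_rsum_lim (a : nat -> R) : ex_series a -> is_lim_seq (rsum a) (Series a).
Proof. by move=> H; apply/is_series_rsum; apply: Series_correct. Qed.

Lemma rsum_le_Series (a : nat -> R) (n : nat) :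
  (forall i, 0 <= a i) -> ex_series a -> rsum a n <= Series a.
Proof.
move=> H0 H.
apply: (is_lim_seq_le_loc (fun=> rsum a n) (rsum a) (rsum a n) (Series a)).
- by exists n => m Hm; apply: rsum_incr.
- exact: is_lim_seq_const.
- exact: Series_rsum_lim.
Qed.

Lemma ex_series_bounded (a : nat -> R) (M : R) :
  (forall i, 0 <= a i) -> (forall n, rsum a n <= M) -> ex_series a.
Proof.
move=> H0 HM.
have [l Hl] : ex_finite_lim_seq (rsum a).
  apply: (ex_finite_lim_seq_incr _ M) => // n /=; by have := H0 n; lra.
by exists l; apply/is_series_rsum.
Qed.

Lemma Series_le_bound (a : nat -> R) (M : R) :
  ex_series a -> (forall n, rsum a n <= M) -> Series a <= M.
Proof.
move=> H HM.
apply: (is_lim_seq_le (rsum a) (fun=> M) (Series a) M) => //.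
- exact: Series_rsum_lim.
- exact: is_lim_seq_const.
Qed.

Lemma Series_ge0 (a : nat -> R) : (forall i, 0 <= a i) -> ex_series a -> 0 <= Series a.
Proof. by move=> H0 H; apply: Rle_trans (rsum_le_Series a 0 H0 H); rewrite /=; lra. Qed.

Lemma ex_series_le0 (a b : nat -> R) :
  (forall n, 0 <= a n <= b n) -> ex_series b -> ex_series a.
Proof.
move=> H Hb; apply: (ex_series_le (K := R_AbsRing) (V := R_CompleteNormedModule) a b) => // n.
by rewrite /norm /= /abs /= Rabs_pos_eq; have := H n; lra.
Qed.

Lemma ex_series_extR (a b : nat -> R) : (forall n, a n = b n) -> ex_series a -> ex_series b.
Proof. exact: (ex_series_ext (V := R_NormedModule) a b). Qed.

Lemma ex_series_scalR (c : R) (a : nat -> R) : ex_series a -> ex_series (fun n => c * a n).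
Proof. exact: (ex_series_scal (V := R_NormedModule) c a). Qed.

Lemma asum_le (a : nat -> C) (b : nat -> R) :
  (forall n, Cmod (a n) <= b n) -> ex_series b -> asum a.
Proof. by move=> H; apply: ex_series_le0 => n; split => //; exact: Cmod_ge_0. Qed.

Lemma asum_ext (a b : nat -> C) : (forall n, a n = b n) -> asum a -> asum b.
Proof. by move=> H; apply: ex_series_ext => n; rewrite H. Qed.

Lemma asum_Re (a : nat -> C) : asum a -> ex_series (fun n => Re (a n)).
Proof.
move=> H; apply: ex_series_Rabs; apply: ex_series_le0 H => n.
by split; [exact: Rabs_pos | exact: re_le_Cmod].
Qed.

Lemma asum_Im (a : nat -> C) : asum a -> ex_series (fun n => Im (a n)).
Proof.
move=> H; apply: ex_series_Rabs; apply: ex_series_le0 H => n.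
by split; [exact: Rabs_pos | exact: im_le_Cmod].
Qed.

Lemma asum_plus (a b : nat -> C) : asum a -> asum b -> asum (fun n => a n + b n)%C.
Proof.
move=> Ha Hb; apply: (asum_le _ (fun n => Cmod (a n) + Cmod (b n))).
- by move=> n; exact: Cmod_triangle.
- exact: (ex_series_plus (V := R_NormedModule)).
Qed.

Lemma asum_scal (c : C) (a : nat -> C) : asum a -> asum (fun n => c * a n)%C.
Proof.
move=> Ha; apply: (asum_le _ (fun n => Cmod c * Cmod (a n))).
- by move=> n; rewrite Cmod_mult; lra.
- exact: (ex_series_scal (V := R_NormedModule)).
Qed.

Lemma asum_opp (a : nat -> C) : asum a -> asum (fun n => - a n)%C.
Proof. by apply: ex_series_ext => n; rewrite Cmod_opp. Qed.

Lemma asum_minus (a b : nat -> C) : asum a -> asum b -> asum (fun n => a n - b n)%C.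
Proof. by move=> Ha Hb; apply: asum_plus => //; apply: asum_opp. Qed.

Lemma asum_shift (a : nat -> C) (n : nat) : asum a <-> asum (fun k => a (n + k)%nat).
Proof. exact: (ex_series_incr_n (V := R_NormedModule) (fun k => Cmod (a k)) n). Qed.

Lemma CSer_ext (a b : nat -> C) : (forall n, a n = b n) -> CSer a = CSer b.
Proof. by move=> H; rewrite /CSer; congr pair; apply: Series_ext => n; rewrite H. Qed.

Lemma CSer_plus (a b : nat -> C) :
  asum a -> asum b -> CSer (fun n => a n + b n)%C = (CSer a + CSer b)%C.
Proof.
move=> Ha Hb; apply: Ceq; rewrite /=; apply: Series_plus.
- exact: asum_Re.
- exact: asum_Re.
- exact: asum_Im.
- exact: asum_Im.
Qed.

Lemma CSer_scal (c : C) (a : nat -> C) : asum a -> CSer (fun n => c * a n)%C = (c * CSer a)%C.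
Proof.
move=> Ha; have Hr := asum_Re _ Ha; have Hi := asum_Im _ Ha.
have S k (b : nat -> R) : ex_series b -> ex_series (fun n => k * b n).
  by move=> H; apply: (ex_series_scal (V := R_NormedModule)).
apply: Ceq.
- rewrite Re_mult /CSer /= -!Series_scal_l -Series_minus; [|exact: S|exact: S].
  by apply: Series_ext => n.
- rewrite Im_mult /CSer /= -!Series_scal_l -Series_plus; [|exact: S|exact: S].
  by apply: Series_ext => n.
Qed.

Lemma CSer_opp (a : nat -> C) : asum a -> CSer (fun n => - a n)%C = (- CSer a)%C.
Proof.
move=> Ha; rewrite (CSer_ext _ (fun n => RtoC (-1) * a n)%C); last first.
  by move=> n; apply: Ceq => /=; ring.
by rewrite CSer_scal //; apply: Ceq => /=; ring.
Qed.

Lemma CSer_minus (a b : nat -> C) :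
  asum a -> asum b -> CSer (fun n => a n - b n)%C = (CSer a - CSer b)%C.
Proof. by move=> Ha Hb; rewrite CSer_plus ?CSer_opp //; apply: asum_opp. Qed.

(** Rotation by [w] reduces the claim to a real series through [Cmod_Re_le]; bounding the two
    components separately would cost a factor. *)
Lemma Cmod_CSer (a : nat -> C) (b : nat -> R) :
  (forall n, Cmod (a n) <= b n) -> ex_series b -> Cmod (CSer a) <= Series b.
Proof.
move=> H Hb; have Ha := asum_le _ _ H Hb.
have b0 n : 0 <= b n by apply: Rle_trans (H n); exact: Cmod_ge_0.
apply: Cmod_Re_le; last exact: Series_ge0.
move=> w Hw.
rewrite -CSer_scal //= -/(Re _).
have Hwa := asum_scal w _ Ha.
apply: Rle_trans (Rle_abs _) _.
apply: Rle_trans (Series_Rabs _ _) _.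
  apply: ex_series_le0 Hwa => n; split; [exact: Rabs_pos | exact: (re_le_Cmod (w * a n))].
apply: Series_le => // n; split; first exact: Rabs_pos.
apply: Rle_trans (re_le_Cmod (w * a n)) _.
by rewrite Cmod_mult Hw Rmult_1_l.
Qed.

Lemma csum_Re (a : nat -> C) (n : nat) : Re (csum a n) = rsum (fun k => Re (a k)) n.
Proof. by elim: n => [//|n IH]; rewrite /= -IH. Qed.

Lemma csum_Im (a : nat -> C) (n : nat) : Im (csum a n) = rsum (fun k => Im (a k)) n.
Proof. by elim: n => [//|n IH]; rewrite /= -IH. Qed.

Lemma CSer_lim (a : nat -> C) : asum a -> Clim (csum a) (CSer a).
Proof.
move=> Ha; split.
- apply: (is_lim_seq_ext (rsum (fun k => Re (a k)))); first by move=> n; rewrite csum_Re.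
  by apply: Series_rsum_lim; apply: asum_Re.
- apply: (is_lim_seq_ext (rsum (fun k => Im (a k)))); first by move=> n; rewrite csum_Im.
  by apply: Series_rsum_lim; apply: asum_Im.
Qed.

Lemma CSer_unique (a : nat -> C) (l : C) : asum a -> Clim (csum a) l -> CSer a = l.
Proof. by move=> Ha H; apply: Clim_unique H; apply: CSer_lim. Qed.

Lemma csum_ext (f g : nat -> C) (n : nat) :
  (forall i, (i < n)%nat -> f i = g i) -> csum f n = csum g n.
Proof.
elim: n => [//|n IH] H /=; rewrite (H n); last by lia.
by rewrite IH // => i Hi; apply: H; lia.
Qed.

Lemma csum_plus (f g : nat -> C) (n : nat) :
  csum (fun i => f i + g i)%C n = (csum f n + csum g n)%C.
Proof. by elim: n => [|n IH] /=; [ring | rewrite IH; ring]. Qed.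

Lemma csum_scal (c : C) (f : nat -> C) (n : nat) : csum (fun i => c * f i)%C n = (c * csum f n)%C.
Proof. by elim: n => [|n IH] /=; [ring | rewrite IH; ring]. Qed.

Lemma csum_app (f : nat -> C) (n m : nat) :
  csum f (n + m) = (csum f n + csum (fun i => f (n + i)%nat) m)%C.
Proof.
elim: m => [|m IH] /=; first by rewrite Nat.add_0_r; ring.
by rewrite Nat.add_succ_r /= IH; ring.
Qed.

Lemma csum_S_l (f : nat -> C) (n : nat) :
  csum f (S n) = (f 0%nat + csum (fun i => f (S i)) n)%C.
Proof. by rewrite -(Nat.add_1_l n) csum_app /=; ring. Qed.

Lemma csum_rev (f : nat -> C) (n : nat) : csum (fun i => f (n - S i)%nat) n = csum f n.
Proof.
elim: n => [//|n IH].
rewrite csum_S_l /= Nat.sub_0_r -IH; ring.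
Qed.

Lemma Cmod_csum (f : nat -> C) (n : nat) : Cmod (csum f n) <= rsum (fun i => Cmod (f i)) n.
Proof.
elim: n => [|n IH] /=; first by rewrite Cmod_0; lra.
by apply: Rle_trans (Cmod_triangle _ _) _; lra.
Qed.

Lemma CSer_split (a : nat -> C) (n : nat) :
  asum a -> CSer a = (csum a n + CSer (fun k => a (n + k)%nat))%C.
Proof.
move=> Ha; have Hs := (proj1 (asum_shift a n) Ha).
apply: CSer_unique => //.
have H : Clim (fun m => csum a n + csum (fun k => a (n + k)%nat) m)%C
              (csum a n + CSer (fun k => a (n + k)%nat))%C.
  by apply: Clim_plus; [exact: Clim_const | exact: CSer_lim].
case: H => H1 H2; split; apply/(is_lim_seq_incr_n _ n).
- by apply: is_lim_seq_ext H1 => m; rewrite Nat.add_comm csum_app.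
- by apply: is_lim_seq_ext H2 => m; rewrite Nat.add_comm csum_app.
Qed.

Lemma is_series_0 : is_series (fun=> 0) 0.
Proof.
apply/is_series_rsum; apply: (is_lim_seq_ext (fun=> 0)); last exact: is_lim_seq_const.
by elim=> [//|n IH] /=; rewrite -IH; ring.
Qed.

Lemma ex_series_0 : ex_series (fun=> 0).
Proof. by exists 0; exact: is_series_0. Qed.

Lemma CSer_0 (a : nat -> C) : (forall n, a n = 0%C) -> CSer a = 0%C.
Proof.
move=> H.
have Ha : asum a.
  apply: (asum_ext (fun=> 0%C)) => //.
  apply: (ex_series_ext (fun=> 0)) => [n|]; first by rewrite Cmod_0.
  exact: ex_series_0.
apply: CSer_unique => //; apply: (Clim_ext (fun=> 0%C)); last exact: Clim_const.
by elim=> [//|n IH] /=; rewrite -IH H; ring.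
Qed.

Lemma CSer_csum (a : nat -> C) (N : nat) :
  (forall k, (N <= k)%nat -> a k = 0%C) -> asum a /\ CSer a = csum a N.
Proof.
move=> H.
have Hs : asum (fun k => a (N + k)%nat).
  apply: (ex_series_ext (fun=> 0)) => [n|]; first by rewrite H ?Cmod_0 //; lia.
  exact: ex_series_0.
have Ha : asum a by apply/(asum_shift a N).
split => //; rewrite (CSer_split _ N) // (CSer_0 (fun k => _)); first ring.
by move=> k; apply: H; lia.
Qed.

Lemma Series_tail_lim (b : nat -> R) :
  ex_series b -> is_lim_seq (fun n => Series (fun k => b (n + k)%nat)) 0.
Proof.
move=> Hb; have H := Series_rsum_lim b Hb.
apply: (is_lim_seq_ext (fun n => Series b - rsum b n)).
  case=> [|n]; first by rewrite /=; ring_simplify; apply: Series_ext => k.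
  rewrite (Series_incr_n b (S n)) //; last by lia.
  by rewrite rsum_sum_n sum_n_Reals /=; ring.
by rewrite -(Rminus_diag (Series b)); apply: is_lim_seq_minus' => //; exact: is_lim_seq_const.
Qed.

Lemma Clim_csum (a : nat -> nat -> C) (b : nat -> C) (K : nat) :
  (forall k, Clim (fun n => a n k) (b k)) -> Clim (fun n => csum (a n) K) (csum b K).
Proof.
move=> H; elim: K => [|K IH] /=; first exact: Clim_const.
exact: Clim_plus.
Qed.

Lemma Cmod_le_lim (u : nat -> C) (l : C) (M : R) (N : nat) :
  (forall n, (N <= n)%nat -> Cmod (u n) <= M) -> Clim u l -> Cmod l <= M.
Proof.
move=> H Hl.
apply: (is_lim_seq_le_loc (fun n => Cmod (u n)) (fun=> M) (Cmod l) M).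
- by exists N.
- exact: Clim_Cmod_lim.
- exact: is_lim_seq_const.
Qed.

(** Dominated convergence for series. The domination is asked only for large [n] and [k]: finitely
    many terms converge one by one, and only the tails need a uniform bound. *)
Lemma tannery (a : nat -> nat -> C) (b : nat -> C) (B : nat -> R) (K N : nat) :
  (forall n k, (N <= n)%nat -> (K <= k)%nat -> Cmod (a n k) <= B k) -> ex_series B ->
  (forall n, asum (a n)) ->
  (forall k, Clim (fun n => a n k) (b k)) ->
  asum b /\ Clim (fun n => CSer (a n)) (CSer b).
Proof.
move=> HB SB Sa Hl.
have Hb k : (K <= k)%nat -> Cmod (b k) <= B k.
  by move=> Hk; apply: (Cmod_le_lim _ _ _ N _ (Hl k)) => n Hn; apply: HB.
have Sb : asum b.
  apply/(asum_shift b K); apply: (asum_le _ (fun k => B (K + k)%nat)).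
    by move=> k; apply: Hb; lia.
  by move/(ex_series_incr_n (V := R_NormedModule) B K): SB.
split => //; apply/Clim_Cmod; apply/is_lim_seq_spec => eps.
have SBm M : ex_series (fun k => B (M + k)%nat).
  by move/(ex_series_incr_n (V := R_NormedModule) B M): SB.
have [M0 HM0] : exists M, forall m, (M <= m)%nat -> Series (fun k => B (m + k)%nat) < eps / 4.
  have /is_lim_seq_spec /(_ (mkposreal (eps / 4) ltac:(have := cond_pos eps; lra))) [M HM] := Series_tail_lim B SB.
  by exists M => m Hm; have := HM m Hm; rewrite /= Rminus_0_r => /Rabs_def2; lra.
(* Both tails beyond [M] are below [eps / 4], and for large [n] the two heads of length [M] differ
   by less than [eps / 2]. *)
set M := (Nat.max K M0).
have HM : Series (fun k => B (M + k)%nat) < eps / 4 by apply: HM0; rewrite /M; lia.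
have /Clim_Cmod /is_lim_seq_spec /(_ (mkposreal (eps / 2) ltac:(have := cond_pos eps; lra))) [N1 HN1] := Clim_csum a b M Hl.
exists (Nat.max N N1) => n Hn.
have {HN1} /= := HN1 n ltac:(lia); rewrite !Rminus_0_r !(Rabs_pos_eq _ (Cmod_ge_0 _)) => HN1.
rewrite (CSer_split (a n) M) // (CSer_split b M) //.
have T1 : Cmod (CSer (fun k => a n (M + k)%nat)) <= Series (fun k => B (M + k)%nat).
  by apply: Cmod_CSer => // k; apply: HB; rewrite /M; lia.
have T2 : Cmod (CSer (fun k => b (M + k)%nat)) <= Series (fun k => B (M + k)%nat).
  by apply: Cmod_CSer => // k; apply: Hb; rewrite /M; lia.
set x := csum (a n) M in HN1 *; set y := csum b M in HN1 *.
set s := CSer _ in T1 *; set t := CSer _ in T2 *.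
have -> : (x + s - (y + t) = (x - y) + (s - t))%C by ring.
have := Cmod_triangle (x - y) (s - t); have := Cmod_minus_le s t; lra.
Qed.

Lemma rsum_Series_swap (a : nat -> nat -> R) (N : nat) :
  (forall n, ex_series (fun i => a i n)) ->
  ex_series (fun i => rsum (a i) N) /\
  Series (fun i => rsum (a i) N) = rsum (fun n => Series (fun i => a i n)) N.
Proof.
move=> H; elim: N => [|N [IH1 IH2]] /=.
  split; last by apply: is_series_unique; apply/is_series_rsum; apply: (is_lim_seq_ext (fun=> 0)); [elim=> [//|n IH] /=; lra | exact: is_lim_seq_const].
  exact: ex_series_0.
split; first by apply: (ex_series_plus (V := R_NormedModule)).
by rewrite Series_plus // IH2.
Qed.

Lemma csum_CSer_swap (a : nat -> nat -> C) (N : nat) :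
  (forall i, asum (a i)) ->
  asum (fun n => csum (fun i => a i n) N) /\
  csum (fun i => CSer (a i)) N = CSer (fun n => csum (fun i => a i n) N).
Proof.
move=> H; elim: N => [|N [IH1 IH2]] /=.
  have [] := CSer_csum (fun=> 0%C) 0 => // S E; split=> //; by rewrite E.
by split; [apply: asum_plus | rewrite CSer_plus // IH2].
Qed.

(** The sum of the first [N] entries of column [n] is dominated by the full sum of absolute values
    in that column, and these column sums are summable because their partial sums stay below
    [Series R0]. Then [tannery] lets [N] tend to infinity. *)
Lemma fubini (a : nat -> nat -> C) (R0 : nat -> R) :
  (forall i, asum (a i)) ->
  (forall i, Series (fun n => Cmod (a i n)) <= R0 i) -> ex_series R0 ->
  (forall n, asum (fun i => a i n)) /\
  asum (fun i => CSer (a i)) /\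
  ex_series (fun n => Series (fun i => Cmod (a i n))) /\
  asum (fun n => CSer (fun i => a i n)) /\
  CSer (fun i => CSer (a i)) = CSer (fun n => CSer (fun i => a i n)).
Proof.
move=> Ha HR SR.
have Hle i n : Cmod (a i n) <= R0 i.
  apply: Rle_trans (HR i).
  apply: Rle_trans (rsum_le_Series (fun n => Cmod (a i n)) (S n) _ (Ha i)); last by move=> ?; exact: Cmod_ge_0.
  rewrite /=; have := rsum_ge0 (fun n => Cmod (a i n)) n (fun k => Cmod_ge_0 _); lra.
have Hc n : asum (fun i => a i n) by apply: asum_le SR => i; exact: Hle.
have Hrow : asum (fun i => CSer (a i)).
  apply: asum_le SR => i; apply: Rle_trans (HR i); apply: Cmod_CSer; last exact: Ha.
  by move=> n; lra.
have SC : ex_series (fun n => Series (fun i => Cmod (a i n))).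
  apply: (ex_series_bounded _ (Series R0)).
    by move=> n; apply: Series_ge0; [move=> i; exact: Cmod_ge_0 | exact: Hc].
  move=> N; have [_ <-] := rsum_Series_swap (fun i n => Cmod (a i n)) N Hc.
  apply: Series_le => // i; split; first by apply: rsum_ge0 => ?; exact: Cmod_ge_0.
  apply: Rle_trans (HR i); apply: rsum_le_Series; last exact: Ha.
  by move=> ?; exact: Cmod_ge_0.
have HB N n : Cmod (csum (fun i => a i n) N) <= Series (fun i => Cmod (a i n)).
  apply: Rle_trans (Cmod_csum _ _) _; apply: rsum_le_Series; last exact: Hc.
  by move=> ?; exact: Cmod_ge_0.
have [S1 L1] := tannery (fun N n => csum (fun i => a i n) N) (fun n => CSer (fun i => a i n))
  (fun n => Series (fun i => Cmod (a i n))) 0 0 (fun N n _ _ => HB N n) SC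
  (fun N => proj1 (csum_CSer_swap a N Ha)) (fun n => CSer_lim _ (Hc n)).
do !split => //.
apply: CSer_unique => //.
apply: Clim_ext L1 => N; by rewrite (proj2 (csum_CSer_swap a N Ha)).
Qed.

(** * The complex exponential *)

Definition cexp (z : C) : C := (exp (Re z) * cos (Im z), exp (Re z) * sin (Im z)).

Lemma cexp_add (a b : C) : cexp (a + b) = (cexp a * cexp b)%C.
Proof.
case: a => a1 a2; case: b => b1 b2; apply: Ceq; rewrite /cexp /= exp_plus ?cos_plus ?sin_plus; ring.
Qed.

Lemma cexp_0 : cexp 0 = 1%C.
Proof. by apply: Ceq; rewrite /cexp /= exp_0 ?cos_0 ?sin_0; ring. Qed.

Lemma cexp_RtoC (x : R) : cexp x = RtoC (exp x).
Proof. by apply: Ceq; rewrite /cexp /= ?cos_0 ?sin_0; ring. Qed.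

Lemma Cmod_cexp (z : C) : Cmod (cexp z) = exp (Re z).
Proof.
rewrite /Cmod /cexp /=.
have -> : exp (Re z) * cos (Im z) * (exp (Re z) * cos (Im z) * 1) +
          exp (Re z) * sin (Im z) * (exp (Re z) * sin (Im z) * 1) = Rsqr (exp (Re z)).
  have := sin2_cos2 (Im z); rewrite /Rsqr => H.
  transitivity (exp (Re z) * exp (Re z) * (sin (Im z) * sin (Im z) + cos (Im z) * cos (Im z))); first ring.
  by rewrite H; ring.
by rewrite sqrt_Rsqr //; left; exact: exp_pos.
Qed.

Lemma cexp_neq0 (z : C) : cexp z <> 0%C.
Proof. by apply/Cmod_gt_0; rewrite Cmod_cexp; exact: exp_pos. Qed.

Lemma cexp_opp (z : C) : cexp (- z) = (/ cexp z)%C.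
Proof.
have H : (cexp (- z) * cexp z = 1)%C.
  by rewrite -cexp_add (_ : (- z + z = 0)%C) ?cexp_0 //; ring.
have N := cexp_neq0 z.
by rewrite -(Cmult_1_r (cexp (- z))) -(Cinv_r (cexp z) N) Cmult_assoc H; ring.
Qed.

Lemma cexp_minus (a b : C) : cexp (a - b) = (cexp a / cexp b)%C.
Proof. by rewrite /Cminus cexp_add cexp_opp. Qed.

Lemma cexp_nat (n : nat) (z : C) : cexp (RtoC (INR n) * z) = (cexp z ^ n)%C.
Proof.
elim: n => [|n IH]; first by rewrite /= Cmult_0_l cexp_0.
rewrite S_INR RtoC_plus Cmult_plus_distr_r cexp_add IH Cmult_1_l /=; ring.
Qed.

Lemma cexp_2PI (k : nat) : cexp (RtoC (2 * PI * INR k) * Ci) = 1%C.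
Proof.
have -> : (RtoC (2 * PI * INR k) * Ci = RtoC (INR k) * (RtoC (2 * PI) * Ci))%C.
  by rewrite RtoC_mult; ring.
rewrite cexp_nat (_ : cexp (RtoC (2 * PI) * Ci) = 1%C) ?Cpow_1_l //.
have E : (RtoC (2 * PI) * Ci = (0, 2 * PI)%R)%C by apply: Ceq => /=; ring.
by rewrite E /cexp /= exp_0 cos_2PI sin_2PI; apply: Ceq => /=; ring.
Qed.

(** * Taylor estimates *)

Lemma is_derive_Rplus (f g : R -> R) (t df dg : R) :
  is_derive f t df -> is_derive g t dg -> is_derive (fun t => f t + g t) t (df + dg).
Proof. exact: (is_derive_plus (V := R_NormedModule) f g). Qed.

Lemma is_derive_Rminus (f g : R -> R) (t df dg : R) :
  is_derive f t df -> is_derive g t dg -> is_derive (fun t => f t - g t) t (df - dg).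
Proof. exact: (is_derive_minus (V := R_NormedModule) f g). Qed.

Lemma MVT_0 (f df : R -> R) (x : R) :
  0 <= x -> (forall t, 0 <= t <= x -> is_derive f t (df t)) ->
  exists c, 0 <= c <= x /\ f x - f 0 = df c * x.
Proof.
move=> Hx Hd.
have := MVT_gen f 0 x df; rewrite /= Rmin_left // Rmax_right // Rminus_0_r; apply.
- by move=> t Ht; apply: Hd; lra.
- move=> t Ht; apply: derivable_continuous_pt; exists (df t).
  by apply/is_derive_Reals; apply: Hd.
Qed.

Lemma is_derive_nondecreasing (f df : R -> R) (x : R) :
  0 <= x -> (forall t, 0 <= t <= x -> is_derive f t (df t)) ->
  (forall t, 0 <= t <= x -> 0 <= df t) -> f 0 <= f x.
Proof.
move=> Hx Hd Hp.
have [c [Hc E]] := MVT_0 f df x Hx Hd.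
by have := Hp c Hc; nra.
Qed.

Lemma is_derive_rsum (g : nat -> R -> R) (dg : nat -> R -> R) (n : nat) (t : R) :
  (forall i, is_derive (g i) t (dg i t)) ->
  is_derive (fun t => rsum (fun i => g i t) n) t (rsum (fun i => dg i t) n).
Proof.
move=> H; elim: n => [|n IH] /=; first exact: is_derive_const.
by apply: is_derive_Rplus.
Qed.

Lemma rsum_S_l (f : nat -> R) (n : nat) : rsum f (S n) = f 0%nat + rsum (fun i => f (S i)) n.
Proof. by elim: n => [|n IH]; [rewrite /=; ring | rewrite [LHS]/= -/(rsum f (S n)) IH /=; ring]. Qed.

(** Induction on [n]: the derivative of the remainder is the remainder of the previous order for the
    shifted sequence, and a function vanishing at 0 whose derivative is dominated by that of [b] is
    itself dominated by [b]. The function is given as the sequence of all its derivatives, which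
    avoids iterated [Derive]. *)
Lemma taylor_real (n : nat) (g : nat -> R -> R) (x B : R) :
  0 <= x -> (forall i t, is_derive (g i) t (g (S i) t)) ->
  (forall t, 0 <= t <= x -> Rabs (g n t) <= B) ->
  Rabs (g 0%nat x - rsum (fun i => g i 0 * (x ^ i / INR (fact i))) n) <= B * (x ^ n / INR (fact n)).
Proof.
elim: n g x => [|n IH] g x Hx Hd HB.
  by have := HB x ltac:(lra); rewrite /= Rminus_0_r; lra.
pose h t := g 0%nat t - rsum (fun i => g i 0 * (t ^ i / INR (fact i))) (S n).
pose dh t := g 1%nat t - rsum (fun i => g (S i) 0 * (t ^ i / INR (fact i))) n.
pose b t := B * (t ^ S n / INR (fact (S n))).
pose db t := B * (t ^ n / INR (fact n)).
have F k := INR_fact_neq_0 k.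
have Dpow k t : is_derive (fun t => t ^ S k / INR (fact (S k))) t (t ^ k / INR (fact k)).
  have E : INR (fact (S k)) = INR (S k) * INR (fact k) by rewrite fact_simpl mult_INR.
  have N : INR (S k) <> 0 by apply: not_0_INR; lia.
  apply: (is_derive_ext (fun t => / INR (fact (S k)) * t ^ S k)); first by move=> u; rewrite Rmult_comm.
  have -> : t ^ k / INR (fact k) = / INR (fact (S k)) * (INR (S k) * 1 * t ^ k) by rewrite E; field; split.
  apply: is_derive_scal; apply: (is_derive_pow (fun u => u) (S k)); exact: is_derive_id.
have Dh t : is_derive h t (dh t).
  apply: (is_derive_ext (fun t => g 0%nat t - (g 0%nat 0 + rsum (fun i => g (S i) 0 * (t ^ S i / INR (fact (S i)))) n))).
    by move=> u; rewrite /h rsum_S_l /= Rdiv_1_r Rmult_1_r.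
  apply: is_derive_Rminus; first exact: Hd.
  rewrite -(Rplus_0_l (rsum _ _)).
  apply: is_derive_Rplus; first exact: is_derive_const.
  apply: (is_derive_rsum (fun i t => g (S i) 0 * (t ^ S i / INR (fact (S i)))) (fun i t => g (S i) 0 * (t ^ i / INR (fact i)))) => i.
  exact: (is_derive_scal (fun t => t ^ S i / INR (fact (S i)))).
have Db t : is_derive b t (db t) by apply: is_derive_scal.
have H0 : h 0 = 0.
  rewrite /h rsum_S_l /= Rdiv_1_r Rmult_1_r.
  rewrite (rsum_ext _ (fun=> 0)); last by move=> i _; rewrite /Rdiv !Rmult_0_l Rmult_0_r.
  have -> : rsum (fun=> 0) n = 0 by elim: (n) => [//|m /= ->]; ring.
  ring.
have b0 : b 0 = 0 by rewrite /b /= /Rdiv; ring.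
have Hdh t : 0 <= t <= x -> Rabs (dh t) <= db t.
  move=> Ht; apply: (IH (fun i => g (S i)) t) => //; first lra.
  by move=> u Hu; apply: HB; lra.
have P1 : b 0 - h 0 <= b x - h x.
  apply: (is_derive_nondecreasing (fun t => b t - h t) (fun t => db t - dh t)) => //.
    by move=> t _; apply: is_derive_Rminus.
  by move=> t /Hdh /Rabs_le_between; lra.
have P2 : b 0 + h 0 <= b x + h x.
  apply: (is_derive_nondecreasing (fun t => b t + h t) (fun t => db t + dh t)) => //.
    by move=> t _; apply: is_derive_Rplus.
  by move=> t /Hdh /Rabs_le_between; lra.
by apply: Rabs_le; rewrite -/(h x) -/(b x); lra.
Qed.

Definition cder (f : R -> C) (t : R) (d : C) : Prop :=
  is_derive (fun t => Re (f t)) t (Re d) /\ is_derive (fun t => Im (f t)) t (Im d).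

(** The real formula is applied to [Re (w f)] for each [w] of modulus 1. *)
Lemma taylor_C (n : nat) (f : nat -> R -> C) (x B : R) :
  0 <= x -> 0 <= B -> (forall i t, cder (f i) t (f (S i) t)) ->
  (forall t, 0 <= t <= x -> Cmod (f n t) <= B) ->
  Cmod (f 0%nat x - csum (fun i => f i 0 * RtoC (x ^ i / INR (fact i)))%C n)
    <= B * (x ^ n / INR (fact n)).
Proof.
move=> Hx HB0 Hd HB.
apply: Cmod_Re_le; last first.
  apply: Rmult_le_pos => //; apply: Rmult_le_pos; first exact: pow_le.
  by left; apply: Rinv_0_lt_compat; exact: INR_fact_lt_0.
move=> w Hw.
have := taylor_real n (fun i t => Re (w * f i t)) x B Hx.
have D i t : is_derive (fun t => Re (w * f i t)) t (Re (w * f (S i) t)).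
  have [D1 D2] := Hd i t.
  apply: (is_derive_ext (fun t => Re w * Re (f i t) - Im w * Im (f i t))); first by move=> u; rewrite Re_mult.
  rewrite Re_mult.
  by apply: is_derive_Rminus; apply: is_derive_scal.
move=> /(_ D) H.
have /H {H} H0 : forall t, 0 <= t <= x -> Rabs (Re (w * f n t)) <= B.
  move=> t /HB HB1; apply: Rle_trans (re_le_Cmod _) _.
  by rewrite Cmod_mult Hw Rmult_1_l.
apply: Rle_trans (Rle_abs _) _; apply: Rle_trans H0; right; congr Rabs.
have -> : (w * (f 0%nat x - csum (fun i => f i 0 * RtoC (x ^ i / INR (fact i))) n)
   = w * f 0%nat x - csum (fun i => w * (f i 0 * RtoC (x ^ i / INR (fact i)))) n)%C.
  by rewrite csum_scal; ring.
rewrite /Cminus Re_plus re_opp csum_Re /Rminus; congr (_ + - _).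
by apply: rsum_ext => i _; rewrite Cmult_assoc re_scal_r.
Qed.

Lemma cder_cexp (w : C) (t : R) : cder (fun t => cexp (RtoC t * w)) t (w * cexp (RtoC t * w)).
Proof.
case: w => a b.
have E u : cexp (RtoC u * (a, b)) = (exp (u * a) * cos (u * b), exp (u * a) * sin (u * b)).
  by rewrite /cexp /=; congr (exp _ * cos _, exp _ * sin _); ring.
split.
- apply: (is_derive_ext (fun t => exp (t * a) * cos (t * b))); first by move=> u; rewrite E.
  by rewrite E /=; auto_derive => //; ring.
- apply: (is_derive_ext (fun t => exp (t * a) * sin (t * b))); first by move=> u; rewrite E.
  by rewrite E /=; auto_derive => //; ring.
Qed.

Lemma cder_scal (c : C) (f : R -> C) (t : R) (d : C) :
  cder f t d -> cder (fun t => c * f t)%C t (c * d)%C.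
Proof.
move=> [D1 D2]; split.
- apply: (is_derive_ext (fun t => Re c * Re (f t) - Im c * Im (f t))); first by move=> u; rewrite Re_mult.
  by rewrite Re_mult; apply: is_derive_Rminus; apply: is_derive_scal.
- apply: (is_derive_ext (fun t => Re c * Im (f t) + Im c * Re (f t))); first by move=> u; rewrite Im_mult.
  by rewrite Im_mult; apply: is_derive_Rplus; apply: is_derive_scal.
Qed.

(** Taylor's formula for [t |-> cexp (t w)] on [[0, 1]]. The exponential in the remainder involves
    an upper bound of [Re w] only, and not the modulus of [w]. *)
Lemma cexp_taylor (n : nat) (w : C) (c : R) :
  0 <= c -> Re w <= c ->
  Cmod (cexp w - csum (fun i => w ^ i * RtoC (/ INR (fact i)))%C n)
    <= Cmod w ^ n * exp c / INR (fact n).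
Proof.
move=> Hc Hw.
have := taylor_C n (fun i t => w ^ i * cexp (RtoC t * w))%C 1 (Cmod w ^ n * exp c).
have P : 0 <= Cmod w ^ n by apply: pow_le; exact: Cmod_ge_0.
move=> H; have {H} := H ltac:(lra) (Rmult_le_pos _ _ P (Rlt_le _ _ (exp_pos c))).
have D i t : cder (fun t => w ^ i * cexp (RtoC t * w))%C t (w ^ S i * cexp (RtoC t * w))%C.
  have -> : (w ^ S i * cexp (RtoC t * w) = w ^ i * (w * cexp (RtoC t * w)))%C by rewrite Cpow_S; ring.
  by apply: cder_scal; exact: cder_cexp.
move=> /(_ D) H.
have /H {H} : forall t, 0 <= t <= 1 -> Cmod (w ^ n * cexp (RtoC t * w)) <= Cmod w ^ n * exp c.
  move=> t Ht; rewrite Cmod_mult Cmod_pow; apply: Rmult_le_compat_l => //.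
  rewrite Cmod_cexp re_scal_l.
  have [L|L] := Rle_lt_dec (t * Re w) c; last by nra.
  by case: L => [L|->]; [left; exact: exp_increasing | right].
rewrite /= Cmult_1_l pow1 => H; apply: Rle_trans (Rle_trans _ _ _ H _); last by right; field; exact: INR_fact_neq_0.
right; congr (Cmod (_ - _)%C); first by rewrite Cmult_1_l.
apply: csum_ext => i _.
by rewrite Cmult_0_l cexp_0 pow1 Cmult_1_r /Rdiv Rmult_1_l.
Qed.

Lemma cexp_sub1 (w : C) (c : R) : 0 <= c -> Re w <= c -> Cmod (cexp w - 1) <= Cmod w * exp c.
Proof.
move=> Hc Hw; have := cexp_taylor 1 w c Hc Hw.
rewrite /= Rinv_1 !Cmult_1_l Cplus_0_l Rmult_1_r /Rdiv Rinv_1 Rmult_1_r //.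
Qed.

Lemma cexp_sub2 (w : C) (c : R) :
  0 <= c -> Re w <= c -> Cmod (cexp w - 1 - w) <= Cmod w ^ 2 * exp c.
Proof.
move=> Hc Hw; have := cexp_taylor 2 w c Hc Hw.
rewrite /= Rinv_1 Cmult_1_r Cmult_1_r Cplus_0_l !Cmult_1_r => H.
have -> : (cexp w - 1 - w = cexp w - (1 + w))%C by ring.
apply: Rle_trans H _; have := exp_pos c; have := Cmod_ge_0 w => H1 H2.
have := Rmult_le_pos _ _ (Rmult_le_pos _ _ H1 H1) (Rlt_le _ _ H2); lra.
Qed.

(** * Complex differentiability with a quadratic remainder *)

(** Analytic functions satisfy this strong form of differentiability. With a quadratic remainder the
    rules for products, compositions and exponentials are plain inequalities, without epsilons. The
    condition [r <= 1] gives [|h|^2 <= |h|]. *)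
Definition qder (F : C -> C) (z d : C) : Prop :=
  exists K r : R, 0 <= K /\ 0 < r <= 1 /\
    forall h, Cmod h < r -> Cmod (F (z + h) - F z - h * d)%C <= K * Cmod h ^ 2.

Lemma qder_ext (F G : C -> C) (z d : C) :
  (forall w, 0 < Re w -> F w = G w) -> 0 < Re z -> qder F z d -> qder G z d.
Proof.
move=> E Hz [K [r [HK [Hr H]]]].
exists K, (Rmin r (Re z)); split => //; split.
  by split; [apply: Rmin_pos; lra | apply: Rle_trans (Rmin_l _ _) _; lra].
move=> h Hh; have Hh1 : Cmod h < r by apply: Rlt_le_trans Hh (Rmin_l _ _).
rewrite -!E //; first exact: H.
rewrite Re_plus; have := re_le_Cmod h; have := Rmin_r r (Re z).
move=> H1 /Rabs_le_between; lra.
Qed.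

Lemma qder_const (c z : C) : qder (fun=> c) z 0.
Proof.
exists 0, 1; split; [lra|split; [lra|]] => h _.
have -> : (c - c - h * 0 = 0)%C by ring.
by rewrite Cmod_0; lra.
Qed.

Lemma qder_plus (F G : C -> C) (z d e : C) :
  qder F z d -> qder G z e -> qder (fun w => F w + G w)%C z (d + e)%C.
Proof.
move=> [K [r [HK [Hr H]]]] [K' [r' [HK' [Hr' H']]]].
exists (K + K'), (Rmin r r'); split; [lra|split].
  by split; [apply: Rmin_pos; lra | apply: Rle_trans (Rmin_l _ _) _; lra].
move=> h Hh.
have H1 := H h (Rlt_le_trans _ _ _ Hh (Rmin_l _ _)).
have H2 := H' h (Rlt_le_trans _ _ _ Hh (Rmin_r _ _)).
have -> : (F (z + h) + G (z + h) - (F z + G z) - h * (d + e)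
  = (F (z + h) - F z - h * d) + (G (z + h) - G z - h * e))%C by ring.
apply: Rle_trans (Cmod_triangle _ _) _; lra.
Qed.

Lemma qder_mult (F G : C -> C) (z d e : C) :
  qder F z d -> qder G z e -> qder (fun w => F w * G w)%C z (d * G z + F z * e)%C.
Proof.
move=> [K [r [HK [Hr H]]]] [K' [r' [HK' [Hr' H']]]].
have Pd := Cmod_ge_0 d; have Pe := Cmod_ge_0 e; have PF := Cmod_ge_0 (F z); have PG := Cmod_ge_0 (G z).
exists (Cmod (F z) * K' + Cmod (G z) * K + (Cmod d + K) * (Cmod e + K')), (Rmin r r'); split; [nra|split].
  by split; [apply: Rmin_pos; lra | apply: Rle_trans (Rmin_l _ _) _; lra].
move=> h Hh.
have H1 := H h (Rlt_le_trans _ _ _ Hh (Rmin_l _ _)).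
have H2 := H' h (Rlt_le_trans _ _ _ Hh (Rmin_r _ _)).
have Hh1 : Cmod h <= 1 by have := Rmin_l r r'; lra.
have Ph := Cmod_ge_0 h.
set a := (F (z + h) - F z - h * d)%C in H1 *.
set b := (G (z + h) - G z - h * e)%C in H2 *.
have -> : (F (z + h) * G (z + h) - F z * G z - h * (d * G z + F z * e)
  = (F z * b + G z * a) + (h * d + a) * (h * e + b))%C by rewrite /a /b; ring.
have Sq : Cmod h ^ 2 <= Cmod h by simpl; nra.
have A1 : Cmod (h * d + a) <= Cmod h * (Cmod d + K).
  apply: Rle_trans (Cmod_triangle _ _) _; rewrite Cmod_mult; nra.
have B1 : Cmod (h * e + b) <= Cmod h * (Cmod e + K').
  apply: Rle_trans (Cmod_triangle _ _) _; rewrite Cmod_mult; nra.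
apply: Rle_trans (Cmod_triangle _ _) _.
have T1 : Cmod (F z * b + G z * a) <= (Cmod (F z) * K' + Cmod (G z) * K) * Cmod h ^ 2.
  apply: Rle_trans (Cmod_triangle _ _) _; rewrite !Cmod_mult; nra.
have T2 : Cmod ((h * d + a) * (h * e + b)) <= (Cmod d + K) * (Cmod e + K') * Cmod h ^ 2.
  rewrite Cmod_mult.
  apply: Rle_trans (Rmult_le_compat _ _ _ _ (Cmod_ge_0 _) (Cmod_ge_0 _) A1 B1) _; simpl; lra.
lra.
Qed.

Lemma qder_id (z : C) : qder (fun w => w) z 1.
Proof.
exists 0, 1; split; [lra|split; [lra|]] => h _.
have -> : (z + h - z - h * 1 = 0)%C by ring.
by rewrite Cmod_0; lra.
Qed.

Lemma qder_scal (c : C) (F : C -> C) (z d : C) : qder F z d -> qder (fun w => c * F w)%C z (c * d)%C.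
Proof.
move=> H; have := qder_mult _ _ _ _ _ (qder_const c z) H.
by rewrite Cmult_0_l Cplus_0_l.
Qed.

Lemma qder_inv (z : C) : 0 < Re z -> qder (fun w => / w)%C z (- / (z * z))%C.
Proof.
move=> Hz; have Pz := Re_pos_Cmod z Hz; have Nz := Re_pos_neq0 z Hz.
exists (2 / Cmod z ^ 3), (Rmin 1 (Cmod z / 2)).
have P3 : 0 < Cmod z ^ 3 by apply: pow_lt.
split; first by apply: Rmult_le_pos; [lra | left; apply: Rinv_0_lt_compat].
split; first by split; [apply: Rmin_pos; lra | exact: Rmin_l].
move=> h Hh; have Hh1 := Rlt_le_trans _ _ _ Hh (Rmin_r _ _).
have M : Cmod z / 2 <= Cmod (z + h).
  have := Cmod_minus_ge z (- h); rewrite Cmod_opp (_ : (z - - h = z + h)%C); [lra | ring].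
have N : (z + h)%C <> 0%C by apply/Cmod_gt_0; lra.
have -> : (/ (z + h) - / z - h * (- / (z * z)) = h * h * (/ (z + h) * (/ z * / z)))%C by field.
rewrite !Cmod_mult !Cmod_inv'.
have -> : 2 / Cmod z ^ 3 * Cmod h ^ 2 = Cmod h * Cmod h * (/ (Cmod z / 2) * (/ Cmod z * / Cmod z)) by field; lra.
apply: Rmult_le_compat_l; first by have := Cmod_ge_0 h; nra.
apply: Rmult_le_compat_r.
  by apply: Rmult_le_pos; left; apply: Rinv_0_lt_compat.
apply: Rinv_le_contravar => //; lra.
Qed.

Lemma qder_cexp (F : C -> C) (z d : C) :
  qder F z d -> qder (fun w => cexp (F w)) z (cexp (F z) * d)%C.
Proof.
move=> [K [r [HK [Hr H]]]].
have Pd := Cmod_ge_0 d; have PE := exp_pos (Re (F z)); have PE' := exp_pos (Cmod d + K).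
exists (exp (Re (F z)) * ((Cmod d + K) ^ 2 * exp (Cmod d + K) + K)), r; split.
  by apply: Rmult_le_pos; [lra | have := pow2_ge_0 (Cmod d + K); nra].
split=> // h Hh; have H1 := H h Hh; have Ph := Cmod_ge_0 h.
set a := (F (z + h) - F z - h * d)%C in H1 *.
have A1 : Cmod (h * d + a) <= Cmod h * (Cmod d + K).
  apply: Rle_trans (Cmod_triangle _ _) _; rewrite Cmod_mult.
  have Sq : Cmod h ^ 2 <= Cmod h by simpl; nra.
  nra.
have -> : (cexp (F (z + h)) - cexp (F z) - h * (cexp (F z) * d)
  = cexp (F z) * ((cexp (h * d + a) - 1 - (h * d + a)) + a))%C.
  have -> : (F (z + h) = F z + (h * d + a))%C by rewrite /a; ring.
  by rewrite cexp_add; ring.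
rewrite Cmod_mult Cmod_cexp Rmult_assoc; apply: Rmult_le_compat_l; first lra.
apply: Rle_trans (Cmod_triangle _ _) _; rewrite Rmult_plus_distr_r; apply: Rplus_le_compat => //.
apply: Rle_trans (cexp_sub2 _ (Cmod d + K) _ _) _; first lra.
  apply: Rle_trans (Re_le_Cmod _) _; nra.
rewrite (_ : (Cmod d + K) ^ 2 * exp (Cmod d + K) * Cmod h ^ 2 = (Cmod h * (Cmod d + K)) ^ 2 * exp (Cmod d + K)); last ring.
apply: Rmult_le_compat_r; first lra.
by apply: pow_incr; split => //; exact: Cmod_ge_0.
Qed.

Lemma qder_is_derive (F : C -> C) (z v w : C) (t : R) :
  qder F (z + RtoC t * v) 0 -> is_derive (fun t => Re (w * F (z + RtoC t * v)%C)) t 0.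
Proof.
move=> [K [r [HK [Hr H]]]].
apply/is_derive_Reals => eps Heps.
have Pv := Cmod_ge_0 v; have Pw := Cmod_ge_0 w.
pose M := Cmod w * K * Cmod v ^ 2 + 1.
have PM : 0 < M by rewrite /M; have := Rmult_le_pos _ _ (Rmult_le_pos _ _ Pw HK) (pow2_ge_0 (Cmod v)); lra.
have Pdl : 0 < Rmin (r / (Cmod v + 1)) (eps / M).
  by apply: Rmin_pos; apply: Rdiv_lt_0_compat; lra.
exists (mkposreal _ Pdl) => h Hh0 /= Hh.
have Hh1 := Rlt_le_trans _ _ _ Hh (Rmin_l _ _).
have Hh2 := Rlt_le_trans _ _ _ Hh (Rmin_r _ _).
have Hmod : Cmod (RtoC h * v) = Rabs h * Cmod v by rewrite Cmod_mult Cmod_R.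
have B : Cmod (RtoC h * v) < r.
  rewrite Hmod.
  have E : r = r / (Cmod v + 1) * (Cmod v + 1) by field; lra.
  have := Rabs_pos h; nra.
have := H _ B.
have -> : (z + RtoC t * v + RtoC h * v = z + RtoC (t + h) * v)%C by rewrite RtoC_plus; ring.
have -> : (F (z + RtoC (t + h) * v) - F (z + RtoC t * v) - RtoC h * v * 0
   = F (z + RtoC (t + h) * v) - F (z + RtoC t * v))%C by ring.
set d := (_ - _)%C => Hd.
have Pa : 0 < Rabs h by exact: Rabs_pos_lt.
rewrite Rminus_0_r /Rdiv Rabs_mult Rabs_inv.
have E1 : Re (w * F (z + RtoC (t + h) * v)%C) - Re (w * F (z + RtoC t * v)%C) = Re (w * d).
  by rewrite !Re_mult /d Re_plus Im_plus re_opp im_opp; ring.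
rewrite E1.
apply: (Rmult_lt_reg_r (Rabs h)) => //.
rewrite Rmult_assoc Rinv_l ?Rmult_1_r; last lra.
apply: Rle_lt_trans (re_le_Cmod _) _; rewrite Cmod_mult.
rewrite Hmod in Hd.
apply: (Rle_lt_trans _ (Rabs h * (Rabs h * (Cmod w * K * Cmod v ^ 2)))).
  apply: Rle_trans (Rmult_le_compat_l _ _ _ Pw Hd) _; right; ring.
rewrite (Rmult_comm eps); apply: Rmult_lt_compat_l => //.
apply: (Rle_lt_trans _ (Rabs h * M)); first by apply: Rmult_le_compat_l; rewrite /M; lra.
have E : eps = eps / M * M by field; lra.
by rewrite E; apply: Rmult_lt_compat_r.
Qed.

(** The half-plane is convex, so the mean value theorem applies to [Re (w F)] along the segment from
    [a] to [b]; the choices [w = 1] and [w = - Ci] recover the two components. *)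
Lemma qder_zero_const (F : C -> C) (a b : C) :
  0 < Re a -> 0 < Re b -> (forall z, 0 < Re z -> qder F z 0) -> F a = F b.
Proof.
move=> Ha Hb H.
suff E w : Re (w * F a) = Re (w * F b).
  apply: Ceq; first by have := E 1%C; rewrite !Cmult_1_l.
  have := E (- Ci)%C; rewrite !Re_mult /=; lra.
have D t : 0 <= t <= 1 -> is_derive (fun t => Re (w * F (a + RtoC t * (b - a))%C)) t ((fun=> 0) t).
  move=> Ht; apply: qder_is_derive; apply: H.
  rewrite Re_plus re_scal_l Re_plus re_opp; nra.
have [c [_ E]] := MVT_0 _ _ 1 ltac:(lra) D.
move: E; rewrite (_ : (a + 0 * (b - a) = a)%C); last ring.
rewrite (_ : (a + 1 * (b - a) = b)%C); last ring.
lra.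
Qed.

Lemma cexp_geom (w : C) : Cmod w < 1 -> asum (fun n => w ^ n)%C /\ CSer (fun n => w ^ n)%C = (/ (1 - w))%C.
Proof.
move=> Hw.
have Sa : asum (fun n => w ^ n)%C.
  apply: (ex_series_ext (fun n => Cmod w ^ n)) => [n|]; first by rewrite Cmod_pow.
  by apply: ex_series_geom; rewrite Rabs_pos_eq //; exact: Cmod_ge_0.
have N : (1 - w)%C <> 0%C.
  by apply/Cmod_gt_0; have := Cmod_minus_ge 1 w; rewrite Cmod_1; lra.
split=> //; apply: CSer_unique => //.
apply: (Clim_ext (fun n => (1 - w ^ n) * / (1 - w))%C).
  by elim=> [|n IH] /=; [field | rewrite -IH; field].
rewrite -[X in Clim _ X]Cmult_1_l; apply: Clim_mult; last exact: Clim_const.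
rewrite -[X in Clim _ X](_ : (1 - 0 = 1)%C); last ring.
apply: Clim_minus; first exact: Clim_const.
apply/Clim_Cmod; apply: (is_lim_seq_ext (fun n => Cmod w ^ n)).
  by move=> n; rewrite -Cmod_pow; congr Cmod; ring.
by apply: is_lim_seq_geom; rewrite Rabs_pos_eq //; exact: Cmod_ge_0.
Qed.

(** The signs of Taylor polynomials of the cosine at 1.5695 and at 1.571 enclose its zero
    [PI / 2]. *)
Lemma PI_bounds : 3.139 < PI < 3.142.
Proof.
split.
- suff : 1.5695 < PI / 2 by lra.
  apply: PI2_lower_bound; first lra.
  have [H _] := pre_cos_bound 1.5695 1 ltac:(lra) ltac:(lra).
  apply: Rlt_le_trans H.
  by rewrite /cos_approx /sum_f_R0 /cos_term /=; lra.
- have H := proj2 (pre_cos_bound 1.571 1 ltac:(lra) ltac:(lra)).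
  suff : PI / 2 < 1.571 by lra.
  apply: Rnot_le_lt => L.
  have H0 : 0 <= cos 1.571 by apply: cos_ge_0 => //; have := PI2_RGT_0; lra.
  have H1 := Rle_trans _ _ _ H0 H.
  have F k m : Z.of_nat (fact k) = m -> INR (fact k) = IZR m by move=> <-; exact: INR_IZR_INZ.
  move: H1; rewrite /cos_approx -[(2 * (1 + 1))%nat]/4%nat /sum_f_R0 /cos_term.
  rewrite (F (2 * 0)%nat 1%Z) // (F (2 * 1)%nat 2%Z) // (F (2 * 2)%nat 24%Z) //.
  rewrite (F (2 * 3)%nat 720%Z) // (F (2 * 4)%nat 40320%Z) //.
  by cbn [pow Nat.mul Nat.add]; lra.
Qed.

Lemma sin_ge_half (u : R) : 0 <= u <= PI / 2 -> u / 2 <= sin u.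
Proof.
move=> Hu; have [P1 P2] := PI_bounds.
have [H _] := pre_sin_bound u 0 ltac:(lra) ltac:(lra).
apply: Rle_trans H; rewrite /sin_approx /sum_f_R0 /sin_term /=.
have U : 0 <= u * u <= 2.47 by nra.
nra.
Qed.

Lemma ex_series_inv_sqr : ex_series (fun i => / INR (S i) ^ 2).
Proof.
apply: (ex_series_bounded _ 2).
  by move=> i; left; apply: Rinv_0_lt_compat; apply: pow_lt; apply: lt_0_INR; lia.
suff H n : rsum (fun i => / INR (S i) ^ 2) (S n) <= 2 - / INR (S n).
  case=> [|n]; first by rewrite /=; lra.
  apply: Rle_trans (H n) _.
  have : 0 < / INR (S n) by apply: Rinv_0_lt_compat; apply: lt_0_INR; lia.
  lra.
elim: n => [|n IH]; first by rewrite /=; lra.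
rewrite rsum_S.
have P : 0 < INR (S n) by apply: lt_0_INR; lia.
rewrite (S_INR (S n)); set y := INR (S n) in IH P *.
(* Comparison with a telescoping series. *)
have : / (y + 1) ^ 2 <= / y - / (y + 1).
  have -> : / y - / (y + 1) = / (y * (y + 1)) by field; lra.
  by apply: Rinv_le_contravar; nra.
lra.
Qed.

(** * Partial fractions of the hyperbolic cotangent *)

(** This is [coth (x / 2) / 2], normalised to have residue 1 at each of its poles, which are the
    points [wk k] and their opposites. *)
Definition chi (x : C) : C := (/ (cexp x - 1) + / 2)%C.

Definition wk (k : nat) : C := (RtoC (2 * PI * INR k) * Ci)%C.

Lemma Re_wk (k : nat) : Re (wk k) = 0.
Proof. by rewrite /wk /=; ring. Qed.

Lemma wk_0 : wk 0 = 0%C.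
Proof. by rewrite /wk /= Rmult_0_r Cmult_0_l. Qed.

Lemma Im_wk (k : nat) : Im (wk k) = 2 * PI * INR k.
Proof. by rewrite /wk /=; ring. Qed.

Lemma cexp_wk (k : nat) : cexp (wk k) = 1%C.
Proof. exact: cexp_2PI. Qed.

Lemma cexp_sub1_neq0 (x : C) : 0 < Re x -> (cexp x - 1)%C <> 0%C.
Proof.
move=> H; apply/Cmod_gt_0.
have := Cmod_minus_ge (cexp x) 1; rewrite Cmod_1 Cmod_cexp.
have := exp_ineq1 (Re x) ltac:(lra); lra.
Qed.

Lemma cexp_PI : cexp (RtoC PI * Ci) = RtoC (-1).
Proof.
have -> : (RtoC PI * Ci = (0, PI)%R)%C by apply: Ceq => /=; ring.
by rewrite /cexp /= exp_0 cos_PI sin_PI; apply: Ceq => /=; ring.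
Qed.

(** With [a = cexp (x / 2)] this is the decomposition of [1 / (a^2 - 1)] over [a - 1] and [a + 1].
    Iterated, it writes [chi x] as the average of [2^n] values at the points [(x + wk k) / 2^n], a
    finite form of the partial fractions. *)
Lemma chi_dup (x : C) : 0 < Re x ->
  chi x = (/ 2 * (chi (x * RtoC (/ 2)) + chi (x * RtoC (/ 2) + RtoC PI * Ci)))%C.
Proof.
move=> Hx; rewrite /chi cexp_add cexp_PI.
have E : cexp x = (cexp (x * RtoC (/ 2)) * cexp (x * RtoC (/ 2)))%C.
  rewrite -cexp_add; congr cexp; rewrite RtoC_inv; [field | lra].
have H1 : (cexp (x * RtoC (/ 2)) - 1)%C <> 0%C.
  by apply: cexp_sub1_neq0; rewrite re_scal_r; lra.
have H2 : (cexp (x * RtoC (/ 2) + RtoC PI * Ci) - 1)%C <> 0%C.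
  by apply: cexp_sub1_neq0; rewrite Re_plus re_scal_r /=; lra.
rewrite cexp_add cexp_PI in H2.
have H3 := cexp_sub1_neq0 x Hx; rewrite E in H3 *.
by field.
Qed.

Lemma chi_dup_n (n : nat) (x : C) : 0 < Re x ->
  chi x = (RtoC (/ 2 ^ n) * csum (fun k => chi ((x + wk k) * RtoC (/ 2 ^ n))) (2 ^ n)%nat)%C.
Proof.
move=> Hx; elim: n => [|n IH].
  by rewrite /= Rinv_1 wk_0 Cplus_0_l Cplus_0_r !Cmult_1_l Cmult_1_r.
have P : 0 < / 2 ^ n by apply: Rinv_0_lt_compat; apply: pow_lt; lra.
have -> : (2 ^ S n = 2 ^ n + 2 ^ n)%nat by rewrite Nat.pow_succ_r'; lia.
rewrite csum_app IH -csum_plus.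
have -> : / 2 ^ S n = / 2 ^ n * / 2 by rewrite /= Rinv_mult Rmult_comm.
rewrite RtoC_mult -Cmult_assoc; congr Cmult.
rewrite -csum_scal; apply: csum_ext => k _.
rewrite chi_dup; last by rewrite re_scal_r Re_plus Re_wk; nra.
rewrite (_ : RtoC (/ 2) = (/ 2)%C); last by rewrite RtoC_inv //; lra.
congr (_ * (_ + _))%C; congr chi; first by rewrite Cmult_assoc.
have E : (RtoC PI * Ci = wk (2 ^ n) * (RtoC (/ 2 ^ n) * / 2))%C.
  rewrite /wk pow_INR.
  have Z : (2 ^ n <> 0)%R by apply: pow_nonzero; lra.
  rewrite (_ : (/ 2)%C = RtoC (/ 2)); last by rewrite RtoC_inv //; lra.
  apply: Ceq; rewrite /=; [ring | field_simplify => //].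
  by rewrite (_ : (1 + 1 = 2)) //; field.
rewrite E /wk plus_INR !Rmult_plus_distr_l RtoC_plus; ring.
Qed.

Lemma cexp_Ci_sum (t : R) :
  (cexp (RtoC t * Ci) + / cexp (RtoC t * Ci) = RtoC (2 - 4 * sin (t / 2) ^ 2))%C.
Proof.
rewrite -cexp_opp.
have -> : (RtoC t * Ci = (0, t)%R)%C by apply: Ceq => /=; ring.
have E : cos t = 1 - 2 * sin (t / 2) ^ 2.
  have {1}-> : t = 2 * (t / 2) by field.
  by rewrite cos_2a_sin /=; ring.
apply: Ceq; rewrite /cexp /= Ropp_0 exp_0 ?cos_neg ?sin_neg ?E /=; ring.
Qed.

Lemma chi_pair (y : C) (t : R) : 0 < Re y ->
  (chi (y + RtoC t * Ci) + chi (y - RtoC t * Ci) =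
   (cexp y + 1) * (cexp y - 1) /
     ((cexp y - 1) * (cexp y - 1) + cexp y * RtoC (4 * sin (t / 2) ^ 2)))%C.
Proof.
move=> Hy.
have H1 : (cexp (y + RtoC t * Ci) - 1)%C <> 0%C.
  by apply: cexp_sub1_neq0; rewrite Re_plus /=; lra.
have H2 : (cexp (y - RtoC t * Ci) - 1)%C <> 0%C.
  by apply: cexp_sub1_neq0; rewrite Re_plus /=; lra.
have H := cexp_Ci_sum t; have N := cexp_neq0 (RtoC t * Ci).
rewrite /chi; rewrite cexp_minus cexp_add in H1 H2 *.
set a := cexp y in H1 H2 *; set b := cexp (RtoC t * Ci) in H N H1 H2 *.
have -> : RtoC (4 * sin (t / 2) ^ 2) = (2 - (b + / b))%C by rewrite H -RtoC_minus; congr RtoC; ring.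
have D : ((a - 1) * (a - 1) + a * (2 - (b + / b)) = (a * b - 1) * (a / b - 1))%C by field.
have N3 : (a - b)%C <> 0%C.
  move=> E; apply: H2; have -> : (a = a - b + b)%C by ring.
  by rewrite E; field.
by rewrite D; field.
Qed.

Definition pfpair (x : C) (i : nat) : C := (/ (x + wk (S i)) + / (x - wk (S i)))%C.

Definition chi_term (x : C) (n i : nat) : C :=
  (RtoC (/ 2 ^ S n) * (chi (x * RtoC (/ 2 ^ S n) + RtoC (2 * PI * INR (S i) * / 2 ^ S n) * Ci)
     + chi (x * RtoC (/ 2 ^ S n) - RtoC (2 * PI * INR (S i) * / 2 ^ S n) * Ci)))%C.

(** The summand of index [k] is paired with that of index [2^(n+1) - k], which by periodicity is the
    one of index [- k]. Only the indices 0 and [2^n] remain unpaired. The pairing is what makes the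
    limiting series absolutely convergent. *)
Lemma chi_finite (n : nat) (x : C) : 0 < Re x ->
  (chi x = RtoC (/ 2 ^ S n) * (chi (x * RtoC (/ 2 ^ S n)) + chi (x * RtoC (/ 2 ^ S n) + RtoC PI * Ci))
     + csum (chi_term x n) (2 ^ n - 1)%nat)%C.
Proof.
move=> Hx; rewrite (chi_dup_n (S n)) //.
have P2 : (1 <= 2 ^ n)%nat by have := Nat.pow_nonzero 2 n ltac:(lia); lia.
set m := (2 ^ n - 1)%nat.
have Em : (2 ^ S n)%nat = (S m + S m)%nat by rewrite Nat.pow_succ_r' /m; lia.
have Em2 : 2 ^ S n = 2 * INR (S m).
  by rewrite (_ : S m = (2 ^ n)%nat) ?pow_INR //; rewrite /m; lia.
rewrite Em csum_app !csum_S_l -(csum_rev (fun i => chi ((x + wk (S m + S i)) * _))).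
set q := / 2 ^ S n.
have Pm : INR (S m) <> 0 by apply: not_0_INR; lia.
have Q : q * (2 * INR (S m)) = 1 by rewrite /q Em2; field.
have E0 : ((x + wk 0) * RtoC q = x * RtoC q)%C by rewrite wk_0 Cplus_0_r.
have E1 : ((x + wk (S m + 0)) * RtoC q = x * RtoC q + RtoC PI * Ci)%C.
  rewrite /wk Nat.add_0_r Cmult_plus_distr_r; congr Cplus.
  rewrite -Cmult_assoc (Cmult_comm Ci) Cmult_assoc -RtoC_mult; congr (RtoC _ * _)%C.
  transitivity (PI * (q * (2 * INR (S m)))); first ring.
  by rewrite Q; ring.
rewrite E0 E1.
have E2 : csum (chi_term x n) m = (RtoC q * (csum (fun i => chi ((x + wk (S i)) * RtoC q)) m +
    csum (fun i => chi ((x + wk (S m + S (m - S i))) * RtoC q)) m))%C.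
  rewrite -csum_plus -csum_scal; apply: csum_ext => i Hi.
  rewrite /chi_term -/q; congr (_ * (_ + _))%C.
    by congr chi; rewrite /wk RtoC_mult; ring.
  rewrite /chi; congr (/ (_ - _) + _)%C.
  have -> : ((x + wk (S m + S (m - S i))) * RtoC q =
     x * RtoC q - RtoC (2 * PI * INR (S i) * q) * Ci + wk 1)%C.
    rewrite /wk (_ : INR (S m + S (m - S i)) = 2 * INR (S m) - INR (S i)); last first.
      have -> : (S m + S (m - S i) = S m + S m - S i)%nat by lia.
      by rewrite minus_INR ?plus_INR; [ring | lia].
    have -> : (RtoC (2 * PI * INR 1) = RtoC (2 * PI * (q * (2 * INR (S m)))))%C by rewrite Q.
    by rewrite !RtoC_mult RtoC_minus !RtoC_mult; ring.
  by rewrite cexp_add cexp_wk Cmult_1_r.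
rewrite E2; ring.
Qed.

Lemma pow2S_inv (n : nat) : 0 < / 2 ^ S n <= 1.
Proof.
split; first by apply: Rinv_0_lt_compat; apply: pow_lt; lra.
rewrite -Rinv_1; apply: Rinv_le_contravar; first lra.
by apply: pow_R1_Rle; lra.
Qed.

Lemma pow2S_inv_lim : is_lim_seq (fun n => / 2 ^ S n) 0.
Proof.
apply: (is_lim_seq_ext (fun n => (/ 2) ^ S n)); first by move=> n; rewrite pow_inv.
apply: (proj1 (is_lim_seq_incr_1 (fun n => (/ 2) ^ n) 0)).
by apply: is_lim_seq_geom; rewrite Rabs_pos_eq; lra.
Qed.

Lemma Cmod_scal_r (x : C) (h : R) : 0 <= h -> Cmod (x * RtoC h) = Cmod x * h.
Proof. by move=> H; rewrite Cmod_mult Cmod_R Rabs_pos_eq. Qed.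

Lemma lim_scal0 (c : R) (u : nat -> R) : is_lim_seq u 0 -> is_lim_seq (fun n => c * u n) 0.
Proof.
move=> H; have := is_lim_seq_mult' _ _ _ _ (is_lim_seq_const c) H.
by rewrite Rmult_0_r.
Qed.

Lemma Re_scal_le (x : C) (h : R) : 0 < h <= 1 -> Re (x * RtoC h) <= Cmod x.
Proof.
move=> H; apply: Rle_trans (Re_le_Cmod _) _; rewrite Cmod_scal_r; last lra.
have := Cmod_ge_0 x; nra.
Qed.

Lemma lim_expm1 (x : C) (h : nat -> R) :
  (forall n, 0 < h n <= 1) -> is_lim_seq h 0 ->
  Clim (fun n => (cexp (x * RtoC (h n)) - 1) * RtoC (/ h n))%C x.
Proof.
move=> Hh H0.
apply: (Clim_squeeze _ _ (fun n => Cmod x ^ 2 * exp (Cmod x) * h n)); last exact: lim_scal0.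
move=> n; have [h0 h1] := Hh n.
have -> : ((cexp (x * RtoC (h n)) - 1) * RtoC (/ h n) - x
   = (cexp (x * RtoC (h n)) - 1 - x * RtoC (h n)) * RtoC (/ h n))%C.
  rewrite RtoC_inv; last lra.
  by field; move/RtoC_inj; lra.
rewrite Cmod_scal_r; last by left; apply: Rinv_0_lt_compat.
have E : Cmod x ^ 2 * exp (Cmod x) * h n = (Cmod x * h n) ^ 2 * exp (Cmod x) * / h n by field; lra.
rewrite E; apply: Rmult_le_compat_r; first by left; apply: Rinv_0_lt_compat.
rewrite -Cmod_scal_r; last lra.
by apply: cexp_sub2; [exact: Cmod_ge_0 | apply: Re_scal_le].
Qed.

Lemma lim_exp1 (x : C) (h : nat -> R) :
  (forall n, 0 < h n <= 1) -> is_lim_seq h 0 -> Clim (fun n => cexp (x * RtoC (h n)))%C 1.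
Proof.
move=> Hh H0.
apply: (Clim_squeeze _ _ (fun n => Cmod x * exp (Cmod x) * h n)); last exact: lim_scal0.
move=> n; have [h0 h1] := Hh n.
rewrite (_ : Cmod x * exp (Cmod x) * h n = Cmod (x * RtoC (h n)) * exp (Cmod x)); last first.
  by rewrite Cmod_scal_r; [ring | lra].
by apply: cexp_sub1; [exact: Cmod_ge_0 | apply: Re_scal_le].
Qed.

Lemma lim_sin (t : R) (h : nat -> R) :
  (forall n, 0 < h n <= 1) -> is_lim_seq h 0 -> is_lim_seq (fun n => sin (t * h n) * / h n) t.
Proof.
move=> Hh H0.
have [_] := lim_expm1 (0, t) h Hh H0.
apply: is_lim_seq_ext => n /=.
by rewrite /cexp /= !(Rmult_0_l, Rmult_0_r, Rminus_0_r, Rplus_0_l, Rplus_0_r) exp_0; ring.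
Qed.

Lemma wk_neq (x : C) (k : nat) : 0 < Re x -> (x + wk k)%C <> 0%C /\ (x - wk k)%C <> 0%C.
Proof.
by move=> Hx; split; apply: Re_pos_neq0; rewrite Re_plus ?re_opp Re_wk; lra.
Qed.

Lemma pfpairE (x : C) (i : nat) : 0 < Re x ->
  pfpair x i = ((1 + 1) * x / (x * x + RtoC ((2 * PI * INR (S i)) ^ 2)))%C /\
  (x * x + RtoC ((2 * PI * INR (S i)) ^ 2) <> 0)%C.
Proof.
move=> Hx; have [N1 N2] := wk_neq x (S i) Hx.
have E : (x * x + RtoC ((2 * PI * INR (S i)) ^ 2) = (x + wk (S i)) * (x - wk (S i)))%C.
  rewrite /wk; set c := 2 * PI * INR (S i).
  rewrite RtoC_pow; transitivity (x * x - (Ci * Ci) * (RtoC c * RtoC c))%C; last ring.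
  have -> : (Ci * Ci = RtoC (-1))%C by apply: Ceq => /=; ring.
  by rewrite /=; ring.
rewrite E; split; last by apply: Cmult_neq_0.
by rewrite /pfpair; field.
Qed.

(** In this form every factor has a finite limit as [h] tends to 0: [a] tends to 1, [u] to [x], and
    the sine quotient to [PI (i + 1)]. *)
Lemma chi_termE (x : C) (n i : nat) : 0 < Re x ->
  let h := / 2 ^ S n in
  let a := cexp (x * RtoC h) in
  let u := ((a - 1) * RtoC (/ h))%C in
  chi_term x n i = ((a + 1) * u / (u * u + a * RtoC (4 * (sin (PI * INR (S i) * h) * / h) ^ 2)))%C /\
  (u * u + a * RtoC (4 * (sin (PI * INR (S i) * h) * / h) ^ 2) =
    RtoC (/ h * / h) * ((a - 1) * (a - 1) + a * RtoC (4 * sin (PI * INR (S i) * h) ^ 2)))%C.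
Proof.
move=> Hx h a u; have [h0 h1] := pow2S_inv n; rewrite -/h in h0 h1.
have Hy : 0 < Re (x * RtoC h) by rewrite re_scal_r; nra.
have Nh : RtoC h <> 0%C by move/RtoC_inj; lra.
have E : (u * u + a * RtoC (4 * (sin (PI * INR (S i) * h) * / h) ^ 2) =
    RtoC (/ h * / h) * ((a - 1) * (a - 1) + a * RtoC (4 * sin (PI * INR (S i) * h) ^ 2)))%C.
  have -> : 4 * (sin (PI * INR (S i) * h) * / h) ^ 2 = (/ h * / h) * (4 * sin (PI * INR (S i) * h) ^ 2) by ring.
  by rewrite /u RtoC_mult RtoC_mult; ring.
split => //.
rewrite E /chi_term -/h chi_pair //.
have -> : 2 * PI * INR (S i) * h / 2 = PI * INR (S i) * h by field.
rewrite -/a /u; set D := ((a - 1) * (a - 1) + _)%C.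
rewrite RtoC_mult RtoC_inv; last lra.
(* If the denominator vanishes, both sides are 0 by the convention [/ 0 = 0]. *)
have [->|ND] := Ceq_dec D 0; last by field.
have I0 : (/ 0 = 0)%C by apply: Ceq; rewrite /Cinv /= /Rdiv; ring.
by rewrite Cmult_0_r /Cdiv I0; ring.
Qed.

Lemma chi_term_lim (x : C) (i : nat) : 0 < Re x -> Clim (fun n => chi_term x n i) (pfpair x i).
Proof.
move=> Hx; have [-> N] := pfpairE x i Hx.
apply: (Clim_ext _ _ _ (fun n => esym (proj1 (chi_termE x n i Hx)))).
have L1 := lim_expm1 x _ pow2S_inv pow2S_inv_lim.
have L2 := lim_exp1 x _ pow2S_inv pow2S_inv_lim.
have L3 := lim_sin (PI * INR (S i)) _ pow2S_inv pow2S_inv_lim.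
apply: Clim_mult; first by apply: Clim_mult => //; apply: Clim_plus => //; exact: Clim_const.
apply: Clim_inv => //.
apply: Clim_plus; first exact: Clim_mult.
rewrite -[X in Clim _ X]Cmult_1_l; apply: Clim_mult => //; apply: Clim_RtoC.
rewrite (_ : (2 * PI * INR (S i)) ^ 2 = 4 * ((PI * INR (S i)) * (PI * INR (S i)))); last ring.
apply: is_lim_seq_mult'; first exact: is_lim_seq_const.
apply: (is_lim_seq_ext (fun n => (sin (PI * INR (S i) * / 2 ^ S n) * / / 2 ^ S n) * (sin (PI * INR (S i) * / 2 ^ S n) * / / 2 ^ S n))).
  by move=> n; ring.
exact: is_lim_seq_mult'.
Qed.

(** The restriction on [i] places [PI (i + 1) h] in [[0, PI / 2]], where the sine is at least half
    of its argument. The condition [X <= INR (S i)] then lets the sine term of the denominator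
    outweigh [(a - 1)^2]. *)
Lemma chi_term_bound (x : C) (n i : nat) : 0 < Re x -> (i < 2 ^ n - 1)%nat ->
  let X := Cmod x * exp (Cmod x) in
  X <= INR (S i) -> Cmod (chi_term x n i) <= X * (X + 2) * / INR (S i) ^ 2.
Proof.
move=> Hx Hi X HX; have [-> ->] := chi_termE x n i Hx.
have [h0 h1] := pow2S_inv n.
set h := / 2 ^ S n in h0 h1 *.
have Hhi : INR (S i) * h <= / 2.
  have H1 : INR (S i) <= 2 ^ n by rewrite (_ : 2 ^ n = INR (2 ^ n)); [apply: le_INR; lia | rewrite pow_INR].
  have P : 0 < 2 ^ n by apply: pow_lt; lra.
  rewrite /h /= Rinv_mult.
  have : INR (S i) * / 2 ^ n <= 1 by apply: (Rmult_le_reg_r (2 ^ n)) => //; field_simplify; lra.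
  by rewrite -/(INR (S i)); lra.
set a := cexp (x * RtoC h).
have PX : 0 < X by apply: Rmult_lt_0_compat; [exact: Re_pos_Cmod | exact: exp_pos].
have A1 : Cmod (a - 1) <= X * h.
  have := cexp_sub1 (x * RtoC h) (Cmod x) (Cmod_ge_0 _) (Re_scal_le _ _ (conj h0 h1)).
  by rewrite Cmod_scal_r /X /a; [lra | lra].
have A2 : 1 <= Cmod a.
  rewrite /a Cmod_cexp -exp_0; have : 0 < Re (x * RtoC h) by rewrite re_scal_r; nra.
  by move=> H; left; apply: exp_increasing.
have A3 : Cmod (a + 1) <= X + 2.
  have -> : (a + 1 = (a - 1) + 2)%C by ring.
  apply: Rle_trans (Cmod_triangle _ _) _; rewrite Cmod_R Rabs_pos_eq; [nra | lra].
have PI0 := PI_bounds.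
have Pi : 1 <= INR (S i) by rewrite S_INR; have := pos_INR i; lra.
have Hs : 3 / 2 * (INR (S i) * h) <= sin (PI * INR (S i) * h).
  have := sin_ge_half (PI * INR (S i) * h).
  have : 0 <= INR (S i) * h by apply: Rmult_le_pos; lra.
  by move=> H0 H; have := H ltac:(nra); nra.
set s := sin (PI * INR (S i) * h) in Hs *.
set D := ((a - 1) * (a - 1) + a * RtoC (4 * s ^ 2))%C.
(* [8 = 9 - 1]: on the one hand [4 s^2 >= 9 (i + 1)^2 h^2], on the other
   [|a - 1|^2 <= (X h)^2 <= (i + 1)^2 h^2]. *)
have HD : 8 * INR (S i) ^ 2 * h ^ 2 <= Cmod D.
  have P : 0 <= INR (S i) * h by apply: Rmult_le_pos; lra.
  have S2 : 9 / 4 * (INR (S i) ^ 2 * h ^ 2) <= s ^ 2.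
    by have -> : 9 / 4 * (INR (S i) ^ 2 * h ^ 2) = (3 / 2 * (INR (S i) * h)) ^ 2; [field | apply: pow_incr; lra].
  have := Cmod_minus_ge (a * RtoC (4 * s ^ 2)) (- ((a - 1) * (a - 1))).
  rewrite Cmod_opp (_ : (a * RtoC (4 * s ^ 2) - - ((a - 1) * (a - 1)) = D)%C); last by rewrite /D; ring.
  rewrite Cmod_mult Cmod_R Rabs_pos_eq; last by have := pow2_ge_0 s; lra.
  rewrite Cmod_mult.
  have P1 := Cmod_ge_0 (a - 1).
  have Q1 : Cmod (a - 1) * Cmod (a - 1) <= (X * h) * (X * h) by nra.
  have Q2 : (X * h) * (X * h) <= INR (S i) ^ 2 * h ^ 2.
    have -> : INR (S i) ^ 2 * h ^ 2 = (INR (S i) * h) * (INR (S i) * h) by ring.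
    by have : X * h <= INR (S i) * h; nra.
  have Q3 : 4 * s ^ 2 <= Cmod a * (4 * s ^ 2) by have := pow2_ge_0 s; nra.
  lra.
rewrite /Cdiv !Cmod_mult Cmod_inv' !Cmod_mult !Cmod_R !Rabs_mult !(Rabs_pos_eq (/ h)); last by left; apply: Rinv_0_lt_compat.
have PD : 0 < 8 * INR (S i) ^ 2 * h ^ 2.
  by apply: Rmult_lt_0_compat; [have := pow_lt (INR (S i)) 2 ltac:(lra); lra | apply: pow_lt].
rewrite (Rinv_mult (/ h * / h)) (Rinv_mult (/ h) (/ h)) Rinv_inv.
have -> : Cmod (a + 1) * (Cmod (a - 1) * / h) * (h * h * / Cmod D) = Cmod (a + 1) * Cmod (a - 1) * (h * / Cmod D) by field; lra.
apply: (Rle_trans _ ((X + 2) * (X * h) * (h * / (8 * INR (S i) ^ 2 * h ^ 2)))).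
  apply: Rmult_le_compat.
  - by apply: Rmult_le_pos; exact: Cmod_ge_0.
  - by apply: Rmult_le_pos; [lra | left; apply: Rinv_0_lt_compat; lra].
  - by apply: Rmult_le_compat => //; exact: Cmod_ge_0.
  - by apply: Rmult_le_compat_l; [lra | apply: Rinv_le_contravar].
have -> : (X + 2) * (X * h) * (h * / (8 * INR (S i) ^ 2 * h ^ 2)) = / 8 * (X * (X + 2) * / INR (S i) ^ 2) by field; lra.
set y := X * (X + 2) * / INR (S i) ^ 2.
suff : 0 <= y by lra.
by apply: Rmult_le_pos; [nra | left; apply: Rinv_0_lt_compat; apply: pow_lt; lra].
Qed.

Theorem chi_partial_fractions (x : C) : 0 < Re x ->
  asum (pfpair x) /\ chi x = (/ x + CSer (pfpair x))%C.
Proof.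
move=> Hx.
pose X := Cmod x * exp (Cmod x).
(* The finite sum of pairs is extended by 0 to an infinite series, so that [tannery] applies. *)
pose g n i := if Nat.ltb i (2 ^ n - 1) then chi_term x n i else 0%C.
have [K HK] : exists K, X <= INR K.
  by have [K HK] := INR_unbounded X; exists K; lra.
have Gs n : asum (g n) /\ CSer (g n) = csum (chi_term x n) (2 ^ n - 1).
  have [S E] := CSer_csum (g n) (2 ^ n - 1) ltac:(by move=> k Hk; rewrite /g; case: Nat.ltb_spec => //; lia).
  split => //; rewrite E; apply: csum_ext => k Hk.
  by rewrite /g; case: Nat.ltb_spec => //; lia.
have Gl k : Clim (fun n => g n k) (pfpair x k).
  apply: (Clim_ext_loc (fun n => chi_term x n k) _ _ (S (S k))); last exact: chi_term_lim.
  move=> n Hn; rewrite /g; case: Nat.ltb_spec => //.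
  have := Nat.pow_gt_lin_r 2 n ltac:(lia); lia.
have Sb : ex_series (fun k => X * (X + 2) * / INR (S k) ^ 2).
  by apply: (ex_series_scal (V := R_NormedModule)); exact: ex_series_inv_sqr.
have Gb n k : (0 <= n)%nat -> (K <= k)%nat -> Cmod (g n k) <= X * (X + 2) * / INR (S k) ^ 2.
  move=> _ Hk; rewrite /g; case: Nat.ltb_spec => H.
    apply: chi_term_bound => //; apply: Rle_trans HK _; apply: le_INR; lia.
  rewrite Cmod_0; apply: Rmult_le_pos; last by left; apply: Rinv_0_lt_compat; apply: pow_lt; apply: lt_0_INR; lia.
  by have : 0 < X; [apply: Rmult_lt_0_compat; [exact: Re_pos_Cmod | exact: exp_pos] | nra].
have [S1 L1] := tannery g (pfpair x) _ K 0 Gb Sb (fun n => proj1 (Gs n)) Gl.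
split => //.
have Nx := Re_pos_neq0 x Hx.
apply: (Clim_unique (fun n => chi x)); first exact: Clim_const.
apply: (Clim_ext _ _ _ (fun n => esym (chi_finite n x Hx))).
apply: Clim_plus; last by apply: Clim_ext L1 => n; rewrite (proj2 (Gs n)).
have LE := lim_expm1 x _ pow2S_inv pow2S_inv_lim.
have LE1 := lim_exp1 x _ pow2S_inv pow2S_inv_lim.
have Lh := Clim_RtoC _ _ pow2S_inv_lim.
have N2 : (- (1) - 1)%C <> 0%C by move=> E; have := f_equal Re E; rewrite /=; lra.
(* The unpaired summand of index 0 tends to [/ x], and the one of index [2^n] tends to 0. *)
rewrite (_ : (/ x = (/ x + 0 * / 2) + 0 * (/ (- (1) - 1) + / 2))%C); last by field.
apply: (Clim_ext (fun n => (/ ((cexp (x * RtoC (/ 2 ^ S n)) - 1) * RtoC (/ / 2 ^ S n)) + RtoC (/ 2 ^ S n) * / 2)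
   + RtoC (/ 2 ^ S n) * (/ (- cexp (x * RtoC (/ 2 ^ S n)) - 1) + / 2))%C).
  move=> n; rewrite /chi cexp_add cexp_PI.
  have [h0 h1] := pow2S_inv n; set h := / 2 ^ S n in h0 h1 *.
  have Nh : RtoC h <> 0%C by move/RtoC_inj; lra.
  have Hy : 0 < Re (x * RtoC h) by rewrite re_scal_r; nra.
  have N1 := cexp_sub1_neq0 _ Hy.
  rewrite (RtoC_inv h); last lra.
  rewrite (_ : (/ ((cexp (x * RtoC h) - 1) * / RtoC h) = RtoC h * / (cexp (x * RtoC h) - 1))%C); last by field.
  by rewrite (_ : (cexp (x * RtoC h) * RtoC (-1) = - cexp (x * RtoC h))%C); [ring | ring].
apply: Clim_plus.
  apply: Clim_plus; first by apply: Clim_inv.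
  by apply: Clim_mult => //; exact: Clim_const.
apply: Clim_mult => //; apply: Clim_plus; last exact: Clim_const.
apply: Clim_inv => //; apply: Clim_minus; last exact: Clim_const.
exact: Clim_opp.
Qed.

(** * The Lipschitz summation formula *)

Lemma CSer_RtoC (a : nat -> R) : ex_series a -> CSer (fun n => RtoC (a n)) = RtoC (Series a).
Proof.
move=> Ha; apply: Ceq => //=.
by apply: is_series_unique; exact: is_series_0.
Qed.

Lemma CV_radius_pos (a : nat -> R) (r : R) :
  0 < r -> ex_series (fun n => Rabs (a n * r ^ n)) -> Rbar_lt 0 (CV_radius a).
Proof.
move=> Hr Ha.
have [H _] := Lub_Rbar_correct (CV_disk a).
exact: (Rbar_lt_le_trans 0 r (CV_radius a) Hr (H r Ha)).
Qed.

Lemma power_series_unique (a b : nat -> C) (rho : R) : 0 < rho ->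
  (forall t, Rabs t < rho -> asum (fun n => a n * RtoC (t ^ n))%C /\ asum (fun n => b n * RtoC (t ^ n))%C /\
     CSer (fun n => a n * RtoC (t ^ n))%C = CSer (fun n => b n * RtoC (t ^ n))%C) ->
  forall n, a n = b n.
Proof.
move=> Hr H n.
have H2 := H (rho / 2) ltac:(rewrite Rabs_pos_eq; lra).
have S (p : C -> R) (c : nat -> C) : (forall z, Rabs (p z) <= Cmod z) -> (forall z t, p (z * RtoC t)%C = p z * t) ->
   asum (fun n => c n * RtoC ((rho / 2) ^ n))%C -> Rbar_lt 0 (CV_radius (fun n => p (c n))).
  move=> Hp Hs; move=> Hc; apply: (CV_radius_pos _ (rho / 2)); first lra.
  by apply: ex_series_le0 Hc => k; split; [exact: Rabs_pos | rewrite -Hs].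
have U (p : C -> R) : (forall z, Rabs (p z) <= Cmod z) -> (forall z t, p (z * RtoC t)%C = p z * t) ->
   (forall t, Rabs t < rho -> Series (fun n => p (a n * RtoC (t ^ n))%C) = Series (fun n => p (b n * RtoC (t ^ n))%C)) ->
   p (a n) = p (b n).
  move=> Hp Hs HE.
  apply: (PSeries_ext_recip (fun n => p (a n)) (fun n => p (b n)) n).
  - by apply: S => //; have [] := H2.
  - by apply: S => //; have [_ []] := H2.
  - exists (mkposreal rho Hr) => t; rewrite /ball /= /AbsRing_ball /abs /minus /plus /opp /= => Ht.
    rewrite /PSeries.
    have := HE t ltac:(by move: Ht; rewrite Ropp_0 Rplus_0_r).
    move=> E; etransitivity; last etransitivity; last by apply: Series_ext => k; exact: Hs.
      by apply: Series_ext => k; rewrite -Hs.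
    exact: E.
apply: Ceq.
- by apply: U; [exact: re_le_Cmod | exact: re_scal_r | move=> t /H [_ [_]] E; exact: (f_equal Re E)].
- by apply: U; [exact: im_le_Cmod | exact: im_scal_r | move=> t /H [_ [_]] E; exact: (f_equal Im E)].
Qed.

(** The constant is independent of [r]. If [k <= r (|Im x| + 1)], the real part [r Re x] is large
    enough; otherwise the imaginary part is at least [(2 PI - 1) k]. *)
Lemma wk_lower (x : C) : 0 < Re x ->
  exists c, 0 < c <= 1 /\ forall r k, 0 < r ->
    c * INR k <= Cmod (RtoC r * x + wk k) /\ c * INR k <= Cmod (RtoC r * x - wk k).
Proof.
move=> Hx; have PI0 := PI_bounds.
have Pi := Rabs_pos (Im x).
pose c := Rmin 1 (Re x / (Rabs (Im x) + 1)).
have c0 : 0 < c by apply: Rmin_pos; [lra | apply: Rdiv_lt_0_compat; lra].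
have c1 : c <= 1 by exact: Rmin_l.
have c2 : c * (Rabs (Im x) + 1) <= Re x.
  apply: (Rle_trans _ (Re x / (Rabs (Im x) + 1) * (Rabs (Im x) + 1))).
    by apply: Rmult_le_compat_r; [lra | exact: Rmin_r].
  by right; field; lra.
exists c; split=> // r k Hr.
have Pk := pos_INR k.
have Hy y : Re y = r * Re x -> 2 * PI * INR k - r * Rabs (Im x) <= Rabs (Im y) -> c * INR k <= Cmod y.
  move=> E1 E2.
  have [L|L] := Rle_lt_dec (INR k) (r * (Rabs (Im x) + 1)).
    apply: Rle_trans (Re_le_Cmod y); rewrite E1.
    apply: (Rle_trans _ (r * (c * (Rabs (Im x) + 1)))); first by nra.
    by apply: Rmult_le_compat_l; lra.
  by apply: Rle_trans (im_le_Cmod y); nra.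
have PP : 0 <= 2 * PI * INR k by nra.
have Er : r * Rabs (Im x) = Rabs (r * Im x) by rewrite Rabs_mult (Rabs_pos_eq r); lra.
split; apply: Hy.
- by rewrite Re_plus Re_wk re_scal_l; ring.
- rewrite Er Im_plus Im_wk im_scal_l; have := Rabs_triang_inv (2 * PI * INR k) (- (r * Im x)).
  rewrite Rabs_Ropp (Rabs_pos_eq (2 * PI * _)) //.
  by rewrite /Rminus Ropp_involutive Rplus_comm (Rplus_comm _ (r * Im x)).
- by rewrite Re_plus re_opp Re_wk re_scal_l; ring.
- rewrite Er Im_plus im_opp Im_wk im_scal_l; have := Rabs_triang_inv (2 * PI * INR k) (r * Im x).
  rewrite (Rabs_pos_eq (2 * PI * _)) //.
  by rewrite -(Rabs_Ropp (_ - _)) Ropp_minus_distr.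
Qed.

(** Opposite poles are grouped because for [s = 0] the ungrouped series does not converge
    absolutely. *)
Definition pfpow (s : nat) (x : C) (i : nat) : C :=
  (/ (x + wk (S i)) ^ S s + / (x - wk (S i)) ^ S s)%C.

Lemma INR_S_pos (i : nat) : 0 < INR (S i).
Proof. by apply: lt_0_INR; lia. Qed.

Lemma Cmod_inv_pow_le (y : C) (al d : R) (s : nat) :
  0 < al -> 0 < d -> al <= Cmod y -> d <= Cmod y ->
  Cmod (/ y ^ S (S s)) <= / d ^ 2 * / al ^ s.
Proof.
move=> Ha Hd Hy1 Hy2; rewrite Cmod_inv' Cmod_pow.
have -> : Cmod y ^ S (S s) = Cmod y ^ 2 * Cmod y ^ s by rewrite /=; ring.
have P2 : 0 < Cmod y ^ 2 by apply: pow_lt; lra.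
have Ps : 0 < Cmod y ^ s by apply: pow_lt; lra.
rewrite Rinv_mult; apply: Rmult_le_compat; try by left; apply: Rinv_0_lt_compat.
- by apply: Rinv_le_contravar; [apply: pow_lt | apply: pow_incr; lra].
- by apply: Rinv_le_contravar; [apply: pow_lt | apply: pow_incr; lra].
Qed.

Lemma Cmod_wk_ge (x : C) (k : nat) : Re x <= Cmod (x + wk k) /\ Re x <= Cmod (x - wk k).
Proof.
split; apply: Rle_trans (Re_le_Cmod _); rewrite Re_plus ?re_opp Re_wk; lra.
Qed.

Lemma pfpow_bound (x : C) : 0 < Re x ->
  exists K, 0 < K /\ forall s i, Cmod (pfpow s x i) <= K * / INR (S i) ^ 2 * / Re x ^ s.
Proof.
move=> Hx; have [c [[c0 c1] Hc]] := wk_lower x Hx.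
have Px := Re_pos_Cmod x Hx.
exists (2 * Cmod x * / c ^ 2).
have Pc : 0 < / c ^ 2 by apply: Rinv_0_lt_compat; apply: pow_lt.
split; first by nra.
move=> s i; have := Hc 1 (S i) Rlt_0_1; rewrite Cmult_1_l => -[H1 H2]; have [R1 R2] := Cmod_wk_ge x (S i).
have Pi := INR_S_pos i; have Pd : 0 < c * INR (S i) by exact: Rmult_lt_0_compat.
have [N1 N2] := wk_neq x (S i) Hx.
have E : / c ^ 2 * / INR (S i) ^ 2 = / (c * INR (S i)) ^ 2 by rewrite -Rinv_mult; congr Rinv; ring.
have Pe : 0 < / (c * INR (S i)) ^ 2 by apply: Rinv_0_lt_compat; apply: pow_lt.
(* For exponent 1 the cancellation between opposite poles is used; from exponent 2 on each of the
   two terms is bounded separately. *)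
case: s => [|s].
  have -> : pfpow 0 x i = ((1 + 1) * x * (/ (x + wk (S i)) * / (x - wk (S i))))%C.
    by rewrite /pfpow /= !Cmult_1_r; field.
  rewrite !Cmod_mult !Cmod_inv' (_ : Cmod (1 + 1) = 2); last first.
    by rewrite -RtoC_plus Cmod_R Rabs_pos_eq; lra.
  rewrite [X in _ <= X](_ : _ = 2 * Cmod x * (/ (c * INR (S i)) * / (c * INR (S i)))); last first.
    by rewrite /=; field; split; apply: Rgt_not_eq.
  apply: Rmult_le_compat_l; first lra.
  have P1 : / Cmod (x + wk (S i)) <= / (c * INR (S i)) by apply: Rinv_le_contravar.
  have P2 : / Cmod (x - wk (S i)) <= / (c * INR (S i)) by apply: Rinv_le_contravar.
  by apply: Rmult_le_compat => //; left; apply: Rinv_0_lt_compat; lra.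
apply: Rle_trans (Cmod_triangle _ _) _.
have B1 := Cmod_inv_pow_le _ _ _ s Hx Pd R1 H1.
have B2 := Cmod_inv_pow_le _ _ _ s Hx Pd R2 H2.
have Pa : 0 < / Re x ^ s by apply: Rinv_0_lt_compat; apply: pow_lt.
apply: (Rle_trans _ (2 * (/ (c * INR (S i)) ^ 2 * / Re x ^ s))); first lra.
rewrite (_ : 2 * Cmod x * / c ^ 2 * / INR (S i) ^ 2 = 2 * Cmod x * / (c * INR (S i)) ^ 2); last by rewrite -E; ring.
have -> : / Re x ^ S s = / Re x * / Re x ^ s by rewrite /= Rinv_mult.
have : 1 <= Cmod x * / Re x.
  apply: (Rmult_le_reg_r (Re x)) => //; rewrite Rmult_assoc Rinv_l; last lra.
  by rewrite Rmult_1_l Rmult_1_r; exact: Re_le_Cmod.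
have := Rmult_lt_0_compat _ _ Pe Pa; set u := / (c * _) ^ 2; set v := / Re x ^ s => Puv H.
rewrite (_ : 2 * Cmod x * u * (/ Re x * v) = 2 * (u * v) * (Cmod x * / Re x)); last ring.
nra.
Qed.

Lemma asum_pfpow (s : nat) (x : C) : 0 < Re x -> asum (pfpow s x).
Proof.
move=> Hx; have [K [_ HK]] := pfpow_bound x Hx.
apply: asum_le (HK s) _.
apply: (ex_series_extR (fun i => (K * / Re x ^ s) * / INR (S i) ^ 2)); first by move=> n; ring.
by apply: ex_series_scalR; exact: ex_series_inv_sqr.
Qed.

Lemma inv_geom (y : C) (t : R) : Rabs t < Cmod y ->
  asum (fun s => / y ^ S s * RtoC (t ^ s))%C /\ CSer (fun s => / y ^ S s * RtoC (t ^ s))%C = (/ (y - t))%C.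
Proof.
move=> Ht; have Py : 0 < Cmod y by have := Rabs_pos t; lra.
have Ny : y <> 0%C by apply/Cmod_gt_0.
have Nyt : (y - t)%C <> 0%C.
  by apply/Cmod_gt_0; have := Cmod_minus_ge y t; rewrite Cmod_R; lra.
have Hw : Cmod (RtoC t * / y) < 1.
  rewrite Cmod_mult Cmod_R Cmod_inv'; apply: (Rmult_lt_reg_r (Cmod y)) => //.
  by rewrite Rmult_assoc Rinv_l ?Rmult_1_r ?Rmult_1_l //; lra.
have [Sg Eg] := cexp_geom _ Hw.
have E s : (/ y ^ S s * RtoC (t ^ s) = / y * (RtoC t * / y) ^ s)%C.
  rewrite Cpow_mult_l Cpow_inv // RtoC_pow Cpow_S.
  have Ns := Cpow_nz y s Ny; by field.
have Sa := asum_scal (/ y)%C _ Sg.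
split; first by apply: asum_ext Sa => s; rewrite E.
rewrite (CSer_ext _ _ E) CSer_scal // Eg.
by field; repeat split => //; move=> E0; apply: Nyt; rewrite -E0; ring.
Qed.

Lemma ex_series_geom_pos (q : R) : 0 <= q < 1 -> ex_series (fun n => q ^ n) /\ Series (fun n => q ^ n) = / (1 - q).
Proof.
move=> Hq; have H : Rabs q < 1 by rewrite Rabs_pos_eq; lra.
by split; [exact: ex_series_geom | exact: Series_geom].
Qed.

(** Each [1 / (x - t +- wk k)] is expanded geometrically in [t]. All poles lie at distance at least
    [Re x] from [x], so [|t| < Re x] makes the double series absolutely convergent. *)
Lemma chi_taylor (x : C) (t : R) : 0 < Re x -> Rabs t < Re x ->
  asum (fun s => CSer (pfpow s x) * RtoC (t ^ s))%C /\
  CSer (pfpair (x - t)) = CSer (fun s => CSer (pfpow s x) * RtoC (t ^ s))%C.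
Proof.
move=> Hx Ht; have [K [K0 HK]] := pfpow_bound x Hx.
have Q : 0 <= Rabs t / Re x < 1.
  split; first by apply: Rmult_le_pos; [exact: Rabs_pos | left; apply: Rinv_0_lt_compat].
  by apply: (Rmult_lt_reg_r (Re x)) => //; rewrite Rmult_assoc Rinv_l ?Rmult_1_r ?Rmult_1_l //; lra.
have [SQ EQ] := ex_series_geom_pos _ Q.
pose a i s := (pfpow s x i * RtoC (t ^ s))%C.
have Ba i s : Cmod (a i s) <= K * / INR (S i) ^ 2 * (Rabs t / Re x) ^ s.
  rewrite Cmod_mult Cmod_R -RPow_abs Rpow_mult_distr pow_inv.
  have := Rmult_le_compat_r _ _ _ (pow_le _ s (Rabs_pos t)) (HK s i); lra.
have Sb i : ex_series (fun s => K * / INR (S i) ^ 2 * (Rabs t / Re x) ^ s).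
  by apply: ex_series_scalR.
have Sa i : asum (a i) by apply: asum_le (Ba i) (Sb i).
have Ra i : Series (fun s => Cmod (a i s)) <= (K / (1 - Rabs t / Re x)) * / INR (S i) ^ 2.
  apply: (Rle_trans _ (Series (fun s => K * / INR (S i) ^ 2 * (Rabs t / Re x) ^ s))).
    by apply: Series_le => // s; split => //; exact: Cmod_ge_0.
  by rewrite Series_scal_l EQ; right; rewrite /Rdiv; ring.
have SR : ex_series (fun i => (K / (1 - Rabs t / Re x)) * / INR (S i) ^ 2).
  by apply: ex_series_scalR; exact: ex_series_inv_sqr.
have [_ [_ [_ [S2 E2]]]] := fubini a _ Sa Ra SR.
have E3 s : CSer (fun i => a i s) = (CSer (pfpow s x) * RtoC (t ^ s))%C.
  rewrite (CSer_ext _ (fun i => RtoC (t ^ s) * pfpow s x i)%C); last by move=> i; rewrite /a; ring.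
  by rewrite CSer_scal; [ring | exact: asum_pfpow].
split; first by apply: asum_ext S2.
rewrite -(CSer_ext _ _ E3) -E2; apply: CSer_ext => i.
have [R1 R2] := Cmod_wk_ge x (S i).
have [S3 E4] := inv_geom (x + wk (S i)) t ltac:(lra).
have [S5 E6] := inv_geom (x - wk (S i)) t ltac:(lra).
rewrite /a (CSer_ext _ (fun s => / (x + wk (S i)) ^ S s * RtoC (t ^ s) + / (x - wk (S i)) ^ S s * RtoC (t ^ s))%C); last first.
  by move=> s; rewrite /pfpow; ring.
by rewrite CSer_plus // E4 E6 /pfpair; congr (/ _ + / _)%C; ring.
Qed.

Definition lip_term (s : nat) (x : C) (n : nat) : C :=
  (RtoC (INR n ^ s / INR (fact s)) * cexp (- (RtoC (INR n) * x)))%C.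

Lemma chi_exp (x : C) : 0 < Re x ->
  asum (fun n => cexp (- (RtoC (INR n) * x)))%C /\
  CSer (fun n => cexp (- (RtoC (INR n) * x)))%C = (chi x + / 2)%C.
Proof.
move=> Hx; have Hw : Cmod (cexp (- x)) < 1.
  by rewrite Cmod_cexp re_opp -exp_0; apply: exp_increasing; lra.
have [S E] := cexp_geom _ Hw.
have EE n : (cexp (- x) ^ n = cexp (- (RtoC (INR n) * x)))%C.
  by rewrite -cexp_nat; congr cexp; ring.
split; first by apply: asum_ext S.
rewrite -(CSer_ext _ _ EE) E /chi cexp_opp.
have N := cexp_neq0 x; have N1 := cexp_sub1_neq0 x Hx.
have E2 : (/ 2 + / 2 = 1)%C by field.
rewrite -Cplus_assoc E2; field.
by split => // E0; apply: N1; rewrite -E0; ring.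
Qed.

(** Counterpart of [chi_taylor]: the same function of [t] is expanded through the geometric series
    in [e^(-(x - t))], followed by the exponential series of each [e^(n t)]. *)
Lemma lip_series (x : C) (t : R) : 0 < Re x -> Rabs t < Re x ->
  (forall s, asum (lip_term s x)) /\
  asum (fun s => CSer (lip_term s x) * RtoC (t ^ s))%C /\
  (chi (x - t) + / 2)%C = CSer (fun s => CSer (lip_term s x) * RtoC (t ^ s))%C.
Proof.
move=> Hx.
pose a (t : R) n s := (lip_term s x n * RtoC (t ^ s))%C.
have Ex (y : R) : ex_series (fun s => y ^ s / INR (fact s)) /\ Series (fun s => y ^ s / INR (fact s)) = exp y.
  have H : is_series (fun s => y ^ s / INR (fact s)) (exp y).
    have := is_exp_Reals y; rewrite /is_pseries; apply: is_series_ext => n.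
    by rewrite pow_n_pow /scal /= /mult /=.
  by split; [exists (exp y) | exact: is_series_unique].
have Ma u n s : Cmod (a u n s) = exp (- (INR n * Re x)) * ((INR n * Rabs u) ^ s / INR (fact s)).
  rewrite /a /lip_term !Cmod_mult !Cmod_R Cmod_cexp re_opp re_scal_l -RPow_abs Rpow_mult_distr.
  rewrite Rabs_pos_eq; first by rewrite /Rdiv; ring.
  apply: Rmult_le_pos; first by apply: pow_le; exact: pos_INR.
  by left; apply: Rinv_0_lt_compat; exact: INR_fact_lt_0.
have Sa u n : asum (a u n).
  apply: (ex_series_extR (fun s => exp (- (INR n * Re x)) * ((INR n * Rabs u) ^ s / INR (fact s)))) => [s|].
    by rewrite Ma.
  by apply: ex_series_scalR; exact: (proj1 (Ex _)).
have Ra u n : Series (fun s => Cmod (a u n s)) <= exp (- (INR n * (Re x - Rabs u))).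
  rewrite (Series_ext _ _ (Ma u n)) Series_scal_l (proj2 (Ex _)) -exp_plus.
  by right; congr exp; ring.
have SR u : Rabs u < Re x -> ex_series (fun n => exp (- (INR n * (Re x - Rabs u)))).
  move=> Hu; have [S _] := ex_series_geom_pos (exp (- (Re x - Rabs u))) ltac:(split; [left; exact: exp_pos | rewrite -exp_0; apply: exp_increasing; lra]).
  apply: ex_series_extR S => n.
  by rewrite -Rpower_pow ?/Rpower ?ln_exp; [congr exp; ring | exact: exp_pos].
have EC u n : CSer (a u n) = cexp (- (RtoC (INR n) * (x - u))).
  rewrite (CSer_ext _ (fun s => cexp (- (RtoC (INR n) * x)) * RtoC ((INR n * u) ^ s / INR (fact s)))%C); last first.
    move=> s; rewrite /a /lip_term Rpow_mult_distr /Rdiv !RtoC_mult; ring.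
  have [S1 E1] := Ex (INR n * u).
  have Sr : asum (fun s => RtoC ((INR n * u) ^ s / INR (fact s))).
    apply: (ex_series_extR (fun s => Rabs (INR n * u) ^ s / INR (fact s))) => [s|]; last exact: (proj1 (Ex _)).
    set y := INR n * u; rewrite Cmod_R /Rdiv Rabs_mult RPow_abs (Rabs_pos_eq (/ _)) //.
    by left; apply: Rinv_0_lt_compat; exact: INR_fact_lt_0.
  by rewrite CSer_scal // CSer_RtoC // E1 -cexp_RtoC -cexp_add; congr cexp; rewrite RtoC_mult; ring.
move=> Ht.
have S0 s : asum (lip_term s x).
  have Pu : Rabs (Re x / 2) < Re x by rewrite Rabs_pos_eq; lra.
  have [H _] := fubini (a (Re x / 2)) _ (Sa _) (Ra _) (SR _ Pu).
  have Pp : 0 < (Re x / 2) ^ s by apply: pow_lt; lra.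
  have := asum_scal (RtoC (/ (Re x / 2) ^ s)) _ (H s); apply: asum_ext => n.
  rewrite /a (Cmult_comm (lip_term s x n)) Cmult_assoc -RtoC_mult Rinv_l; last lra.
  by rewrite Cmult_1_l.
have [_ [_ [_ [S2 E2]]]] := fubini (a t) _ (Sa _) (Ra _) (SR _ Ht).
have E3 s : CSer (fun i => a t i s) = (CSer (lip_term s x) * RtoC (t ^ s))%C.
  rewrite (CSer_ext _ (fun i => RtoC (t ^ s) * lip_term s x i)%C); last by move=> i; rewrite /a; ring.
  by rewrite CSer_scal; [ring | exact: S0].
split=> //; split; first by apply: asum_ext S2.
rewrite -(CSer_ext _ _ E3) -E2 (CSer_ext _ _ (EC t)).
have [_ <-] := chi_exp (x - t)%C ltac:(rewrite Re_plus re_opp /=; have := Rle_abs t; lra).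
by [].
Qed.

(** Comparison of the coefficients of [t^s] in the two expansions of [chi (x - t)], by exponentials
    and by poles; this takes the place of Poisson summation. The geometric series sums to
    [chi + / 2], whence the extra [/ 2] at [s = 0]. *)
Theorem lipschitz (s : nat) (x : C) : 0 < Re x ->
  CSer (lip_term s x) =
    (/ x ^ S s + CSer (pfpow s x) + RtoC (match s with O => / 2 | _ => 0 end))%C.
Proof.
move=> Hx.
pose h (s : nat) : C := RtoC (match s with O => / 2 | _ => 0 end).
move: s; apply: (power_series_unique _ _ (Re x) Hx) => t Ht.
have [_ [S1 E1]] := lip_series x t Hx Ht.
have [S2 E2] := chi_taylor x t Hx Ht.
have [S3 E3] := inv_geom x t ltac:(have := Re_le_Cmod x; lra).
have [S4 E4] := CSer_csum (fun s => h s * RtoC (t ^ s))%C 1 ltac:(by case=> [|k] Hk; [lia | rewrite /h Cmult_0_l]).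
have S23 := asum_plus _ _ S3 S2.
have S234 := asum_plus _ _ S23 S4.
have EE n : ((/ x ^ S n * RtoC (t ^ n) + CSer (pfpow n x) * RtoC (t ^ n)) + h n * RtoC (t ^ n) =
   (/ x ^ S n + CSer (pfpow n x) + RtoC (match n with O => / 2 | _ => 0 end)) * RtoC (t ^ n))%C.
  by rewrite /h; ring.
split => //; split; first by apply: asum_ext S234.
rewrite -(CSer_ext _ _ EE) CSer_plus // CSer_plus // E3 E4 -E1 -E2.
have Hxt : 0 < Re (x - t) by rewrite Re_plus re_opp /=; have := Rle_abs t; lra.
have [_ ->] := chi_partial_fractions _ Hxt.
rewrite /h /= Cplus_0_l Cmult_1_r RtoC_inv //; lra.
Qed.

(** * Quasi-modularity of the Eisenstein series of weight two *)

Definition zeta2 : R := Series (fun i => / INR (S i) ^ 2).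

Lemma csum_RtoC (f : nat -> R) (n : nat) : csum (fun i => RtoC (f i)) n = RtoC (rsum f n).
Proof. by elim: n => [//|n IH] /=; rewrite IH RtoC_plus. Qed.

(** The limit is the Taylor coefficient [B_2 / 2!] of [h / (e^h - 1)], read off from the cubic
    Taylor polynomial of [exp]. *)
Lemma expm1_quotient_lim (h : nat -> R) : (forall n, 0 < h n <= 1) -> is_lim_seq h 0 ->
  is_lim_seq (fun n => (/ (exp (h n) - 1) + / 2 - / h n) * / h n) (/ 12).
Proof.
move=> Hh H0.
pose r n := (exp (h n) - (1 + h n + h n ^ 2 / 2 + h n ^ 3 / 6)) / h n ^ 3.
have Lr : is_lim_seq r 0.
  apply/is_lim_seq_sub0.
  apply: (is_lim_seq_le_le (fun=> 0) _ (fun n => exp 1 / 24 * h n)); last first.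
  - exact: lim_scal0.
  - exact: is_lim_seq_const.
  - move=> n; split; first exact: Rabs_pos.
    have [h0 h1] := Hh n.
    have P3 : 0 < h n ^ 3 by apply: pow_lt.
    have := cexp_taylor 4 (RtoC (h n)) 1 ltac:(lra) h1.
    rewrite Cmod_R Rabs_pos_eq; last lra.
    rewrite cexp_RtoC (csum_ext _ (fun i => RtoC (h n ^ i * / INR (fact i)))); last first.
      by move=> i _; rewrite RtoC_mult RtoC_pow.
    rewrite csum_RtoC -RtoC_minus Cmod_R => T.
    rewrite Rminus_0_r /r /Rdiv Rabs_mult (Rabs_pos_eq (/ _)); last by left; apply: Rinv_0_lt_compat.
    apply: (Rmult_le_reg_r (h n ^ 3)) => //; rewrite Rmult_assoc Rinv_l ?Rmult_1_r; last lra.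
    apply: Rle_trans (Rle_trans _ _ _ _ T) _; [right; congr Rabs | right]; rewrite /=; field.
apply: (is_lim_seq_ext (fun n => (/ 6 + / 6 * h n + (h n - 2) * r n) * (/ 2 * / ((exp (h n) - 1) * / h n)))).
  move=> n; have [h0 h1] := Hh n; rewrite /r.
  have := exp_ineq1 (h n) ltac:(lra) => E.
  field; lra.
have -> : / 12 = (/ 6 + 0 + (0 - 2) * 0) * (/ 2 * / 1) by field.
apply: is_lim_seq_mult'.
  apply: is_lim_seq_plus'.
    by apply: is_lim_seq_plus'; [exact: is_lim_seq_const | exact: lim_scal0].
  apply: is_lim_seq_mult' => //; apply: is_lim_seq_minus' => //; exact: is_lim_seq_const.
apply: is_lim_seq_mult'; first exact: is_lim_seq_const.
apply: (is_lim_seq_inv _ (Finite 1)); last by case; lra.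
have [+ _] := lim_expm1 1 h Hh H0.
by apply: is_lim_seq_ext => n; rewrite Cmult_1_l cexp_RtoC re_scal_r /=; ring.
Qed.

(** Dividing the partial fractions of [chi x - / x] by [x] and letting [x] tend to 0 along
    [/ 2 ^ S n] gives [/ 12] on one side and [zeta2 / (2 PI^2)] on the other. *)
Theorem zeta2_value : zeta2 = PI ^ 2 / 6.
Proof.
have PI0 := PI_bounds.
pose h n := / 2 ^ S n.
pose q (h : R) k := 2 / (h ^ 2 + (2 * PI * INR (S k)) ^ 2).
have Pk k : 0 < (2 * PI * INR (S k)) ^ 2.
  by apply: pow_lt; have := INR_S_pos k; nra.
have Sb : ex_series (fun k => 2 * / INR (S k) ^ 2).
  by apply: ex_series_scalR; exact: ex_series_inv_sqr.
have Bq x k : 0 <= q x k <= 2 * / INR (S k) ^ 2.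
  have := Pk k; have := pow2_ge_0 x => H1 H2.
  split; first by apply: Rmult_le_pos; [lra | left; apply: Rinv_0_lt_compat; lra].
  apply: Rmult_le_compat_l; first lra.
  have Pi := INR_S_pos k.
  apply: Rinv_le_contravar; first by apply: pow_lt.
  have : INR (S k) ^ 2 <= (2 * PI * INR (S k)) ^ 2 by apply: pow_incr; nra.
  lra.
have Eq' x : 0 < x -> RtoC ((/ (exp x - 1) + / 2 - / x) * / x) = CSer (fun k => RtoC (q x k)).
  move=> h0.
  have := exp_ineq1 x ltac:(lra) => E.
  have [S2 E2] := chi_partial_fractions (RtoC x) h0.
  have -> : RtoC ((/ (exp x - 1) + / 2 - / x) * / x) = ((chi (RtoC x) - / RtoC x) * RtoC (/ x))%C.
    rewrite /chi cexp_RtoC -RtoC_minus -!RtoC_inv; try lra.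
    by rewrite -RtoC_plus -RtoC_minus -RtoC_mult.
  have -> : (chi (RtoC x) - / RtoC x = CSer (pfpair (RtoC x)))%C by rewrite E2; ring.
  rewrite Cmult_comm -CSer_scal //; apply: CSer_ext => k.
  have [-> _] := pfpairE (RtoC x) k h0.
  have D : x ^ 2 + (2 * PI * INR (S k)) ^ 2 <> 0.
    by have := Pk k; have := pow2_ge_0 x; lra.
  rewrite /q /Rdiv RtoC_mult !RtoC_inv //; last lra.
  rewrite RtoC_plus.
  have Nh : RtoC x <> 0%C by move/RtoC_inj; lra.
  have ND : (RtoC x * RtoC x + RtoC ((2 * PI * INR (S k)) ^ 2))%C <> 0%C.
    by rewrite -RtoC_mult -RtoC_plus; move/RtoC_inj; simpl in D |- *; lra.
  rewrite (_ : RtoC (x ^ 2) = (RtoC x * RtoC x)%C); last by rewrite RtoC_pow /=; ring.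
  by field.
have Eq n := Eq' (h n) (proj1 (pow2S_inv n)).
have Sq x : asum (fun k => RtoC (q x k)).
  apply: asum_le Sb => k; rewrite Cmod_R Rabs_pos_eq; have := Bq x k; lra.
have [S0 L0] : asum (fun k => RtoC (q 0 k)) /\ Clim (fun n => CSer (fun k => RtoC (q (h n) k))) (CSer (fun k => RtoC (q 0 k))).
  apply: (tannery _ _ (fun k => 2 * / INR (S k) ^ 2) 0 0) => //.
    by move=> n k _ _; rewrite Cmod_R Rabs_pos_eq; have := Bq (h n) k; lra.
  move=> k; apply: Clim_RtoC; rewrite /q /Rdiv.
  apply: is_lim_seq_mult'; first exact: is_lim_seq_const.
  apply: (is_lim_seq_inv _ (Finite (0 ^ 2 + (2 * PI * INR (S k)) ^ 2))); last first.
    by case; have := Pk k; rewrite /=; lra.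
  apply: is_lim_seq_plus'; last exact: is_lim_seq_const.
  apply: (is_lim_seq_ext (fun n => h n * h n)); first by move=> n; ring.
  rewrite (_ : 0 ^ 2 = 0 * 0); last ring.
  by apply: is_lim_seq_mult'; exact: pow2S_inv_lim.
have L1 := Clim_RtoC _ _ (expm1_quotient_lim h pow2S_inv pow2S_inv_lim).
have E := Clim_unique _ _ _ (Clim_ext _ _ _ Eq L1) L0.
move: E; rewrite CSer_RtoC; last by apply: ex_series_le0 Sb => k; exact: Bq.
move/RtoC_inj.
rewrite (Series_ext _ (fun k => / (2 * PI ^ 2) * / INR (S k) ^ 2)); last first.
  move=> k; rewrite /q; have := INR_S_pos k => Pi; field; lra.
rewrite Series_scal_l -/zeta2 => E.
apply: (Rmult_eq_reg_l (/ (2 * PI ^ 2))); last first.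
  by apply: Rinv_neq_0_compat; nra.
rewrite -E; field; lra.
Qed.

Definition lip1 (x : C) : C := CSer (lip_term 1 x).

(** With [q = e^(- tau)] this is the sum of [sigma(N) q^N], that is [(1 - E_2) / 24]. *)
Definition eis (tau : C) : C := CSer (fun m => lip1 (RtoC (INR (S m)) * tau)).

Lemma exp_neg_lt1 (a : R) : 0 < a -> 0 <= exp (- a) < 1.
Proof.
by move=> Ha; split; [left; exact: exp_pos | rewrite -exp_0; apply: exp_increasing; lra].
Qed.

Lemma exp_nat_pow (n : nat) (a : R) : exp (- (INR n * a)) = exp (- a) ^ n.
Proof.
elim: n => [|n IH]; first by rewrite /= Rmult_0_l Ropp_0 exp_0.
by rewrite S_INR /= -IH -exp_plus; congr exp; ring.
Qed.

Lemma Cmod_lip_term1 (x : C) (n : nat) :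
  Cmod (lip_term 1 x n) = INR n * exp (- (INR n * Re x)).
Proof.
rewrite /lip_term Cmod_mult Cmod_cexp Cmod_R re_opp re_scal_l /= Rdiv_1_r Rmult_1_r.
by rewrite Rabs_pos_eq //; exact: pos_INR.
Qed.

Lemma asum_lip_term (s : nat) (x : C) : 0 < Re x -> asum (lip_term s x).
Proof. by move=> Hx; have [] := lip_series x 0 Hx; rewrite ?Rabs_R0. Qed.

Lemma lip1_bound (x : C) (m : nat) : 0 < Re x ->
  Cmod (lip1 (RtoC (INR (S m)) * x)) <= exp (- Re x) ^ m * Series (fun n => INR n * exp (- (INR n * Re x))).
Proof.
move=> Hx.
have S0 : ex_series (fun n => INR n * exp (- (INR n * Re x))).
  by apply: ex_series_extR (asum_lip_term 1 x Hx) => n; rewrite Cmod_lip_term1.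
rewrite -Series_scal_l; apply: Cmod_CSer; last exact: ex_series_scalR.
move=> n; rewrite Cmod_lip_term1 re_scal_l -exp_nat_pow.
case: n => [|n]; first by rewrite /= !Rmult_0_l; lra.
have -> : exp (- (INR m * Re x)) * (INR (S n) * exp (- (INR (S n) * Re x))) =
   INR (S n) * (exp (- (INR m * Re x)) * exp (- (INR (S n) * Re x))) by ring.
rewrite -exp_plus.
apply: Rmult_le_compat_l; first exact: pos_INR.
have H : - (INR (S n) * (INR (S m) * Re x)) <= - (INR m * Re x) + - (INR (S n) * Re x).
  rewrite !S_INR; have := pos_INR n; have := pos_INR m => A B.
  have := Rmult_le_pos _ _ (Rmult_le_pos _ _ A B) (Rlt_le _ _ Hx); lra.
by case: H => [H|->]; [left; exact: exp_increasing | right].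
Qed.

Lemma asum_eis (tau : C) : 0 < Re tau -> asum (fun m => lip1 (RtoC (INR (S m)) * tau)).
Proof.
move=> Hx; apply: asum_le (lip1_bound tau ^~ Hx) _.
apply: (ex_series_extR (fun m => Series (fun n => INR n * exp (- (INR n * Re tau))) * exp (- Re tau) ^ m)).
  by move=> m; rewrite Rmult_comm.
by apply: ex_series_scalR; have [] := ex_series_geom_pos _ (exp_neg_lt1 _ Hx).
Qed.

Definition grid (tau : C) (m n : nat) : C := pfpow 1 (RtoC (INR (S m)) * tau) n.

(** For [y] equal to [(m + 1) tau] plus or minus a pole, [1 / y^2] is compared with
    [1 / ((y - tau / 2) (y + tau / 2))], which telescopes in [m]. The differences form an absolutely
    convergent double series, so both orders of summation give them the same sum. *)
Definition grid_diff (tau : C) (m n : nat) : C :=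
  (grid tau m n - / tau * (pfpair (RtoC (INR m + / 2) * tau) n - pfpair (RtoC (INR (S m) + / 2) * tau) n))%C.

Lemma grid_diff_bound (tau : C) : 0 < Re tau ->
  exists K, forall m n, Cmod (grid_diff tau m n) <= K * / INR (S m) ^ 2 * / INR (S n) ^ 2.
Proof.
move=> Ht; have [c [[c0 c1] Hc]] := wk_lower tau Ht.
set al := Re tau in Ht; have Pt := Re_pos_Cmod tau Ht.
exists (Cmod tau ^ 2 / (al ^ 2 * c ^ 2)) => m n.
have Pm := INR_S_pos m; have Pn := INR_S_pos n.
have Pm0 := pos_INR m.
have Em : INR (S m) = INR m + 1 by rewrite S_INR.
(* Of the four factors in the denominator of the difference, two are bounded below through [m] and
   two through [n]; hence the product of the two inverse squares. *)
have B y : INR (S m) * al <= Cmod y -> c * INR (S n) <= Cmod y ->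
   INR (S m) * al / 2 <= Cmod (y - RtoC (/ 2) * tau) -> c * INR (S n) <= Cmod (y + RtoC (/ 2) * tau) ->
   Cmod (/ (y * y) - / ((y - RtoC (/ 2) * tau) * (y + RtoC (/ 2) * tau)))
    <= / 2 * (Cmod tau ^ 2 / (al ^ 2 * c ^ 2) * / INR (S m) ^ 2 * / INR (S n) ^ 2).
  move=> H1 H2 H3 H4.
  have Q1 : 0 < INR (S m) * al by apply: Rmult_lt_0_compat.
  have Q2 : 0 < c * INR (S n) by apply: Rmult_lt_0_compat.
  have N1 : y <> 0%C by apply/Cmod_gt_0; lra.
  have N2 : (y - RtoC (/ 2) * tau)%C <> 0%C by apply/Cmod_gt_0; lra.
  have N3 : (y + RtoC (/ 2) * tau)%C <> 0%C by apply/Cmod_gt_0; lra.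
  have -> : (/ (y * y) - / ((y - RtoC (/ 2) * tau) * (y + RtoC (/ 2) * tau)) =
     - ((RtoC (/ 2) * tau) * (RtoC (/ 2) * tau) * ((/ y * / (y - RtoC (/ 2) * tau)) * (/ y * / (y + RtoC (/ 2) * tau)))))%C by field.
  rewrite Cmod_opp !Cmod_mult !Cmod_inv' !Cmod_R !(Rabs_pos_eq (/ 2)); last lra.
  have -> : / 2 * (Cmod tau ^ 2 / (al ^ 2 * c ^ 2) * / INR (S m) ^ 2 * / INR (S n) ^ 2) =
     / 2 * Cmod tau * (/ 2 * Cmod tau) * ((/ (INR (S m) * al) * / (INR (S m) * al / 2)) * (/ (c * INR (S n)) * / (c * INR (S n)))) by field; repeat split; lra.
  apply: Rmult_le_compat_l; first by nra.
  apply: Rmult_le_compat; try apply: Rmult_le_compat; try apply: Rinv_le_contravar; try lra;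
    try (apply: Rmult_le_pos); try (by left; apply: Rinv_0_lt_compat; lra).
have Rp r k : 0 < r -> r * al <= Cmod (RtoC r * tau + wk k) /\ r * al <= Cmod (RtoC r * tau - wk k).
  by move=> Hr; have := Cmod_wk_ge (RtoC r * tau) k; rewrite re_scal_l.
have E1 : (RtoC (INR m + / 2) * tau = RtoC (INR (S m)) * tau - RtoC (/ 2) * tau)%C.
  by rewrite (_ : INR m + / 2 = INR (S m) - / 2); [rewrite RtoC_minus; ring | rewrite Em; field].
have E2 : (RtoC (INR (S m) + / 2) * tau = RtoC (INR (S m)) * tau + RtoC (/ 2) * tau)%C.
  by rewrite RtoC_plus; ring.
have [A1 A2] := Rp (INR (S m)) (S n) Pm.
have [A3 A4] := Rp (INR m + / 2) (S n) ltac:(lra).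
have [C1 C2] := Hc (INR (S m)) (S n) Pm.
have [C3 C4] := Hc (INR (S m) + / 2) (S n) ltac:(lra).
have F1 : INR (S m) * al / 2 <= (INR m + / 2) * al by rewrite Em; nra.
have G1 : (RtoC (INR (S m)) * tau + wk (S n) - RtoC (/ 2) * tau = RtoC (INR m + / 2) * tau + wk (S n))%C by rewrite E1; ring.
have G2 : (RtoC (INR (S m)) * tau + wk (S n) + RtoC (/ 2) * tau = RtoC (INR (S m) + / 2) * tau + wk (S n))%C by rewrite E2; ring.
have G3 : (RtoC (INR (S m)) * tau - wk (S n) - RtoC (/ 2) * tau = RtoC (INR m + / 2) * tau - wk (S n))%C by rewrite E1; ring.
have G4 : (RtoC (INR (S m)) * tau - wk (S n) + RtoC (/ 2) * tau = RtoC (INR (S m) + / 2) * tau - wk (S n))%C by rewrite E2; ring.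
have H1 := B (RtoC (INR (S m)) * tau + wk (S n))%C A1 C1 ltac:(rewrite G1; lra) ltac:(rewrite G2; lra).
have H2 := B (RtoC (INR (S m)) * tau - wk (S n))%C A2 C2 ltac:(rewrite G3; lra) ltac:(rewrite G4; lra).
have Nt := Re_pos_neq0 tau Ht.
have Nr r k : 0 < r -> (RtoC r * tau + wk k)%C <> 0%C /\ (RtoC r * tau - wk k)%C <> 0%C.
  by move=> Hr; apply: wk_neq; rewrite re_scal_l; exact: Rmult_lt_0_compat.
have [M1 M2] := Nr (INR (S m)) (S n) Pm.
have [M3 M4] := Nr (INR m + / 2) (S n) ltac:(lra).
have [M5 M6] := Nr (INR (S m) + / 2) (S n) ltac:(lra).
rewrite G1 G2 in H1; rewrite G3 G4 in H2.
have T w : (RtoC (INR m + / 2) * tau + w)%C <> 0%C -> (RtoC (INR (S m) + / 2) * tau + w)%C <> 0%C ->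
   (/ ((RtoC (INR m + / 2) * tau + w) * (RtoC (INR (S m) + / 2) * tau + w)) =
    / tau * (/ (RtoC (INR m + / 2) * tau + w) - / (RtoC (INR (S m) + / 2) * tau + w)))%C.
  have -> : INR (S m) + / 2 = (INR m + / 2) + 1 by rewrite Em; ring.
  rewrite (RtoC_plus _ 1) => K1 K2; field; repeat split => //.
rewrite T // in H1; rewrite (T (- wk (S n))%C) // in H2.
have -> : grid_diff tau m n = ((/ ((RtoC (INR (S m)) * tau + wk (S n)) * (RtoC (INR (S m)) * tau + wk (S n))) -
   / tau * (/ (RtoC (INR m + / 2) * tau + wk (S n)) - / (RtoC (INR (S m) + / 2) * tau + wk (S n)))) +
   (/ ((RtoC (INR (S m)) * tau - wk (S n)) * (RtoC (INR (S m)) * tau - wk (S n))) -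
   / tau * (/ (RtoC (INR m + / 2) * tau + - wk (S n)) - / (RtoC (INR (S m) + / 2) * tau + - wk (S n)))))%C.
  by rewrite /grid_diff /grid /pfpow /pfpair Cpow_S (Cpow_S (_ - _)%C) !Cpow_1_r /Cminus; ring.
apply: Rle_trans (Cmod_triangle _ _) _; lra.
Qed.

Lemma inv_half_lim (a : R) : 0 < a -> is_lim_seq (fun n => / ((INR n + / 2) * a)) 0.
Proof.
move=> Ha.
apply: (is_lim_seq_ext (fun n => / a * / (INR n + / 2))).
  by move=> n; have := pos_INR n => H; field; lra.
apply: lim_scal0.
have H : is_lim_seq (fun n => INR n + / 2) p_infty.
  by apply: (is_lim_seq_plus _ _ p_infty (/ 2)); [exact: is_lim_seq_INR | exact: is_lim_seq_const |].
exact: (is_lim_seq_inv _ _ H).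
Qed.

Lemma grid_telescope (tau : C) (n M : nat) :
  (csum (fun m => grid tau m n) M =
   / tau * (pfpair (RtoC (/ 2) * tau) n - pfpair (RtoC (INR M + / 2) * tau) n)
   + csum (fun m => grid_diff tau m n) M)%C.
Proof.
elim: M => [|M IH]; first by rewrite /= Rplus_0_l; ring.
by rewrite !csum_S IH /grid_diff; ring.
Qed.

(** The boundary term of the telescoping tends to [/ 2] after summation over [n], although by
    [pfpair_lim] each of its terms tends to 0. This is the source of [/ (2 * tau)] in
    [eis_transform]. *)
Lemma chi_lim (tau : C) : 0 < Re tau ->
  Clim (fun M => CSer (pfpair (RtoC (INR M + / 2) * tau))) (/ 2)%C.
Proof.
move=> Ht.
apply: (Clim_squeeze _ _ (fun M => 2 * / ((INR M + / 2) * Re tau))); last first.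
  by apply: lim_scal0; exact: inv_half_lim.
move=> M; set x := (RtoC (INR M + / 2) * tau)%C.
have PM := pos_INR M.
have Ex : Re x = (INR M + / 2) * Re tau by rewrite re_scal_l.
have Hx : 0 < Re x by rewrite Ex; nra.
have [_ E] := chi_partial_fractions x Hx.
have -> : (CSer (pfpair x) - / 2 = / (cexp x - 1) - / x)%C.
  have -> : CSer (pfpair x) = (chi x - / x)%C by rewrite E; ring.
  by rewrite /chi; ring.
rewrite -Ex.
apply: Rle_trans (Cmod_minus_le _ _) _; rewrite !Cmod_inv'.
have B1 : / Cmod (cexp x - 1) <= / Re x.
  apply: Rinv_le_contravar => //.
  have := Cmod_minus_ge (cexp x) 1; rewrite Cmod_1 Cmod_cexp.
  have := exp_ineq1 (Re x) ltac:(lra); lra.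
have B2 : / Cmod x <= / Re x by apply: Rinv_le_contravar => //; exact: Re_le_Cmod.
lra.
Qed.

Lemma pfpair_lim (tau : C) (n : nat) : 0 < Re tau ->
  Clim (fun M => pfpair (RtoC (INR M + / 2) * tau) n) 0%C.
Proof.
move=> Ht.
apply: (Clim_squeeze _ _ (fun M => 2 * / ((INR M + / 2) * Re tau))); last first.
  by apply: lim_scal0; exact: inv_half_lim.
move=> M; set x := (RtoC (INR M + / 2) * tau)%C.
have PM := pos_INR M.
have Ex : Re x = (INR M + / 2) * Re tau by rewrite re_scal_l.
have Hx : 0 < Re x by rewrite Ex; nra.
have [H1 H2] := Cmod_wk_ge x (S n).
rewrite -Ex /Cminus Copp_0 Cplus_0_r.
apply: Rle_trans (Cmod_triangle _ _) _; rewrite !Cmod_inv'.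
have B1 : / Cmod (x + wk (S n)) <= / Re x by apply: Rinv_le_contravar.
have B2 : / Cmod (x - wk (S n)) <= / Re x by apply: Rinv_le_contravar.
by have := Rplus_le_compat _ _ _ _ B1 B2; rewrite /Cminus; lra.
Qed.

Lemma asum_inv_sqr (c : C) : asum (fun i => c * RtoC (/ INR (S i) ^ 2))%C /\
  CSer (fun i => c * RtoC (/ INR (S i) ^ 2))%C = (c * RtoC zeta2)%C.
Proof.
have S0 : asum (fun i => RtoC (/ INR (S i) ^ 2)).
  apply: asum_le ex_series_inv_sqr => i; rewrite Cmod_R Rabs_pos_eq; first lra.
  by left; apply: Rinv_0_lt_compat; apply: pow_lt; exact: INR_S_pos.
split; first exact: asum_scal.
by rewrite CSer_scal // CSer_RtoC //; exact: ex_series_inv_sqr.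
Qed.

(** Multiplication by [2 PI i / tau], up to sign, carries the lattice points with parameter [tau] to
    those with parameter [s = 4 PI^2 / tau] and exchanges [m] and [n]. The sum over [m] is therefore
    again an instance of [lipschitz]. *)
Lemma grid_dual (tau : C) (n : nat) : 0 < Re tau ->
  let s := (RtoC (4 * PI ^ 2) * / tau)%C in
  asum (fun m => grid tau m n) /\
  CSer (fun m => grid tau m n) =
    (RtoC (/ (4 * PI ^ 2)) * RtoC (/ INR (S n) ^ 2) - s * / tau * lip1 (RtoC (INR (S n)) * s))%C.
Proof.
move=> Ht s; have PI0 := PI_bounds; have Nt := Re_pos_neq0 tau Ht.
have Pn := INR_S_pos n.
have Hs : 0 < Re s.
  rewrite /s re_scal_l; apply: Rmult_lt_0_compat; first by nra.
  rewrite /Cinv /=; apply: Rdiv_lt_0_compat => //.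
  by have := pow2_ge_0 (snd tau); have := pow2_gt_0 (fst tau) ltac:(rewrite -/(Re tau); lra); rewrite /=; lra.
have Hx : 0 < Re (RtoC (INR (S n)) * s) by rewrite re_scal_l; nra.
have Np : RtoC PI <> 0%C by move/RtoC_inj; lra.
have Nn : RtoC (INR (S n)) <> 0%C by move/RtoC_inj; lra.
have C2 : (Ci * Ci = RtoC (-1))%C by apply: Ceq => /=; ring.
have Ni : Ci <> 0%C by move=> E; have := f_equal Im E; rewrite /=; lra.
have E4 : RtoC (4 * PI ^ 2) = (4 * (RtoC PI * RtoC PI))%C.
  by rewrite RtoC_mult RtoC_pow /=; ring.
have E2 : RtoC (2 * PI) = (2 * RtoC PI)%C by rewrite (RtoC_mult 2).
have W k : wk k = (2 * RtoC PI * RtoC (INR k) * Ci)%C.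
  by rewrite /wk (RtoC_mult (2 * PI)) E2.
have EG m : (grid tau m n = - (s * / tau) * pfpow 1 (RtoC (INR (S n)) * s) m)%C.
  have Pm := INR_S_pos m.
  have Hm : 0 < Re (RtoC (INR (S m)) * tau) by rewrite re_scal_l; nra.
  have [N1 N2] := wk_neq _ (S n) Hm; have [N3 N4] := wk_neq _ (S m) Hx.
  have D1 : (RtoC (INR (S n)) * s + wk (S m) = RtoC (2 * PI) * Ci * / tau * (RtoC (INR (S m)) * tau - wk (S n)))%C.
    rewrite /s E4 !W E2.
    transitivity (RtoC (INR (S n)) * (4 * (RtoC PI * RtoC PI)) * / tau + 2 * RtoC PI * RtoC (INR (S m)) * Ci * (tau * / tau))%C.
      by rewrite Cinv_r //; ring.
    transitivity (- (4 * (RtoC PI * RtoC PI) * RtoC (INR (S n)) * / tau) * (Ci * Ci) + 2 * RtoC PI * RtoC (INR (S m)) * Ci * (tau * / tau))%C; last ring.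
    by rewrite C2; ring.
  have D2 : (RtoC (INR (S n)) * s - wk (S m) = - (RtoC (2 * PI) * Ci * / tau) * (RtoC (INR (S m)) * tau + wk (S n)))%C.
    rewrite /s E4 !W E2.
    transitivity (RtoC (INR (S n)) * (4 * (RtoC PI * RtoC PI)) * / tau - 2 * RtoC PI * RtoC (INR (S m)) * Ci * (tau * / tau))%C.
      by rewrite Cinv_r //; ring.
    transitivity (- (4 * (RtoC PI * RtoC PI) * RtoC (INR (S n)) * / tau) * (Ci * Ci) - 2 * RtoC PI * RtoC (INR (S m)) * Ci * (tau * / tau))%C; last ring.
    by rewrite C2; ring.
  rewrite /grid /pfpow D1 D2.
  set a := (RtoC (INR (S m)) * tau + wk (S n))%C in N1 *.
  set b := (RtoC (INR (S m)) * tau - wk (S n))%C in N2 *.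
  have N2pi : RtoC (2 * PI) <> 0%C by move/RtoC_inj; lra.
  have I (w : C) : w <> 0%C -> (/ (RtoC (2 * PI) * Ci * / tau * w) ^ 2 = - (tau * tau / RtoC (4 * PI ^ 2)) * / w ^ 2)%C.
    move=> Nw.
    have -> : ((RtoC (2 * PI) * Ci * / tau * w) ^ 2 = (Ci * Ci) * (RtoC (4 * PI ^ 2) * (/ tau * / tau) * w ^ 2))%C.
      by rewrite E4 E2 /=; ring.
    by rewrite C2 E4 /=; field.
  have I2 (w : C) : w <> 0%C -> (/ (- (RtoC (2 * PI) * Ci * / tau) * w) ^ 2 = - (tau * tau / RtoC (4 * PI ^ 2)) * / w ^ 2)%C.
    by move=> Nw; rewrite -I //; congr Cinv; rewrite /=; ring.
  by rewrite I // I2 // /s E4 /=; field.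
have Sp := asum_pfpow 1 _ Hx.
have Sg := asum_scal (- (s * / tau))%C _ Sp.
split; first by apply: asum_ext Sg => m; rewrite EG.
rewrite (CSer_ext _ _ EG) CSer_scal // /lip1 lipschitz //.
rewrite /s E4 !RtoC_inv; try by (apply: pow_nonzero || idtac); nra.
by rewrite E4 RtoC_pow /=; field.
Qed.

(* The double series over [grid] converges only conditionally: summing it by rows and by columns
   gives results that differ by the boundary term [/ (2 * tau)]. *)
Theorem eis_transform (tau : C) : 0 < Re tau ->
  let s := (RtoC (4 * PI ^ 2) * / tau)%C in
  eis tau = (RtoC (PI ^ 2 / 6) * / (tau * tau) + RtoC (/ 24) - / (2 * tau) - s * / tau * eis s)%C.
Proof.
move=> Ht s; have PI0 := PI_bounds; have Nt := Re_pos_neq0 tau Ht.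
have Hs : 0 < Re s.
  rewrite /s re_scal_l; apply: Rmult_lt_0_compat; first by nra.
  rewrite /Cinv /=; apply: Rdiv_lt_0_compat => //.
  by have := pow2_ge_0 (snd tau); have := pow2_gt_0 (fst tau) ltac:(rewrite -/(Re tau); lra); rewrite /=; lra.
have Hm m : 0 < Re (RtoC (INR (S m)) * tau) by rewrite re_scal_l; have := INR_S_pos m; nra.
have [K HK] := grid_diff_bound tau Ht.
have Sd m : asum (grid_diff tau m).
  apply: asum_le (HK m) _; by apply: ex_series_scalR; exact: ex_series_inv_sqr.
have Rd m : Series (fun n => Cmod (grid_diff tau m n)) <= K * zeta2 * / INR (S m) ^ 2.
  have -> : K * zeta2 * / INR (S m) ^ 2 = K * / INR (S m) ^ 2 * zeta2 by ring.
  rewrite /zeta2 -Series_scal_l; apply: Series_le.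
    by move=> n; split; [exact: Cmod_ge_0 | exact: HK].
  by apply: ex_series_scalR; exact: ex_series_inv_sqr.
have SR : ex_series (fun m => K * zeta2 * / INR (S m) ^ 2).
  by apply: ex_series_scalR; exact: ex_series_inv_sqr.
have [Fc [Frow [_ [Fcol FE]]]] := fubini (grid_diff tau) _ Sd Rd SR.
set X := CSer (fun m => CSer (grid_diff tau m)) in FE.
have Hh : 0 < Re (RtoC (/ 2) * tau) by rewrite re_scal_l; lra.
pose b0 := CSer (pfpair (RtoC (/ 2) * tau)).
have [Sb0 _] := chi_partial_fractions _ Hh.
have G1 m : (CSer (grid tau m) = lip1 (RtoC (INR (S m)) * tau) - / (tau * tau) * RtoC (/ INR (S m) ^ 2))%C.
  rewrite /lip1 lipschitz // /grid Cplus_0_r.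
  have Nm : RtoC (INR (S m)) <> 0%C by move/RtoC_inj; have := INR_S_pos m; lra.
  rewrite RtoC_inv; last by apply: pow_nonzero; have := INR_S_pos m; lra.
  rewrite RtoC_pow /=; set A := CSer _; by field.
have [Sz Ez] := asum_inv_sqr (/ (tau * tau)).
have Sl := asum_eis tau Ht.
have E1 : CSer (fun m => CSer (grid tau m)) = (eis tau - / (tau * tau) * RtoC zeta2)%C.
  by rewrite (CSer_ext _ _ G1) CSer_minus // Ez.
have L1 : Clim (fun M => csum (fun m => CSer (grid tau m)) M) (eis tau - / (tau * tau) * RtoC zeta2)%C.
  rewrite -E1; apply: CSer_lim.
  by apply: asum_ext (asum_minus _ _ Sl Sz) => m; rewrite G1.
have L2 : Clim (fun M => csum (fun m => CSer (grid tau m)) M) (/ tau * (b0 - / 2) + X)%C.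
  apply: (Clim_ext (fun M => / tau * (b0 - CSer (pfpair (RtoC (INR M + / 2) * tau))) + csum (fun m => CSer (grid_diff tau m)) M)%C).
    move=> M.
    have HM : 0 < Re (RtoC (INR M + / 2) * tau) by rewrite re_scal_l; have := pos_INR M; nra.
    have [SM _] := chi_partial_fractions _ HM.
    have [Sx ->] := csum_CSer_swap (grid_diff tau) M Sd.
    have [_ ->] := csum_CSer_swap (grid tau) M (fun m => asum_pfpow 1 _ (Hm m)).
    have Sm := asum_minus _ _ Sb0 SM.
    rewrite -CSer_minus // -CSer_scal // -CSer_plus //; last exact: asum_scal.
    by apply: CSer_ext => n; rewrite grid_telescope.
  apply: Clim_plus; last exact: CSer_lim.
  apply: Clim_mult; first exact: Clim_const.
  by apply: Clim_minus; [exact: Clim_const | exact: chi_lim].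
have H1 := Clim_unique _ _ _ L1 L2.
have G2 n : CSer (fun m => grid tau m n) = (/ tau * pfpair (RtoC (/ 2) * tau) n + CSer (fun m => grid_diff tau m n))%C.
  apply: CSer_unique; first by have [] := grid_dual tau n Ht.
  apply: (Clim_ext _ _ _ (fun M => esym (grid_telescope tau n M))).
  apply: Clim_plus; last exact: CSer_lim.
  apply: Clim_mult; first exact: Clim_const.
  rewrite -[X in Clim _ X](_ : (pfpair (RtoC (/ 2) * tau) n - 0 = pfpair (RtoC (/ 2) * tau) n)%C); last ring.
  by apply: Clim_minus; [exact: Clim_const | exact: pfpair_lim].
have E2 : CSer (fun n => CSer (fun m => grid tau m n)) = (/ tau * b0 + X)%C.
  by rewrite (CSer_ext _ _ G2) CSer_plus ?CSer_scal // ?FE //; exact: asum_scal.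
have E3 : CSer (fun n => CSer (fun m => grid tau m n)) = (RtoC (/ (4 * PI ^ 2)) * RtoC zeta2 - s * / tau * eis s)%C.
  have [S1 <-] := asum_inv_sqr (RtoC (/ (4 * PI ^ 2))).
  rewrite -CSer_scal; last exact: asum_eis.
  rewrite -CSer_minus //; last by apply: asum_scal; exact: asum_eis.
  by apply: CSer_ext => n; have [_ ->] := grid_dual tau n Ht.
(* The two values of the column sum determine [/ tau * b0 + X], and [H1] expresses [eis tau] through
   this quantity. *)
rewrite E2 in E3.
have -> : eis tau = (/ (tau * tau) * RtoC zeta2 + (/ tau * b0 + X) - / (2 * tau))%C.
  have -> : eis tau = ((eis tau - / (tau * tau) * RtoC zeta2) + / (tau * tau) * RtoC zeta2)%C by ring.
  by rewrite H1; field.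
rewrite E3 zeta2_value -RtoC_mult.
have -> : / (4 * PI ^ 2) * (PI ^ 2 / 6) = / 24 by field; lra.
ring.
Qed.

(** * The modular transformation of the partition generating function *)

Lemma qder_comp (F G : C -> C) (z d e : C) :
  qder G z d -> qder F (G z) e -> qder (fun w => F (G w)) z (d * e)%C.
Proof.
move=> [K [r [HK [Hr H]]]] [K' [r' [HK' [Hr' H']]]].
have Pd := Cmod_ge_0 d; have Pe := Cmod_ge_0 e.
pose M := Cmod d + K + 1.
have PM : 1 <= M by rewrite /M; lra.
exists (K * Cmod e + K' * M ^ 2), (Rmin r (r' / M)).
split; first by have := pow2_ge_0 M; nra.
have Pr' : 0 < r' / M by apply: Rdiv_lt_0_compat; lra.
split; first by split; [apply: Rmin_pos; lra | apply: Rle_trans (Rmin_l _ _) _; lra].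
move=> h Hh; have Ph := Cmod_ge_0 h.
have H1 := H h (Rlt_le_trans _ _ _ Hh (Rmin_l _ _)).
have Hh1 : Cmod h <= 1 by have := Rmin_l r (r' / M); lra.
have Hh2 : Cmod h * M < r'.
  have := Rmin_r r (r' / M) => L.
  have E : r' = r' / M * M by field; lra.
  by rewrite E; apply: Rmult_lt_compat_r; lra.
set a := (G (z + h) - G z - h * d)%C in H1 *.
pose k := (h * d + a)%C.
have Bk : Cmod k <= Cmod h * M.
  apply: Rle_trans (Cmod_triangle _ _) _; rewrite Cmod_mult.
  have Sq : Cmod h ^ 2 <= Cmod h by simpl; nra.
  rewrite /M; nra.
have Ek : (G (z + h) = G z + k)%C by rewrite /k /a; ring.
have H2 := H' k ltac:(lra).
rewrite Ek.
have -> : (F (G z + k) - F (G z) - h * (d * e) = (F (G z + k) - F (G z) - k * e) + a * e)%C by rewrite /k; ring.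
apply: Rle_trans (Cmod_triangle _ _) _; rewrite Cmod_mult.
have B1 : Cmod k ^ 2 <= (Cmod h * M) ^ 2 by apply: pow_incr; split => //; exact: Cmod_ge_0.
have B2 : K' * Cmod k ^ 2 <= K' * (Cmod h * M) ^ 2 by exact: Rmult_le_compat_l.
have B3 : Cmod a * Cmod e <= K * Cmod h ^ 2 * Cmod e by exact: Rmult_le_compat_r.
rewrite Rpow_mult_distr in B2; lra.
Qed.

Lemma exp_le (x y : R) : x <= y -> exp x <= exp y.
Proof. by case=> [H|->]; [left; exact: exp_increasing | right]. Qed.

(** Each [e^(- n h)] is expanded to second order. As [|h| <= Re x / 2], the factor [e^(n |h|)] in
    the remainder uses up half of the decay [e^(- n Re x)]. *)
Lemma dirichlet_quad (a : nat -> R) (x h : C) :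
  (forall n, 0 <= a n) -> 0 < Re x -> Cmod h <= Re x / 2 ->
  ex_series (fun n => a n * INR n ^ 2 * exp (- (INR n * (Re x / 2)))) ->
  asum (fun n => RtoC (a n) * cexp (- (RtoC (INR n) * (x + h))))%C ->
  asum (fun n => RtoC (a n) * cexp (- (RtoC (INR n) * x)))%C ->
  asum (fun n => RtoC (a n * INR n) * cexp (- (RtoC (INR n) * x)))%C ->
  Cmod (CSer (fun n => RtoC (a n) * cexp (- (RtoC (INR n) * (x + h)))) -
        CSer (fun n => RtoC (a n) * cexp (- (RtoC (INR n) * x))) +
        h * CSer (fun n => RtoC (a n * INR n) * cexp (- (RtoC (INR n) * x))))%C
  <= Cmod h ^ 2 * Series (fun n => a n * INR n ^ 2 * exp (- (INR n * (Re x / 2)))).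
Proof.
move=> Ha Hx Hh S2 S1 S0 Sd.
have Sm := asum_minus _ _ S1 S0.
rewrite -CSer_minus // -CSer_scal // -CSer_plus //; last exact: asum_scal.
rewrite -Series_scal_l; apply: Cmod_CSer; last exact: ex_series_scalR.
move=> n; have Pn := pos_INR n; have Ph := Cmod_ge_0 h.
pose w := (- (RtoC (INR n) * h))%C.
have -> : (RtoC (a n) * cexp (- (RtoC (INR n) * (x + h))) - RtoC (a n) * cexp (- (RtoC (INR n) * x)) +
   h * (RtoC (a n * INR n) * cexp (- (RtoC (INR n) * x))) =
   RtoC (a n) * cexp (- (RtoC (INR n) * x)) * (cexp w - 1 - w))%C.
  rewrite (_ : (- (RtoC (INR n) * (x + h)) = - (RtoC (INR n) * x) + w)%C); last by rewrite /w; ring.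
  by rewrite cexp_add RtoC_mult /w; ring.
have Mw : Cmod w = INR n * Cmod h by rewrite /w Cmod_opp Cmod_mult Cmod_R Rabs_pos_eq.
have Pc : 0 <= INR n * (Re x / 2) by apply: Rmult_le_pos; lra.
have B := cexp_sub2 w (INR n * (Re x / 2)) Pc ltac:(apply: Rle_trans (Re_le_Cmod w) _; rewrite Mw; apply: Rmult_le_compat_l; lra).
rewrite !Cmod_mult Cmod_R (Rabs_pos_eq _ (Ha n)) Cmod_cexp re_opp re_scal_l.
have PE := exp_pos (- (INR n * Re x)).
apply: (Rle_trans _ (a n * exp (- (INR n * Re x)) * (Cmod w ^ 2 * exp (INR n * (Re x / 2))))).
  by apply: Rmult_le_compat_l => //; apply: Rmult_le_pos => //; lra.
rewrite Mw.
have -> : exp (- (INR n * (Re x / 2))) = exp (- (INR n * Re x)) * exp (INR n * (Re x / 2)).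
  by rewrite -exp_plus; congr exp; field.
by right; ring.
Qed.

Lemma ex_series_pow_exp (s : nat) (b : R) : 0 < b -> ex_series (fun n => INR n ^ s * exp (- (INR n * b))).
Proof.
move=> Hb; have H := asum_lip_term s (RtoC b) Hb.
apply: ex_series_extR (ex_series_scalR (INR (fact s)) _ H) => n.
rewrite /lip_term Cmod_mult Cmod_R Cmod_cexp re_opp re_scal_l Rabs_pos_eq.
  by rewrite /=; field; exact: INR_fact_neq_0.
apply: Rmult_le_pos; first by apply: pow_le; exact: pos_INR.
by left; apply: Rinv_0_lt_compat; exact: INR_fact_lt_0.
Qed.

Definition Lam_term (tau : C) (m : nat) : C :=
  (RtoC (/ INR (S m)) * / (cexp (RtoC (INR (S m)) * tau) - 1))%C.

(** The Lambert series of [- log (q; q)_oo] at [q = e^(- tau)]: its exponential is identified with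
    the limit of the inverse products in [qp_lim], and its derivative with [- eis] in [qder_Lam]. *)
Definition Lam (tau : C) : C := CSer (Lam_term tau).

Lemma Cmod_inv_expm1 (x : C) : 0 < Re x -> Cmod (/ (cexp x - 1)) <= / (exp (Re x) - 1).
Proof.
move=> Hx; rewrite Cmod_inv'.
have := exp_ineq1 (Re x) ltac:(lra) => H.
apply: Rinv_le_contravar; first lra.
by have := Cmod_minus_ge (cexp x) 1; rewrite Cmod_1 Cmod_cexp.
Qed.

Lemma Re_scal_pos (r : R) (x : C) : 0 < r -> 0 < Re x -> 0 < Re (RtoC r * x).
Proof. by move=> H1 H2; rewrite re_scal_l; exact: Rmult_lt_0_compat. Qed.

Lemma asum_Lam (tau : C) : 0 < Re tau -> asum (Lam_term tau).
Proof.
move=> Ht; apply: (asum_le _ (fun m => / Re tau * / INR (S m) ^ 2)); last first.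
  by apply: ex_series_scalR; exact: ex_series_inv_sqr.
move=> m; have Pm := INR_S_pos m.
have Hx := Re_scal_pos _ _ Pm Ht.
rewrite Cmod_mult Cmod_R Rabs_pos_eq; last by left; apply: Rinv_0_lt_compat.
rewrite (_ : / Re tau * / INR (S m) ^ 2 = / INR (S m) * / (INR (S m) * Re tau)); last by field; lra.
apply: Rmult_le_compat_l; first by left; apply: Rinv_0_lt_compat.
apply: Rle_trans (Cmod_inv_expm1 _ Hx) _.
rewrite re_scal_l in Hx *.
have := exp_ineq1 (INR (S m) * Re tau) ltac:(lra) => H.
by apply: Rinv_le_contravar; lra.
Qed.

Lemma qder_Lam (tau : C) : 0 < Re tau -> qder Lam tau (- eis tau)%C.
Proof.
move=> Ht; set al := Re tau in Ht *.
pose be := al / 2; have Pbe : 0 < be by rewrite /be; lra.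
pose S2 := Series (fun n => INR n ^ 2 * exp (- (INR n * be))).
have SS2 := ex_series_pow_exp 2 be Pbe.
pose K m := INR (S m) * exp (- be) ^ m * S2.
have [Sg _] := ex_series_geom_pos _ (exp_neg_lt1 _ Pbe).
have SK : ex_series K.
  apply: (ex_series_extR (fun m => S2 * (INR m ^ 1 * exp (- (INR m * be)) + exp (- be) ^ m))).
    by move=> m; rewrite /K S_INR exp_nat_pow /=; ring.
  apply: ex_series_scalR; apply: (ex_series_plus (V := R_NormedModule)) => //.
  exact: ex_series_pow_exp.
have K0 m : 0 <= K m.
  apply: Rmult_le_pos; first by apply: Rmult_le_pos; [exact: pos_INR | apply: pow_le; left; exact: exp_pos].
  apply: Series_ge0 SS2 => n; apply: Rmult_le_pos; [exact: pow2_ge_0 | left; exact: exp_pos].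
exists (Series K), (Rmin 1 be).
split; first exact: Series_ge0.
split; first by split; [apply: Rmin_pos; lra | exact: Rmin_l].
move=> h Hh; have Hh2 : Cmod h <= be by have := Rmin_r 1 be; lra.
have Hth : 0 < Re (tau + h).
  by rewrite Re_plus -/al; have := re_le_Cmod h; move/Rabs_le_between; rewrite /be in Hh2; lra.
have Sl := asum_eis tau Ht.
have -> : (Lam (tau + h) - Lam tau - h * - eis tau = Lam (tau + h) - Lam tau + h * eis tau)%C by ring.
rewrite /Lam /eis -CSer_minus; try exact: asum_Lam.
have S0 : asum (fun m => Lam_term (tau + h) m - Lam_term tau m)%C by apply: asum_minus; exact: asum_Lam.
rewrite -CSer_scal // -CSer_plus //; last exact: asum_scal.
rewrite Rmult_comm -Series_scal_l; apply: Cmod_CSer; last exact: ex_series_scalR.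
move=> m; have Pm := INR_S_pos m; have Pm1 : 1 <= INR (S m) by rewrite S_INR; have := pos_INR m; lra.
set k := INR (S m) in Pm Pm1 *.
have Hx := Re_scal_pos _ _ Pm Ht; have Hxh := Re_scal_pos _ _ Pm Hth.
have [T1 E1] := chi_exp _ Hx; have [T2 E2] := chi_exp _ Hxh.
have One x : asum (fun n => cexp (- (RtoC (INR n) * x)))%C -> asum (fun n => RtoC 1 * cexp (- (RtoC (INR n) * x)))%C.
  by apply: asum_ext => n; rewrite Cmult_1_l.
have OneE x : CSer (fun n => RtoC 1 * cexp (- (RtoC (INR n) * x)))%C = CSer (fun n => cexp (- (RtoC (INR n) * x)))%C.
  by apply: CSer_ext => n; rewrite Cmult_1_l.
have Lt n x : (lip_term 1 x n = RtoC (1 * INR n) * cexp (- (RtoC (INR n) * x)))%C.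
  by rewrite /lip_term /= Rdiv_1_r Rmult_1_r Rmult_1_l.
have Rx : Re (RtoC k * tau) / 2 = k * be by rewrite re_scal_l /be -/al; field.
(* Extracting [exp (- be) ^ m] here is what makes the termwise constants summable over [m]. *)
have Bn n : 1 * INR n ^ 2 * exp (- (INR n * (k * be))) <= exp (- be) ^ m * (INR n ^ 2 * exp (- (INR n * be))).
  case: n => [|n]; first by rewrite /= !Rmult_0_l Rmult_0_r; lra.
  rewrite Rmult_1_l -exp_nat_pow (Rmult_comm (exp _)) Rmult_assoc -exp_plus.
  apply: Rmult_le_compat_l; first exact: pow2_ge_0.
  apply: exp_le; rewrite /k !S_INR; have := pos_INR n; have := pos_INR m => A B.
  by have := Rmult_le_pos _ _ (Rmult_le_pos _ _ A B) (Rlt_le _ _ Pbe); lra.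
have Pn n : 0 <= 1 * INR n ^ 2 * exp (- (INR n * (k * be))).
  by apply: Rmult_le_pos; [have := pow2_ge_0 (INR n); lra | left; exact: exp_pos].
have SB : ex_series (fun n => exp (- be) ^ m * (INR n ^ 2 * exp (- (INR n * be)))) by exact: ex_series_scalR.
have := dirichlet_quad (fun=> 1) (RtoC k * tau) (RtoC k * h) (fun=> Rle_0_1) Hx.
rewrite -Cmult_plus_distr_l !OneE E1 E2 Rx.
move=> D; have {D} := D _ _ (One _ T2) (One _ T1).
have -> : CSer (fun n => RtoC (1 * INR n) * cexp (- (RtoC (INR n) * (RtoC k * tau))))%C = lip1 (RtoC k * tau).
  by apply: CSer_ext => n; rewrite Lt.
move=> D; have {D} D := D _ _ _.
have {}D : Cmod (chi (RtoC k * (tau + h)) + / 2 - (chi (RtoC k * tau) + / 2) + RtoC k * h * lip1 (RtoC k * tau))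
   <= Cmod (RtoC k * h) ^ 2 * Series (fun n => 1 * INR n ^ 2 * exp (- (INR n * (k * be)))).
  apply: D.
  - by rewrite Cmod_mult Cmod_R Rabs_pos_eq; [apply: Rmult_le_compat_l; lra | lra].
  - by apply: ex_series_le0 SB => n; split; [exact: Pn | exact: Bn].
  - by apply: asum_ext (asum_lip_term 1 _ Hx) => n; rewrite Lt.
have -> : (Lam_term (tau + h) m - Lam_term tau m + h * lip1 (RtoC k * tau) =
  RtoC (/ k) * (chi (RtoC k * (tau + h)) + / 2 - (chi (RtoC k * tau) + / 2) + RtoC k * h * lip1 (RtoC k * tau)))%C.
  rewrite /Lam_term -/k /chi RtoC_inv; last lra.
  have Nk : RtoC k <> 0%C by move/RtoC_inj; lra.
  have N1 := cexp_sub1_neq0 _ Hx; have N2 := cexp_sub1_neq0 _ Hxh.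
  by field.
rewrite Cmod_mult Cmod_R Rabs_pos_eq; last by left; apply: Rinv_0_lt_compat.
apply: (Rle_trans _ (/ k * (Cmod (RtoC k * h) ^ 2 * (exp (- be) ^ m * S2)))).
  apply: Rmult_le_compat_l; first by left; apply: Rinv_0_lt_compat.
  apply: Rle_trans D _; apply: Rmult_le_compat_l; first exact: pow2_ge_0.
  by rewrite /S2 -Series_scal_l; apply: Series_le.
rewrite Cmod_mult Cmod_R Rabs_pos_eq; last lra.
by right; rewrite /K -/k; field; lra.
Qed.

Lemma Re_inv_pos (z : C) : 0 < Re z -> 0 < Re (/ z).
Proof.
move=> Hz; rewrite /Cinv /=; apply: Rdiv_lt_0_compat => //.
by have := pow2_ge_0 (snd z); have := pow2_gt_0 (fst z) ltac:(rewrite -/(Re z); lra); rewrite /=; lra.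
Qed.

(** By [eis_transform] the function [R0] has derivative [/ tau], so [cexp (R0 tau) / tau] is
    constant; no logarithm of [tau] is required. The constant is evaluated at [2 PI], the fixed
    point of [tau |-> 4 PI^2 / tau] in the half-plane, where the terms of [R0] cancel. *)
Theorem Lam_transform (tau : C) : 0 < Re tau ->
  cexp (2 * Lam tau) =
    (tau * RtoC (/ (2 * PI)) * cexp (RtoC (PI ^ 2 / 3) * / tau - RtoC (/ 12) * tau)
      * cexp (2 * Lam (RtoC (4 * PI ^ 2) * / tau)))%C.
Proof.
move=> Ht; have PI0 := PI_bounds.
pose s (t : C) := (RtoC (4 * PI ^ 2) * / t)%C.
pose R0 (t : C) := (2 * Lam t + RtoC (- (PI ^ 2 / 3)) * / t + RtoC (/ 12) * t + RtoC (-2) * Lam (s t))%C.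
have Hs t : 0 < Re t -> 0 < Re (s t).
  by move=> H; apply: Re_scal_pos; [nra | exact: Re_inv_pos].
have Ds t : 0 < Re t -> qder s t (RtoC (4 * PI ^ 2) * - / (t * t))%C.
  by move=> H; apply: qder_scal; exact: qder_inv.
have DR t : 0 < Re t -> qder R0 t (/ t)%C.
  move=> H; have Nt := Re_pos_neq0 t H.
  have -> : (/ t = 2 * - eis t + RtoC (- (PI ^ 2 / 3)) * - / (t * t) + RtoC (/ 12) * 1 + RtoC (-2) * ((RtoC (4 * PI ^ 2) * - / (t * t)) * - eis (s t)))%C.
    rewrite (eis_transform t H) -/(s t).
    have -> : PI ^ 2 / 3 = 2 * (PI ^ 2 / 6) by field.
    have -> : / 12 = 2 * / 24 by field.
    rewrite RtoC_opp (RtoC_mult 2 (PI ^ 2 / 6)) (RtoC_mult 2 (/ 24)) /s.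
    set A := eis _; set B := RtoC (PI ^ 2 / 6); set D := RtoC (4 * PI ^ 2); set F := RtoC (/ 24).
    by field.
  apply: qder_plus; last first.
    by apply: qder_scal; apply: qder_comp; [exact: Ds | apply: qder_Lam; exact: Hs].
  apply: qder_plus; last by apply: qder_scal; exact: qder_id.
  apply: qder_plus; first by apply: qder_scal; exact: qder_Lam.
  by apply: qder_scal; exact: qder_inv.
pose H t := (cexp (R0 t) * / t)%C.
have DH t : 0 < Re t -> qder H t 0%C.
  move=> Pt; have Nt := Re_pos_neq0 t Pt.
  have := qder_mult _ _ _ _ _ (qder_cexp _ _ _ (DR t Pt)) (qder_inv t Pt).
  by rewrite (_ : (cexp (R0 t) * / t * / t + cexp (R0 t) * - / (t * t) = 0)%C) //; field.
have P2 : 0 < Re (RtoC (2 * PI)) by rewrite /=; lra.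
have := qder_zero_const H tau (RtoC (2 * PI)) Ht P2 DH.
have -> : H (RtoC (2 * PI)) = RtoC (/ (2 * PI)).
  have E : s (RtoC (2 * PI)) = RtoC (2 * PI).
    rewrite /s -RtoC_inv; last lra.
    by rewrite -RtoC_mult; congr RtoC; field; lra.
  rewrite /H /R0 E -RtoC_inv; last lra.
  have -> : (2 * Lam (RtoC (2 * PI)) + RtoC (- (PI ^ 2 / 3)) * RtoC (/ (2 * PI)) + RtoC (/ 12) * RtoC (2 * PI) + RtoC (-2) * Lam (RtoC (2 * PI)) = 0)%C.
    set l := Lam _.
    have E2 : RtoC (- (PI ^ 2 / 3) * / (2 * PI) + / 12 * (2 * PI)) = 0%C.
      by congr RtoC; field; lra.
    rewrite RtoC_plus !(RtoC_mult _ (/ (2 * PI))) (RtoC_mult (/ 12)) in E2.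
    transitivity (2 * l + (RtoC (- (PI ^ 2 / 3)) * RtoC (/ (2 * PI)) + RtoC (/ 12) * RtoC (2 * PI)) + RtoC (-2) * l)%C; first ring.
    by rewrite E2; ring.
  by rewrite cexp_0 Cmult_1_l.
rewrite /H /R0 -/(s tau) => E.
have Nt := Re_pos_neq0 tau Ht.
have -> : (2 * Lam tau = (2 * Lam tau + RtoC (- (PI ^ 2 / 3)) * / tau + RtoC (/ 12) * tau + RtoC (-2) * Lam (s tau)) +
  ((RtoC (PI ^ 2 / 3) * / tau - RtoC (/ 12) * tau) + 2 * Lam (s tau)))%C by rewrite RtoC_opp; ring.
set A := (_ + RtoC (-2) * _)%C in E *.
rewrite (cexp_add A) (cexp_add (_ - _)%C) -E.
by field.
Qed.

(** * The partition product *)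

Fixpoint qp (q : C) (n : nat) : C :=
  match n with O => 1%C | S k => (qp q k * (1 - q ^ S k))%C end.

(** This is [- log (1 - e^(- x))]; the term [n = 0] vanishes because [/ INR 0 = 0]. *)
Definition logG (x : C) : C := CSer (fun n => RtoC (/ INR n) * cexp (- (RtoC (INR n) * x)))%C.

Lemma asum_cexp_nat (x : C) (a : nat -> R) : 0 < Re x -> (forall n, Rabs (a n) <= 1) ->
  asum (fun n => RtoC (a n) * cexp (- (RtoC (INR n) * x)))%C.
Proof.
move=> Hx Ha; apply: asum_le (proj1 (chi_exp x Hx)) => n.
rewrite Cmod_mult Cmod_R; have := Cmod_ge_0 (cexp (- (RtoC (INR n) * x))).
by have := Ha n; have := Rabs_pos (a n); nra.
Qed.

Lemma inv_INR_le1 (n : nat) : Rabs (/ INR n) <= 1.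
Proof.
case: n => [|n]; first by rewrite /= Rinv_0 Rabs_R0; lra.
have P := INR_S_pos n; rewrite Rabs_pos_eq; last by left; apply: Rinv_0_lt_compat.
rewrite -Rinv_1; apply: Rinv_le_contravar; first lra.
by rewrite S_INR; have := pos_INR n; lra.
Qed.

(** The coefficient [/ INR n * INR n] is 0 at [n = 0] and 1 elsewhere, so this is the geometric
    series without its first term, in the shape that [dirichlet_quad] produces. *)
Lemma CSer_cexp_S (x : C) : 0 < Re x ->
  CSer (fun n => RtoC (/ INR n * INR n) * cexp (- (RtoC (INR n) * x)))%C = (/ (cexp x - 1))%C.
Proof.
move=> Hx; have [S0 E] := chi_exp x Hx.
rewrite (CSer_split _ 1); last first.
  apply: asum_cexp_nat => // -[|n]; first by rewrite /= Rmult_0_r Rabs_R0; lra.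
  by rewrite Rinv_l ?Rabs_R1; [lra | apply: Rgt_not_eq; exact: INR_S_pos].
rewrite (CSer_split _ 1) // [csum _ 1]/= Cmult_0_l Copp_0 cexp_0 in E.
rewrite [csum _ 1]/= Rmult_0_r Cmult_0_l !Cplus_0_l.
rewrite (CSer_ext _ (fun k => cexp (- (RtoC (INR (1 + k)) * x)))); last first.
  move=> k; rewrite Rinv_l ?Cmult_1_l //; apply: Rgt_not_eq; exact: INR_S_pos.
set T := CSer _ in E *.
have -> : (T = chi x + / 2 - 1)%C by rewrite -E; ring.
by rewrite /chi; field; exact: cexp_sub1_neq0.
Qed.

Lemma qder_logG (x : C) : 0 < Re x -> qder logG x (- / (cexp x - 1))%C.
Proof.
move=> Hx; set al := Re x in Hx *.
have SS := ex_series_pow_exp 1 (al / 2) ltac:(lra).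
have E n : INR n ^ 1 * exp (- (INR n * (al / 2))) = / INR n * INR n ^ 2 * exp (- (INR n * (al / 2))).
  case: n => [|n]; first by rewrite /= !Rmult_0_l Rmult_0_r Rmult_0_l.
  by have := INR_S_pos n; set y := INR (S n) => P; field; lra.
have SB := ex_series_extR _ _ E SS.
exists (Series (fun n => / INR n * INR n ^ 2 * exp (- (INR n * (al / 2))))), (Rmin 1 (al / 2)).
split.
  apply: Series_ge0 SB => n; rewrite -E; apply: Rmult_le_pos; last by left; exact: exp_pos.
  by apply: pow_le; exact: pos_INR.
split; first by split; [apply: Rmin_pos; lra | exact: Rmin_l].
move=> h Hh; have Hh2 : Cmod h <= al / 2 by have := Rmin_r 1 (al / 2); lra.
have Hxh : 0 < Re (x + h).
  by rewrite Re_plus -/al; have := re_le_Cmod h; move/Rabs_le_between; lra.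
have -> : (logG (x + h) - logG x - h * - / (cexp x - 1) = logG (x + h) - logG x + h * / (cexp x - 1))%C by ring.
rewrite -CSer_cexp_S // Rmult_comm.
apply: dirichlet_quad => //.
- case=> [|n]; first by rewrite /= Rinv_0; lra.
  by left; apply: Rinv_0_lt_compat; exact: INR_S_pos.
- by apply: asum_cexp_nat => // n; exact: inv_INR_le1.
- by apply: asum_cexp_nat => // n; exact: inv_INR_le1.
- apply: asum_cexp_nat => // -[|n]; first by rewrite /= Rmult_0_r Rabs_R0; lra.
  by rewrite Rinv_l ?Rabs_R1; [lra | apply: Rgt_not_eq; exact: INR_S_pos].
Qed.

Lemma one_minus_neq0 (x : C) : 0 < Re x -> (1 - cexp (- x))%C <> 0%C.
Proof.
move=> Hx; apply/Cmod_gt_0; have := Cmod_minus_ge 1 (cexp (- x)).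
rewrite Cmod_1 Cmod_cexp re_opp; have := exp_neg_lt1 _ Hx; lra.
Qed.

Lemma logG_bound (x : C) : 0 < Re x -> Cmod (logG x) <= / (exp (Re x) - 1).
Proof.
move=> Hx; have Hr : 0 < Re (RtoC (Re x)) by [].
have := CSer_cexp_S (RtoC (Re x)) Hr.
rewrite cexp_RtoC -RtoC_minus -RtoC_inv; last by have := exp_ineq1 (Re x); lra.
rewrite (CSer_ext _ (fun n => RtoC (/ INR n * INR n * exp (- (INR n * Re x))))); last first.
  by move=> n; rewrite -RtoC_mult -RtoC_opp cexp_RtoC -RtoC_mult.
have S0 : ex_series (fun n => / INR n * INR n * exp (- (INR n * Re x))).
  apply: ex_series_le0 (ex_series_pow_exp 0 _ Hx) => -[|n].
    by rewrite /= Rmult_0_r !Rmult_0_l Ropp_0 exp_0; lra.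
  rewrite Rinv_l; last by apply: Rgt_not_eq; exact: INR_S_pos.
  by rewrite /=; have := exp_pos (- (INR (S n) * Re x)); rewrite -/(INR (S n)); lra.
rewrite CSer_RtoC // => /RtoC_inj <-.
apply: Cmod_CSer => // n; rewrite Cmod_mult Cmod_R Cmod_cexp re_opp re_scal_l.
apply: Rmult_le_compat_r; first by left; exact: exp_pos.
case: n => [|n]; first by rewrite /= Rinv_0 Rabs_R0; lra.
by rewrite Rinv_l; [exact: inv_INR_le1 | apply: Rgt_not_eq; exact: INR_S_pos].
Qed.

(** The product [(1 - e^(- t)) e^(logG t)] has derivative 0, hence is constant on the half-plane,
    and it tends to 1 along the positive integers. *)
Lemma cexp_logG (x : C) : 0 < Re x -> cexp (logG x) = (/ (1 - cexp (- x)))%C.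
Proof.
move=> Hx.
pose H t := ((1 - cexp (- t)) * cexp (logG t))%C.
have DH t : 0 < Re t -> qder H t 0%C.
  move=> Ht; have N := cexp_sub1_neq0 t Ht; have N0 := cexp_neq0 t.
  have D1 : qder (fun t => 1 - cexp (- t))%C t (0 + RtoC (-1) * (cexp (- t) * (RtoC (-1) * 1)))%C.
    apply: (qder_ext (fun t => 1 + RtoC (-1) * cexp (RtoC (-1) * t))%C) => //.
      by move=> w _; rewrite (_ : (RtoC (-1) * w = - w)%C); ring.
    apply: qder_plus; first exact: qder_const.
    apply: qder_scal.
    rewrite (_ : (- t = RtoC (-1) * t)%C); last ring.
    by apply: qder_cexp; apply: qder_scal; exact: qder_id.
  have -> : (RtoC 0 = (0 + RtoC (-1) * (cexp (- t) * (RtoC (-1) * 1))) * cexp (logG t)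
    + (1 - cexp (- t)) * (cexp (logG t) * - / (cexp t - 1)))%C by rewrite cexp_opp; field.
  by apply: qder_mult => //; apply: qder_cexp; exact: qder_logG.
have E1 n : H x = H (RtoC (INR (S n))).
  by apply: qder_zero_const => //; rewrite /=; exact: INR_S_pos.
have L0 : is_lim_seq (fun n => / INR (S n)) 0.
  apply: (is_lim_seq_inv _ p_infty) => //.
  by apply: (proj1 (is_lim_seq_incr_1 INR p_infty)); exact: is_lim_seq_INR.
have Bn n : / (exp (INR (S n)) - 1) <= / INR (S n).
  by have P := INR_S_pos n; have := exp_ineq1 (INR (S n)) ltac:(lra) => E; apply: Rinv_le_contravar; lra.
have L1 : Clim (fun n => cexp (logG (RtoC (INR (S n))))) 1%C.
  apply: (Clim_squeeze _ _ (fun n => exp 1 * / INR (S n))); last exact: lim_scal0.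
  move=> n; have P := INR_S_pos n.
  have B : Cmod (logG (RtoC (INR (S n)))) <= / INR (S n).
    by apply: Rle_trans (logG_bound (RtoC (INR (S n))) P) (Bn n).
  have := inv_INR_le1 (S n); rewrite Rabs_pos_eq; last by left; apply: Rinv_0_lt_compat.
  move=> B1; apply: Rle_trans (cexp_sub1 _ 1 _ _) _; first lra.
    by apply: Rle_trans (Re_le_Cmod _) _; lra.
  by rewrite Rmult_comm; apply: Rmult_le_compat_l; [left; exact: exp_pos | lra].
have L2 : Clim (fun n => 1 - cexp (- RtoC (INR (S n))))%C (1 - 0)%C.
  apply: Clim_minus; first exact: Clim_const.
  apply: (Clim_squeeze _ _ (fun n => / INR (S n))) => // n.
  rewrite /Cminus Copp_0 Cplus_0_r Cmod_cexp /= -/(INR (S n)) exp_Ropp.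
  have P := INR_S_pos n; have := exp_ineq1 (INR (S n)) ltac:(lra) => E.
  by apply: Rinv_le_contravar; lra.
have L3 := Clim_ext _ _ _ (fun n => esym (E1 n)) (Clim_mult _ _ _ _ L2 L1).
have EH := Clim_unique _ _ _ (Clim_const (H x)) L3.
have N := one_minus_neq0 x Hx.
have -> : cexp (logG x) = (H x * / (1 - cexp (- x)))%C by rewrite /H; field.
by rewrite EH; field.
Qed.

Lemma cexp_neg_pow (tau : C) (m : nat) : (cexp (- tau) ^ m = cexp (- (RtoC (INR m) * tau)))%C.
Proof. by rewrite -cexp_nat; congr cexp; ring. Qed.

Lemma qp_neq0 (tau : C) (n : nat) : 0 < Re tau -> qp (cexp (- tau)) n <> 0%C.
Proof.
move=> Ht; elim: n => [|n IH]; first by move=> /= /RtoC_inj; lra.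
rewrite [qp _ _]/=; apply: Cmult_neq_0 => //.
rewrite -Cpow_S cexp_neg_pow; apply: one_minus_neq0; apply: Re_scal_pos => //; exact: INR_S_pos.
Qed.

Lemma inv_qp (tau : C) (n : nat) : 0 < Re tau ->
  (/ qp (cexp (- tau)) n = cexp (csum (fun m => logG (RtoC (INR (S m)) * tau)) n))%C.
Proof.
move=> Ht; elim: n => [|n IH]; first by rewrite /= cexp_0; field.
have Hm := Re_scal_pos _ _ (INR_S_pos n) Ht.
rewrite csum_S cexp_add -IH cexp_logG // -cexp_neg_pow.
have N1 := qp_neq0 tau n Ht; have N2 := one_minus_neq0 _ Hm.
rewrite -cexp_neg_pow in N2.
by rewrite [qp _ (S n)]/= -Cpow_S; field.
Qed.

(** Expanding every [logG] turns the logarithm of the product into an absolutely convergent double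
    series; summing it in the other order gives the Lambert series. *)
Theorem qp_lim (tau : C) : 0 < Re tau -> Clim (fun n => / qp (cexp (- tau)) n)%C (cexp (Lam tau)).
Proof.
move=> Ht; set al := Re tau in Ht.
pose a m n := (RtoC (/ INR n) * cexp (- (RtoC (INR n) * (RtoC (INR (S m)) * tau))))%C.
have Hm m := Re_scal_pos _ _ (INR_S_pos m) Ht.
have Sa m : asum (a m) by apply: asum_cexp_nat => // n; exact: inv_INR_le1.
have [Sg Eg] := ex_series_geom_pos _ (exp_neg_lt1 _ Ht).
have Ra m : Series (fun n => Cmod (a m n)) <= / (1 - exp (- al)) * exp (- al) ^ m.
  rewrite -Eg -Series_scal_r; apply: Series_le; last first.
    by apply: (ex_series_extR (fun n => exp (- al) ^ m * exp (- al) ^ n)); [move=> n; ring | exact: ex_series_scalR].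
  move=> n; split; first exact: Cmod_ge_0.
  rewrite /a Cmod_mult Cmod_R Cmod_cexp re_opp !re_scal_l -/al.
  case: n => [|n].
    rewrite /= Rinv_0 Rabs_R0 Rmult_0_l Rmult_1_l; apply: pow_le; left; exact: exp_pos.
  apply: (Rle_trans _ (1 * exp (- (INR (S n) * (INR (S m) * al))))).
    by apply: Rmult_le_compat_r; [left; exact: exp_pos | exact: inv_INR_le1].
  rewrite Rmult_1_l -!exp_nat_pow -exp_plus; apply: exp_le.
  rewrite !S_INR; have := pos_INR n; have := pos_INR m => A B.
  by have := Rmult_le_pos _ _ (Rmult_le_pos _ _ A B) (Rlt_le _ _ Ht); lra.
have SR : ex_series (fun m => / (1 - exp (- al)) * exp (- al) ^ m) by exact: ex_series_scalR.
have [Fc [Fr [_ [Fcol FE]]]] := fubini a _ Sa Ra SR.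
have Col k : CSer (fun m => a m (S k)) = Lam_term tau k.
  have Hk := Re_scal_pos _ _ (INR_S_pos k) Ht.
  have SC := CSer_cexp_S _ Hk.
  rewrite /Lam_term -SC -CSer_scal; last first.
    apply: asum_cexp_nat => // -[|n]; first by rewrite /= Rmult_0_r Rabs_R0; lra.
    by rewrite Rinv_l ?Rabs_R1; [lra | apply: Rgt_not_eq; exact: INR_S_pos].
  rewrite [RHS](CSer_split _ 1); last first.
    apply: asum_scal; apply: asum_cexp_nat => // -[|n]; first by rewrite /= Rmult_0_r Rabs_R0; lra.
    by rewrite Rinv_l ?Rabs_R1; [lra | apply: Rgt_not_eq; exact: INR_S_pos].
  rewrite [csum _ 1]/= Rmult_0_r !Cmult_0_l Cmult_0_r !Cplus_0_l.
  apply: CSer_ext => m; rewrite /a [(1 + m)%nat]/= Rinv_l; last by apply: Rgt_not_eq; exact: INR_S_pos.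
  rewrite Cmult_1_l; congr (_ * cexp _)%C; ring.
have E : CSer (fun m => logG (RtoC (INR (S m)) * tau)) = Lam tau.
  (* The column of index 0 vanishes, hence the shift by one against [Lam_term]. *)
  rewrite [LHS]FE (CSer_split _ 1) // [csum _ 1]/= (CSer_0 (fun m => a m 0%nat)); last first.
    by move=> m; rewrite /a /= Rinv_0 Cmult_0_l.
  rewrite !Cplus_0_l; apply: CSer_ext => k; exact: Col.
have L := CSer_lim _ Fr.
rewrite [CSer _]E in L.
apply: (Clim_ext _ _ _ (fun n => esym (inv_qp tau n Ht))).
have L2 : Clim (fun n => cexp (csum (fun m => logG (RtoC (INR (S m)) * tau)) n - Lam tau))%C 1%C.
  have LC := proj1 (Clim_Cmod _ _) L.
  apply/Clim_Cmod.
  apply: (is_lim_seq_le_le_loc (fun=> 0) _ (fun n => exp 1 * Cmod (csum (fun m => logG (RtoC (INR (S m)) * tau)) n - Lam tau))); last first.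
  - exact: lim_scal0.
  - exact: is_lim_seq_const.
  - have /is_lim_seq_spec /(_ (mkposreal 1 Rlt_0_1)) [N HN] := LC.
    exists N => n Hn; have := HN n Hn; rewrite /= Rminus_0_r Rabs_pos_eq; last exact: Cmod_ge_0.
    move=> B; split; first exact: Cmod_ge_0.
    rewrite Rmult_comm; apply: cexp_sub1; first lra.
    by apply: Rle_trans (Re_le_Cmod _) _; apply: Rlt_le.
apply: (Clim_ext (fun n => cexp (Lam tau) * cexp (csum (fun m => logG (RtoC (INR (S m)) * tau)) n - Lam tau))%C).
  by move=> n; rewrite -cexp_add; congr cexp; ring.
by rewrite -[X in Clim _ X]Cmult_1_r; apply: Clim_mult => //; exact: Clim_const.
Qed.

(** * The false theta function and the generating function of unimodal sequences *)

Fixpoint tri (n : nat) : nat := match n with O => O | S k => (tri k + S k)%nat end.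

Definition psi (q : C) : C := CSer (fun j => RtoC ((-1) ^ j) * q ^ tri j)%C.

Lemma tri_ge (n : nat) : (n <= tri n)%nat.
Proof. by case: n => [//|n] /=; lia. Qed.

Lemma pow_decr (r : R) (m n : nat) : 0 <= r <= 1 -> (m <= n)%nat -> r ^ n <= r ^ m.
Proof.
move=> Hr; elim=> [|k _ IH]; first lra.
rewrite /=; have := pow_le r k (proj1 Hr) => P; nra.
Qed.

Lemma asum_psi (q : C) : Cmod q < 1 -> asum (fun j => RtoC ((-1) ^ j) * q ^ tri j)%C.
Proof.
move=> Hq; have Pq := Cmod_ge_0 q.
apply: asum_le (proj1 (ex_series_geom_pos _ (conj Pq Hq))) => j.
rewrite Cmod_mult Cmod_R pow_1_abs Rmult_1_l Cmod_pow.
by apply: pow_decr; [lra | exact: tri_ge].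
Qed.

Lemma Cmod_psi (q : C) : Cmod q < 1 -> Cmod (psi q) <= / (1 - Cmod q).
Proof.
move=> Hq; have Pq := Cmod_ge_0 q.
have [S0 <-] := ex_series_geom_pos _ (conj Pq Hq).
apply: Cmod_CSer => // j.
rewrite Cmod_mult Cmod_R pow_1_abs Rmult_1_l Cmod_pow.
by apply: pow_decr; [lra | exact: tri_ge].
Qed.

Lemma Clim_bounded (u : nat -> C) (l : C) : Clim u l -> exists B, forall n, Cmod (u n) <= B.
Proof.
move=> /Clim_Cmod_lim H.
have [B HB] := filterlim_bounded (V := R_NormedModule) _ (ex_intro _ (Cmod l) H).
exists B => n; apply: Rle_trans (HB n).
exact: Rle_abs.
Qed.

(** The case [k = 0] is the generating function wanted; the offset [k] in the second product is
    introduced to obtain a recurrence. *)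
Definition heine_term (tau : C) (k n : nat) : C :=
  (cexp (- tau) ^ n * (/ qp (cexp (- tau)) n * / qp (cexp (- tau)) (n + k)))%C.

Definition heine (tau : C) (k : nat) : C := CSer (heine_term tau k).

Lemma Cmod_q_lt1 (tau : C) : 0 < Re tau -> 0 <= Cmod (cexp (- tau)) < 1.
Proof. by move=> Ht; rewrite Cmod_cexp re_opp; exact: exp_neg_lt1. Qed.

Lemma heine_bound (tau : C) : 0 < Re tau ->
  exists B, 0 <= B /\ forall k n, Cmod (heine_term tau k n) <= B * Cmod (cexp (- tau)) ^ n.
Proof.
move=> Ht; have [B HB] := Clim_bounded _ _ (qp_lim tau Ht).
have PB : 0 <= B by apply: Rle_trans (HB 0%nat); exact: Cmod_ge_0.
exists (B * B); split; first nra.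
move=> k n; rewrite !Cmod_mult Cmod_pow Rmult_comm.
apply: Rmult_le_compat_r; first by apply: pow_le; exact: Cmod_ge_0.
by apply: Rmult_le_compat; try exact: Cmod_ge_0.
Qed.

Lemma asum_heine (tau : C) (k : nat) : 0 < Re tau -> asum (heine_term tau k).
Proof.
move=> Ht; have [B [_ HB]] := heine_bound tau Ht.
apply: asum_le (HB k) _; apply: ex_series_scalR.
exact: (proj1 (ex_series_geom_pos _ (Cmod_q_lt1 tau Ht))).
Qed.

(** The factor [1 - q^(n+k+1)] raises the offset to [k + 1], and [1 - q^n] lowers the index of the
    first product. Writing [1 - q^(n+k+1)] as [1 - q^(k+1) (1 - (1 - q^n))] combines both into the
    relation. *)
Lemma heine_rec (tau : C) (k : nat) : 0 < Re tau ->
  let q := cexp (- tau) in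
  (heine tau k + q ^ S k * heine tau (S k) = heine tau (S k) + q ^ S (S k) * heine tau (S (S k)))%C.
Proof.
move=> Ht q.
have S0 := asum_heine tau k Ht; have S1 := asum_heine tau (S k) Ht; have S2 := asum_heine tau (S (S k)) Ht.
pose d n := ((1 - q ^ n) * heine_term tau (S k) n)%C.
have N n := qp_neq0 tau n Ht.
have E1 n : (heine_term tau k n = heine_term tau (S k) n - q ^ S k * (heine_term tau (S k) n - d n))%C.
  rewrite /d /heine_term -/q Nat.add_succ_r.
  have N1 := N (S (n + k)); have N0 := N (n + k)%nat; have Nn := N n; rewrite -/q in N0 N1 Nn.
  have Eq : (qp q (S (n + k)) = qp q (n + k) * (1 - q ^ n * q ^ S k))%C.
    by rewrite [LHS]/= -Cpow_S -Cpow_add_r Nat.add_succ_r.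
  rewrite Eq in N1 *.
  have N3 : (1 - q ^ n * q ^ S k)%C <> 0%C by move=> E; apply: N1; rewrite E; ring.
  by field.
have E2 n : d (S n) = (q * heine_term tau (S (S k)) n)%C.
  rewrite /d /heine_term -/q.
  have Nn := N n; have N1 := N (S n); have N2 := N (n + S (S k))%nat; rewrite -/q in Nn N1 N2.
  rewrite (_ : (S n + S k = n + S (S k))%nat); last by lia.
  rewrite [qp q (S n)]/= -Cpow_S in N1 *.
  have N3 : (1 - q ^ S n)%C <> 0%C by move=> E; apply: N1; rewrite E; ring.
  have EE : (q ^ S n = q * q ^ n)%C by rewrite Cpow_S.
  transitivity (q ^ S n * (/ qp q n * / qp q (n + S (S k))))%C; first by field.
  by rewrite EE; ring.
have Sd : asum d.
  apply/(asum_shift d 1); apply: asum_ext (asum_scal q _ S2) => n.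
  by rewrite E2.
have Ed : CSer d = (q * heine tau (S (S k)))%C.
  rewrite (CSer_split _ 1) // [csum _ 1]/= -CSer_scal // (CSer_ext (fun k0 => d (1 + k0)%nat) _ E2).
  by rewrite /d /=; ring.
have Sm := asum_minus _ _ S1 Sd.
have -> : heine tau k = (heine tau (S k) - q ^ S k * (heine tau (S k) - q * heine tau (S (S k))))%C.
  rewrite -Ed /heine (CSer_ext _ _ E1) CSer_minus ?CSer_scal ?CSer_minus //.
  exact: asum_scal.
by rewrite (Cpow_S q (S k)); ring.
Qed.

(** The sum telescopes, since [q^n / (q; q)_n] is the difference of the inverse products of index
    [n] and [n - 1]. *)
Lemma sum_q_qp (tau : C) (n : nat) : 0 < Re tau ->
  (csum (fun i => cexp (- tau) ^ i * / qp (cexp (- tau)) i) (S n) = / qp (cexp (- tau)) n)%C.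
Proof.
move=> Ht; elim: n => [|n IH]; first by rewrite /=; field.
have N0 := qp_neq0 tau n Ht; have N1 := qp_neq0 tau (S n) Ht.
rewrite csum_S IH; rewrite [qp _ (S n)]/= -Cpow_S in N1 *.
have N3 : (1 - cexp (- tau) ^ S n)%C <> 0%C by move=> E; apply: N1; rewrite E; ring.
by field.
Qed.

(* A(k) + q^(k+1) A(k+1) does not depend on k and tends to the square of the
   partition product. *)
Theorem heine_psi (tau : C) : 0 < Re tau -> heine tau 0 = (cexp (2 * Lam tau) * psi (cexp (- tau)))%C.
Proof.
move=> Ht; set q := cexp (- tau); set P := cexp (Lam tau).
have Q := Cmod_q_lt1 tau Ht; rewrite -/q in Q.
have [B [PB HB]] := heine_bound tau Ht; rewrite -/q in HB.
have [Sg Eg] := ex_series_geom_pos _ Q.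
have [B1 HB1] := Clim_bounded _ _ (qp_lim tau Ht); rewrite -/q in HB1.
pose D k := (heine tau k + q ^ S k * heine tau (S k))%C.
have ED k : D k = D 0%nat by elim: k => [//|k IH]; rewrite /D -heine_rec //.
have Hh k : Cmod (heine tau k) <= B / (1 - Cmod q).
  rewrite /Rdiv -Eg -Series_scal_l; apply: Cmod_CSer; [exact: HB | exact: ex_series_scalR].
have Lq : is_lim_seq (fun k => Cmod q ^ k) 0 by apply: is_lim_seq_geom; rewrite Rabs_pos_eq; lra.
pose f n := (q ^ n * / qp q n)%C.
have Sf : asum f.
  apply: (asum_le _ (fun n => B1 * Cmod q ^ n)); last exact: ex_series_scalR.
  move=> n; rewrite Cmod_mult Cmod_pow Rmult_comm; apply: Rmult_le_compat_r; last exact: HB1.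
  by apply: pow_le; lra.
have Ef : CSer f = P.
  apply: CSer_unique => //.
  have [L1 L2] := qp_lim tau Ht.
  by split; apply/is_lim_seq_incr_1; [apply: is_lim_seq_ext L1 | apply: is_lim_seq_ext L2] => n; rewrite sum_q_qp.
have LD : Clim D (P * P)%C.
  have [_ LA] := tannery (heine_term tau) (fun n => P * f n)%C (fun n => B * Cmod q ^ n) 0 0
    (fun k n _ _ => HB k n) (ex_series_scalR _ _ Sg) (fun k => asum_heine tau k Ht)
    ltac:(move=> n; rewrite /heine_term -/q;
      apply: (Clim_ext (fun k => (q ^ n * / qp q n) * / qp q (k + n))%C);
        [by move=> k; rewrite (Nat.add_comm k n); ring |];
      rewrite (Cmult_comm P); apply: Clim_mult; [exact: Clim_const |];
      have [L1 L2] := qp_lim tau Ht; split;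
        [exact: (proj1 (is_lim_seq_incr_n _ n _) L1) | exact: (proj1 (is_lim_seq_incr_n _ n _) L2)]).
  rewrite CSer_scal // Ef in LA.
  rewrite -[X in Clim _ X]Cplus_0_r; apply: Clim_plus => //.
  apply: (Clim_squeeze _ _ (fun k => B / (1 - Cmod q) * Cmod q ^ k)); last exact: lim_scal0.
  move=> k; rewrite /Cminus Copp_0 Cplus_0_r Cmod_mult Cmod_pow Rmult_comm.
  apply: Rmult_le_compat => //; try exact: Cmod_ge_0.
    by apply: pow_le; lra.
  by apply: pow_decr; [lra | lia].
have HD k : (heine tau k = P * P - q ^ S k * heine tau (S k))%C.
  rewrite (Clim_unique _ _ _ LD (Clim_ext _ _ _ (fun k => esym (ED k)) (Clim_const (D 0%nat)))) -(ED k) /D; ring.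
(* Iterating [HD] accumulates the exponent [1 + 2 + ... + J], a triangular number, and alternating
   signs. *)
have It J : (heine tau 0 = P * P * csum (fun j => RtoC ((-1) ^ j) * q ^ tri j) J + RtoC ((-1) ^ J) * q ^ tri J * heine tau J)%C.
  elim: J => [|J IH]; first by rewrite /=; ring.
  rewrite csum_S {1}IH {1}(HD J) [tri (S J)]/= Cpow_add_r.
  rewrite (_ : (-1) ^ S J = -1 * (-1) ^ J) // (RtoC_mult (-1)); ring.
have EP : (cexp (2 * Lam tau) = P * P)%C by rewrite -cexp_add; congr cexp; ring.
rewrite EP.
apply: (Clim_unique (fun=> heine tau 0)); first exact: Clim_const.
apply: (Clim_ext _ _ _ (fun J => esym (It J))).
rewrite -[X in Clim _ X]Cplus_0_r; apply: Clim_plus.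
  apply: Clim_mult; first exact: Clim_const.
  by apply: CSer_lim; apply: asum_psi; lra.
apply: (Clim_squeeze _ _ (fun k => B / (1 - Cmod q) * Cmod q ^ k)); last exact: lim_scal0.
move=> k; rewrite /Cminus Copp_0 Cplus_0_r !Cmod_mult Cmod_R pow_1_abs Rmult_1_l Cmod_pow Rmult_comm.
apply: Rmult_le_compat => //; try exact: Cmod_ge_0.
  by apply: pow_le; lra.
by apply: pow_decr; [lra | exact: tri_ge].
Qed.

(** * Power series of partitions with bounded parts and of unimodal sequences *)

Definition shift (c : nat) (h : nat -> C) (i : nat) : C := if Nat.leb c i then h (i - c)%nat else 0%C.

Lemma CSer_shift (c : nat) (h : nat -> C) : asum h -> asum (shift c h) /\ CSer (shift c h) = CSer h.
Proof.
move=> Sh.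
have E i : shift c h (c + i) = h i.
  by rewrite /shift; case: Nat.leb_spec => [_|]; [congr h; lia | lia].
have Ss : asum (shift c h) by apply/(asum_shift _ c); apply: asum_ext Sh => i; rewrite E.
split => //; rewrite (CSer_split _ c) // (CSer_ext _ h E).
rewrite (csum_ext _ (fun=> 0%C)); last by move=> i Hi; rewrite /shift; case: Nat.leb_spec => //; lia.
have -> : csum (fun=> 0%C) c = 0%C by elim: (c) => [//|m /= ->]; ring.
ring.
Qed.

Lemma rsum_shift_le (c N : nat) (h : nat -> R) : (forall i, 0 <= h i) ->
  rsum (fun i => if Nat.leb c i then h (i - c)%nat else 0) N <= rsum h N.
Proof.
move=> Hh; apply: (Rle_trans _ (rsum h (N - c))); last by apply: rsum_incr => //; lia.
elim: N => [|N IH]; first by rewrite /=; lra.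
rewrite rsum_S; case: Nat.leb_spec => H.
  have -> : (S N - c = S (N - c))%nat by lia.
  by rewrite rsum_S; lra.
have E0 : (N - c = 0)%nat by lia.
have E1 : (S N - c = 0)%nat by lia.
by rewrite E0 in IH; rewrite E1; lra.
Qed.

(* [p c i] counts the partitions of [i] into parts at most [c]. *)
Definition part_rec (p : nat -> nat -> R) : Prop :=
  (forall c i, 0 <= p c i) /\
  (forall i, p 0%nat i = match i with O => 1 | _ => 0 end) /\
  (forall c i, p (S c) i = p c i + if Nat.leb (S c) i then p (S c) (i - S c)%nat else 0).

Lemma part_series (p : nat -> nat -> R) (tau : C) (c : nat) : part_rec p -> 0 < Re tau ->
  asum (fun i => RtoC (p c i) * cexp (- tau) ^ i)%C /\
  CSer (fun i => RtoC (p c i) * cexp (- tau) ^ i)%C = (/ qp (cexp (- tau)) c)%C.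
Proof.
move=> [P0 [Pz PS]] Ht; have Q := Cmod_q_lt1 tau Ht; set q := cexp (- tau) in Q *.
have Ea c' i : Cmod (RtoC (p c' i) * q ^ i)%C = p c' i * Cmod q ^ i.
  by rewrite Cmod_mult Cmod_R Cmod_pow Rabs_pos_eq.
have Pt c' i : 0 <= p c' i * Cmod q ^ i by apply: Rmult_le_pos => //; apply: pow_le; lra.
elim: c => [|c [IS IE]].
  have [S0 ->] := CSer_csum (fun i => RtoC (p 0%nat i) * q ^ i)%C 1 ltac:(by case=> [|i] Hi; [lia | rewrite Pz Cmult_0_l]).
  by split => //; rewrite /= Pz; field.
set r := Cmod q in Q *.
have Hr : 0 <= r ^ S c < 1.
  split; first by apply: pow_le; lra.
  by apply: Rle_lt_trans (pow_decr r 1 (S c) _ _) _; [lra | lia | lra].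
have Sc : asum (fun i => RtoC (p (S c) i) * q ^ i)%C.
  apply: (ex_series_bounded _ (Series (fun i => p c i * r ^ i) / (1 - r ^ S c))).
    by move=> i; exact: Cmod_ge_0.
  move=> N; rewrite (rsum_ext _ (fun i => p (S c) i * r ^ i)); last by move=> i _; rewrite Ea.
  have SI : ex_series (fun i => p c i * r ^ i) by apply: ex_series_extR IS => i; rewrite Ea.
  have H1 := rsum_le_Series _ N (Pt c) SI.
  (* Convergence is not known beforehand: for the partial sums [F] and [G] with parts up to [c] and
     up to [c + 1], the recurrence gives [G <= F + r^(c+1) G], which bounds [G]. *)
  have H2 : rsum (fun i => p (S c) i * r ^ i) N <= rsum (fun i => p c i * r ^ i) N + r ^ S c * rsum (fun i => p (S c) i * r ^ i) N.
    apply: (Rle_trans _ (rsum (fun i => p c i * r ^ i) N + r ^ S c * rsum (fun i => if Nat.leb (S c) i then p (S c) (i - S c)%nat * r ^ (i - S c) else 0) N)).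
      right; elim: (N) => [|n IH]; first by rewrite /=; ring.
      rewrite !rsum_S IH (PS c n) Rmult_plus_distr_r.
      case: Nat.leb_spec => H; last by ring.
      have -> : r ^ n = r ^ S c * r ^ (n - S c) by rewrite -pow_add; congr pow; lia.
      ring.
    apply: Rplus_le_compat_l; apply: Rmult_le_compat_l; first lra.
    exact: (rsum_shift_le (S c) N (fun i => p (S c) i * r ^ i)).
  apply: (Rmult_le_reg_r (1 - r ^ S c)); first lra.
  rewrite /Rdiv Rmult_assoc Rinv_l ?Rmult_1_r; last lra.
  by rewrite -/r in H1; set G := rsum _ N in H2 *; set rc := r ^ S c in H2 *; lra.
split => //.
pose h := (fun i => RtoC (p (S c) i) * q ^ i)%C.
have [Ssh Esh] := CSer_shift (S c) h Sc.
have E : (CSer h = / qp q c + q ^ S c * CSer h)%C.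
  rewrite -{2}Esh -IE -CSer_scal // -CSer_plus //; last exact: asum_scal.
  apply: CSer_ext => i; rewrite /h /shift (PS c i).
  case: Nat.leb_spec => H; rewrite RtoC_plus; last by rewrite Cmult_0_r; ring.
  have -> : (q ^ i = q ^ S c * q ^ (i - S c))%C by rewrite -Cpow_add_r; congr (q ^ _)%C; lia.
  ring.
have N1 := qp_neq0 tau (S c) Ht; rewrite -/q in N1.
have N0 := qp_neq0 tau c Ht; rewrite -/q in N0.
rewrite [qp q (S c)]/= -Cpow_S in N1 *.
have N3 : (1 - q ^ S c)%C <> 0%C by move=> E0; apply: N1; rewrite E0; ring.
rewrite -/h.
have E' : (CSer h * (1 - q ^ S c) = / qp q c)%C.
  have -> : (CSer h * (1 - q ^ S c) = CSer h - q ^ S c * CSer h)%C by ring.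
  by rewrite {1}E; ring.
have -> : CSer h = (/ qp q c * / (1 - q ^ S c))%C by rewrite -E'; field.
by field.
Qed.

Definition conv (f g : nat -> R) (n : nat) : R := rsum (fun i => f i * g (n - i)%nat) (S n).

Lemma CSer_conv (f g : nat -> R) (q : C) : (forall i, 0 <= f i) -> (forall i, 0 <= g i) ->
  asum (fun i => RtoC (f i) * q ^ i)%C -> asum (fun i => RtoC (g i) * q ^ i)%C ->
  asum (fun i => RtoC (conv f g i) * q ^ i)%C /\
  CSer (fun i => RtoC (conv f g i) * q ^ i)%C =
    (CSer (fun i => RtoC (f i) * q ^ i) * CSer (fun i => RtoC (g i) * q ^ i))%C.
Proof.
move=> Hf Hg Sf Sg.
pose a i n := shift i (fun j => (RtoC (f i) * q ^ i) * (RtoC (g j) * q ^ j))%C n.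
have Sr i := CSer_shift i _ (asum_scal (RtoC (f i) * q ^ i)%C _ Sg).
have Ra i : Series (fun n => Cmod (a i n)) <= Series (fun j => Cmod (RtoC (g j) * q ^ j)%C) * Cmod (RtoC (f i) * q ^ i).
  have E : CSer (fun n => RtoC (Cmod (a i n))) = RtoC (Cmod (RtoC (f i) * q ^ i) * Series (fun j => Cmod (RtoC (g j) * q ^ j)%C)).
    have Sg' : asum (fun j => RtoC (Cmod (RtoC (g j) * q ^ j)%C)).
      by apply: ex_series_extR Sg => j; rewrite Cmod_R Rabs_pos_eq //; exact: Cmod_ge_0.
    rewrite RtoC_mult -CSer_RtoC // -CSer_scal //.
    have [_ <-] := CSer_shift i _ (asum_scal (RtoC (Cmod (RtoC (f i) * q ^ i)))%C _ Sg').
    by apply: CSer_ext => n; rewrite /a /shift; case: Nat.leb => //; rewrite ?Cmod_0 // -RtoC_mult -Cmod_mult.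
  move: E; rewrite CSer_RtoC; last exact: (proj1 (Sr i)).
  by move/RtoC_inj => ->; rewrite Rmult_comm; lra.
have SR := ex_series_scalR (Series (fun j => Cmod (RtoC (g j) * q ^ j)%C)) _ Sf.
have [_ [_ [_ [Fcol FE]]]] := fubini a _ (fun i => proj1 (Sr i)) Ra SR.
have Col n : CSer (fun i => a i n) = (RtoC (conv f g n) * q ^ n)%C.
  have [_ ->] := CSer_csum (fun i => a i n) (S n) ltac:(by move=> k Hk; rewrite /a /shift; case: Nat.leb_spec => //; lia).
  rewrite /conv -csum_RtoC Cmult_comm -csum_scal; apply: csum_ext => i Hi.
  rewrite /a /shift; case: Nat.leb_spec => H; last lia.
  have -> : (q ^ n = q ^ i * q ^ (n - i))%C by rewrite -Cpow_add_r; congr (q ^ _)%C; lia.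
  by rewrite RtoC_mult; ring.
split; first by apply: asum_ext Fcol => n; rewrite Col.
rewrite -(CSer_ext _ _ Col) -FE Cmult_comm -CSer_scal //.
apply: CSer_ext => i; rewrite (proj2 (Sr i)) CSer_scal //; ring.
Qed.

(** Here [c] is the peak, and the convolution distributes the rest over the two sides. Under
    [part_rec] the summand [c = 0] contributes only at [n = 0], where it gives the convention
    [u(0) = 1]. *)
Definition unim (p : nat -> nat -> R) (n : nat) : R := rsum (fun c => conv (p c) (p c) (n - c)%nat) (S n).

Theorem unim_series (p : nat -> nat -> R) (tau : C) : part_rec p -> 0 < Re tau ->
  asum (fun n => RtoC (unim p n) * cexp (- tau) ^ n)%C /\
  CSer (fun n => RtoC (unim p n) * cexp (- tau) ^ n)%C = (cexp (2 * Lam tau) * psi (cexp (- tau)))%C.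
Proof.
move=> Hp Ht; have [P0 _] := Hp.
have Cv0 c n : 0 <= conv (p c) (p c) n by apply: rsum_ge0 => i; apply: Rmult_le_pos.
pose a (t : C) c := shift c (fun j => cexp (- t) ^ c * (RtoC (conv (p c) (p c) j) * cexp (- t) ^ j))%C.
have Sr t c : 0 < Re t -> asum (a t c) /\ CSer (a t c) = heine_term t 0 c.
  move=> H; have [S1 E1] := part_series p t c Hp H.
  have [S2 E2] := CSer_conv _ _ _ (P0 c) (P0 c) S1 S1.
  have [S3 E3] := CSer_shift c _ (asum_scal (cexp (- t) ^ c)%C _ S2).
  by split => //; rewrite E3 CSer_scal // E2 E1 /heine_term Nat.add_0_r.
(* The coefficients are nonnegative, so the absolute values of the terms at [tau] are the terms at
   [Re tau]; this supplies the bound for [fubini]. *)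
pose t0 := RtoC (Re tau); have Ht0 : 0 < Re t0 by [].
have Eq0 : cexp (- t0) = RtoC (Cmod (cexp (- tau))).
  by rewrite Cmod_cexp re_opp /t0 -RtoC_opp cexp_RtoC.
have Ra c : Series (fun n => Cmod (a tau c n)) <= Cmod (heine_term t0 0 c).
  have E n : a t0 c n = RtoC (Cmod (a tau c n)).
    rewrite /a /shift; case: Nat.leb; last by rewrite Cmod_0.
    rewrite Eq0 !Cmod_mult !Cmod_pow Cmod_R Rabs_pos_eq // !RtoC_mult !RtoC_pow; ring.
  have [S1 E1] := Sr t0 c Ht0.
  rewrite -E1 (CSer_ext _ _ E) CSer_RtoC; last exact: (proj1 (Sr tau c Ht)).
  by rewrite Cmod_R; exact: Rle_abs.
have [_ [_ [_ [Fcol FE]]]] := fubini (a tau) _ (fun c => proj1 (Sr tau c Ht)) Ra (asum_heine t0 0 Ht0).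
have Col n : CSer (fun c => a tau c n) = (RtoC (unim p n) * cexp (- tau) ^ n)%C.
  have [_ ->] := CSer_csum (fun c => a tau c n) (S n) ltac:(by move=> k Hk; rewrite /a /shift; case: Nat.leb_spec => //; lia).
  rewrite /unim -csum_RtoC Cmult_comm -csum_scal; apply: csum_ext => c Hc.
  rewrite /a /shift; case: Nat.leb_spec => H; last lia.
  have -> : (cexp (- tau) ^ n = cexp (- tau) ^ c * cexp (- tau) ^ (n - c))%C by rewrite -Cpow_add_r; congr (_ ^ _)%C; lia.
  ring.
split; first by apply: asum_ext Fcol => n; rewrite Col.
rewrite -(CSer_ext _ _ Col) -FE -heine_psi //.
by apply: CSer_ext => c; exact: (proj2 (Sr tau c Ht)).
Qed.

(** * Boole summation of the false theta function *)

(** Factorials in binary integers: they reduce to numerals that [lra] can use, whereas [fact 14] in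
    [nat] is far too large to unfold. *)
Fixpoint zfact (n : nat) : Z := match n with O => 1%Z | S k => (Z.of_nat n * zfact k)%Z end.

Lemma INR_zfact (n : nat) : INR (fact n) = IZR (zfact n).
Proof.
rewrite INR_IZR_INZ; congr IZR; elim: n => [//|n IH].
by rewrite fact_simpl Nat2Z.inj_mul IH.
Qed.

Lemma taylor_z (n : nat) (g : nat -> R -> R) (x B : R) :
  0 <= x -> (forall i t, is_derive (g i) t (g (S i) t)) ->
  (forall t, 0 <= t <= x -> Rabs (g n t) <= B) ->
  Rabs (g 0%nat x - rsum (fun i => g i 0 * (x ^ i / IZR (zfact i))) n) <= B * (x ^ n / IZR (zfact n)).
Proof.
move=> Hx Hd HB; have := taylor_real n g x B Hx Hd HB.
rewrite INR_zfact (rsum_ext _ (fun i => g i 0 * (x ^ i / IZR (zfact i)))) // => i _.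
by rewrite INR_zfact.
Qed.

Definition boole_coef (r : nat) : R :=
  match r with
  | 0 => 1 / 2
  | 1 => - 1 / 16
  | 2 => 5 / 768
  | 3 => - 61 / 92160
  | 4 => 1385 / 20643840
  | 5 => - 50521 / 7431782400
  | _ => 2702765 / 3923981107200
  end.

(* The coefficients are those of sech(x/2)/2, so that the even Taylor polynomials cancel. *)
Lemma boole_real (g : nat -> R -> R) (B : R) :
  (forall i t, is_derive (g i) t (g (S i) t)) ->
  (forall t, - / 2 <= t <= / 2 -> Rabs (g 14%nat t) <= B) ->
  Rabs (rsum (fun r => boole_coef r * (g (2 * r)%nat (/ 2) + g (2 * r)%nat (- / 2))) 7 - g 0%nat 0)
    <= 22 / 10 ^ 8 * B.
Proof.
move=> Hd HB.
(* Each even derivative is expanded at 0 to total order 14 at both endpoints; the reflection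
   [t |-> - t] reduces the left endpoint to [taylor_z]. *)
have T r : (r <= 14)%nat ->
  Rabs (g r (/ 2) - rsum (fun i => g (r + i)%nat 0 * ((/ 2) ^ i / IZR (zfact i))) (14 - r)) <= B * ((/ 2) ^ (14 - r) / IZR (zfact (14 - r))) /\
  Rabs (g r (- / 2) - rsum (fun i => g (r + i)%nat 0 * ((- / 2) ^ i / IZR (zfact i))) (14 - r)) <= B * ((/ 2) ^ (14 - r) / IZR (zfact (14 - r))).
  move=> Hr; split.
  - have := taylor_z (14 - r) (fun i => g (r + i)%nat) (/ 2) B ltac:(lra).
    rewrite Nat.add_0_r; apply.
      by move=> i t; rewrite Nat.add_succ_r; exact: Hd.
    by rewrite (_ : (r + (14 - r) = 14)%nat); [move=> t Ht; apply: HB; lra | lia].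
  - have := taylor_z (14 - r) (fun i t => (-1) ^ i * g (r + i)%nat (- t)) (/ 2) B ltac:(lra).
    rewrite Nat.add_0_r Ropp_0 /= Rmult_1_l => H.
    have {}H := H _ _; apply: Rle_trans (H _ _).
    + right; congr (Rabs (_ - _)); apply: rsum_ext => i _.
      by rewrite (_ : - / 2 = -1 * / 2) ?Rpow_mult_distr; [rewrite /Rdiv; ring | ring].
    + move=> i t; rewrite Nat.add_succ_r.
      have D : is_derive (fun t => g (r + i)%nat (- t)) t (-1 * g (S (r + i)) (- t)).
        apply: (is_derive_comp (g (r + i)%nat) (fun t => - t) t); first exact: Hd.
        by auto_derive.
      have := is_derive_scal _ t ((-1) ^ i) _ D.
      by rewrite (_ : -1 * (-1) ^ i * g (S (r + i)) (- t) = (-1) ^ i * (-1 * g (S (r + i)) (- t))) //; ring.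
    + move=> t Ht; rewrite Rabs_mult pow_1_abs Rmult_1_l (_ : (r + (14 - r) = 14)%nat); last by lia.
      by apply: HB; lra.
have HB0 : 0 <= B by apply: Rle_trans (HB 0 ltac:(lra)); exact: Rabs_pos.
have [A0 B0] := T 0%nat ltac:(lia); have [A2 B2] := T 2%nat ltac:(lia).
have [A4 B4] := T 4%nat ltac:(lia); have [A6 B6] := T 6%nat ltac:(lia).
have [A8 B8] := T 8%nat ltac:(lia); have [A10 B10] := T 10%nat ltac:(lia).
have [A12 B12] := T 12%nat ltac:(lia).
clear T Hd HB.
cbn [rsum Nat.add Nat.sub pow] in A0, A2, A4, A6, A8, A10, A12, B0, B2, B4, B6, B8, B10, B12.
cbn [zfact Z.of_nat Z.mul Pos.of_succ_nat Pos.succ Pos.mul Pos.add Pos.add_carry] in A0, A2, A4, A6, A8, A10, A12, B0, B2, B4, B6, B8, B10, B12.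
cbn [rsum Nat.mul Nat.add boole_coef pow].
move: A0 A2 A4 A6 A8 A10 A12 B0 B2 B4 B6 B8 B10 B12.
move=> /Rabs_le_between A0 /Rabs_le_between A2 /Rabs_le_between A4 /Rabs_le_between A6 /Rabs_le_between A8 /Rabs_le_between A10 /Rabs_le_between A12.
move=> /Rabs_le_between B0 /Rabs_le_between B2 /Rabs_le_between B4 /Rabs_le_between B6 /Rabs_le_between B8 /Rabs_le_between B10 /Rabs_le_between B12.
(* Everything is linear in the derivatives at 0; these cancel, and [22 / 10 ^ 8] bounds the weighted
   sum of the remainders. *)
apply: Rabs_le; split; lra.
Qed.

(** Polynomial factor of the [n]-th derivative of [e^(- tau x^2 / 2)], a rescaled Hermite polynomial
    given by its three-term recurrence. *)
Fixpoint hq (tau : C) (n : nat) (x : R) : C :=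
  match n with
  | O => 1%C
  | S O => (- tau * RtoC x)%C
  | S (S k as m) => (- tau * (RtoC x * hq tau m x + RtoC (INR m) * hq tau k x))%C
  end.

Definition gau (tau : C) (x : R) : C := cexp (- tau * RtoC (x ^ 2 / 2)).

Definition gd (tau : C) (n : nat) (x : R) : C := (hq tau n x * gau tau x)%C.

Lemma cder_ext (f g : R -> C) (t : R) (d e : C) : (forall x, f x = g x) -> d = e -> cder f t d -> cder g t e.
Proof.
move=> E <- [D1 D2]; split.
- by apply: is_derive_ext D1 => x; rewrite E.
- by apply: is_derive_ext D2 => x; rewrite E.
Qed.

Lemma cder_mult (f g : R -> C) (t : R) (d e : C) :
  cder f t d -> cder g t e -> cder (fun t => f t * g t)%C t (d * g t + f t * e)%C.
Proof.
move=> [D1 D2] [E1 E2]; split.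
- apply: (is_derive_ext (fun t => Re (f t) * Re (g t) - Im (f t) * Im (g t))); first by move=> u; rewrite Re_mult.
  rewrite Re_plus !Re_mult.
  have := is_derive_Rminus _ _ _ _ _ (is_derive_mult _ _ _ _ _ D1 E1 Rmult_comm) (is_derive_mult _ _ _ _ _ D2 E2 Rmult_comm).
  rewrite /plus /mult /= => H.
  have <- : Re d * Re (g t) + Re (f t) * Re e - (Im d * Im (g t) + Im (f t) * Im e) =
     Re d * Re (g t) - Im d * Im (g t) + (Re (f t) * Re e - Im (f t) * Im e) by ring.
  exact: H.
- apply: (is_derive_ext (fun t => Re (f t) * Im (g t) + Im (f t) * Re (g t))); first by move=> u; rewrite Im_mult.
  rewrite Im_plus !Im_mult.
  have := is_derive_Rplus _ _ _ _ _ (is_derive_mult _ _ _ _ _ D1 E2 Rmult_comm) (is_derive_mult _ _ _ _ _ D2 E1 Rmult_comm).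
  rewrite /plus /mult /= => H.
  have <- : Re d * Im (g t) + Re (f t) * Im e + (Im d * Re (g t) + Im (f t) * Re e) =
     Re d * Im (g t) + Im d * Re (g t) + (Re (f t) * Im e + Im (f t) * Re e) by ring.
  exact: H.
Qed.

Lemma cder_plus (f g : R -> C) (t : R) (d e : C) :
  cder f t d -> cder g t e -> cder (fun t => f t + g t)%C t (d + e)%C.
Proof. by move=> [D1 D2] [E1 E2]; split; apply: is_derive_Rplus. Qed.

Lemma cder_RtoC (t : R) : cder (fun x => RtoC x) t 1%C.
Proof. by split; [exact: is_derive_id | exact: is_derive_const]. Qed.

Lemma cder_const (c : C) (t : R) : cder (fun=> c) t 0%C.
Proof. by split; exact: is_derive_const. Qed.

Lemma hqSS (tau : C) (n : nat) (x : R) :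
  hq tau (S (S n)) x = (- tau * (RtoC x * hq tau (S n) x + RtoC (INR (S n)) * hq tau n x))%C.
Proof. by []. Qed.

(** The Appell property of Hermite polynomials. All smaller orders are carried along in the
    induction, since the recurrence reaches back two steps. *)
Lemma cder_hq (tau : C) (n : nat) (t : R) :
  cder (hq tau (S n)) t (RtoC (INR (S n)) * (- tau * hq tau n t))%C.
Proof.
suff H m : (m <= n)%nat -> cder (hq tau (S m)) t (RtoC (INR (S m)) * (- tau * hq tau m t))%C by apply: H.
elim: n m => [|n IH] m Hm.
  have -> : m = 0%nat by lia.
  apply: (cder_ext (fun t => - tau * RtoC t)%C _ _ (- tau * 1)%C) => //; first by rewrite /=; ring.
  by apply: cder_scal; exact: cder_RtoC.
case: m Hm => [|m] Hm; first by apply: IH; lia.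
have D1 := IH m ltac:(lia).
have D0 : cder (hq tau m) t (match m with O => 0 | S k => RtoC (INR m) * (- tau * hq tau k t) end)%C.
  by case: m Hm D1 => [|k] Hm D1; [exact: cder_const | apply: IH; lia].
apply: (cder_ext (fun x => - tau * (RtoC x * hq tau (S m) x + RtoC (INR (S m)) * hq tau m x))%C _ _
   (- tau * ((1 * hq tau (S m) t + RtoC t * (RtoC (INR (S m)) * (- tau * hq tau m t))) +
     RtoC (INR (S m)) * (match m with O => 0 | S k => RtoC (INR m) * (- tau * hq tau k t) end)))%C) => //.
  rewrite (S_INR (S m)) RtoC_plus.
  case: m {Hm D1 D0} => [|k]; first by rewrite /=; ring.
  rewrite hqSS; ring.
apply: cder_scal; apply: cder_plus; last exact: cder_scal.
by apply: cder_mult => //; exact: cder_RtoC.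
Qed.

Lemma cder_gau (tau : C) (t : R) : cder (gau tau) t (- tau * RtoC t * gau tau t)%C.
Proof.
case: tau => a b.
have E u : gau (a, b) u = (exp (- a * (u ^ 2 / 2)) * cos (- b * (u ^ 2 / 2)), exp (- a * (u ^ 2 / 2)) * sin (- b * (u ^ 2 / 2))).
  by rewrite /gau /cexp /=; congr (exp _ * cos _, exp _ * sin _); ring.
split.
- apply: (is_derive_ext (fun u => exp (- a * (u ^ 2 / 2)) * cos (- b * (u ^ 2 / 2)))); first by move=> u; rewrite E.
  by rewrite E /=; auto_derive => //; rewrite /= /Rdiv; field.
- apply: (is_derive_ext (fun u => exp (- a * (u ^ 2 / 2)) * sin (- b * (u ^ 2 / 2)))); first by move=> u; rewrite E.
  by rewrite E /=; auto_derive => //; rewrite /= /Rdiv; field.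
Qed.

Lemma cder_gd (tau : C) (n : nat) (t : R) : cder (gd tau n) t (gd tau (S n) t).
Proof.
case: n => [|n].
  apply: (cder_ext (gau tau) _ _ _ _ _ _ (cder_gau tau t)); first by move=> x; rewrite /gd /= Cmult_1_l.
  by rewrite /gd.
apply: (cder_ext (fun t => hq tau (S n) t * gau tau t)%C _ _ _ _ _ _ (cder_mult _ _ _ _ _ (cder_hq tau n t) (cder_gau tau t))) => //.
rewrite /gd hqSS; ring.
Qed.

(** Hermite polynomials with all coefficients made nonnegative, which majorise [hq] after rescaling
    by [sqrt |tau|]. *)
Fixpoint hr (n : nat) (xi : R) : R :=
  match n with
  | O => 1
  | S O => xi
  | S (S k as m) => xi * hr m xi + INR m * hr k xi
  end.

Lemma hrSS (n : nat) (xi : R) : hr (S (S n)) xi = xi * hr (S n) xi + INR (S n) * hr n xi.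
Proof. by []. Qed.

Lemma hr_ge0 (n : nat) (xi : R) : 0 <= xi -> 0 <= hr n xi.
Proof.
move=> Hx; suff : 0 <= hr n xi /\ 0 <= hr (S n) xi by case.
elim: n => [|n [IH1 IH2]]; first by rewrite /=; lra.
split=> //; rewrite hrSS; apply: Rplus_le_le_0_compat; apply: Rmult_le_pos => //.
exact: pos_INR.
Qed.

Lemma Cmod_hq (tau : C) (s x : R) (n : nat) : 0 <= s -> Cmod tau = s ^ 2 -> 
  Cmod (hq tau n x) <= s ^ n * hr n (s * Rabs x).
Proof.
move=> Hs Ht; have Px := Rabs_pos x.
have Psx : 0 <= s * Rabs x by exact: Rmult_le_pos.
suff : Cmod (hq tau n x) <= s ^ n * hr n (s * Rabs x) /\ Cmod (hq tau (S n) x) <= s ^ S n * hr (S n) (s * Rabs x) by case.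
elim: n => [|n [IH1 IH2]].
  rewrite /= Cmod_1 Cmod_mult Cmod_opp Cmod_R Ht; split; [lra | right; ring].
split => //; rewrite hqSS Cmod_mult Cmod_opp Ht.
apply: (Rle_trans _ (s ^ 2 * (Rabs x * (s ^ S n * hr (S n) (s * Rabs x)) + INR (S n) * (s ^ n * hr n (s * Rabs x))))).
  apply: Rmult_le_compat_l; first exact: pow2_ge_0.
  apply: Rle_trans (Cmod_triangle _ _) _; rewrite !Cmod_mult !Cmod_R (Rabs_pos_eq (INR _)); last exact: pos_INR.
  by apply: Rplus_le_compat; apply: Rmult_le_compat_l => //; exact: pos_INR.
by right; rewrite hrSS -!tech_pow_Rmult; ring.
Qed.

Lemma exp1_ge : 2.7 <= exp 1.
Proof.
have H : is_series (fun n => 1 ^ n / INR (fact n)) (exp 1).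
  have := is_exp_Reals 1; rewrite /is_pseries; apply: is_series_ext => n.
  by rewrite pow_n_pow /scal /= /mult /=.
rewrite -(is_series_unique _ _ H).
have P i : 0 <= 1 ^ i / INR (fact i).
  by rewrite pow1; apply: Rmult_le_pos; [lra | left; apply: Rinv_0_lt_compat; exact: INR_fact_lt_0].
have S0 : ex_series (fun n => 1 ^ n / INR (fact n)) by exists (exp 1).
apply: Rle_trans (rsum_le_Series _ 5 P S0).
by rewrite /=; lra.
Qed.

(** The inequality [e^x >= e x] at [x = y / p], raised to the power [p], with 2.7 as a lower bound
    for [e]. *)
Lemma pow_le_exp (p : nat) (y : R) : (0 < p)%nat -> 0 <= y -> (2.7 * y / INR p) ^ p <= exp y.
Proof.
move=> Hp Hy; have Pp : 0 < INR p by apply: lt_0_INR.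
have E : exp y = exp (y / INR p) ^ p.
  by rewrite -Rpower_pow ?/Rpower ?ln_exp; [congr exp; field; lra | exact: exp_pos].
rewrite E; apply: pow_incr; split.
  by apply: Rmult_le_pos; [lra | left; apply: Rinv_0_lt_compat].
have -> : y / INR p = 1 + (y / INR p - 1) by ring.
rewrite exp_plus.
have H1 := exp1_ge.
have H2 : y / INR p <= exp (y / INR p - 1) by have := exp_ineq1_le (y / INR p - 1); lra.
have P : 0 <= y / INR p by apply: Rmult_le_pos; [lra | left; apply: Rinv_0_lt_compat].
have -> : 2.7 * y / INR p = 2.7 * (y / INR p) by field; lra.
by apply: Rmult_le_compat => //; lra.
Qed.

(** Every power of [xi^2] is absorbed by [pow_le_exp]. The rate 0.3 is chosen below 0.4, because in
    the sector of [psi_boole] the Gaussian decays at a rate [Re tau / 2 >= 0.4 |tau|]. *)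
Lemma hr14_bound (xi : R) : hr 14 xi <= 10 ^ 8 * exp (0.3 * xi ^ 2).
Proof.
set y := 0.3 * xi ^ 2.
have Py : 0 <= y by rewrite /y; have := pow2_ge_0 xi; lra.
have -> : hr 14 xi = xi ^ 14 + 91 * xi ^ 12 + 3003 * xi ^ 10 + 45045 * xi ^ 8 + 315315 * xi ^ 6 + 945945 * xi ^ 4 + 945945 * xi ^ 2 + 135135.
  by rewrite /=; ring.
have H1 := pow_le_exp 1 y ltac:(lia) Py; have H2 := pow_le_exp 2 y ltac:(lia) Py.
have H3 := pow_le_exp 3 y ltac:(lia) Py; have H4 := pow_le_exp 4 y ltac:(lia) Py.
have H5 := pow_le_exp 5 y ltac:(lia) Py; have H6 := pow_le_exp 6 y ltac:(lia) Py.
have H7 := pow_le_exp 7 y ltac:(lia) Py; have H0 : 1 <= exp y by have := exp_ineq1_le y; lra.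
set E := exp y in H0 H1 H2 H3 H4 H5 H6 H7 *.
have X : xi ^ 2 = y / 0.3 by rewrite /y; lra.
have -> : xi ^ 14 = (xi ^ 2) ^ 7 by ring.
have -> : xi ^ 12 = (xi ^ 2) ^ 6 by ring.
have -> : xi ^ 10 = (xi ^ 2) ^ 5 by ring.
have -> : xi ^ 8 = (xi ^ 2) ^ 4 by ring.
have -> : xi ^ 6 = (xi ^ 2) ^ 3 by ring.
have -> : xi ^ 4 = (xi ^ 2) ^ 2 by ring.
rewrite X !(INR_IZR_INZ 1, INR_IZR_INZ 2, INR_IZR_INZ 3, INR_IZR_INZ 4, INR_IZR_INZ 5, INR_IZR_INZ 6, INR_IZR_INZ 7) in H1 H2 H3 H4 H5 H6 H7 *.
cbn [Z.of_nat Pos.of_succ_nat Pos.succ] in H1, H2, H3, H4, H5, H6, H7.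
by clear X Py; clearbody E y; lra.
Qed.

(** Approximate solution [S] of [S x + S (x + 1) = gau (x + / 2)], whose exact decaying solution is
    the alternating sum of the values [gau (x + k + / 2)]. *)
Definition boole_sum (tau : C) (x : R) : C :=
  csum (fun r => RtoC (boole_coef r) * gd tau (2 * r) x)%C 7.

Lemma hr_poly (n : nat) : exists c, 0 <= c /\ forall xi, 0 <= xi -> hr n xi <= c * (1 + xi) ^ n.
Proof.
suff [c [d [Hc [Hd [H1 H2]]]]] : exists c d, 0 <= c /\ 0 <= d /\
   (forall xi, 0 <= xi -> hr n xi <= c * (1 + xi) ^ n) /\ (forall xi, 0 <= xi -> hr (S n) xi <= d * (1 + xi) ^ S n).
  by exists c.
elim: n => [|n [c [d [Hc [Hd [H1 H2]]]]]].
  by exists 1, 1; do 2 (split; first lra); split => xi Hx /=; lra.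
have Pn := INR_S_pos n.
exists d, (d + INR (S n) * c); split => //; split; first by nra.
split => // xi Hx; rewrite hrSS.
have A := H1 xi Hx; have B := H2 xi Hx.
have P : 0 <= (1 + xi) ^ n by apply: pow_le; lra.
rewrite -!tech_pow_Rmult in B *.
have B2 : xi * hr (S n) xi <= (1 + xi) * (d * ((1 + xi) * (1 + xi) ^ n)).
  by apply: Rmult_le_compat => //; [exact: hr_ge0 | lra].
have A2 : INR (S n) * hr n xi <= INR (S n) * (c * ((1 + xi) * ((1 + xi) * (1 + xi) ^ n))).
  apply: Rmult_le_compat_l; first lra.
  apply: Rle_trans A _; apply: Rmult_le_compat_l => //.
  have Q : 0 <= xi * (1 + xi) ^ n by apply: Rmult_le_pos.
  have Q2 : 0 <= xi * (xi * (1 + xi) ^ n) by apply: Rmult_le_pos.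
  nra.
nra.
Qed.

Lemma Cmod_gau (tau : C) (x : R) : Cmod (gau tau x) = exp (- (Re tau * (x ^ 2 / 2))).
Proof. by rewrite /gau Cmod_cexp re_scal_r re_opp; congr exp; ring. Qed.

Lemma Cmod_gd (tau : C) (n : nat) (x : R) :
  Cmod (gd tau n x) <= sqrt (Cmod tau) ^ n * hr n (sqrt (Cmod tau) * Rabs x) * exp (- (Re tau * (x ^ 2 / 2))).
Proof.
rewrite /gd Cmod_mult Cmod_gau; apply: Rmult_le_compat_r; first by left; exact: exp_pos.
by apply: Cmod_hq; [exact: sqrt_pos | rewrite pow2_sqrt //; exact: Cmod_ge_0].
Qed.

Lemma gd_lim (tau : C) (n : nat) : 0 < Re tau -> Clim (fun K => gd tau n (INR K)) 0%C.
Proof.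
move=> Ht; have [c [Hc Hp]] := hr_poly n.
set s := sqrt (Cmod tau); have Ps : 0 <= s by exact: sqrt_pos.
set b := Re tau / 2; have Pb : 0 < b by rewrite /b; lra.
have L := ex_series_lim_0 _ (ex_series_pow_exp n b Pb).
have L1 : is_lim_seq (fun K => INR (S K) ^ n * exp (- (INR (S K) * b))) 0.
  exact: (proj1 (is_lim_seq_incr_1 _ _) L).
apply: (Clim_squeeze _ _ (fun K => (s ^ n * c * (1 + s) ^ n * exp b) * (INR (S K) ^ n * exp (- (INR (S K) * b))))); last exact: lim_scal0.
move=> K; rewrite /Cminus Copp_0 Cplus_0_r.
have PK := pos_INR K.
apply: Rle_trans (Cmod_gd tau n (INR K)) _; rewrite -/s (Rabs_pos_eq _ PK).
have H1 : hr n (s * INR K) <= c * ((1 + s) ^ n * INR (S K) ^ n).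
  apply: Rle_trans (Hp _ (Rmult_le_pos _ _ Ps PK)) _; apply: Rmult_le_compat_l => //.
  rewrite -Rpow_mult_distr; apply: pow_incr; rewrite S_INR; nra.
have H2 : exp (- (Re tau * (INR K ^ 2 / 2))) <= exp b * exp (- (INR (S K) * b)).
  rewrite -exp_plus; apply: exp_le; rewrite S_INR.
  have -> : Re tau * (INR K ^ 2 / 2) = b * INR K ^ 2 by rewrite /b; field.
  have : INR K <= INR K ^ 2.
    case: K {H1 PK} => [|K]; first by rewrite /=; lra.
    by rewrite S_INR; have := pos_INR K; rewrite /=; nra.
  nra.
have -> : s ^ n * c * (1 + s) ^ n * exp b * (INR (S K) ^ n * exp (- (INR (S K) * b))) =
   (s ^ n * (c * ((1 + s) ^ n * INR (S K) ^ n))) * (exp b * exp (- (INR (S K) * b))) by ring.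
apply: Rmult_le_compat => //.
- apply: Rmult_le_pos; first by apply: pow_le.
  by apply: hr_ge0; exact: Rmult_le_pos.
- by left; exact: exp_pos.
- by apply: Rmult_le_compat_l => //; exact: pow_le.
Qed.

Lemma boole_local (tau : C) (y B : R) :
  (forall t, y - / 2 <= t <= y + / 2 -> Cmod (gd tau 14 t) <= B) ->
  Cmod (boole_sum tau (y + / 2) + boole_sum tau (y - / 2) - gau tau y) <= 22 / 10 ^ 8 * B.
Proof.
move=> HB.
have B0 : 0 <= B by apply: Rle_trans (HB y ltac:(lra)); exact: Cmod_ge_0.
apply: Cmod_Re_le; last by apply: Rmult_le_pos; lra.
move=> w Hw.
have := boole_real (fun i t => Re (w * gd tau i (y + t))) B.
move=> H; have {H} := H _ _.
have D i t : is_derive (fun t => Re (w * gd tau i (y + t))) t (Re (w * gd tau (S i) (y + t))).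
  have [D _] := cder_scal w _ _ _ (cder_gd tau i (y + t)).
  have := is_derive_comp (fun t => Re (w * gd tau i t)) (fun t => y + t) t _ _ D.
  move=> H; have {H} := H 1 ltac:(auto_derive => //).
  by rewrite /scal /= /mult /= Rmult_1_l.
move=> H; have {H} H := H D _.
apply: Rle_trans (H _); last first.
  move=> t Ht; apply: Rle_trans (re_le_Cmod _) _; rewrite Cmod_mult Hw Rmult_1_l.
  by apply: HB; lra.
apply: Rle_trans (Rle_abs _) _; right; congr Rabs.
have E x : Re (w * boole_sum tau x) = rsum (fun r => boole_coef r * Re (w * gd tau (2 * r) x)) 7.
  rewrite /boole_sum -csum_scal csum_Re; apply: rsum_ext => r _.
  by rewrite -re_scal_l; congr Re; ring.
have -> : (w * (boole_sum tau (y + / 2) + boole_sum tau (y - / 2) - gau tau y) =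
  w * boole_sum tau (y + / 2) + w * boole_sum tau (y - / 2) - w * gau tau y)%C by ring.
rewrite /Cminus !Re_plus re_opp !E.
have -> : (w * gd tau 0 (y + 0) = w * gau tau y)%C by rewrite Rplus_0_r /gd /= Cmult_1_l.
rewrite /Rminus; congr (_ + _).
elim: {1 2 3}7%nat => [|n IH]; first by rewrite /=; ring.
by rewrite !rsum_S -IH; ring.
Qed.

Lemma INR_tri (n : nat) : INR (tri n) = INR n * (INR n + 1) / 2.
Proof.
elim: n => [|n IH]; first by rewrite /=; field.
by rewrite [tri (S n)]/= plus_INR IH S_INR; field.
Qed.

(** As [(k + 1/2)^2 / 2 = k (k + 1) / 2 + 1/8], the false theta function is, up to the factor
    [e^(- tau / 8)], an alternating sum of Gaussian values at half-integers. *)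
Lemma gau_half (tau : C) (k : nat) :
  gau tau (INR k + / 2) = (cexp (- tau * RtoC (/ 8)) * cexp (- tau) ^ tri k)%C.
Proof.
rewrite -cexp_nat -cexp_add /gau; congr cexp.
rewrite INR_tri (_ : (INR k + / 2) ^ 2 / 2 = / 8 + INR k * (INR k + 1) / 2); last by field.
by rewrite RtoC_plus; ring.
Qed.

(** The alternating sum telescopes up to local errors [rho k] of size at most
    [22 T^7 e^(- k T / 10)]. Summation over [k] costs a factor [10.01 / T], and
    [22 * 10.01 < 221]. *)
Theorem psi_boole (tau : C) : 0 < Re tau -> Cmod tau <= 5 / 4 * Re tau -> Cmod tau <= / 100 ->
  Cmod (cexp (- tau * RtoC (/ 8)) * psi (cexp (- tau)) - boole_sum tau 0) <= 221 * Cmod tau ^ 6.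
Proof.
move=> Ht Hsec Hsm; set T := Cmod tau in Hsec Hsm *.
have PT : 0 < T by exact: Re_pos_Cmod.
pose rho k := (boole_sum tau (INR k) + boole_sum tau (INR (S k)) - gau tau (INR k + / 2))%C.
(* Of the Gaussian decay rate [0.4 T t^2], the polynomial bound consumes [0.3 T t^2]. The remaining
   [0.1 T t^2] is at least [k v], because [t^2 >= k] on [[k, k + 1]]. *)
set v := T / 10; have Pv : 0 < v <= / 1000 by rewrite /v; lra.
have Brho k : Cmod (rho k) <= 22 * T ^ 7 * exp (- v) ^ k.
  have -> : rho k = (boole_sum tau ((INR k + / 2) + / 2) + boole_sum tau ((INR k + / 2) - / 2) - gau tau (INR k + / 2))%C.
    rewrite /rho S_INR (_ : INR k + / 2 + / 2 = INR k + 1); last by field.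
    by rewrite (_ : INR k + / 2 - / 2 = INR k); ring.
  have -> : 22 * T ^ 7 * exp (- v) ^ k = 22 / 10 ^ 8 * (10 ^ 8 * T ^ 7 * exp (- v) ^ k) by field.
  apply: boole_local => t Ht'.
  have Pk := pos_INR k; have Pt : 0 <= t by lra.
  apply: Rle_trans (Cmod_gd tau 14 t) _; rewrite (Rabs_pos_eq _ Pt) -/T.
  have Ps := sqrt_pos T.
  have S2 : sqrt T ^ 2 = T by rewrite pow2_sqrt //; lra.
  have -> : sqrt T ^ 14 = T ^ 7 by rewrite -{2}S2 -pow_mult.
  have H1 := hr14_bound (sqrt T * t); rewrite Rpow_mult_distr S2 in H1.
  rewrite -exp_nat_pow.
  have H2 : exp (0.3 * (T * t ^ 2)) * exp (- (Re tau * (t ^ 2 / 2))) <= exp (- (INR k * v)).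
    rewrite -exp_plus; apply: exp_le.
    have Kt : INR k <= t ^ 2.
      case: k Ht' Pk => [|k] Ht' Pk; first by rewrite /=; nra.
      by have := pos_INR k; rewrite S_INR in Ht' *; simpl; nra.
    have Q : 0.8 * T * t ^ 2 <= Re tau * t ^ 2 by apply: Rmult_le_compat_r; [exact: pow2_ge_0 | lra].
    have Q2 : INR k * v <= t ^ 2 * v by apply: Rmult_le_compat_r; lra.
    rewrite /v in Q2 *; lra.
  have P7 : 0 <= T ^ 7 by apply: pow_le; lra.
  apply: (Rle_trans _ (T ^ 7 * (10 ^ 8 * exp (0.3 * (T * t ^ 2))) * exp (- (Re tau * (t ^ 2 / 2))))).
    apply: Rmult_le_compat_r; first by left; exact: exp_pos.
    exact: Rmult_le_compat_l.
  have := Rmult_le_compat_l (10 ^ 8 * T ^ 7) _ _ ltac:(nra) H2; lra.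
have Q := exp_neg_lt1 v (proj1 Pv).
have [Sg Eg] := ex_series_geom_pos _ Q.
have Srho : asum (fun k => RtoC ((-1) ^ k) * rho k)%C.
  apply: (asum_le _ _ _ (ex_series_scalR (22 * T ^ 7) _ Sg)) => k.
  by rewrite Cmod_mult Cmod_R pow_1_abs Rmult_1_l.
have Bs : Cmod (CSer (fun k => RtoC ((-1) ^ k) * rho k)%C) <= 22 * T ^ 7 * / (1 - exp (- v)).
  rewrite -Eg -Series_scal_l; apply: Cmod_CSer; last exact: ex_series_scalR.
  by move=> k; rewrite Cmod_mult Cmod_R pow_1_abs Rmult_1_l.
have Bq : / (1 - exp (- v)) <= 10.01 / T.
  have E1 : exp (- v) <= / (1 + v).
    by rewrite exp_Ropp; apply: Rinv_le_contravar; [lra | have := exp_ineq1_le v; lra].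
  apply: (Rle_trans _ (/ (1 - / (1 + v)))).
    have : / (1 + v) < 1 by rewrite -Rinv_1; apply: Rinv_lt_contravar; lra.
    by move=> H; apply: Rinv_le_contravar; lra.
  have -> : / (1 - / (1 + v)) = (1 + v) / v by field; lra.
  have Ev : / v = 10 * / T by rewrite /v; field; lra.
  have -> : 10.01 / T = 1.001 / v by rewrite /Rdiv Ev; lra.
  by apply: Rmult_le_compat_r; [left; apply: Rinv_0_lt_compat; lra | lra].
have Tel K : (csum (fun k => RtoC ((-1) ^ k) * gau tau (INR k + / 2)) K =
   boole_sum tau 0 - RtoC ((-1) ^ K) * boole_sum tau (INR K) - csum (fun k => RtoC ((-1) ^ k) * rho k) K)%C.
  elim: K => [|K IH]; first by rewrite /=; ring.
  rewrite !csum_S IH -tech_pow_Rmult (RtoC_mult (-1)) /rho; ring.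
have Sq : Cmod (cexp (- tau)) < 1 by have := Cmod_q_lt1 tau Ht; lra.
have Spsi := asum_psi _ Sq.
have E : (cexp (- tau * RtoC (/ 8)) * psi (cexp (- tau)) = boole_sum tau 0 - 0 - CSer (fun k => RtoC ((-1) ^ k) * rho k))%C.
  rewrite /psi -CSer_scal //.
  apply: (Clim_unique _ _ _ (CSer_lim _ (asum_scal _ _ Spsi))).
  apply: (Clim_ext (fun K => boole_sum tau 0 - RtoC ((-1) ^ K) * boole_sum tau (INR K) - csum (fun k => RtoC ((-1) ^ k) * rho k) K)%C).
    by move=> K; rewrite -Tel; apply: csum_ext => k _; rewrite gau_half; ring.
  apply: Clim_minus; last exact: CSer_lim.
  apply: Clim_minus; first exact: Clim_const.
  have L : Clim (fun K => boole_sum tau (INR K)) 0%C.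
    have := Clim_csum (fun K r => RtoC (boole_coef r) * gd tau (2 * r) (INR K))%C (fun=> 0%C) 7.
    have -> : csum (fun=> 0%C) 7 = 0%C by rewrite /=; ring.
    apply=> r; rewrite -(Cmult_0_r (RtoC (boole_coef r))).
    by apply: Clim_mult; [exact: Clim_const | exact: gd_lim].
  apply/Clim_Cmod; have LC := proj1 (Clim_Cmod _ _) L.
  apply: is_lim_seq_ext LC => K.
  by rewrite /Cminus !Copp_0 !Cplus_0_r Cmod_mult Cmod_R pow_1_abs Rmult_1_l.
rewrite E (_ : (boole_sum tau 0 - 0 - CSer (fun k => RtoC ((-1) ^ k) * rho k) - boole_sum tau 0 = - CSer (fun k => RtoC ((-1) ^ k) * rho k))%C); last by ring.
rewrite Cmod_opp; apply: Rle_trans Bs _.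
have P7 : 0 <= 22 * T ^ 7 by have := pow_le T 7 ltac:(lra); lra.
apply: Rle_trans (Rmult_le_compat_l _ _ _ P7 Bq) _.
have ET : T ^ 7 / T = T ^ 6 by field; lra.
have -> : 22 * T ^ 7 * (10.01 / T) = 220.22 * (T ^ 7 / T) by rewrite /Rdiv; lra.
rewrite ET.
have := pow_le T 6 ltac:(lra); lra.
Qed.

(** * Bessel-type comparison sequences *)

Definition kap : R := PI ^ 2 / 3.

Lemma kap_bounds : 3.28 < kap < 3.3.
Proof. by have := PI_bounds; rewrite /kap => H; nra. Qed.

Definition vcoef (nu s : nat) : R := kap ^ (s + nu) / INR (fact (s + nu)).

(** For [n > 0] this is [(kap / n)^(nu / 2) I_nu (2 sqrt (kap n))]. These numbers are, up to a
    bounded error in the generating function, the coefficients belonging to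
    [tau^(nu - 1) e^(kap / tau)]. *)
Definition vser (nu n : nat) : R := Series (fun s => vcoef nu s * (INR n ^ s / INR (fact s))).

Lemma ex_series_exp (y : R) :
  ex_series (fun s => y ^ s / INR (fact s)) /\ Series (fun s => y ^ s / INR (fact s)) = exp y.
Proof.
have H : is_series (fun s => y ^ s / INR (fact s)) (exp y).
  have := is_exp_Reals y; rewrite /is_pseries; apply: is_series_ext => n.
  by rewrite pow_n_pow /scal /= /mult /=.
by split; [exists (exp y) | exact: is_series_unique].
Qed.

Lemma inv_fact_pos (n : nat) : 0 < / INR (fact n).
Proof. by apply: Rinv_0_lt_compat; exact: INR_fact_lt_0. Qed.

Lemma cexp_series (w : C) :
  asum (fun n => w ^ n * RtoC (/ INR (fact n)))%C /\ CSer (fun n => w ^ n * RtoC (/ INR (fact n)))%C = cexp w.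
Proof.
have [S1 _] := ex_series_exp (Cmod w).
have Sw : asum (fun n => w ^ n * RtoC (/ INR (fact n)))%C.
  apply: ex_series_extR S1 => n; rewrite Cmod_mult Cmod_pow Cmod_R Rabs_pos_eq //.
  by left; exact: inv_fact_pos.
split => //; apply: CSer_unique => //.
have L := ex_series_lim_0 _ S1.
apply: (Clim_squeeze _ _ (fun n => exp (Cmod w) * (Cmod w ^ n / INR (fact n)))); last exact: lim_scal0.
move=> n; rewrite -Cmod_opp (_ : (- (csum (fun i => w ^ i * RtoC (/ INR (fact i))) n - cexp w) =
  cexp w - csum (fun i => w ^ i * RtoC (/ INR (fact i))) n)%C); last by ring.
apply: Rle_trans (cexp_taylor n w (Cmod w) (Cmod_ge_0 _) (Re_le_Cmod _)) _.
by right; rewrite /Rdiv; ring.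
Qed.

Definition lip_rem (s : nat) (tau : C) : C :=
  (CSer (pfpow s tau) + RtoC (match s with O => / 2 | _ => 0 end))%C.

(** For [|Im tau| <= PI] the [k]-th pole on either side is at distance at least [PI k] from [tau],
    so the series is dominated by a multiple of [zeta2], whatever [s] is. *)
Lemma lip_rem_bound (s : nat) (tau : C) :
  0 < Re tau <= / 2 -> Rabs (Im tau) <= PI -> Cmod (lip_rem s tau) <= 2.
Proof.
move=> [H0 H1] Hi; have PI0 := PI_bounds.
have Hk k : PI * INR (S k) <= Cmod (tau + wk (S k)) /\ PI * INR (S k) <= Cmod (tau - wk (S k)).
  have Pk : 1 <= INR (S k) by rewrite S_INR; have := pos_INR k; lra.
  have PP : 0 <= 2 * PI * INR (S k) by nra.
  have Q : PI * INR (S k) <= 2 * PI * INR (S k) - Rabs (Im tau) by nra.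
  split; apply: Rle_trans (im_le_Cmod _); apply: Rle_trans Q _.
  - rewrite Im_plus Im_wk; have := Rabs_triang_inv (2 * PI * INR (S k)) (- Im tau).
    rewrite Rabs_Ropp (Rabs_pos_eq (2 * PI * _)) //.
    by rewrite /Rminus Ropp_involutive Rplus_comm (Rplus_comm _ (Im tau)).
  - rewrite Im_plus im_opp Im_wk; have := Rabs_triang_inv (2 * PI * INR (S k)) (Im tau).
    rewrite (Rabs_pos_eq (2 * PI * _)) //.
    by rewrite -(Rabs_Ropp (_ - _)) Ropp_minus_distr.
have Pz k : 0 < PI * INR (S k) by have := INR_S_pos k; nra.
have Z (c : R) : Series (fun k => c * / INR (S k) ^ 2) = c * (PI ^ 2 / 6).
  by rewrite Series_scal_l -/zeta2 zeta2_value.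
have SZ (c : R) : ex_series (fun k => c * / INR (S k) ^ 2).
  by apply: ex_series_scalR; exact: ex_series_inv_sqr.
have MT : Cmod tau <= 4 by apply: Rle_trans (Cmod_Re_Im tau) _; rewrite Rabs_pos_eq; lra.
have PP : 0 < PI ^ 2 by nra.
apply: Rle_trans (Cmod_triangle _ _) _; rewrite Cmod_R.
case: s => [|s].
  rewrite Rabs_pos_eq; last lra.
  suff B : Cmod (CSer (pfpow 0 tau)) <= 8 / PI ^ 2 * (PI ^ 2 / 6).
    have E : 8 / PI ^ 2 * (PI ^ 2 / 6) = 8 / 6 by field; lra.
    by rewrite E in B; lra.
  rewrite -Z; apply: Cmod_CSer => // k.
  have [A1 A2] := Hk k; have [N1 N2] := wk_neq tau (S k) H0.
  have -> : pfpow 0 tau k = ((1 + 1) * tau * (/ (tau + wk (S k)) * / (tau - wk (S k))))%C.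
    by rewrite /pfpow /= !Cmult_1_r; field.
  rewrite !Cmod_mult !Cmod_inv' (_ : Cmod (1 + 1) = 2); last first.
    by rewrite -RtoC_plus Cmod_R Rabs_pos_eq; lra.
  have -> : 8 / PI ^ 2 * / INR (S k) ^ 2 = 8 * (/ (PI * INR (S k)) * / (PI * INR (S k))).
    by have := INR_S_pos k => ?; field; lra.
  have I1 : / Cmod (tau + wk (S k)) <= / (PI * INR (S k)) by apply: Rinv_le_contravar.
  have I2 : / Cmod (tau - wk (S k)) <= / (PI * INR (S k)) by apply: Rinv_le_contravar.
  have Q1 : 0 < / Cmod (tau + wk (S k)) by apply: Rinv_0_lt_compat; have := Pz k; lra.
  have Q2 : 0 < / Cmod (tau - wk (S k)) by apply: Rinv_0_lt_compat; have := Pz k; lra.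
  apply: Rmult_le_compat; [have := Cmod_ge_0 tau; lra | nra | lra | ].
  by apply: Rmult_le_compat; lra.
rewrite Rabs_R0 Rplus_0_r.
suff B : Cmod (CSer (pfpow (S s) tau)) <= 2 / PI ^ 2 * (PI ^ 2 / 6).
  have E : 2 / PI ^ 2 * (PI ^ 2 / 6) = 2 / 6 by field; lra.
  by rewrite E in B; lra.
rewrite -Z; apply: Cmod_CSer => // k.
have [A1 A2] := Hk k.
have Pk : 1 <= INR (S k) by rewrite S_INR; have := pos_INR k; lra.
have L1 : 1 <= PI * INR (S k) by nra.
have B1 := Cmod_inv_pow_le _ 1 (PI * INR (S k)) s Rlt_0_1 (Pz k) (Rle_trans _ _ _ L1 A1) A1.
have B2 := Cmod_inv_pow_le _ 1 (PI * INR (S k)) s Rlt_0_1 (Pz k) (Rle_trans _ _ _ L1 A2) A2.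
rewrite pow1 Rinv_1 Rmult_1_r in B1 B2.
apply: Rle_trans (Cmod_triangle _ _) _.
have -> : 2 / PI ^ 2 * / INR (S k) ^ 2 = 2 * / (PI * INR (S k)) ^ 2 by field; lra.
lra.
Qed.

Lemma ex_series_vcoef (nu : nat) (y : R) :
  ex_series (fun s => vcoef nu s * y ^ (s + nu)) /\ (0 <= y -> Series (fun s => vcoef nu s * y ^ (s + nu)) <= exp (kap * y)).
Proof.
have [S1 E1] := ex_series_exp (kap * y).
have E s : (kap * y) ^ (nu + s) / INR (fact (nu + s)) = vcoef nu s * y ^ (s + nu).
  by rewrite /vcoef Rpow_mult_distr (Nat.add_comm nu s) /Rdiv; ring.
have S2 : ex_series (fun s => (kap * y) ^ (nu + s) / INR (fact (nu + s))).
  by apply: (proj1 (ex_series_incr_n (V := R_NormedModule) (fun s => (kap * y) ^ s / INR (fact s)) nu)).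
split; first by apply: ex_series_extR S2.
move=> Hy; rewrite -(Series_ext _ _ E) -E1.
case: nu S2 {E} => [|nu] S2; first by apply: Req_le; apply: Series_ext => s.
rewrite [X in _ <= X](Series_incr_n _ (S nu)) //; last by lia.
have P : 0 <= sum_f_R0 (fun s => (kap * y) ^ s / INR (fact s)) (Nat.pred (S nu)).
  apply: cond_pos_sum => k; apply: Rmult_le_pos; last by left; exact: inv_fact_pos.
  by apply: pow_le; apply: Rmult_le_pos => //; have := kap_bounds; lra.
lra.
Qed.

Lemma vcoef_pos (nu s : nat) : 0 <= vcoef nu s.
Proof.
apply: Rmult_le_pos; last by left; exact: inv_fact_pos.
by apply: pow_le; have := kap_bounds; lra.
Qed.

(** For fixed [s], [lipschitz] gives [tau^(- s - 1)] plus [lip_rem s]. The main parts add up to the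
    exponential series of [kap / tau] without its first [nu] terms, and the remainders to at most
    [2 e^kap]. The estimate holds on both arcs at once. *)
Theorem vser_series (nu : nat) (tau : C) : 0 < Re tau <= / 2 -> Rabs (Im tau) <= PI ->
  asum (fun n => RtoC (vser nu n) * cexp (- tau) ^ n)%C /\
  Cmod (CSer (fun n => RtoC (vser nu n) * cexp (- tau) ^ n)%C
    - tau ^ nu * / tau * (cexp (RtoC kap * / tau) - csum (fun r => (RtoC kap * / tau) ^ r * RtoC (/ INR (fact r)))%C nu))
  <= 2 * exp kap.
Proof.
move=> Ht Hi; have [H0 H1] := Ht; have K0 := kap_bounds; have PI0 := PI_bounds.
have Nt := Re_pos_neq0 tau H0.
set al := Re tau in H0 H1.
pose a s n := (RtoC (vcoef nu s) * lip_term s tau n)%C.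
have Pc s := vcoef_pos nu s.
have Sl s := asum_lip_term s tau H0.
have Sa s : asum (a s) by exact: asum_scal.
have Hal : 0 < Re (RtoC al) <= / 2 by [].
(* The absolute values of the terms at [tau] are the terms at [Re tau], to which [lipschitz] applies
   as well. *)
have Mreal s : Series (fun n => Cmod (lip_term s tau n)) <= / al ^ S s + 2.
  have E n : lip_term s (RtoC al) n = RtoC (Cmod (lip_term s tau n)).
    rewrite /lip_term Cmod_mult Cmod_cexp Cmod_R Rabs_pos_eq.
      by rewrite re_opp re_scal_l RtoC_mult -RtoC_mult -RtoC_opp cexp_RtoC.
    apply: Rmult_le_pos; last by left; exact: inv_fact_pos.
    by apply: pow_le; exact: pos_INR.
  have := lipschitz s (RtoC al) (proj1 Hal).
  rewrite (CSer_ext _ _ E) CSer_RtoC; last exact: (Sl s).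
  move=> EE; apply: Rle_trans (Rle_abs _) _; rewrite -Cmod_R EE -Cplus_assoc -/(lip_rem s (RtoC al)).
  apply: Rle_trans (Cmod_triangle _ _) _.
  apply: Rplus_le_compat; last by apply: lip_rem_bound => //; rewrite /= Rabs_R0; lra.
  rewrite Cmod_inv' Cmod_pow Cmod_R Rabs_pos_eq; lra.
have [Sv1 _] := ex_series_vcoef nu (/ al).
have [Sv2 Bv2] := ex_series_vcoef nu 1.
have Sv2' : ex_series (vcoef nu) by apply: ex_series_extR Sv2 => s; rewrite pow1 Rmult_1_r.
have SR : ex_series (fun s => vcoef nu s * (/ al ^ S s + 2)).
  apply: (ex_series_extR (fun s => (al ^ nu / al) * (vcoef nu s * (/ al) ^ (s + nu)) + 2 * vcoef nu s)).
    move=> s; rewrite pow_add !pow_inv /=.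
    have P1 := pow_lt al nu H0; have P2 := pow_lt al s H0.
    by field; lra.
  apply: (ex_series_plus (V := R_NormedModule)); first exact: ex_series_scalR.
  exact: ex_series_scalR.
have Ra s : Series (fun n => Cmod (a s n)) <= vcoef nu s * (/ al ^ S s + 2).
  apply: (Rle_trans _ (vcoef nu s * Series (fun n => Cmod (lip_term s tau n)))).
    by right; rewrite -Series_scal_l; apply: Series_ext => n; rewrite Cmod_mult Cmod_R Rabs_pos_eq.
  by apply: Rmult_le_compat_l.
have [Fr [_ [_ [Fcol FE]]]] := fubini a _ Sa Ra SR.
have Col n : CSer (fun s => a s n) = (RtoC (vser nu n) * cexp (- tau) ^ n)%C.
  rewrite (CSer_ext _ (fun s => cexp (- tau) ^ n * RtoC (vcoef nu s * (INR n ^ s / INR (fact s))))%C); last first.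
    by move=> s; rewrite /a /lip_term cexp_neg_pow RtoC_mult; ring.
  have Sn : ex_series (fun s => vcoef nu s * (INR n ^ s / INR (fact s))).
    have := Fr n => Sn.
    apply: (ex_series_extR (fun s => exp (INR n * al) * Cmod (a s n))); last exact: ex_series_scalR.
    move=> s; rewrite /a /lip_term !Cmod_mult Cmod_cexp !Cmod_R re_opp re_scal_l -/al.
    rewrite !Rabs_pos_eq //; last first.
      apply: Rmult_le_pos; last by left; exact: inv_fact_pos.
      by apply: pow_le; exact: pos_INR.
    transitivity (vcoef nu s * (INR n ^ s / INR (fact s)) * (exp (INR n * al) * exp (- (INR n * al)))); first ring.
    by rewrite -exp_plus Rplus_opp_r exp_0; ring.
  rewrite CSer_scal ?CSer_RtoC // /vser; first ring.
  apply: (ex_series_extR _ _ _ Sn) => s; rewrite Cmod_R Rabs_pos_eq //.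
  apply: Rmult_le_pos => //; apply: Rmult_le_pos; last by left; exact: inv_fact_pos.
  by apply: pow_le; exact: pos_INR.
split; first by apply: asum_ext Fcol => n; rewrite Col.
rewrite -(CSer_ext _ _ Col) -FE.
pose w := (RtoC kap * / tau)%C.
have [Sw Ew] := cexp_series w.
pose m s := (tau ^ nu * / tau * (w ^ (nu + s) * RtoC (/ INR (fact (nu + s)))))%C.
have Sm : asum m.
  by apply: asum_scal; exact: (proj1 (asum_shift (fun n => w ^ n * RtoC (/ INR (fact n)))%C nu) Sw).
have Em : CSer m = (tau ^ nu * / tau * (cexp w - csum (fun r => w ^ r * RtoC (/ INR (fact r))) nu))%C.
  rewrite CSer_scal; last exact: (proj1 (asum_shift (fun n => w ^ n * RtoC (/ INR (fact n)))%C nu) Sw).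
  by rewrite -Ew (CSer_split (fun n => w ^ n * RtoC (/ INR (fact n)))%C nu) //; ring.
have Ea s : CSer (a s) = (m s + RtoC (vcoef nu s) * lip_rem s tau)%C.
  rewrite CSer_scal // lipschitz // -Cplus_assoc -/(lip_rem s tau) Cmult_plus_distr_l; congr Cplus.
  rewrite /m /w /vcoef Cpow_mult_l Cpow_inv // Cpow_add_r Cpow_S (Nat.add_comm nu s) /Rdiv RtoC_mult RtoC_pow.
  have N1 := Cpow_nz tau nu Nt; have N2 := Cpow_nz tau s Nt.
  by rewrite !Cpow_add_r; field.
have Srem : asum (fun s => RtoC (vcoef nu s) * lip_rem s tau)%C.
  apply: (asum_le _ (fun s => 2 * vcoef nu s)); last exact: ex_series_scalR.
  move=> s; rewrite Cmod_mult Cmod_R Rabs_pos_eq //.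
  by have := lip_rem_bound s tau Ht Hi; have := Pc s; nra.
rewrite (CSer_ext _ _ Ea) CSer_plus // Em.
set X := (_ * (cexp w - _))%C.
rewrite (_ : (X + CSer (fun s => RtoC (vcoef nu s) * lip_rem s tau) - X = CSer (fun s => RtoC (vcoef nu s) * lip_rem s tau))%C); last by ring.
apply: (Rle_trans _ (Series (fun s => 2 * vcoef nu s))).
  apply: Cmod_CSer; last exact: ex_series_scalR.
  move=> s; rewrite Cmod_mult Cmod_R Rabs_pos_eq //.
  by have := lip_rem_bound s tau Ht Hi; have := Pc s; nra.
rewrite Series_scal_l; apply: Rmult_le_compat_l; first lra.
rewrite (Series_ext _ (fun s => vcoef nu s * 1 ^ (s + nu))); last by move=> s; rewrite pow1 Rmult_1_r.
by apply: Rle_trans (Bv2 ltac:(lra)) _; rewrite Rmult_1_r; lra.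
Qed.

(** * Estimates on the major and minor arcs *)

Lemma Lam_small (s : C) : 1 <= Re s -> Cmod (Lam s) <= 4 * exp (- Re s).
Proof.
move=> Hs; have H0 : 0 < Re s by lra.
have Q := exp_neg_lt1 _ H0; have [Sg Eg] := ex_series_geom_pos _ Q.
have E1 : exp (- Re s) <= / 2.
  rewrite exp_Ropp; apply: Rinv_le_contravar; first lra.
  by have := exp_ineq1_le (Re s); lra.
apply: (Rle_trans _ (Series (fun m => 2 * exp (- Re s) * exp (- Re s) ^ m))).
  apply: Cmod_CSer; last exact: ex_series_scalR.
  move=> m; have Pm : 1 <= INR (S m) by rewrite S_INR; have := pos_INR m; lra.
  have Hm : 0 < Re (RtoC (INR (S m)) * s) by apply: Re_scal_pos; lra.
  rewrite Cmod_mult Cmod_R Rabs_pos_eq; last by left; apply: Rinv_0_lt_compat; lra.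
  have I1 : / INR (S m) <= 1 by rewrite -Rinv_1; apply: Rinv_le_contravar; lra.
  have := Cmod_inv_expm1 _ Hm; rewrite re_scal_l => B.
  have L : 1 <= INR (S m) * Re s by nra.
  have E2 : 2 <= exp (INR (S m) * Re s) by have := exp_ineq1_le (INR (S m) * Re s); lra.
  have -> : 2 * exp (- Re s) * exp (- Re s) ^ m = / (exp (INR (S m) * Re s) / 2).
    rewrite Rinv_div (_ : 2 / exp (INR (S m) * Re s) = 2 * exp (- (INR (S m) * Re s))); last by rewrite exp_Ropp.
    by rewrite exp_nat_pow /=; ring.
  have B2 : / (exp (INR (S m) * Re s) - 1) <= / (exp (INR (S m) * Re s) / 2) by apply: Rinv_le_contravar; lra.
  have P1 : 0 < / INR (S m) by apply: Rinv_0_lt_compat; lra.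
  have P2 := Cmod_ge_0 (/ (cexp (RtoC (INR (S m)) * s) - 1)).
  nra.
rewrite Series_scal_l Eg.
have : / (1 - exp (- Re s)) <= 2.
  by rewrite -(Rinv_inv 2); apply: Rinv_le_contravar; lra.
by have := exp_pos (- Re s); nra.
Qed.

Lemma Re_inv (z : C) : Re (/ z) = Re z / Cmod z ^ 2.
Proof. by rewrite Cmod_sqr. Qed.

(* Degree 4 Taylor polynomial of [2 e^(- tau / 12) psi(e^(- tau))]. *)
Definition cpoly (tau : C) : C :=
  (1 + tau * (1 / 6 + tau * (13 / 288 + tau * (7 / 324 + tau * (7441 / 497664)))))%C.

Lemma Cfrac (a b : R) : b <> 0 -> (RtoC a / RtoC b)%C = RtoC (a / b).
Proof. by move=> Hb; rewrite RtoC_div. Qed.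

Lemma Cmod_horner (c x tau : C) (b T : R) : Cmod tau <= T -> Cmod x <= b -> Cmod (c + tau * x) <= Cmod c + T * b.
Proof.
move=> H1 H2; apply: Rle_trans (Cmod_triangle _ _) _; rewrite Cmod_mult.
by apply: Rplus_le_compat_l; apply: Rmult_le_compat => //; exact: Cmod_ge_0.
Qed.

(** The part of degree at most 4 of [boole_sum tau 0]; [A4] is the Taylor polynomial of
    [e^(tau / 24)], and their product agrees with [cpoly / 2] up to degree 4. *)
Definition D4 (tau : C) : C :=
  (1 / 2 + tau * (1 / 16 + tau * (5 / 256 + tau * (61 / 6144 + tau * (1385 / 196608)))))%C.

Definition A4 (tau : C) : C :=
  (1 + tau * (1 / 24 + tau * (1 / 1152 + tau * (1 / 82944 + tau * (1 / 7962624)))))%C.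

(** At [x = 0] the recurrence of [hq] loses its first term, so the even orders are double factorials
    times powers of [- tau]. *)
Lemma boole_sum_0 (tau : C) :
  boole_sum tau 0 = (D4 tau + tau ^ 5 * (50521 / 7864320 + tau * (2702765 / 377487360)))%C.
Proof.
have E0 : gau tau 0 = 1%C by rewrite /gau /= Rmult_0_l /Rdiv Rmult_0_l Cmult_0_r cexp_0.
have H2 n : hq tau (S (S n)) 0 = (- tau * (RtoC (INR (S n)) * hq tau n 0))%C by rewrite hqSS; ring.
rewrite /boole_sum /gd E0; cbn [csum Nat.mul Nat.add boole_coef].
rewrite !H2 !INR_IZR_INZ; cbn [Z.of_nat Pos.of_succ_nat Pos.succ hq].
rewrite !RtoC_div; try lra.
by rewrite /D4 /=; field.
Qed.

Lemma pow5_small (T : R) : 0 <= T <= 0.0072 -> 0 <= T ^ 5 <= / 1000.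
Proof.
move=> HT; split; first by apply: pow_le; lra.
apply: (Rle_trans _ (0.0072 ^ 5)); [apply: pow_incr; lra | lra].
Qed.

Lemma exp_tau24 (tau : C) : 0 < Re tau -> Cmod tau <= 0.0072 ->
  Cmod (cexp (tau * RtoC (/ 24))) <= 1.001 /\
  Cmod (cexp (tau * RtoC (/ 24)) - A4 tau) <= / 1000 * Cmod tau ^ 5.
Proof.
move=> H0 HT; have HR := Re_le_Cmod tau.
have E : Cmod (tau * RtoC (/ 24)) = Cmod tau / 24 by rewrite Cmod_scal_r; [rewrite /Rdiv | lra].
have Rx : Re (tau * RtoC (/ 24)) <= 0.0003 by rewrite re_scal_r; lra.
have Ex : exp 0.0003 <= 1.001.
  have H x : 0 < x < 1 -> exp x <= / (1 - x).
    move=> Hx; have E1 := exp_ineq1_le (- x); rewrite exp_Ropp in E1.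
    by rewrite -(Rinv_inv (exp x)); apply: Rinv_le_contravar; lra.
  by apply: Rle_trans (H 0.0003 ltac:(lra)) _; lra.
split; first by rewrite Cmod_cexp; apply: Rle_trans (exp_le _ _ Rx) Ex.
have := cexp_taylor 5 (tau * RtoC (/ 24)) 0.0003 ltac:(lra) Rx.
have -> : csum (fun i => (tau * RtoC (/ 24)) ^ i * RtoC (/ INR (fact i)))%C 5 = A4 tau.
  rewrite (csum_ext _ (fun i => (tau * (1 / 24)) ^ i * / RtoC (IZR (zfact i)))%C); last first.
    have E24 : RtoC (/ 24) = (1 / 24)%C by rewrite RtoC_inv; [field | lra].
    move=> i _; rewrite E24 -INR_zfact RtoC_inv //; exact: INR_fact_neq_0.
  by cbn [csum zfact Z.of_nat Z.mul Pos.of_succ_nat Pos.succ Pos.mul Pos.add Cpow]; rewrite /A4; field.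
rewrite E INR_zfact => H; apply: Rle_trans H _.
cbn [zfact Z.of_nat Z.mul Pos.of_succ_nat Pos.succ Pos.mul Pos.add].
have P5 : 0 <= Cmod tau ^ 5 by apply: pow_le; exact: Cmod_ge_0.
have -> : (Cmod tau / 24) ^ 5 = Cmod tau ^ 5 / 7962624 by field.
rewrite /Rdiv; nra.
Qed.

Lemma Cmod_C (a b : R) : 0 < b -> 0 <= a -> Cmod (RtoC a / RtoC b) = a / b.
Proof.
move=> Hb Ha; rewrite -RtoC_div; last lra.
by rewrite Cmod_R Rabs_pos_eq //; apply: Rmult_le_pos => //; left; apply: Rinv_0_lt_compat.
Qed.

Lemma D4_bound (tau : C) : Cmod tau <= 0.0072 -> Cmod (D4 tau) <= 0.51.
Proof.
move=> HT; have P := Cmod_ge_0 tau; rewrite /D4.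
have B0 : Cmod (1385 / 196608) <= 0.01 by rewrite Cmod_C; lra.
have B1 := Cmod_horner (61 / 6144) _ _ _ _ HT B0; rewrite (Cmod_C 61) in B1; try lra.
have B2 := Cmod_horner (5 / 256) _ _ _ _ HT B1; rewrite (Cmod_C 5) in B2; try lra.
have B3 := Cmod_horner (1 / 16) _ _ _ _ HT B2; rewrite (Cmod_C 1) in B3; try lra.
have B4 := Cmod_horner (1 / 2) _ _ _ _ HT B3; rewrite (Cmod_C 1) in B4; try lra.
Qed.

Lemma A4D4 (tau : C) : Cmod tau <= 0.0072 ->
  Cmod (A4 tau * D4 tau - 1 / 2 * cpoly tau) <= / 1000 * Cmod tau ^ 5.
Proof.
move=> HT; have P := Cmod_ge_0 tau.
have -> : (A4 tau * D4 tau - 1 / 2 * cpoly tau = tau ^ 5 * (9631 / 31850496 + tau * (2119 / 339738624 +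
   tau * (527 / 6115295232 + tau * (1385 / 1565515579392)))))%C.
  by rewrite /A4 /D4 /cpoly /=; field.
rewrite Cmod_mult Cmod_pow Rmult_comm; apply: Rmult_le_compat_r; first exact: pow_le.
have B0 : Cmod (1385 / 1565515579392) <= 0.01 by rewrite Cmod_C; lra.
have B1 := Cmod_horner (527 / 6115295232) _ _ _ _ HT B0; rewrite (Cmod_C 527) in B1; try lra.
have B2 := Cmod_horner (2119 / 339738624) _ _ _ _ HT B1; rewrite (Cmod_C 2119) in B2; try lra.
have B3 := Cmod_horner (9631 / 31850496) _ _ _ _ HT B2; rewrite (Cmod_C 9631) in B3; try lra.
Qed.

(** In the sector the real part of [4 PI^2 / tau] is at least [31 / |tau|], since
    [4 PI^2 * 4/5 > 31]. The exponentially small quantity is then weakened to a multiple of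
    [|tau|^5], the order of the other errors. *)
Lemma Lam_dual_small (tau : C) : 0 < Re tau -> Cmod tau <= 5 / 4 * Re tau -> Cmod tau <= 0.0072 ->
  Cmod (cexp (2 * Lam (RtoC (4 * PI ^ 2) * / tau)) - 1) <= / 1000 * Cmod tau ^ 5.
Proof.
move=> H0 Hsec HT; have PI0 := PI_bounds; set T := Cmod tau in Hsec HT *.
have PT : 0 < T by exact: Re_pos_Cmod.
set s := (RtoC (4 * PI ^ 2) * / tau)%C.
have Hs : 31 / T <= Re s.
  rewrite /s re_scal_l Re_inv -/T.
  have -> : 4 * PI ^ 2 * (Re tau / T ^ 2) = (4 * PI ^ 2 * (Re tau / T)) / T by field; lra.
  apply: Rmult_le_compat_r; first by left; apply: Rinv_0_lt_compat.
  have : 4 / 5 <= Re tau / T by apply: (Rmult_le_reg_r T) => //; rewrite (_ : Re tau / T * T = Re tau); [lra | field; lra].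
  have : 39 <= 4 * PI ^ 2 by nra.
  nra.
have Hs1 : 1 <= Re s.
  apply: Rle_trans Hs; apply: (Rmult_le_reg_r T) => //; rewrite (_ : 31 / T * T = 31); [lra | field; lra].
have BL := Lam_small s Hs1.
have BE : exp (- Re s) <= T ^ 5 / 10 ^ 6.
  have X : 0 <= 31 / T by apply: Rmult_le_pos; [lra | left; apply: Rinv_0_lt_compat].
  have := pow_le_exp 5 (31 / T) ltac:(lia) X.
  rewrite (INR_IZR_INZ 5) [Z.of_nat 5]/= => H.
  apply: (Rle_trans _ (exp (- (31 / T)))); first by apply: exp_le; lra.
  rewrite exp_Ropp.
  have -> : T ^ 5 / 10 ^ 6 = / (10 ^ 6 / T ^ 5) by field; lra.
  apply: Rinv_le_contravar; first by apply: Rdiv_lt_0_compat; [lra | apply: pow_lt].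
  apply: Rle_trans H.
  have -> : (2.7 * (31 / T) / 5) ^ 5 = (2.7 * 31 / 5) ^ 5 * / T ^ 5.
    by rewrite -pow_inv -Rpow_mult_distr; congr pow; rewrite /Rdiv; ring.
  apply: Rmult_le_compat_r; first by left; apply: Rinv_0_lt_compat; apply: pow_lt.
  lra.
have [P5 Q5] := pow5_small T ltac:(lra).
have BM : Cmod (2 * Lam s) <= 8 * (T ^ 5 / 10 ^ 6).
  by rewrite Cmod_mult Cmod_R Rabs_pos_eq; lra.
have B1 : Cmod (2 * Lam s) <= 1 by lra.
apply: Rle_trans (cexp_sub1 _ 1 ltac:(lra) (Rle_trans _ _ _ (Re_le_Cmod _) B1)) _.
have E3 := exp_le_3; have E0 := exp_pos 1; have P0 := Cmod_ge_0 (2 * Lam s).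
have : Cmod (2 * Lam s) * exp 1 <= 8 * (T ^ 5 / 10 ^ 6) * 3 by apply: Rmult_le_compat; lra.
lra.
Qed.

Definition Ugf (tau : C) : C := (cexp (2 * Lam tau) * psi (cexp (- tau)))%C.

Lemma Cmod_cexp_inv (tau : C) : Cmod (cexp (RtoC kap * / tau)) = exp (kap * Re tau / Cmod tau ^ 2).
Proof. by rewrite Cmod_cexp re_scal_l Re_inv; congr exp; rewrite /Rdiv; ring. Qed.

(** The modular factor [e^(- tau / 12)] is split as [e^(tau / 24) e^(- tau / 8)], the second factor
    being the one that [psi_boole] requires. The three factors [a], [b], [d] are then replaced by
    [A4], 1 and [D4] one at a time. *)
Theorem major_arc (tau : C) : 0 < Re tau -> Cmod tau <= 5 / 4 * Re tau -> Cmod tau <= 0.0072 ->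
  Cmod (Ugf tau - RtoC (/ (4 * PI)) * tau * cexp (RtoC kap * / tau) * cpoly tau)
    <= 2 / (2 * PI) * Cmod tau ^ 6 * exp (kap * Re tau / Cmod tau ^ 2).
Proof.
move=> H0 Hsec HT; have PI0 := PI_bounds; set T := Cmod tau in Hsec HT *.
have PT : 0 < T by exact: Re_pos_Cmod.
pose a := cexp (tau * RtoC (/ 24)).
pose b := cexp (2 * Lam (RtoC (4 * PI ^ 2) * / tau)).
pose d := (cexp (- tau * RtoC (/ 8)) * psi (cexp (- tau)))%C.
have [Ba Ba4] := exp_tau24 tau H0 HT; rewrite -/a -/T in Ba Ba4.
have Bb := Lam_dual_small tau H0 Hsec HT; rewrite -/b -/T in Bb.
have BD4 := D4_bound tau HT; have BAD := A4D4 tau HT; rewrite -/T in BAD.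
have [P5 Q5] := pow5_small T ltac:(lra).
(* [221 * 0.0072 + 0.01 < 1.62], where 0.01 accounts for the terms of degree 5 and 6 of
   [boole_sum tau 0]. *)
have Bd : Cmod (d - D4 tau) <= 1.62 * T ^ 5.
  have := psi_boole tau H0 Hsec ltac:(rewrite -/T; lra).
  rewrite -/d boole_sum_0 -/T => B1.
  have B0 : Cmod (2702765 / 377487360) <= 0.01 by rewrite Cmod_C; lra.
  have B2 := Cmod_horner (50521 / 7864320) _ _ _ _ HT B0; rewrite (Cmod_C 50521) in B2; try lra.
  set x := (50521 / 7864320 + _)%C in B1 B2.
  have -> : (d - D4 tau = (d - (D4 tau + tau ^ 5 * x)) + tau ^ 5 * x)%C by ring.
  apply: Rle_trans (Cmod_triangle _ _) _; rewrite Cmod_mult Cmod_pow -/T.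
  have B3 : T ^ 5 * Cmod x <= T ^ 5 * 0.01 by apply: Rmult_le_compat_l; lra.
  have E6 : T ^ 6 = T * T ^ 5 by [].
  have B4 : T * T ^ 5 <= 0.0072 * T ^ 5 by apply: Rmult_le_compat_r.
  rewrite E6 in B1; lra.
have EU : Ugf tau = (RtoC (/ (2 * PI)) * tau * cexp (RtoC kap * / tau) * (a * b * d))%C.
  rewrite /Ugf Lam_transform // -/b /a /d -/kap.
  have -> : cexp (RtoC kap * / tau - RtoC (/ 12) * tau) = (cexp (RtoC kap * / tau) * cexp (tau * RtoC (/ 24)) * cexp (- tau * RtoC (/ 8)))%C.
    rewrite -!cexp_add; congr cexp.
    have -> : / 12 = / 8 - / 24 by field.
    by rewrite RtoC_minus; ring.
  ring.
clearbody a b d.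
have E4 : RtoC (/ (4 * PI)) = (RtoC (/ (2 * PI)) * (1 / 2))%C.
  rewrite -RtoC_div; last lra.
  by rewrite -RtoC_mult; congr RtoC; field; lra.
have -> : (Ugf tau - RtoC (/ (4 * PI)) * tau * cexp (RtoC kap * / tau) * cpoly tau =
  RtoC (/ (2 * PI)) * tau * cexp (RtoC kap * / tau) * (a * d * (b - 1) + a * (d - D4 tau) + (a - A4 tau) * D4 tau + (A4 tau * D4 tau - 1 / 2 * cpoly tau)))%C.
  by rewrite EU E4; ring.
rewrite !Cmod_mult Cmod_R Cmod_cexp_inv -/T Rabs_pos_eq; last by left; apply: Rinv_0_lt_compat; lra.
have Bdd : Cmod d <= 0.52.
  have := Cmod_triangle (d - D4 tau) (D4 tau); rewrite (_ : (d - D4 tau + D4 tau = d)%C); last ring.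
  lra.
set X := (a * d * _ + _ + _ + _)%C.
suff BX : Cmod X <= 2 * T ^ 5.
  have -> : 2 / (2 * PI) * T ^ 6 * exp (kap * Re tau / T ^ 2) = / (2 * PI) * T * exp (kap * Re tau / T ^ 2) * (2 * T ^ 5) by rewrite /Rdiv /=; ring.
  apply: Rmult_le_compat_l => //; apply: Rmult_le_pos; last by left; exact: exp_pos.
  by apply: Rmult_le_pos; [left; apply: Rinv_0_lt_compat; lra | lra].
have Pa := Cmod_ge_0 a; have Pd := Cmod_ge_0 d; have PD := Cmod_ge_0 (D4 tau).
have T1 : Cmod (a * d * (b - 1)) <= 1.001 * 0.52 * (/ 1000 * T ^ 5).
  rewrite !Cmod_mult; apply: Rmult_le_compat Bb; [exact: Rmult_le_pos | exact: Cmod_ge_0 |].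
  exact: Rmult_le_compat.
have T2 : Cmod (a * (d - D4 tau)) <= 1.001 * (1.62 * T ^ 5).
  by rewrite !Cmod_mult; apply: Rmult_le_compat => //; exact: Cmod_ge_0.
have T3 : Cmod ((a - A4 tau) * D4 tau) <= / 1000 * T ^ 5 * 0.51.
  by rewrite !Cmod_mult; apply: Rmult_le_compat => //; exact: Cmod_ge_0.
apply: Rle_trans (Cmod_triangle _ _) _; apply: (Rle_trans _ ((1.001 * 0.52 * (/ 1000 * T ^ 5) + 1.001 * (1.62 * T ^ 5) + / 1000 * T ^ 5 * 0.51) + / 1000 * T ^ 5)); last lra.
apply: Rplus_le_compat => //; apply: Rle_trans (Cmod_triangle _ _) _; apply: Rplus_le_compat => //.
by apply: Rle_trans (Cmod_triangle _ _) _; apply: Rplus_le_compat.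
Qed.

Lemma exp_kap_le : exp kap <= 81.
Proof.
have K := kap_bounds.
apply: (Rle_trans _ (exp (INR 4 * 1))); first by apply: exp_le; rewrite /=; lra.
have -> : exp (INR 4 * 1) = exp 1 ^ 4.
  by rewrite -Rpower_pow ?/Rpower ?ln_exp //; exact: exp_pos.
have -> : 81 = 3 ^ 4 by ring.
by apply: pow_incr; split; [left; exact: exp_pos | exact: exp_le_3].
Qed.

(** Since [r <= nu], the removed terms of the exponential series contain only nonnegative powers of
    [tau] and stay bounded near 0. *)
Lemma partial_bound (nu : nat) (tau : C) : tau <> 0%C -> Cmod tau <= 4 ->
  Cmod (tau ^ S nu * / tau * csum (fun r => (RtoC kap * / tau) ^ r * RtoC (/ INR (fact r)))%C (S nu)) <= 4 ^ nu * exp kap.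
Proof.
move=> Nt HT; have K := kap_bounds; have P := Cmod_ge_0 tau.
have [Se Ee] := ex_series_exp kap.
rewrite -csum_scal; apply: Rle_trans (Cmod_csum _ _) _.
apply: (Rle_trans _ (4 ^ nu * rsum (fun r => kap ^ r / INR (fact r)) (S nu))); last first.
  rewrite -Ee; apply: Rmult_le_compat_l; first by apply: pow_le; lra.
  apply: rsum_le_Series => // i; apply: Rmult_le_pos; last by left; exact: inv_fact_pos.
  by apply: pow_le; lra.
have Eq : 4 ^ nu * rsum (fun r => kap ^ r / INR (fact r)) (S nu) = rsum (fun r => 4 ^ nu * (kap ^ r / INR (fact r))) (S nu).
  move: (4 ^ nu) => c4.
  by elim: (S nu) => [|k IH]; [rewrite /=; ring | rewrite !rsum_S -IH; ring].
rewrite Eq; apply: rsum_le => r Hr.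
have -> : (tau ^ S nu * / tau * ((RtoC kap * / tau) ^ r * RtoC (/ INR (fact r))) =
   tau ^ (nu - r) * (RtoC (kap ^ r) * RtoC (/ INR (fact r))))%C.
  rewrite Cpow_mult_l Cpow_inv // RtoC_pow (_ : S nu = S ((nu - r) + r)); last by lia.
  rewrite Cpow_S Cpow_add_r; have N2 := Cpow_nz tau r Nt; by field.
rewrite !Cmod_mult Cmod_pow !Cmod_R !Rabs_pos_eq; last first.
- by apply: pow_le; lra.
- by left; exact: inv_fact_pos.
apply: Rmult_le_compat_r.
  by apply: Rmult_le_pos; [apply: pow_le; lra | left; exact: inv_fact_pos].
apply: (Rle_trans _ (4 ^ (nu - r))); first by apply: pow_incr; lra.
by apply: Rle_pow; [lra | lia].
Qed.

(** The coefficients are those of [tau * cpoly tau], with [vser nu] standing for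
    [tau^(nu - 1) e^(kap / tau)]. *)
Definition vtot (n : nat) : R :=
  / (4 * PI) * (vser 2 n + 1 / 6 * vser 3 n + 13 / 288 * vser 4 n + 7 / 324 * vser 5 n + 7441 / 497664 * vser 6 n).

Theorem vtot_series (tau : C) : 0 < Re tau <= / 2 -> Rabs (Im tau) <= PI ->
  asum (fun n => RtoC (vtot n) * cexp (- tau) ^ n)%C /\
  Cmod (CSer (fun n => RtoC (vtot n) * cexp (- tau) ^ n)%C
     - RtoC (/ (4 * PI)) * tau * cexp (RtoC kap * / tau) * cpoly tau) <= 300.
Proof.
move=> Ht Hi; have PI0 := PI_bounds; have EK := exp_kap_le.
have Nt := Re_pos_neq0 tau (proj1 Ht).
have HT : Cmod tau <= 4 by apply: Rle_trans (Cmod_Re_Im tau) _; rewrite Rabs_pos_eq; lra.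
have F nu : asum (fun n => RtoC (vser (S nu) n) * cexp (- tau) ^ n)%C /\
   Cmod (CSer (fun n => RtoC (vser (S nu) n) * cexp (- tau) ^ n)%C - tau ^ S nu * / tau * cexp (RtoC kap * / tau)) <= 162 + 4 ^ nu * 81.
  have [S1 B1] := vser_series (S nu) tau Ht Hi; split => //.
  have B2 := partial_bound nu tau Nt HT.
  set X := CSer _ in B1 *; set Y := csum _ _ in B1 B2.
  have -> : (X - tau ^ S nu * / tau * cexp (RtoC kap * / tau) = (X - tau ^ S nu * / tau * (cexp (RtoC kap * / tau) - Y)) - tau ^ S nu * / tau * Y)%C by ring.
  apply: Rle_trans (Cmod_minus_le _ _) _.
  have P4 : 0 < 4 ^ nu by apply: pow_lt; lra.
  have := Rmult_le_compat_l _ _ _ (Rlt_le _ _ P4) EK; lra.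
have [S2 B2] := F 1%nat; have [S3 B3] := F 2%nat; have [S4 B4] := F 3%nat.
have [S5 B5] := F 4%nat; have [S6 B6] := F 5%nat.
set X2 := CSer _ in B2; set X3 := CSer _ in B3; set X4 := CSer _ in B4; set X5 := CSer _ in B5; set X6 := CSer _ in B6.
have Sc (c : C) f : asum f -> asum (fun n => c * f n)%C by exact: asum_scal.
have E n : (RtoC (vtot n) * cexp (- tau) ^ n = RtoC (/ (4 * PI)) * ((((RtoC (vser 2 n) * cexp (- tau) ^ n +
   RtoC (1 / 6) * (RtoC (vser 3 n) * cexp (- tau) ^ n)) + RtoC (13 / 288) * (RtoC (vser 4 n) * cexp (- tau) ^ n)) +
   RtoC (7 / 324) * (RtoC (vser 5 n) * cexp (- tau) ^ n)) + RtoC (7441 / 497664) * (RtoC (vser 6 n) * cexp (- tau) ^ n)))%C.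
  by rewrite /vtot RtoC_mult !RtoC_plus !(RtoC_mult (_ / _)); ring.
have A3 := asum_plus _ _ S2 (Sc (RtoC (1 / 6))%C _ S3).
have A4 := asum_plus _ _ A3 (Sc (RtoC (13 / 288))%C _ S4).
have A5 := asum_plus _ _ A4 (Sc (RtoC (7 / 324))%C _ S5).
have A6 := asum_plus _ _ A5 (Sc (RtoC (7441 / 497664))%C _ S6).
split; first by apply: asum_ext (Sc (RtoC (/ (4 * PI))) _ A6) => n; rewrite E.
rewrite (CSer_ext _ _ E) CSer_scal // CSer_plus //; last exact: Sc.
rewrite CSer_plus //; last exact: Sc.
rewrite CSer_plus //; last exact: Sc.
rewrite CSer_plus //; last exact: Sc.
rewrite !CSer_scal // -/X2 -/X3 -/X4 -/X5 -/X6.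
set w := cexp (RtoC kap * / tau) in B2 B3 B4 B5 B6 *.
have -> : (RtoC (/ (4 * PI)) * (X2 + RtoC (1 / 6) * X3 + RtoC (13 / 288) * X4 + RtoC (7 / 324) * X5 + RtoC (7441 / 497664) * X6) - RtoC (/ (4 * PI)) * tau * w * cpoly tau =
  RtoC (/ (4 * PI)) * ((X2 - tau ^ 2 * / tau * w) + RtoC (1 / 6) * (X3 - tau ^ 3 * / tau * w) + RtoC (13 / 288) * (X4 - tau ^ 4 * / tau * w)
   + RtoC (7 / 324) * (X5 - tau ^ 5 * / tau * w) + RtoC (7441 / 497664) * (X6 - tau ^ 6 * / tau * w)))%C.
  rewrite /cpoly !Cfrac; try lra.
  by rewrite /=; field.
rewrite Cmod_mult Cmod_R Rabs_pos_eq; last by left; apply: Rinv_0_lt_compat; lra.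
(* The weighted errors of the five series add up to less than 3600, and [4 PI >= 12]. *)
apply: (Rle_trans _ (/ 12 * 3600)); last lra.
apply: Rmult_le_compat; [left; apply: Rinv_0_lt_compat; lra | exact: Cmod_ge_0 | apply: Rinv_le_contravar; lra |].
set Y2 := (X2 - _)%C in B2 *; set Y3 := (X3 - _)%C in B3 *; set Y4 := (X4 - _)%C in B4 *.
set Y5 := (X5 - _)%C in B5 *; set Y6 := (X6 - _)%C in B6 *.
have M (a b : R) (Y : C) : 0 < b -> 0 <= a -> Cmod (RtoC (a / b) * Y) = a / b * Cmod Y.
  by move=> Hb Ha; rewrite Cmod_mult Cmod_R Rabs_pos_eq //; apply: Rmult_le_pos => //; left; exact: Rinv_0_lt_compat.
have G3 := M 1 6 Y3 ltac:(lra) ltac:(lra); have G4 := M 13 288 Y4 ltac:(lra) ltac:(lra).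
have G5 := M 7 324 Y5 ltac:(lra) ltac:(lra); have G6 := M 7441 497664 Y6 ltac:(lra) ltac:(lra).
have T1 := Cmod_triangle (Y2 + RtoC (1 / 6) * Y3 + RtoC (13 / 288) * Y4 + RtoC (7 / 324) * Y5) (RtoC (7441 / 497664) * Y6).
have T2 := Cmod_triangle (Y2 + RtoC (1 / 6) * Y3 + RtoC (13 / 288) * Y4) (RtoC (7 / 324) * Y5).
have T3 := Cmod_triangle (Y2 + RtoC (1 / 6) * Y3) (RtoC (13 / 288) * Y4).
have T4 := Cmod_triangle Y2 (RtoC (1 / 6) * Y3).
rewrite /= in B2 B3 B4 B5 B6; lra.
Qed.

Lemma Cmod_expm1_sqr (tau : C) :
  Cmod (cexp tau - 1) ^ 2 = (exp (Re tau) - 1) ^ 2 + 4 * exp (Re tau) * sin (Im tau / 2) ^ 2.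
Proof.
rewrite Cmod_sqr Re_plus Im_plus re_opp im_opp /cexp /=.
have E : cos (Im tau) = 1 - 2 * sin (Im tau / 2) ^ 2.
  have {1}-> : Im tau = 2 * (Im tau / 2) by field.
  by rewrite cos_2a_sin /=; ring.
have S2 : sin (Im tau) ^ 2 = 1 - cos (Im tau) ^ 2.
  by have := sin2_cos2 (Im tau); rewrite /Rsqr /= => H; lra.
transitivity (exp (Re tau) ^ 2 * cos (Im tau) ^ 2 - 2 * exp (Re tau) * cos (Im tau) + 1 + exp (Re tau) ^ 2 * sin (Im tau) ^ 2); first by rewrite /=; ring.
by rewrite S2 E /=; ring.
Qed.

(** Each term of the Lambert series is bounded by its value at [Re tau]; the gain from the imaginary
    part is kept in the first term only. *)
Lemma Re_Lam_minor (tau : C) : 0 < Re tau ->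
  Re (Lam tau) <= Re (Lam (RtoC (Re tau))) - / (exp (Re tau) - 1) + / Cmod (cexp tau - 1).
Proof.
move=> Ht; set al := Re tau in Ht *.
have Hal : 0 < Re (RtoC al) by [].
have S1 := asum_Lam tau Ht; have S2 := asum_Lam _ Hal.
have E m : Re (Lam_term (RtoC al) m) = / INR (S m) * / (exp (INR (S m) * al) - 1).
  have P : 0 < INR (S m) * al by apply: Rmult_lt_0_compat => //; exact: INR_S_pos.
  rewrite /Lam_term -RtoC_mult cexp_RtoC -RtoC_minus -RtoC_inv.
    by rewrite re_scal_l.
  by have := exp_ineq1 _ (Rgt_not_eq _ _ P); lra.
have B m : Re (Lam_term tau m) <= / INR (S m) * / Cmod (cexp (RtoC (INR (S m)) * tau) - 1).
  apply: Rle_trans (Re_le_Cmod _) _; rewrite Cmod_mult Cmod_inv' Cmod_R Rabs_pos_eq; first lra.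
  by left; apply: Rinv_0_lt_compat; exact: INR_S_pos.
rewrite /Lam /CSer [Re _]/= [Re (Series _, _)]/=.
rewrite (Series_incr_1 (fun n => Re (Lam_term tau n))); last exact: asum_Re.
rewrite (Series_incr_1 (fun n => Re (Lam_term (RtoC al) n))); last exact: asum_Re.
have I1 : INR 1 = 1 by [].
have B0 := B 0%nat; have E0 := E 0%nat; rewrite I1 Rinv_1 Rmult_1_l Cmult_1_l in B0.
rewrite I1 Rinv_1 !Rmult_1_l in E0.
have Ss : Series (fun k => Re (Lam_term tau (S k))) <= Series (fun k => Re (Lam_term (RtoC al) (S k))).
  apply: (is_lim_seq_le (rsum (fun k => Re (Lam_term tau (S k)))) (rsum (fun k => Re (Lam_term (RtoC al) (S k)))) (Series _) (Series _)).
  - move=> n; apply: rsum_le => m _; apply: Rle_trans (B (S m)) _; rewrite E.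
    have Pm := INR_S_pos (S m).
    apply: Rmult_le_compat_l; first by left; apply: Rinv_0_lt_compat.
    have Hm : 0 < Re (RtoC (INR (S (S m))) * tau) by apply: Re_scal_pos.
    by have := Cmod_inv_expm1 _ Hm; rewrite Cmod_inv' re_scal_l.
  - by apply: Series_rsum_lim; apply: asum_Re; exact: (proj1 (asum_shift _ 1) S1).
  - by apply: Series_rsum_lim; apply: asum_Re; exact: (proj1 (asum_shift _ 1) S2).
lra.
Qed.

(** The saving [0.38 / al] is [2 (0.994 - 0.804) / al], the difference between the first Lambert
    terms at [Re tau] and at [tau]. The factor [al] of the modular transformation cancels the
    trivial bound [1.006 / al] for [psi]. *)
Theorem minor_arc (tau : C) : 0 < Re tau <= 0.00576 -> 3 / 4 * Re tau <= Rabs (Im tau) <= PI ->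
  Cmod (Ugf tau) <= exp ((kap - 0.38) / Re tau).
Proof.
move=> [H0 H1] [Hi1 Hi2]; have PI0 := PI_bounds; set al := Re tau in H0 H1 Hi1 *.
have Hal : 0 < Re (RtoC al) by [].
have Ea : al <= exp al - 1 <= al / (1 - al).
  split; first by have := exp_ineq1_le al; lra.
  have E1 := exp_ineq1_le (- al); rewrite exp_Ropp in E1.
  have : exp al <= / (1 - al) by rewrite -(Rinv_inv (exp al)); apply: Rinv_le_contravar; lra.
  have -> : al / (1 - al) = / (1 - al) - 1 by field; lra.
  lra.
have A1 : 0.994 / al <= / (exp al - 1).
  apply: (Rle_trans _ (/ (al / (1 - al)))); last by apply: Rinv_le_contravar; lra.
  have -> : / (al / (1 - al)) = (1 - al) / al by field; lra.
  by apply: Rmult_le_compat_r; [left; apply: Rinv_0_lt_compat | lra].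
have Sn : 0.37 * al <= sin (Rabs (Im tau) / 2).
  apply: (Rle_trans _ (sin (3 / 8 * al))).
    have [H _] := pre_sin_bound (3 / 8 * al) 0 ltac:(lra) ltac:(lra).
    apply: Rle_trans H; rewrite /sin_approx /sum_f_R0 /sin_term /=; nra.
  by apply: sin_incr_1; lra.
have A2 : / Cmod (cexp tau - 1) <= 0.804 / al.
  have Q := Cmod_expm1_sqr tau; rewrite -/al in Q.
  have S2 : sin (Im tau / 2) ^ 2 = sin (Rabs (Im tau) / 2) ^ 2.
    rewrite /Rabs; case: Rcase_abs => // _.
    by rewrite (_ : - Im tau / 2 = - (Im tau / 2)) ?sin_neg; [ring | field].
  rewrite S2 in Q.
  have Q1 : (0.37 * al) ^ 2 <= sin (Rabs (Im tau) / 2) ^ 2 by apply: pow_incr; lra.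
  have Q2 : al ^ 2 <= (exp al - 1) ^ 2 by apply: pow_incr; lra.
  (* [1 + 4 * 0.37^2 > 1.244^2], and [1 / 1.244 < 0.804]. *)
  have Q3 : (1.244 * al) ^ 2 <= Cmod (cexp tau - 1) ^ 2.
    rewrite Q; have := pow2_ge_0 (0.37 * al); have : 1 <= exp al by lra.
    move=> X1 X2; have : 4 * (0.37 * al) ^ 2 <= 4 * exp al * sin (Rabs (Im tau) / 2) ^ 2 by nra.
    simpl in *; nra.
  have Q4 : 1.244 * al <= Cmod (cexp tau - 1).
    by apply: (Rsqr_incr_0_var _ _ _ (Cmod_ge_0 _)); rewrite !Rsqr_pow2.
  apply: (Rle_trans _ (/ (1.244 * al))); first by apply: Rinv_le_contravar; lra.
  rewrite Rinv_mult; apply: Rmult_le_compat_r; [left; exact: Rinv_0_lt_compat | lra].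
have RL := Re_Lam_minor tau H0; rewrite -/al in RL.
have Mal : Cmod (RtoC al) = al by rewrite Cmod_R Rabs_pos_eq; lra.
have LT := Lam_transform (RtoC al) Hal.
have Bb := Lam_dual_small (RtoC al) Hal; rewrite Mal /= in Bb.
have {}Bb := Bb ltac:(lra) ltac:(lra).
set b := cexp (2 * Lam (_ * _)) in LT Bb.
have Mb : Cmod b <= 1.001.
  have [_ Q5] := pow5_small al ltac:(lra).
  have := Cmod_triangle (b - 1) 1; rewrite Cmod_1 (_ : (b - 1 + 1 = b)%C); last ring.
  rewrite /= in Q5; lra.
have ML : exp (2 * Re (Lam (RtoC al))) <= al * exp (kap / al) / 6.
  have -> : exp (2 * Re (Lam (RtoC al))) = Cmod (cexp (2 * Lam (RtoC al))) by rewrite Cmod_cexp re_scal_l.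
  rewrite LT !Cmod_mult Mal Cmod_R Cmod_cexp Rabs_pos_eq; last by left; apply: Rinv_0_lt_compat; lra.
  have -> : Re (RtoC (PI ^ 2 / 3) * / RtoC al - RtoC (/ 12) * RtoC al) = kap / al - al / 12.
    rewrite -RtoC_inv; last lra.
    by rewrite -!RtoC_mult -RtoC_minus /= /kap; field; lra.
  have X : exp (kap / al - al / 12) <= exp (kap / al) by apply: exp_le; lra.
  have X0 := exp_pos (kap / al - al / 12).
  have X1 : / (2 * PI) * 1.001 <= / 6.
    apply: (Rle_trans _ (/ (2 * 3.139) * 1.001)); last lra.
    by apply: Rmult_le_compat_r; [lra | apply: Rinv_le_contravar; lra].
  have PI2 : 0 < / (2 * PI) by apply: Rinv_0_lt_compat; lra.
  apply: (Rle_trans _ (al * exp (kap / al) * (/ (2 * PI) * 1.001))); last first.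
    by apply: Rmult_le_compat_l => //; apply: Rmult_le_pos; [lra | left; exact: exp_pos].
  rewrite (_ : al * exp (kap / al) * (/ (2 * PI) * 1.001) = al * / (2 * PI) * exp (kap / al) * 1.001); last ring.
  apply: Rmult_le_compat => //; try exact: Cmod_ge_0.
    by apply: Rmult_le_pos; [apply: Rmult_le_pos; lra | lra].
  by apply: Rmult_le_compat_l => //; apply: Rmult_le_pos; lra.
have Mpsi : Cmod (psi (cexp (- tau))) <= 1.006 / al.
  have Qq := Cmod_q_lt1 tau H0.
  have P1 : Cmod (cexp (- tau)) < 1 by lra.
  apply: Rle_trans (Cmod_psi _ P1) _.
  rewrite Cmod_cexp re_opp -/al exp_Ropp.
  have -> : / (1 - / exp al) = 1 + / (exp al - 1) by field; lra.
  have : / (exp al - 1) <= / al by apply: Rinv_le_contravar; lra.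
  have : 1 <= 0.00576 / al by apply: (Rmult_le_reg_r al) => //; rewrite /Rdiv Rmult_assoc Rinv_l; lra.
  rewrite /Rdiv; lra.
rewrite /Ugf Cmod_mult Cmod_cexp re_scal_l.
have X : exp (2 * Re (Lam tau)) <= al * exp (kap / al) / 6 * exp (- (0.38 / al)).
  apply: (Rle_trans _ (exp (2 * Re (Lam (RtoC al))) * exp (- (0.38 / al)))).
    rewrite -exp_plus; apply: exp_le; rewrite /Rdiv in A1 A2 *; lra.
  by apply: Rmult_le_compat_r => //; left; exact: exp_pos.
apply: (Rle_trans _ (al * exp (kap / al) / 6 * exp (- (0.38 / al)) * (1.006 / al))).
  by apply: Rmult_le_compat => //; [left; exact: exp_pos | exact: Cmod_ge_0].
have -> : (kap - 0.38) / al = kap / al + - (0.38 / al) by rewrite /Rdiv; ring.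
rewrite exp_plus.
have P1 := exp_pos (kap / al); have P2 := exp_pos (- (0.38 / al)).
have -> : al * exp (kap / al) / 6 * exp (- (0.38 / al)) * (1.006 / al) = (1.006 / 6) * (exp (kap / al) * exp (- (0.38 / al))) * (al * / al) by rewrite /Rdiv; ring.
rewrite Rinv_r; last lra.
by have := Rmult_lt_0_compat _ _ P1 P2; lra.
Qed.

(** * Fourier coefficients *)

Lemma sin_INR_PI (n : nat) : sin (INR n * PI) = 0.
Proof.
elim: n => [|n IH]; first by rewrite /= Rmult_0_l sin_0.
by rewrite S_INR Rmult_plus_distr_r Rmult_1_l neg_sin IH; ring.
Qed.

Definition sinint (x t : R) : R :=
  match Req_EM_T x 0 with left _ => t | right _ => sin (x * t) / x end.

Lemma is_derive_sinint (x t : R) : is_derive (sinint x) t (cos (x * t)).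
Proof.
rewrite /sinint; case: Req_EM_T => H.
  by rewrite H Rmult_0_l cos_0; exact: is_derive_id.
by auto_derive => //; field.
Qed.

Lemma sinint_PI (n k : nat) : n <> k -> sinint (INR n - INR k) PI = 0.
Proof.
move=> H; rewrite /sinint; case: Req_EM_T => E; first by case: H; apply: INR_eq; lra.
by rewrite Rmult_minus_distr_r sin_minus !sin_INR_PI /Rdiv; ring.
Qed.

Lemma Re_csum (f : nat -> C) (N : nat) : Re (csum f N) = rsum (fun k => Re (f k)) N.
Proof. by elim: N => [|N IH]; rewrite ?csum_S ?rsum_S ?Re_plus ?IH. Qed.

(* Only finitely many modes are integrated; the tail enters through its uniform bound and tends to [0]. *)
Lemma fourier_bound (w : nat -> R) (al : R) (n : nat) (B G : R -> R) :
  asum (fun k => RtoC (w k) * cexp (- RtoC al) ^ k)%C ->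
  (forall t, is_derive G t (B t)) ->
  (forall t, Rabs t <= PI -> Cmod (CSer (fun k => RtoC (w k) * cexp (- (al, t)) ^ k)%C) <= B t) ->
  2 * PI * (w n * exp (- (INR n * al))) <= G PI - G (- PI).
Proof.
move=> HS HG HB; have PI0 := PI_bounds.
pose a k := w k * exp (- (INR k * al)).
have Ea k (t : R) : (RtoC (w k) * cexp (- (al, t)) ^ k = RtoC (a k) * cexp (0, (- (INR k * t))%R))%C.
  rewrite cexp_neg_pow /a RtoC_mult -Cmult_assoc -cexp_RtoC -cexp_add; congr (_ * cexp _)%C.
  by apply: Ceq; rewrite /=; ring.
have Ma k t : Cmod (RtoC (w k) * cexp (- (al, t)) ^ k)%C = Rabs (a k).
  by rewrite Ea Cmod_mult Cmod_R Cmod_cexp /= exp_0 Rmult_1_r.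
have Sa : ex_series (fun k => Rabs (a k)).
  by apply: ex_series_extR HS => k; rewrite -(Ma k 0).
have Pa k : 0 <= Rabs (a k) by exact: Rabs_pos.
pose F N t := rsum (fun k => a k * cos ((INR n - INR k) * t)) N.
pose Phi N t := rsum (fun k => a k * sinint (INR n - INR k) t) N.
have HF N t : Rabs t <= PI -> F N t <= B t + (Series (fun k => Rabs (a k)) - rsum (fun k => Rabs (a k)) N).
  move=> Ht; set f := fun k => (RtoC (w k) * cexp (- (al, t)) ^ k)%C.
  have Sf : asum f by apply: ex_series_extR Sa => k; rewrite Ma.
  have -> : F N t = Re (cexp (0, (INR n * t)%R) * csum f N)%C.
    rewrite -csum_scal Re_csum; apply: rsum_ext => k _.
    rewrite /f Ea (_ : (cexp (0, (INR n * t)%R) * (RtoC (a k) * cexp (0, (- (INR k * t))%R)) = RtoC (a k) * (cexp (0, (INR n * t)%R) * cexp (0, (- (INR k * t))%R)))%C); last ring.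
    rewrite -cexp_add re_scal_l /cexp /= Rplus_0_l exp_0 Rmult_1_l.
    by congr (_ * cos _); ring.
  apply: Rle_trans (Re_le_Cmod _) _.
  rewrite Cmod_mult Cmod_cexp [Re _]/= exp_0 Rmult_1_l.
  have -> : csum f N = (CSer f - CSer (fun k => f (N + k)%nat))%C by rewrite (CSer_split f N Sf); ring.
  apply: Rle_trans (Cmod_minus_le _ _) _; apply: Rplus_le_compat; first exact: HB.
  have Sn : ex_series (fun k => Rabs (a (N + k)%nat)) by rewrite -(ex_series_incr_n (fun k => Rabs (a k)) N).
  apply: Rle_trans (Cmod_CSer _ (fun k => Rabs (a (N + k)%nat)) _ Sn) _; first by move=> k; rewrite /f Ma; lra.
  apply: Series_le_bound => // m.
  have := rsum_le_Series _ (N + m) Pa Sa.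
  suff -> : rsum (fun k => Rabs (a k)) (N + m) = rsum (fun k => Rabs (a k)) N + rsum (fun k => Rabs (a (N + k)%nat)) m by lra.
  by elim: m => [|m IH]; rewrite ?Nat.add_0_r ?Nat.add_succ_r ?rsum_S /= ?IH; ring.
have PhiN N t : Phi N (- t) = - Phi N t.
  rewrite /Phi; elim: N => [|N IH]; rewrite ?rsum_S ?IH /=; first ring.
  rewrite /sinint; case: Req_EM_T => H; first ring.
  by rewrite Ropp_mult_distr_r_reverse sin_neg; field.
have FN N t : F N (- t) = F N t.
  by apply: rsum_ext => k _; rewrite Ropp_mult_distr_r_reverse cos_neg.
have dPhi N t : is_derive (Phi N) t (F N t).
  apply: (is_derive_rsum (fun k t => a k * sinint (INR n - INR k) t) (fun k t => a k * cos ((INR n - INR k) * t))) => k.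
  by apply: is_derive_scal; exact: is_derive_sinint.
have PhiPI N : (n < N)%nat -> Phi N PI = a n * PI.
  elim: N => [|N IH] Hn; first lia.
  rewrite /Phi rsum_S -/(Phi N PI); case: (Nat.eq_dec n N) => [<-|Hne].
    rewrite /sinint; case: Req_EM_T => [_|H]; last by lra.
    suff -> : Phi n PI = 0 by ring.
    have Z M : (M <= n)%nat -> Phi M PI = 0.
      elim: M => [|M IHM] HM //; rewrite /Phi rsum_S -/(Phi M PI) IHM; last lia.
      by rewrite sinint_PI; [ring | lia].
    exact: Z.
  have -> : Phi N PI = a n * PI by apply: IH; lia.
  by rewrite sinint_PI; [ring | lia].
have Main N : (n < N)%nat -> rsum (fun k => Rabs (a k)) N <= Series (fun k => Rabs (a k)) + (G PI - G (- PI) - 2 * PI * a n) / (2 * PI).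
  move=> HN; set eps := Series (fun k => Rabs (a k)) - rsum (fun k => Rabs (a k)) N.
  suff : 0 <= G PI - G (- PI) - 2 * Phi N PI + 2 * eps * PI.
    rewrite PhiPI // => X.
    apply: (Rmult_le_reg_r (2 * PI)); first lra.
    have -> : (Series (fun k => Rabs (a k)) + (G PI - G (- PI) - 2 * PI * a n) / (2 * PI)) * (2 * PI) = (Series (fun k => Rabs (a k)) * (2 * PI) + (G PI - G (- PI) - 2 * PI * a n)) by field; lra.
    rewrite /eps in X; lra.
  (* The integral inequality is expressed as monotonicity of a combination of antiderivatives. Since
     that lemma starts at 0, the integrand is symmetrised; [F] is even. *)
  have := is_derive_nondecreasing (fun t => G t - G (- t) - 2 * Phi N t + 2 * eps * t)
    (fun t => B t + B (- t) - 2 * F N t + 2 * eps) PI ltac:(lra).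
  have Z0 : Phi N 0 = 0 by have := PhiN N 0; rewrite Ropp_0; lra.
  rewrite Ropp_0 Z0 (_ : G 0 - G 0 - 2 * 0 + 2 * eps * 0 = 0); last ring.
  apply => [t Ht|t Ht]; last first.
    have H1 := HF N t ltac:(rewrite Rabs_pos_eq; lra).
    have H2 := HF N (- t) ltac:(rewrite Rabs_Ropp Rabs_pos_eq; lra).
    rewrite FN in H2; rewrite -/eps in H1 H2; lra.
  apply: is_derive_Rplus; last by auto_derive => //; ring.
  apply: is_derive_Rminus; last by apply: is_derive_scal; exact: dPhi.
  have -> : B t + B (- t) = B t - (- B (- t)) by ring.
  apply: is_derive_Rminus; first exact: HG.
  have := is_derive_comp G Ropp t (B (- t)) (- 1) (HG _) ltac:(auto_derive => //; ring).
  by rewrite /scal /= /mult /= (_ : -1 * B (- t) = - B (- t)); last ring.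
have L := Series_le_bound _ (Series (fun k => Rabs (a k)) + (G PI - G (- PI) - 2 * PI * a n) / (2 * PI)) Sa.
have {}L := L (fun N => Rle_trans _ _ _ (rsum_incr _ _ _ Pa (Nat.le_max_l N (S n))) (Main _ (Nat.le_max_r N (S n)))).
have P2 : 0 < 2 * PI by lra.
have Q : 0 <= (G PI - G (- PI) - 2 * PI * a n) / (2 * PI) by lra.
have := Rmult_le_compat_r _ _ _ (Rlt_le _ _ P2) Q.
rewrite /Rdiv Rmult_assoc Rinv_l; last lra.
rewrite /a; lra.
Qed.

Lemma Cmod_pair_sqr (a t : R) : Cmod (a, t) ^ 2 = a ^ 2 + t ^ 2.
Proof. by rewrite Cmod_sqr. Qed.

(** Away from the real axis the exponential decays at least like [e^(- 2 t^2 / al^3)], because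
    [16/25 kap > 2]. This Gaussian is replaced by the larger [1 / (1 + 2 t^2 / al^3)], which has an
    arctangent as antiderivative. *)
Lemma major_diff (p : nat -> nat -> R) (al t : R) : part_rec p -> 0 < al <= 0.00576 -> Rabs t <= 3 / 4 * al ->
  Cmod (CSer (fun k => RtoC (unim p k) * cexp (- (al, t)) ^ k)%C - CSer (fun k => RtoC (vtot k) * cexp (- (al, t)) ^ k)%C)
  <= (1.25 * al) ^ 6 / PI * exp (kap / al) * / (1 + 2 * t ^ 2 / al ^ 3) + 300.
Proof.
move=> Hp [Ha1 Ha2] Ht; have PI0 := PI_bounds; have K := kap_bounds.
set tau := ((al, t) : C).
have Hr : 0 < Re tau by [].
have [_ ->] := unim_series p tau Hp Hr; rewrite -/(Ugf tau).
have T2 : Cmod tau ^ 2 = al ^ 2 + t ^ 2 by rewrite /tau Cmod_pair_sqr.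
have P0 := Cmod_ge_0 tau.
have t2 : t ^ 2 <= 9 / 16 * al ^ 2.
  have -> : t ^ 2 = Rabs t ^ 2 by rewrite -!Rsqr_pow2 -Rsqr_abs.
  by have := Rabs_pos t; nra.
have T1 : Cmod tau <= 1.25 * al by nra.
have Bv := proj2 (vtot_series tau ltac:(rewrite /=; lra) ltac:(rewrite /=; lra)).
have Bu := major_arc tau Hr ltac:(rewrite /=; lra) ltac:(lra).
set V := CSer _ in Bv *; set M := (RtoC (/ (4 * PI)) * _ * _ * _)%C in Bu Bv.
have -> : (Ugf tau - V = (Ugf tau - M) - (V - M))%C by ring.
apply: Rle_trans (Cmod_minus_le _ _) _; apply: Rplus_le_compat => //.
apply: Rle_trans Bu _.
have Pt : 0 <= t ^ 2 by exact: pow2_ge_0.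
have Pa : 0 < al ^ 2 by apply: pow_lt.
have Pa3 : 0 < al ^ 3 by apply: pow_lt.
have E1 : exp (kap * Re tau / Cmod tau ^ 2) <= exp (kap / al) * / (1 + 2 * t ^ 2 / al ^ 3).
  apply: (Rle_trans _ (exp (kap / al + - (2 * t ^ 2 / al ^ 3)))).
    apply: exp_le; rewrite T2 [Re _]/=.
    have -> : kap * al / (al ^ 2 + t ^ 2) = kap / al - kap * t ^ 2 / (al * (al ^ 2 + t ^ 2)) by field; split; nra.
    suff : 2 * t ^ 2 / al ^ 3 <= kap * t ^ 2 / (al * (al ^ 2 + t ^ 2)) by lra.
    apply: (Rle_trans _ (kap * t ^ 2 / (al * (25 / 16 * al ^ 2)))).
      have -> : kap * t ^ 2 / (al * (25 / 16 * al ^ 2)) = (16 / 25 * kap) * (t ^ 2 / al ^ 3) by field; lra.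
      rewrite {1}/Rdiv Rmult_assoc; apply: Rmult_le_compat_r; last lra.
      by apply: Rmult_le_pos => //; left; exact: Rinv_0_lt_compat.
    apply: Rmult_le_compat_l; first by nra.
    by apply: Rinv_le_contravar; nra.
  rewrite exp_plus exp_Ropp; apply: Rmult_le_compat_l; first by left; exact: exp_pos.
  have Pq : 0 <= 2 * t ^ 2 / al ^ 3 by apply: Rmult_le_pos; [lra | left; exact: Rinv_0_lt_compat].
  by apply: Rinv_le_contravar; [lra | exact: exp_ineq1_le].
rewrite Rmult_assoc (_ : 2 / (2 * PI) = / PI); last by field; lra.
rewrite (_ : (1.25 * al) ^ 6 / PI * exp (kap / al) * / (1 + 2 * t ^ 2 / al ^ 3) = / PI * ((1.25 * al) ^ 6 * (exp (kap / al) * / (1 + 2 * t ^ 2 / al ^ 3)))); last by rewrite /Rdiv; ring.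
apply: Rmult_le_compat_l; first by left; apply: Rinv_0_lt_compat; lra.
apply: Rmult_le_compat => //; [exact: pow_le | left; exact: exp_pos | exact: pow_incr].
Qed.

(** [304 = 1 + 300 + 3]: the bounds for [Ugf], for the error in [vtot_series], and for the main term
    [M], which is also small on this arc because [16/25 kap < kap - 0.38]. *)
Lemma minor_diff (p : nat -> nat -> R) (al t : R) : part_rec p -> 0 < al <= 0.00576 -> 3 / 4 * al <= Rabs t <= PI ->
  Cmod (CSer (fun k => RtoC (unim p k) * cexp (- (al, t)) ^ k)%C - CSer (fun k => RtoC (vtot k) * cexp (- (al, t)) ^ k)%C)
  <= 304 * exp ((kap - 0.38) / al).
Proof.
move=> Hp [Ha1 Ha2] [Ht1 Ht2]; have PI0 := PI_bounds; have K := kap_bounds.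
set tau := ((al, t) : C).
have Hr : 0 < Re tau by [].
have [_ ->] := unim_series p tau Hp Hr; rewrite -/(Ugf tau).
have T2 : Cmod tau ^ 2 = al ^ 2 + t ^ 2 by rewrite /tau Cmod_pair_sqr.
have P0 := Cmod_ge_0 tau.
have t2 : 9 / 16 * al ^ 2 <= t ^ 2.
  have -> : t ^ 2 = Rabs t ^ 2 by rewrite -!Rsqr_pow2 -Rsqr_abs.
  by have := Rabs_pos t; nra.
have Bt : Cmod tau <= 3.2 by apply: Rle_trans (Cmod_Re_Im _) _; rewrite /= Rabs_pos_eq; lra.
have Bv := proj2 (vtot_series tau ltac:(rewrite /=; lra) ltac:(rewrite /=; lra)).
have Bu := minor_arc tau ltac:(rewrite /=; lra) ltac:(rewrite /=; lra).
rewrite [Re _]/= in Bu.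
set V := CSer _ in Bv *; set M := (RtoC (/ (4 * PI)) * _ * _ * _)%C in Bv.
have Ia : 0 < / al by exact: Rinv_0_lt_compat.
have E1 : 1 <= exp ((kap - 0.38) / al).
  rewrite -exp_0; apply: exp_le; apply: Rmult_le_pos; lra.
have BM : Cmod M <= 3 * exp ((kap - 0.38) / al).
  rewrite /M !Cmod_mult Cmod_R Cmod_cexp_inv Rabs_pos_eq; last by left; apply: Rinv_0_lt_compat; lra.
  have Pa : 0 < al ^ 2 by apply: pow_lt.
  have X : exp (kap * Re tau / Cmod tau ^ 2) <= exp ((kap - 0.38) / al).
    apply: exp_le; rewrite T2 [Re _]/=.
    apply: (Rle_trans _ (kap * al / (25 / 16 * al ^ 2))).
      by apply: Rmult_le_compat_l; [nra | apply: Rinv_le_contravar; nra].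
    have -> : kap * al / (25 / 16 * al ^ 2) = 16 / 25 * kap / al by field; lra.
    by apply: Rmult_le_compat_r; lra.
  have Y : Cmod (cpoly tau) <= 8.
    have B0 : Cmod (7441 / 497664) <= 0.015 by rewrite Cmod_C; lra.
    have B1 := Cmod_horner (7 / 324) _ _ _ _ Bt B0; rewrite (Cmod_C 7) in B1; try lra.
    have B2 := Cmod_horner (13 / 288) _ _ _ _ Bt B1; rewrite (Cmod_C 13) in B2; try lra.
    have B3 := Cmod_horner (1 / 6) _ _ _ _ Bt B2; rewrite (Cmod_C 1) in B3; try lra.
    have B4 := Cmod_horner 1 _ _ _ _ Bt B3; rewrite Cmod_1 in B4.
    by rewrite /cpoly; lra.
  rewrite (_ : / (4 * PI) * Cmod tau * exp (kap * Re tau / Cmod tau ^ 2) * Cmod (cpoly tau) = (/ (4 * PI) * Cmod tau * Cmod (cpoly tau)) * exp (kap * Re tau / Cmod tau ^ 2)); last ring.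
  have I4 : 0 < / (4 * PI) by apply: Rinv_0_lt_compat; lra.
  have I5 : / (4 * PI) <= / 12 by apply: Rinv_le_contravar; lra.
  have P1 := Cmod_ge_0 (cpoly tau).
  apply: Rmult_le_compat => //; [| left; exact: exp_pos |].
    by apply: Rmult_le_pos => //; apply: Rmult_le_pos; lra.
  apply: (Rle_trans _ (/ 12 * 3.2 * 8)); last lra.
  apply: Rmult_le_compat => //; first by apply: Rmult_le_pos; lra.
  by apply: Rmult_le_compat => //; lra.
have -> : (Ugf tau - V = Ugf tau - ((V - M) + M))%C by ring.
apply: Rle_trans (Cmod_minus_le _ _) _.
have := Cmod_triangle (V - M) M; lra.
Qed.

(** Exponent 32 in [pow_le_exp] provides the required [al^8] and leaves 24 powers of [al / c < 0.18]
    to beat the numerical constants. *)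
Lemma exp_minor_small (al : R) : 0 < al <= 0.00576 -> 304 * exp (- (0.38 / al)) <= / 2 * (al ^ 7 * sqrt al).
Proof.
move=> [H0 H1].
have Ia : 0 < / al by exact: Rinv_0_lt_compat.
have Y0 : 0 <= 0.38 / al by apply: Rmult_le_pos; lra.
have := pow_le_exp 32 (0.38 / al) ltac:(lia) Y0.
set c := 2.7 * 0.38 / 32.
have -> : 2.7 * (0.38 / al) / INR 32 = c / al by rewrite /c INR_IZR_INZ; cbn [Z.of_nat Pos.of_succ_nat Pos.succ]; field; lra.
have Pc : 0 < (c / al) ^ 32 by apply: pow_lt; apply: Rmult_lt_0_compat => //; rewrite /c; lra.
move=> X; rewrite exp_Ropp.
apply: (Rle_trans _ (304 * (al / c) ^ 32)).
  apply: Rmult_le_compat_l; first lra.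
  have -> : (al / c) ^ 32 = / (c / al) ^ 32.
    by rewrite -pow_inv; congr (_ ^ _); rewrite /c; field; lra.
  exact: Rinv_le_contravar.
have Pd : 0 <= al / c by rewrite /c; apply: Rmult_le_pos; lra.
have B1 : al / c <= 0.1799.
  by rewrite /c; lra.
have Ss := sqrt_sqrt al (Rlt_le _ _ H0).
have Sp := sqrt_pos al.
have S1 : sqrt al <= 1 by rewrite -sqrt_1; apply: sqrt_le_1; lra.
have B2 : (al / c) ^ 24 <= 0.1799 ^ 24 by apply: pow_incr.
have -> : 304 * (al / c) ^ 32 = (304 * / c ^ 8 * (al / c) ^ 24) * (al ^ 7 * (sqrt al * sqrt al)).
  by rewrite Ss; field; rewrite /c; lra.
have Pa7 : 0 < al ^ 7 by exact: pow_lt.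
have N1 : 304 * / c ^ 8 * (al / c) ^ 24 <= / 2.
  apply: (Rle_trans _ (304 * / c ^ 8 * 0.1799 ^ 24)).
    by apply: Rmult_le_compat_l => //; apply: Rmult_le_pos; [lra | left; apply: Rinv_0_lt_compat; apply: pow_lt; rewrite /c; lra].
  by rewrite /c; lra.
have P8 : 0 <= 304 * / c ^ 8 * (al / c) ^ 24.
  by apply: Rmult_le_pos; [apply: Rmult_le_pos; [lra | left; apply: Rinv_0_lt_compat; apply: pow_lt; rewrite /c; lra] | exact: pow_le].
apply: Rmult_le_compat => //; first by apply: Rmult_le_pos; [lra | nra].
by apply: Rmult_le_compat_l; [lra | nra].
Qed.

(** With [n al = kap / al], undoing the weight [e^(- n al)] turns [e^(kap / al)] into
    [e^(2 kap / al)]. The major arc contributes [al^6] times the window width [al^(3/2)]; each arc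
    is allotted half of the bound. *)
Theorem unim_vtot (p : nat -> nat -> R) (n : nat) (al : R) : part_rec p -> 0 < al <= 0.00576 ->
  INR n * al = kap / al ->
  Rabs (unim p n - vtot n) <= al ^ 7 * sqrt al * exp (2 * kap / al).
Proof.
move=> Hp Ha Hn; have PI0 := PI_bounds; have K := kap_bounds; have [Ha0 Ha1] := Ha.
have Pa3 : 0 < al ^ 3 by exact: pow_lt.
pose M1 := (1.25 * al) ^ 6 / PI * exp (kap / al); pose M2 := 304 * exp ((kap - 0.38) / al).
(* Chosen so that [2 t^2 / al^3 = (t / r)^2]. *)
pose r := al * sqrt al / sqrt 2.
have Sa : 0 < sqrt al by exact: sqrt_lt_R0.
have S2 : 0 < sqrt 2 by apply: sqrt_lt_R0; lra.
have Pr : 0 < r by apply: Rmult_lt_0_compat; [exact: Rmult_lt_0_compat | exact: Rinv_0_lt_compat].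
have r2 : r ^ 2 = al ^ 3 / 2.
  have X1 := sqrt_sqrt al ltac:(lra); have X2 := sqrt_sqrt 2 ltac:(lra).
  rewrite /r (_ : (al * sqrt al / sqrt 2) ^ 2 = al ^ 2 * (sqrt al * sqrt al) / (sqrt 2 * sqrt 2)); last by field; lra.
  by rewrite X1 X2; field.
pose B t := M1 * / (1 + 2 * t ^ 2 / al ^ 3) + M2.
pose G t := M1 * (r * atan (t / r)) + M2 * t.
have HG t : is_derive G t (B t).
  have Q : 0 < r * r + t * t by have := pow2_ge_0 t; nra.
  rewrite /G /B; auto_derive => //.
  rewrite (_ : 2 * t ^ 2 / al ^ 3 = (t / r) ^ 2); last first.
    by rewrite (_ : (t / r) ^ 2 = t ^ 2 / r ^ 2); [rewrite r2; field; lra | field; lra].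
  by rewrite /Rsqr; field; split; nra.
have M1p : 0 <= M1.
  apply: Rmult_le_pos; last by left; exact: exp_pos.
  by apply: Rmult_le_pos; [apply: pow_le; lra | left; apply: Rinv_0_lt_compat; lra].
have E300 : 300 <= M2.
  have Ia : 0 < / al by exact: Rinv_0_lt_compat.
  have : exp 0 <= exp ((kap - 0.38) / al) by apply: exp_le; apply: Rmult_le_pos; lra.
  by rewrite exp_0 /M2; lra.
have HB t : Rabs t <= PI -> Cmod (CSer (fun k => RtoC (unim p k) * cexp (- (al, t)) ^ k)%C - CSer (fun k => RtoC (vtot k) * cexp (- (al, t)) ^ k)%C) <= B t.
  move=> Ht; rewrite /B.
  have Pq : 0 < / (1 + 2 * t ^ 2 / al ^ 3).
    apply: Rinv_0_lt_compat.
    have : 0 <= 2 * t ^ 2 / al ^ 3 by apply: Rmult_le_pos; [have := pow2_ge_0 t; lra | left; exact: Rinv_0_lt_compat].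
    lra.
  case: (Rle_dec (Rabs t) (3 / 4 * al)) => H.
    by have := major_diff p al t Hp Ha H; rewrite /M1; lra.
  have := minor_diff p al t Hp Ha ltac:(lra); rewrite -/M2.
  by have := Rmult_le_pos _ _ M1p (Rlt_le _ _ Pq); lra.
have As t : Rabs t <= PI -> asum (fun k => RtoC (unim p k) * cexp (- (al, t)) ^ k)%C /\ asum (fun k => RtoC (vtot k) * cexp (- (al, t)) ^ k)%C.
  move=> Ht; split; first exact: (proj1 (unim_series p (al, t) Hp Ha0)).
  by apply: (proj1 (vtot_series (al, t) _ _)) => //=; lra.
have GB : G PI - G (- PI) <= PI * (M1 * r) + 2 * PI * M2.
  rewrite /G.
  have A1 := atan_bound (PI / r); have A2 := atan_bound (- PI / r).
  have P1 : 0 <= M1 * r by nra.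
  have : M1 * r * (atan (PI / r) - atan (- PI / r)) <= M1 * r * PI by apply: Rmult_le_compat_l; lra.
  lra.
(* [fourier_bound] is one-sided, so it is applied to the difference and to its opposite. *)
have Key s : s = 1 \/ s = - 1 -> s * (unim p n - vtot n) * exp (- (INR n * al)) <= M1 * r / 2 + M2.
  move=> Hs; pose w k := s * (unim p k - vtot k).
  have Ew t k : (RtoC (w k) * cexp (- (al, t)) ^ k = RtoC s * (RtoC (unim p k) * cexp (- (al, t)) ^ k - RtoC (vtot k) * cexp (- (al, t)) ^ k))%C.
    by rewrite /w RtoC_mult RtoC_minus; ring.
  have F := fourier_bound w al n B G.
  have {}F : 2 * PI * (w n * exp (- (INR n * al))) <= G PI - G (- PI).
    apply: F => // [|t Ht].
      have -> : RtoC al = (al, 0) by [].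
      have [A1 A2] := As 0 ltac:(rewrite Rabs_R0; lra).
      by apply: asum_ext (asum_scal (RtoC s) _ (asum_minus _ _ A1 A2)) => k; rewrite Ew.
    have [A1 A2] := As t Ht.
    rewrite (CSer_ext _ _ (Ew t)) CSer_scal; last exact: asum_minus.
    rewrite CSer_minus // Cmod_mult Cmod_R (_ : Rabs s = 1) ?Rmult_1_l; first exact: HB.
    by case: Hs => ->; rewrite ?Rabs_Ropp Rabs_R1.
  apply: (Rmult_le_reg_l (2 * PI)); first lra.
  have -> : 2 * PI * (M1 * r / 2 + M2) = PI * (M1 * r) + 2 * PI * M2 by field.
  rewrite /w in F; lra.
have Ep := exp_pos (- (INR n * al)).
have Ab : Rabs (unim p n - vtot n) * exp (- (INR n * al)) <= M1 * r / 2 + M2.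
  rewrite /Rabs; case: Rcase_abs => _; [have := Key (- 1) (or_intror erefl) | have := Key 1 (or_introl erefl)]; lra.
rewrite Hn in Ab.
have -> : exp (2 * kap / al) = exp (kap / al) * exp (kap / al).
  by rewrite -exp_plus; congr exp; field; lra.
have Pe := exp_pos (kap / al).
have {}Ab : Rabs (unim p n - vtot n) <= (M1 * r / 2 + M2) * exp (kap / al).
  have := Rmult_le_compat_r _ _ _ (Rlt_le _ _ Pe) Ab.
  by rewrite Rmult_assoc -exp_plus (_ : - (kap / al) + kap / al = 0) ?exp_0; lra.
apply: Rle_trans Ab _; rewrite -Rmult_assoc; apply: Rmult_le_compat_r; first lra.
have -> : M2 = (304 * exp (- (0.38 / al))) * exp (kap / al).
  by rewrite /M2 Rmult_assoc -exp_plus; congr (_ * exp _); field; lra.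
have Q1 := exp_minor_small al Ha.
have Q2 : (1.25 * al) ^ 6 / PI * r / 2 <= / 2 * (al ^ 7 * sqrt al).
  have W : / (sqrt 2 * PI) <= / (1.4 * 3.139).
    apply: Rinv_le_contravar; first lra.
    have : 1.4 <= sqrt 2 by rewrite -(sqrt_square 1.4); [apply: sqrt_le_1; lra | lra].
    nra.
  rewrite /r (_ : (1.25 * al) ^ 6 / PI * (al * sqrt al / sqrt 2) / 2 = / (sqrt 2 * PI) * (1.25 ^ 6 / 2) * (al ^ 7 * sqrt al)); last by field; lra.
  apply: Rmult_le_compat_r; last by lra.
  by apply: Rmult_le_pos; [apply: pow_le; lra | lra].
rewrite /M1; have : ((1.25 * al) ^ 6 / PI * r / 2 + 304 * exp (- (0.38 / al))) * exp (kap / al) <= al ^ 7 * sqrt al * exp (kap / al) by apply: Rmult_le_compat_r; lra.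
rewrite /Rdiv; lra.
Qed.

(** * Laplace's method for Bessel functions *)

Lemma RInt_antideriv (F f : R -> R) (a b : R) : a <= b ->
  (forall x, is_derive F x (f x)) -> (forall x, ex_derive f x) ->
  is_RInt f a b (F b - F a).
Proof.
move=> Hab HF Hf; apply: (is_RInt_derive F f) => x _; first exact: HF.
exact: ex_derive_continuous.
Qed.

Lemma ex_RInt_derive (f : R -> R) (a b : R) : (forall x, ex_derive f x) -> ex_RInt f a b.
Proof. by move=> Hf; apply: ex_RInt_continuous => x _; exact: ex_derive_continuous. Qed.

Definition wal (nu m : nat) : R := RInt (fun s => cos s ^ m * sin s ^ (2 * nu)) 0 PI.

Lemma is_RInt_wal (nu m : nat) : is_RInt (fun s => cos s ^ m * sin s ^ (2 * nu)) 0 PI (wal nu m).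
Proof. by apply: RInt_correct; apply: ex_RInt_derive => x; auto_derive. Qed.

(** Integration over [[0, PI]] of the derivative of [cos^(m+1) sin^(2 nu + 1)], a function vanishing
    at both ends. *)
Lemma wal_rec (nu m : nat) : INR (m + 2 + 2 * nu) * wal nu (m + 2) = INR (m + 1) * wal nu m.
Proof.
have PI0 := PI_bounds.
have D : is_RInt (fun s => INR (m + 2 + 2 * nu) * (cos s ^ (m + 2) * sin s ^ (2 * nu)) - INR (m + 1) * (cos s ^ m * sin s ^ (2 * nu))) 0 PI
   (cos PI ^ (m + 1) * sin PI ^ (2 * nu + 1) - cos 0 ^ (m + 1) * sin 0 ^ (2 * nu + 1)).
  apply: (RInt_antideriv (fun s => cos s ^ (m + 1) * sin s ^ (2 * nu + 1))); first lra.
    move=> x; auto_derive => //.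
    have -> : Nat.pred (m + 1) = m by lia.
    have -> : Nat.pred (2 * nu + 1) = (2 * nu)%nat by lia.
    have C2 : sin x * sin x = 1 - cos x * cos x by have := sin2_cos2 x; rewrite /Rsqr; lra.
    change (nu + (nu + 0))%nat with (2 * nu)%nat; move: (2 * nu)%nat => k.
    rewrite !plus_INR !pow_add (_ : INR 2 = 2) // (_ : INR 1 = 1) // !pow_1.
    have -> : cos x ^ 2 = cos x * cos x by ring.
    transitivity (- (INR m + 1) * cos x ^ m * sin x ^ k * (sin x * sin x) + (INR k + 1) * cos x ^ m * sin x ^ k * (cos x * cos x)); first ring.
    by rewrite C2; ring.
  by move=> x; auto_derive.
rewrite sin_PI sin_0 !pow_add !pow_1 !Rmult_0_r Rminus_0_r in D.
have D2 := is_RInt_minus _ _ _ _ _ _ (is_RInt_scal _ _ _ (INR (m + 2 + 2 * nu)) _ (is_RInt_wal nu (m + 2))) (is_RInt_scal _ _ _ (INR (m + 1)) _ (is_RInt_wal nu m)).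
have := is_RInt_unique _ _ _ _ D; rewrite (is_RInt_unique _ _ _ _ D2).
rewrite /minus /plus /opp /scal /= /mult /=; lra.
Qed.

Lemma wal_1 (nu : nat) : wal nu 1 = 0.
Proof.
have PI0 := PI_bounds.
have D : is_RInt (fun s => cos s ^ 1 * sin s ^ (2 * nu)) 0 PI (sin PI ^ (2 * nu + 1) / INR (2 * nu + 1) - sin 0 ^ (2 * nu + 1) / INR (2 * nu + 1)).
  have N : INR (2 * nu + 1) <> 0 by apply: not_0_INR; lia.
  apply: (RInt_antideriv (fun s => sin s ^ (2 * nu + 1) / INR (2 * nu + 1))); first lra.
    move=> x; auto_derive => //.
    by rewrite (_ : Nat.pred (2 * nu + 1) = (2 * nu)%nat); [field | lia].
  by move=> x; auto_derive.
rewrite /wal (is_RInt_unique _ _ _ _ D) sin_PI sin_0 !pow_add !pow_1; ring.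
Qed.

Lemma wal_odd (nu s : nat) : wal nu (2 * s + 1) = 0.
Proof.
elim: s => [|s IH]; first exact: wal_1.
have := wal_rec nu (2 * s + 1); rewrite IH Rmult_0_r.
rewrite (_ : (2 * s + 1 + 2 = 2 * S s + 1)%nat); last lia.
case/Rmult_integral => //; have : 0 < INR (2 * S s + 1 + 2 * nu) by apply: lt_0_INR; lia.
lra.
Qed.

Lemma wal_even (nu s : nat) (z : R) :
  z ^ (2 * s) / INR (fact (2 * s)) * wal nu (2 * s) =
  wal nu 0 * INR (fact nu) * ((z / 2) ^ (2 * s) / (INR (fact s) * INR (fact (s + nu)))).
Proof.
elim: s => [|s IH].
  by rewrite /=; field; exact: INR_fact_neq_0.
have E := wal_rec nu (2 * s); have F k := INR_fact_neq_0 k.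
have N k : INR (S k) <> 0 by apply: not_0_INR.
rewrite (_ : (2 * s + 2 + 2 * nu = 2 * S (s + nu))%nat) in E; last lia.
rewrite (_ : (2 * s + 2 = 2 * S s)%nat) in E; last lia.
rewrite mult_INR (_ : (2 * s + 1 = S (2 * s))%nat) in E; last lia.
have E2 : wal nu (2 * S s) = INR (S (2 * s)) / (2 * INR (S (s + nu))) * wal nu (2 * s).
  apply: (Rmult_eq_reg_l (INR 2 * INR (S (s + nu)))); last by apply: Rmult_integral_contrapositive_currified => //; rewrite /=; lra.
  by rewrite E (_ : INR 2 = 2) //; field.
rewrite E2 (_ : (2 * S s = S (S (2 * s)))%nat); last lia.
rewrite (_ : (S s + nu = S (s + nu))%nat) // !fact_simpl !mult_INR (_ : INR (S (S (2 * s))) = 2 * INR (S s)); last first.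
  by rewrite !S_INR mult_INR /=; ring.
rewrite (_ : (z / 2) ^ S (S (2 * s)) = (z / 2) ^ 2 * (z / 2) ^ (2 * s)); last by rewrite /=; ring.
rewrite (_ : z ^ S (S (2 * s)) = z ^ 2 * z ^ (2 * s)); last by rewrite /=; ring.
transitivity (z ^ 2 / (4 * INR (S s) * INR (S (s + nu))) * (z ^ (2 * s) / INR (fact (2 * s)) * wal nu (2 * s))).
  by field; repeat split.
by rewrite IH; field; repeat split.
Qed.

(** Poisson's integral for the modified Bessel function, while [bf] is the power series of
    [(z / 2)^(- nu) I_nu (z)]. *)
Definition bj (nu : nat) (z : R) : R := RInt (fun s => exp (z * cos s) * sin s ^ (2 * nu)) 0 PI.

Definition bf (nu : nat) (z : R) : R :=
  Series (fun s => (z / 2) ^ (2 * s) / (INR (fact s) * INR (fact (s + nu)))).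

Lemma exp_rsum_err (x z : R) (N : nat) : Rabs x <= z ->
  Rabs (exp x - rsum (fun k => x ^ k / INR (fact k)) N) <= exp z - rsum (fun k => z ^ k / INR (fact k)) N.
Proof.
move=> H; have [Sx Ex] := ex_series_exp x; have [Sz Ez] := ex_series_exp z.
have L (y : R) : is_lim_seq (fun M => rsum (fun k => y ^ k / INR (fact k)) (N + M) - rsum (fun k => y ^ k / INR (fact k)) N)
    (exp y - rsum (fun k => y ^ k / INR (fact k)) N).
  apply: is_lim_seq_minus'; last exact: is_lim_seq_const.
  have [Sy <-] := ex_series_exp y.
  have := Series_rsum_lim _ Sy; rewrite (is_lim_seq_incr_n _ N).
  by apply: is_lim_seq_ext => M; rewrite Nat.add_comm.
have := is_lim_seq_le _ _ _ _ _ (is_lim_seq_abs _ _ (L x)) (L z); apply => M.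
have T (y : R) : rsum (fun k => y ^ k / INR (fact k)) (N + M) - rsum (fun k => y ^ k / INR (fact k)) N = rsum (fun k => y ^ (N + k) / INR (fact (N + k))) M.
  by elim: M => [|M IH]; rewrite ?Nat.add_0_r ?Nat.add_succ_r ?rsum_S /= -?IH; ring.
rewrite !T; elim: M {T} => [|M IH]; first by rewrite /= Rabs_R0; lra.
rewrite !rsum_S; apply: Rle_trans (Rabs_triang _ _) _; apply: Rplus_le_compat => //.
rewrite Rabs_mult (Rabs_pos_eq (/ _)); last by left; exact: inv_fact_pos.
apply: Rmult_le_compat_r; first by left; exact: inv_fact_pos.
by rewrite -RPow_abs; apply: pow_incr; split => //; exact: Rabs_pos.
Qed.

Lemma ex_series_bf (nu : nat) (z : R) :
  ex_series (fun s => (z / 2) ^ (2 * s) / (INR (fact s) * INR (fact (s + nu)))).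
Proof.
have [Se _] := ex_series_exp ((z / 2) ^ 2).
apply: (ex_series_le0 _ _ _ Se) => s; rewrite pow_mult.
have P : 0 <= ((z / 2) ^ 2) ^ s by apply: pow_le; exact: pow2_ge_0.
split; first by apply: Rmult_le_pos => //; rewrite Rinv_mult; apply: Rmult_le_pos; left; exact: inv_fact_pos.
apply: Rmult_le_compat_l => //; apply: Rinv_le_contravar; first exact: INR_fact_lt_0.
have : 1 <= INR (fact (s + nu)) by apply: (le_INR 1); have := lt_O_fact (s + nu); lia.
by have := INR_fact_lt_0 s; nra.
Qed.

(** By [exp_rsum_err] the exponential series of [z cos s] converges uniformly in [s] and may be
    integrated term by term. Odd Wallis integrals vanish, so the partial sums of even length are
    those of [bf]. *)
Lemma bj_bf (nu : nat) (z : R) : 0 <= z -> bj nu z = wal nu 0 * INR (fact nu) * bf nu z.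
Proof.
move=> Hz; have PI0 := PI_bounds; have [Sz Ez] := ex_series_exp z.
pose g N s := rsum (fun k => (z * cos s) ^ k / INR (fact k)) N * sin s ^ (2 * nu).
have Ig N : is_RInt (g N) 0 PI (rsum (fun k => z ^ k / INR (fact k) * wal nu k) N).
  elim: N => [|N IH].
    apply: (is_RInt_ext (fun _ => 0)) => [s _|]; first by rewrite /g /= Rmult_0_l.
    by have := is_RInt_const 0 PI 0; rewrite /scal /= /mult /= Rmult_0_r.
  apply: (is_RInt_ext (fun s => plus (g N s) (scal (z ^ N / INR (fact N)) (cos s ^ N * sin s ^ (2 * nu))))).
    by move=> s _; rewrite /plus /scal /= /mult /= /g rsum_S Rpow_mult_distr /=; field; exact: INR_fact_neq_0.
  by rewrite rsum_S; apply: is_RInt_plus => //; apply: is_RInt_scal; exact: is_RInt_wal.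
have Ij : is_RInt (fun s => exp (z * cos s) * sin s ^ (2 * nu)) 0 PI (bj nu z).
  by apply: RInt_correct; apply: ex_RInt_derive => x; auto_derive.
have B N : Rabs (bj nu z - rsum (fun k => z ^ k / INR (fact k) * wal nu k) N) <= PI * (exp z - rsum (fun k => z ^ k / INR (fact k)) N).
  have D := is_RInt_minus _ _ _ _ _ _ Ij (Ig N).
  have -> : PI * (exp z - rsum (fun k => z ^ k / INR (fact k)) N) = (PI - 0) * (exp z - rsum (fun k => z ^ k / INR (fact k)) N) by ring.
  apply: (norm_RInt_le_const _ _ _ _ _ _ _ D); first lra.
  move=> s Hs; rewrite /minus /plus /opp /norm /= /abs /= /g.
  have Zs : Rabs (z * cos s) <= z.
    rewrite Rabs_mult (Rabs_pos_eq z) //; have := COS_bound s => Hc.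
    have : Rabs (cos s) <= 1 by apply: Rabs_le; lra.
    by have := Rabs_pos (cos s); nra.
  have E := exp_rsum_err _ _ N Zs.
  set X := exp _ in E *; set Y := rsum _ N in E *.
  rewrite (_ : X * sin s ^ (nu + (nu + 0)) + - (Y * sin s ^ (nu + (nu + 0))) = (X - Y) * sin s ^ (2 * nu)); last by rewrite /=; ring.
  rewrite Rabs_mult; have S1 : Rabs (sin s ^ (2 * nu)) <= 1.
    rewrite -RPow_abs -(pow1 (2 * nu)); apply: pow_incr; split; first exact: Rabs_pos.
    by apply: Rabs_le; have := SIN_bound s; lra.
  by have := Rabs_pos (X - Y); have := Rabs_pos (sin s ^ (2 * nu)); nra.
have L : is_lim_seq (rsum (fun k => z ^ k / INR (fact k) * wal nu k)) (bj nu z).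
  have T : is_lim_seq (fun N => PI * (exp z - rsum (fun k => z ^ k / INR (fact k)) N)) 0.
    have -> : Finite 0 = Rbar_mult PI (exp z - exp z) by congr Finite; ring.
    apply: is_lim_seq_scal_l; apply: is_lim_seq_minus'; first exact: is_lim_seq_const.
    by rewrite -Ez; exact: Series_rsum_lim.
  apply: (is_lim_seq_le_le (fun N => bj nu z - PI * (exp z - rsum (fun k => z ^ k / INR (fact k)) N)) _
     (fun N => bj nu z + PI * (exp z - rsum (fun k => z ^ k / INR (fact k)) N))).
  - by move=> N; have := B N; move=> /Rabs_le_between; lra.
  - rewrite -[X in Finite X]Rminus_0_r; apply: is_lim_seq_minus' => //; exact: is_lim_seq_const.
  - rewrite -[X in Finite X]Rplus_0_r; apply: is_lim_seq_plus' => //; exact: is_lim_seq_const.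
have L2 : is_lim_seq (fun N => rsum (fun k => z ^ k / INR (fact k) * wal nu k) (2 * N)) (bj nu z).
  by apply: (is_lim_seq_subseq _ _ (fun N => 2 * N)%nat) L; apply: eventually_subseq => n; lia.
have Sb := ex_series_bf nu z.
have L3 : is_lim_seq (fun N => wal nu 0 * INR (fact nu) * rsum (fun s => (z / 2) ^ (2 * s) / (INR (fact s) * INR (fact (s + nu)))) N) (wal nu 0 * INR (fact nu) * bf nu z).
  have -> : Finite (wal nu 0 * INR (fact nu) * bf nu z) = Rbar_mult (wal nu 0 * INR (fact nu)) (bf nu z) by [].
  by apply: is_lim_seq_scal_l; exact: Series_rsum_lim.
have := is_lim_seq_unique _ _ L3; rewrite (is_lim_seq_unique _ (bj nu z)); first by case.
apply: is_lim_seq_ext L2; elim => [|N IH]; first by rewrite /= Rmult_0_r.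
rewrite (_ : (2 * S N = S (S (2 * N)))%nat); last lia.
rewrite !rsum_S IH (_ : (S (2 * N) = 2 * N + 1)%nat); last lia.
by rewrite wal_odd wal_even; ring.
Qed.

Lemma wal_1_0 : wal 1 0 = PI / 2.
Proof.
have PI0 := PI_bounds.
have D : is_RInt (fun s => cos s ^ 0 * sin s ^ (2 * 1)) 0 PI ((PI - sin PI * cos PI) / 2 - (0 - sin 0 * cos 0) / 2).
  apply: (RInt_antideriv (fun s => (s - sin s * cos s) / 2)); first lra.
    move=> x; auto_derive => //; have := sin2_cos2 x; rewrite /Rsqr /= => H; lra.
  by move=> x; auto_derive.
by rewrite /wal (is_RInt_unique _ _ _ _ D) sin_PI sin_0; field.
Qed.

Lemma wal_2_0 : wal 2 0 = 3 * PI / 8.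
Proof.
have PI0 := PI_bounds.
have D : is_RInt (fun s => cos s ^ 0 * sin s ^ (2 * 2)) 0 PI
   ((3 * PI / 8 - 3 / 8 * (sin PI * cos PI) - sin PI ^ 3 * cos PI / 4) - (3 * 0 / 8 - 3 / 8 * (sin 0 * cos 0) - sin 0 ^ 3 * cos 0 / 4)).
  apply: (RInt_antideriv (fun s => 3 * s / 8 - 3 / 8 * (sin s * cos s) - sin s ^ 3 * cos s / 4)); first lra.
    move=> x; auto_derive => //.
    have C2 : cos x * cos x = 1 - sin x * sin x by have := sin2_cos2 x; rewrite /Rsqr; lra.
    transitivity (3 / 8 - 3 / 8 * (cos x * cos x) + 3 / 8 * (sin x * sin x) - 3 / 4 * (sin x * sin x) * (cos x * cos x) + sin x ^ 4 / 4); first by rewrite /=; field.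
    by rewrite C2 /=; field.
  by move=> x; auto_derive.
by rewrite /wal (is_RInt_unique _ _ _ _ D) sin_PI sin_0; field.
Qed.

(** Gaussian moments truncated to [[0, 1]], as they arise from the substitution [x = sin (s / 2)].
    The truncation shows up only as the boundary term [exp (- (2 * z))] in [gm_rec]. *)
Definition gm (z : R) (m : nat) : R := RInt (fun x => exp (- (2 * z * x ^ 2)) * x ^ (2 * m)) 0 1.

Lemma is_RInt_gm (z : R) (m : nat) : is_RInt (fun x => exp (- (2 * z * x ^ 2)) * x ^ (2 * m)) 0 1 (gm z m).
Proof. by apply: RInt_correct; apply: ex_RInt_derive => x; auto_derive. Qed.

Lemma gm_rec (z : R) (m : nat) : 4 * z * gm z (S m) = INR (2 * m + 1) * gm z m - exp (- (2 * z)).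
Proof.
have D : is_RInt (fun x => INR (2 * m + 1) * (exp (- (2 * z * x ^ 2)) * x ^ (2 * m)) - 4 * z * (exp (- (2 * z * x ^ 2)) * x ^ (2 * S m))) 0 1
   (exp (- (2 * z * 1 ^ 2)) * 1 ^ (2 * m + 1) - exp (- (2 * z * 0 ^ 2)) * 0 ^ (2 * m + 1)).
  apply: (RInt_antideriv (fun x => exp (- (2 * z * x ^ 2)) * x ^ (2 * m + 1))); first lra.
    move=> x; auto_derive => //.
    change (m + (m + 0))%nat with (2 * m)%nat.
    have -> : Nat.pred (2 * m + 1) = (2 * m)%nat by lia.
    have -> : (2 * S m = 2 * m + 2)%nat by lia.
    by rewrite !pow_add /=; ring.
  by move=> x; auto_derive.
have D2 := is_RInt_minus _ _ _ _ _ _ (is_RInt_scal _ _ _ (INR (2 * m + 1)) _ (is_RInt_gm z m)) (is_RInt_scal _ _ _ (4 * z) _ (is_RInt_gm z (S m))).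
have E : INR (2 * m + 1) * gm z m - 4 * z * gm z (S m) = _ := eq_trans (eq_sym (is_RInt_unique _ _ _ _ D2)) (is_RInt_unique _ _ _ _ D).
rewrite !pow1 pow_add pow_1 !Rmult_0_r !Rmult_1_r Rminus_0_r in E.
lra.
Qed.

Lemma is_RInt_sin_half (z : R) (m : nat) :
  is_RInt (fun s => exp (- (2 * z * sin (s / 2) ^ 2)) * sin (s / 2) ^ (2 * m) * cos (s / 2)) 0 PI (2 * gm z m).
Proof.
have PI0 := PI_bounds.
have H : is_RInt (fun s => scal (cos (s / 2) / 2) (exp (- (2 * z * sin (s / 2) ^ 2)) * sin (s / 2) ^ (2 * m))) 0 PI
   (RInt (fun x => exp (- (2 * z * x ^ 2)) * x ^ (2 * m)) (sin (0 / 2)) (sin (PI / 2))).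
  apply: (is_RInt_comp (fun x => exp (- (2 * z * x ^ 2)) * x ^ (2 * m)) (fun s => sin (s / 2)) (fun s => cos (s / 2) / 2)).
    by move=> x _; apply: ex_derive_continuous; auto_derive.
  move=> x _; split; first by auto_derive => //; rewrite /Rdiv; ring.
  by apply: ex_derive_continuous; auto_derive.
rewrite sin_PI2 (_ : 0 / 2 = 0) ?sin_0 -/(gm z m) in H; last by field.
apply: is_RInt_ext (is_RInt_scal _ _ _ 2 _ H) => s _.
by rewrite /scal /= /mult /=; field.
Qed.

Lemma is_RInt_rsum (f : nat -> R -> R) (v : nat -> R) (a b : R) (n : nat) :
  (forall k, is_RInt (f k) a b (v k)) -> is_RInt (fun s => rsum (fun k => f k s) n) a b (rsum v n).
Proof.
move=> H; elim: n => [|n IH].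
  by have := is_RInt_const a b 0; rewrite /scal /= /mult /= Rmult_0_r.
apply: (is_RInt_ext (fun s => plus (rsum (fun k => f k s) n) (f n s))) => [s _|].
  by rewrite rsum_S.
by rewrite rsum_S; exact: is_RInt_plus.
Qed.

(* With [x = sin (s / 2)] and [c = cos (s / 2)] one has [cos s = 1 - 2 x^2], [sin s = 2 x c] and [2 dx = c ds]. *)
Lemma bj_laplace (nu : nat) (z : R) (p : nat -> R) (N d : nat) :
  (forall c, 0 <= c <= 1 -> Rabs (c ^ (2 * nu + 1) - rsum (fun k => p k * (1 - c ^ 2) ^ k) N) <= (1 - c ^ 2) ^ d) ->
  Rabs (bj (S nu) z - 2 * 4 ^ S nu * exp z * rsum (fun k => p k * gm z (S nu + k)) N) <= 2 * 4 ^ S nu * exp z * gm z (S nu + d).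
Proof.
move=> Hp; have PI0 := PI_bounds.
pose h m s := exp (- (2 * z * sin (s / 2) ^ 2)) * sin (s / 2) ^ (2 * m) * cos (s / 2).
have Ij : is_RInt (fun s => exp (z * cos s) * sin s ^ (2 * S nu)) 0 PI (bj (S nu) z).
  by apply: RInt_correct; apply: ex_RInt_derive => x; auto_derive.
have Ip : is_RInt (fun s => 4 ^ S nu * exp z * rsum (fun k => p k * h (S nu + k)%nat s) N) 0 PI (4 ^ S nu * exp z * rsum (fun k => p k * (2 * gm z (S nu + k))) N).
  apply: is_RInt_scal; apply: (is_RInt_rsum (fun k s => p k * h (S nu + k)%nat s)) => k.
  by apply: is_RInt_scal; exact: is_RInt_sin_half.
have Id : is_RInt (fun s => 4 ^ S nu * exp z * h (S nu + d)%nat s) 0 PI (4 ^ S nu * exp z * (2 * gm z (S nu + d))).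
  by apply: is_RInt_scal; exact: is_RInt_sin_half.
have Ev : 4 ^ S nu * exp z * rsum (fun k => p k * (2 * gm z (S nu + k))) N = 2 * 4 ^ S nu * exp z * rsum (fun k => p k * gm z (S nu + k)) N.
  have -> : rsum (fun k => p k * (2 * gm z (S nu + k))) N = 2 * rsum (fun k => p k * gm z (S nu + k)) N.
    by elim: N {Hp Ip} => [|N IH]; rewrite ?rsum_S ?IH /=; ring.
  ring.
have Pt s : 0 < s < PI -> Rabs (exp (z * cos s) * sin s ^ (2 * S nu) - 4 ^ S nu * exp z * rsum (fun k => p k * h (S nu + k)%nat s) N) <= 4 ^ S nu * exp z * h (S nu + d)%nat s.
  move=> Hs; set c := cos (s / 2); set x := sin (s / 2).
  have C2 : x ^ 2 = 1 - c ^ 2 by have := sin2_cos2 (s / 2); rewrite /Rsqr /= -/c -/x; lra.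
  have Hc : 0 <= c <= 1.
    split; last by have := COS_bound (s / 2); rewrite -/c; lra.
    by apply: cos_ge_0; lra.
  have Hx : 0 <= x by apply: sin_ge_0; lra.
  have Ec : cos s = 1 - 2 * x ^ 2.
    by rewrite {1}(_ : s = 2 * (s / 2)); [rewrite cos_2a_sin -/x; ring | field].
  have Es : sin s = 2 * x * c.
    by rewrite {1}(_ : s = 2 * (s / 2)); [rewrite sin_2a | field].
  have Hh m : h (S nu + m)%nat s = exp (- (2 * z * x ^ 2)) * x ^ (2 * S nu) * c * (1 - c ^ 2) ^ m.
    rewrite /h -/x -/c -C2 (_ : (2 * (S nu + m) = 2 * S nu + 2 * m)%nat); last lia.
    by rewrite pow_add (pow_mult x 2 m); ring.
  have -> : rsum (fun k => p k * h (S nu + k)%nat s) N = exp (- (2 * z * x ^ 2)) * x ^ (2 * S nu) * c * rsum (fun k => p k * (1 - c ^ 2) ^ k) N.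
    by elim: N {Hp Ip Ev} => [|N IH]; rewrite ?rsum_S ?IH ?Hh /=; ring.
  have -> : exp (z * cos s) = exp z * exp (- (2 * z * x ^ 2)) by rewrite -exp_plus Ec; congr exp; ring.
  have -> : sin s ^ (2 * S nu) = 4 ^ S nu * x ^ (2 * S nu) * c * c ^ (2 * nu + 1).
    have E4 : 2 ^ (2 * S nu) = 4 ^ S nu by rewrite pow_mult; congr (_ ^ _); ring.
    have E5 : c ^ (2 * S nu) = c * c ^ (2 * nu + 1) by rewrite (_ : (2 * S nu = S (2 * nu + 1))%nat); [ | lia].
    rewrite Es 2!Rpow_mult_distr E5 E4; ring.
  rewrite Hh; set Q := rsum _ N; set X := exp (- _).
  have P0 : 0 <= 4 ^ S nu * exp z * X * x ^ (2 * S nu) * c.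
    have X0 := exp_pos (- (2 * z * x ^ 2)); have X1 := exp_pos z; have X2 : 0 < 4 ^ S nu by apply: pow_lt; lra.
    have X3 : 0 <= x ^ (2 * S nu) by exact: pow_le.
    move: X2 X3; move: (4 ^ S nu) (x ^ (2 * S nu)) => a b X2 X3.
    have Y1 := Rmult_lt_0_compat _ _ X2 X1; have Y2 := Rmult_lt_0_compat _ _ Y1 X0.
    by apply: Rmult_le_pos; [apply: Rmult_le_pos; [exact: Rlt_le |] | case: Hc].
  have -> : exp z * X * (4 ^ S nu * x ^ (2 * S nu) * c * c ^ (2 * nu + 1)) - 4 ^ S nu * exp z * (X * x ^ (2 * S nu) * c * Q) =
    4 ^ S nu * exp z * X * x ^ (2 * S nu) * c * (c ^ (2 * nu + 1) - Q) by ring.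
  rewrite Rabs_mult (Rabs_pos_eq _ P0).
  have -> : 4 ^ S nu * exp z * (X * x ^ (2 * S nu) * c * (1 - c ^ 2) ^ d) = 4 ^ S nu * exp z * X * x ^ (2 * S nu) * c * (1 - c ^ 2) ^ d by ring.
  by apply: Rmult_le_compat_l => //; exact: Hp.
have Df := is_RInt_minus _ _ _ _ _ _ Ij Ip; rewrite Ev in Df.
have Up := is_RInt_le _ _ 0 PI _ _ _ Df Id.
have Lo := is_RInt_le _ _ 0 PI _ _ _ (is_RInt_opp _ _ _ _ Id) Df.
have U : minus (bj (S nu) z) (2 * 4 ^ S nu * exp z * rsum (fun k => p k * gm z (S nu + k)) N) <= 4 ^ S nu * exp z * (2 * gm z (S nu + d)).
  by apply: Up; [lra | move=> s /Pt /Rabs_le_between; rewrite /minus /plus /opp /=; lra].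
have L : opp (4 ^ S nu * exp z * (2 * gm z (S nu + d))) <= minus (bj (S nu) z) (2 * 4 ^ S nu * exp z * rsum (fun k => p k * gm z (S nu + k)) N).
  by apply: Lo; [lra | move=> s /Pt /Rabs_le_between; rewrite /minus /plus /opp /=; lra].
rewrite /minus /plus /opp /= in U L; apply: Rabs_le; rewrite /=; lra.
Qed.

(** Taylor coefficients of [sqrt (1 - t)] up to degree 4, used with [t = 1 - c^2]. *)
Definition sqrt_coef (k : nat) : R := List.nth k (1 :: - (1 / 2) :: - (1 / 8) :: - (1 / 16) :: - (5 / 128) :: nil)%list 0.

(* The polynomial [1 - t] times that of [sqrt_coef], hence an approximation of [(1 - t)^(3/2)]. *)
Definition sqrt3_coef (k : nat) : R := List.nth k (1 :: - (3 / 2) :: 3 / 8 :: 1 / 16 :: 3 / 128 :: 5 / 128 :: nil)%list 0.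

Lemma sqrt_taylor (c : R) : 0 <= c <= 1 ->
  Rabs (c - rsum (fun k => sqrt_coef k * (1 - c ^ 2) ^ k) 5) <= (1 - c ^ 2) ^ 5.
Proof.
move=> Hc; rewrite /sqrt_coef /=.
have P5 : 0 <= (1 - c) ^ 5 by apply: pow_le; lra.
(* Both sides agree to order 5 at [c = 1], whence the factor [(1 - c)^5]. The cofactor is at most 1,
   hence at most [(1 + c)^5]. *)
set l := c - _; have -> : l = - ((1 - c) ^ 5 * ((35 + 47 * c + 25 * c ^ 2 + 5 * c ^ 3) / 128)).
  rewrite /l; field.
have Q0 : 0 <= (35 + 47 * c + 25 * c ^ 2 + 5 * c ^ 3) / 128 <= (1 + c) ^ 5.
  have C2 : 0 <= c * c <= 1 by nra.
  have C3 : 0 <= c * c * c <= 1 by nra.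
  have -> : 35 + 47 * c + 25 * c ^ 2 + 5 * c ^ 3 = 35 + 47 * c + 25 * (c * c) + 5 * (c * c * c) by ring.
  have := pow_R1_Rle (1 + c) 5 ltac:(lra).
  lra.
rewrite Rabs_Ropp Rabs_pos_eq; last nra.
have -> : (1 - c * (c * 1)) * ((1 - c * (c * 1)) * ((1 - c * (c * 1)) * ((1 - c * (c * 1)) * ((1 - c * (c * 1)) * 1)))) = (1 - c) ^ 5 * (1 + c) ^ 5 by ring.
apply: Rmult_le_compat_l; lra.
Qed.

Lemma sqrt3_taylor (c : R) : 0 <= c <= 1 ->
  Rabs (c ^ 3 - rsum (fun k => sqrt3_coef k * (1 - c ^ 2) ^ k) 6) <= (1 - c ^ 2) ^ 5.
Proof.
move=> Hc; have := sqrt_taylor c Hc; set l := rsum _ 5.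
have -> : rsum (fun k => sqrt3_coef k * (1 - c ^ 2) ^ k) 6 = c ^ 2 * l by rewrite /l /sqrt_coef /sqrt3_coef /=; field.
have -> : c ^ 3 - c ^ 2 * l = c ^ 2 * (c - l) by ring.
rewrite Rabs_mult (Rabs_pos_eq (c ^ 2)); last exact: pow2_ge_0.
have := Rabs_pos (c - l); have : 0 <= c ^ 2 <= 1 by nra.
nra.
Qed.

(** * The Gaussian integral over a finite interval *)

Definition gexp (x : R) : R := RInt (fun t => exp (- t ^ 2)) 0 x.
Definition gdual (x : R) : R := RInt (fun t => exp (- (x ^ 2 * (1 + t ^ 2))) / (1 + t ^ 2)) 0 1.

Lemma one_sqr_neq0 (t : R) : 1 + t ^ 2 <> 0.
Proof. by have := pow2_ge_0 t; lra. Qed.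

Lemma is_derive_gexp (x : R) : is_derive gexp x (exp (- x ^ 2)).
Proof.
apply: (is_derive_RInt (fun t => exp (- t ^ 2)) gexp 0 x).
  apply: filter_forall => b; apply: RInt_correct; apply: ex_RInt_derive => t; by auto_derive.
by apply: ex_derive_continuous; auto_derive.
Qed.

Lemma gexp_scale (x : R) : x * RInt (fun t => exp (- (x ^ 2 * t ^ 2))) 0 1 = gexp x.
Proof.
have H := RInt_comp_lin (fun t => exp (- t ^ 2)) x 0 0 1.
rewrite Rmult_0_r !Rplus_0_r Rmult_1_r in H.
rewrite -/(gexp x) in H; rewrite -H; last by apply: ex_RInt_derive => t; auto_derive.
have -> : x * RInt (fun t => exp (- (x ^ 2 * t ^ 2))) 0 1 = RInt (fun t => scal x (exp (- (x ^ 2 * t ^ 2)))) 0 1.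
  by rewrite RInt_scal //; apply: ex_RInt_derive => t; auto_derive.
apply: RInt_ext => t _; rewrite /scal /= /mult /=; congr (_ * exp _); ring.
Qed.

Lemma is_derive_gdual (x : R) : is_derive gdual x (- 2 * exp (- x ^ 2) * gexp x).
Proof.
pose f x t := exp (- (x ^ 2 * (1 + t ^ 2))) / (1 + t ^ 2).
have Df y t : is_derive (fun u => f u t) y (- (2 * y) * exp (- (y ^ 2 * (1 + t ^ 2)))).
  by have N := one_sqr_neq0 t; rewrite /f; auto_derive => //; simpl in *; field; contradict N; lra.
have H := is_derive_RInt_param f 0 1 x.
have -> : - 2 * exp (- x ^ 2) * gexp x = RInt (fun t => Derive (fun u => f u t) x) 0 1.
  rewrite -gexp_scale.
  rewrite (RInt_ext (fun t => Derive (fun u => f u t) x) (fun t => scal (- (2 * x) * exp (- x ^ 2)) (exp (- (x ^ 2 * t ^ 2))))); last first.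
    move=> t _; rewrite (is_derive_unique _ _ _ (Df x t)).
    change (- (2 * x) * exp (- (x ^ 2 * (1 + t ^ 2))) = - (2 * x) * exp (- x ^ 2) * exp (- (x ^ 2 * t ^ 2))).
    by rewrite Rmult_assoc -exp_plus; congr (_ * exp _); ring.
  rewrite RInt_scal; first by rewrite /scal /= /mult /=; ring.
  by apply: ex_RInt_derive => t; auto_derive.
apply: H.
- by apply: filter_forall => y t _; exists (- (2 * y) * exp (- (y ^ 2 * (1 + t ^ 2)))).
- move=> t _.
  apply: (continuity_2d_pt_ext (fun u v => - (2 * u) * exp (- (u ^ 2 * (1 + v ^ 2))))).
    by move=> u v; rewrite (is_derive_unique _ _ _ (Df u v)).
  apply: continuity_2d_pt_mult.
    apply: (continuity_2d_pt_ext (fun u v => (- 2) * u)); first by move=> u v; ring.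
    apply: continuity_2d_pt_mult; [exact: continuity_2d_pt_const | exact: continuity_2d_pt_id1].
  apply: (continuity_1d_2d_pt_comp exp).
    by apply: derivable_continuous_pt; exact: derivable_pt_exp.
  apply: (continuity_2d_pt_ext (fun u v => (- 1) * u * u * (1 + v * v))); first by move=> u v; ring.
  have K c : continuity_2d_pt (fun _ _ => c) x t by exact: continuity_2d_pt_const.
  have U := continuity_2d_pt_id1 x t; have V := continuity_2d_pt_id2 x t.
  by repeat first [exact: K | exact: U | exact: V | apply: continuity_2d_pt_mult | apply: continuity_2d_pt_plus].
- apply: filter_forall => y; apply: ex_RInt_derive => t; have N := one_sqr_neq0 t.
  by rewrite /f; auto_derive; simpl in *; lra.
Qed.

Lemma gdual_bound (x : R) : 0 <= gdual x <= exp (- x ^ 2).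
Proof.
have I : is_RInt (fun t => exp (- (x ^ 2 * (1 + t ^ 2))) / (1 + t ^ 2)) 0 1 (gdual x).
  apply: RInt_correct; apply: ex_RInt_derive => t; have N := one_sqr_neq0 t.
  by auto_derive; simpl in *; lra.
have C (c : R) : is_RInt (fun _ => c) 0 1 c.
  by have := is_RInt_const 0 1 c; rewrite /scal /= /mult /= (_ : (1 - 0) * c = c); last ring.
have P t : 0 < / (1 + t ^ 2) <= 1.
  have T := pow2_ge_0 t; split; first by apply: Rinv_0_lt_compat; lra.
  by rewrite -Rinv_1; apply: Rinv_le_contravar; lra.
split.
  apply: (is_RInt_le (fun _ => 0) _ 0 1 _ _ _ (C 0) I); first lra.
  by move=> t _; apply: Rmult_le_pos; [left; exact: exp_pos | have := P t; lra].
apply: (is_RInt_le _ (fun _ => exp (- x ^ 2)) 0 1 _ _ _ I (C _)); first lra.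
move=> t _; rewrite -[X in _ <= X]Rmult_1_r; apply: Rmult_le_compat.
- by left; exact: exp_pos.
- by have := P t; lra.
- by apply: exp_le; have := pow2_ge_0 t; have := pow2_ge_0 x; nra.
- by have := P t; lra.
Qed.

Lemma gdual_0 : gdual 0 = PI / 4.
Proof.
rewrite /gdual (RInt_ext _ (fun t => / (1 + t ^ 2))); last first.
  by move=> t _; rewrite (_ : - (0 ^ 2 * (1 + t ^ 2)) = 0) ?exp_0; [rewrite /Rdiv Rmult_1_l | ring].
have D : is_RInt (fun t => / (1 + t ^ 2)) 0 1 (atan 1 - atan 0).
  apply: (RInt_antideriv atan (fun t => / (1 + t ^ 2)) 0 1) => [|t|t]; first lra.
    have N := one_sqr_neq0 t; have := is_derive_atan t.
    by rewrite /Rsqr (_ : t * t = t ^ 2); last ring.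
  by have N := one_sqr_neq0 t; auto_derive.
by rewrite (is_RInt_unique _ _ _ _ D) atan_0 atan_1; ring.
Qed.

(** The left side has derivative 0 and equals [PI / 4] at 0. As [gdual x <= e^(- x^2)], this
    evaluates the Gaussian integral over [[0, x]] with an explicit error and without improper
    integrals. *)
Lemma gexp_sqr (x : R) : 0 <= x -> gexp x ^ 2 + gdual x = PI / 4.
Proof.
move=> Hx.
have G0 : gexp 0 = 0 by rewrite /gexp RInt_point.
have [|c [_ E]] := MVT_0 (fun x => gexp x ^ 2 + gdual x) (fun _ => 0) x Hx.
  move=> t _.
  have -> : 0 = INR 2 * exp (- t ^ 2) * gexp t ^ 1 + (- 2 * exp (- t ^ 2) * gexp t) by rewrite /=; ring.
  have H := is_derive_pow gexp 2 t _ (is_derive_gexp t).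
  exact: is_derive_Rplus H (is_derive_gdual t).
rewrite /= G0 gdual_0 in E; rewrite /=; lra.
Qed.

(** Normalised so that the value tends to the double factorial [(2 m - 1)!!] with an exponentially
    small error. *)
Definition mu (z : R) (m : nat) : R := sqrt (2 * PI * z) * (2 / PI) * (4 * z) ^ m * gm z m.

Lemma mu_0 (z : R) : 0 < z -> Rabs (mu z 0 - 1) <= 2 * exp (- (2 * z)).
Proof.
move=> Hz; have PI0 := PI_bounds.
pose x := sqrt (2 * z).
have Hx : 0 < x by apply: sqrt_lt_R0; lra.
have X2 : x ^ 2 = 2 * z by rewrite /x pow2_sqrt; lra.
have Eg : gm z 0 = gexp x / x.
  rewrite -gexp_scale X2 /gm.
  rewrite (RInt_ext _ (fun t => exp (- (2 * z * t ^ 2)))).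
    have F (I : R) : I = x * I / x by field; lra.
    exact: F.
  by move=> t _; rewrite Rmult_1_r.
have S := gexp_sqr x (Rlt_le _ _ Hx); have [B0 B1] := gdual_bound x.
have Sp : 0 < sqrt PI by apply: sqrt_lt_R0; lra.
have Sp2 : sqrt PI ^ 2 = PI by rewrite pow2_sqrt; lra.
have E : mu z 0 = 2 * gexp x / sqrt PI.
  rewrite /mu Eg (_ : 2 * PI * z = PI * (2 * z)); last ring.
  rewrite sqrt_mult; [|lra|lra]; rewrite -/x -{2}Sp2 /=; field; lra.
have P0 : 0 <= gexp x.
  rewrite /gexp; apply: RInt_ge_0; first lra.
    by apply: ex_RInt_derive => t; auto_derive.
  by move=> t _; left; exact: exp_pos.
have M0 : 0 <= mu z 0 by rewrite E; apply: Rmult_le_pos; [lra | left; exact: Rinv_0_lt_compat].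
have M2 : 1 - mu z 0 ^ 2 = 4 / PI * gdual x.
  rewrite E (_ : (2 * gexp x / sqrt PI) ^ 2 = 4 * gexp x ^ 2 / sqrt PI ^ 2); last by field; lra.
  rewrite Sp2 (_ : gexp x ^ 2 = PI / 4 - gdual x); last lra.
  by field; lra.
rewrite X2 in B1.
have M3 : 0 <= 1 - mu z 0 ^ 2 <= 2 * exp (- (2 * z)).
  rewrite M2; have Q : 0 < 4 / PI <= 2.
    split; first by apply: Rmult_lt_0_compat; [lra | apply: Rinv_0_lt_compat; lra].
    apply: (Rmult_le_reg_r PI); first lra.
    by rewrite /Rdiv Rmult_assoc Rinv_l; lra.
  nra.
by apply: Rabs_le; simpl in M3; nra.
Qed.

Lemma mu_rec (z : R) (m : nat) :
  mu z (S m) = INR (2 * m + 1) * mu z m - sqrt (2 * PI * z) * (2 / PI) * (4 * z) ^ m * exp (- (2 * z)).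
Proof.
have G := gm_rec z m.
transitivity (sqrt (2 * PI * z) * (2 / PI) * (4 * z) ^ m * (4 * z * gm z (S m))); first by rewrite /mu /=; ring.
by rewrite G /mu; ring.
Qed.

(** The bound is shaped for [exp_2z_small]: [4^7 z^13] absorbs [(4 z)^7] and [sqrt (2 PI z) <= z],
    leaving [z^(-5)]. *)
Lemma exp_2z_le (z : R) : 1000 <= z -> exp (- (2 * z)) <= / (4 ^ 7 * z ^ 13).
Proof.
move=> Hz.
have := pow_le_exp 20 (2 * z) ltac:(lia) ltac:(lra).
rewrite (_ : 2.7 * (2 * z) / INR 20 = 0.27 * z); last by rewrite INR_IZR_INZ; cbn [Z.of_nat Pos.of_succ_nat Pos.succ]; lra.
move=> H; rewrite exp_Ropp; apply: Rinv_le_contravar.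
  by apply: Rmult_lt_0_compat; apply: pow_lt; lra.
apply: Rle_trans H; rewrite (_ : (0.27 * z) ^ 20 = 0.27 ^ 20 * z ^ 7 * z ^ 13); last ring.
apply: Rmult_le_compat_r; first by apply: pow_le; lra.
apply: (Rle_trans _ (0.27 ^ 20 * 1000 ^ 7)); first lra.
by apply: Rmult_le_compat_l; [lra | apply: pow_incr; lra].
Qed.

Lemma exp_2z_small (z : R) (m : nat) : 1000 <= z -> (m <= 7)%nat ->
  0 <= sqrt (2 * PI * z) * (2 / PI) * (4 * z) ^ m * exp (- (2 * z)) <= (/ z) ^ 5.
Proof.
move=> Hz Hm; have PI0 := PI_bounds.
have S0 := sqrt_pos (2 * PI * z).
have Q : 0 < 2 / PI <= 1.
  split; first by apply: Rmult_lt_0_compat; [lra | apply: Rinv_0_lt_compat; lra].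
  apply: (Rmult_le_reg_r PI); first lra.
  by rewrite /Rdiv Rmult_assoc Rinv_l; lra.
have S1 : sqrt (2 * PI * z) <= z.
  rewrite -[X in _ <= X](sqrt_square z); last lra.
  by apply: sqrt_le_1; nra.
have P1 : 0 < (4 * z) ^ m by apply: pow_lt; lra.
have P2 : (4 * z) ^ m <= (4 * z) ^ 7 by apply: Rle_pow; [lra | lia].
have Pe := exp_pos (- (2 * z)).
have P3 : 0 < z ^ 5 by apply: pow_lt; lra.
have Ex := exp_2z_le z Hz.
split.
  by apply: Rmult_le_pos; [apply: Rmult_le_pos; [nra | lra] | lra].
apply: (Rle_trans _ (z * 1 * (4 * z) ^ 7 * / (4 ^ 7 * z ^ 13))).
  apply: Rmult_le_compat => //; [|lra|].
    by apply: Rmult_le_pos; [nra | lra].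
  by apply: Rmult_le_compat => //; [nra | lra | apply: Rmult_le_compat; lra].
by right; field; lra.
Qed.

Lemma mu_step (z d D : R) (m : nat) : 1000 <= z -> (m <= 7)%nat -> Rabs (mu z m - d) <= D * (/ z) ^ 5 ->
  Rabs (mu z (S m) - INR (2 * m + 1) * d) <= (INR (2 * m + 1) * D + 1) * (/ z) ^ 5.
Proof.
move=> Hz Hm H; have [E0 E1] := exp_2z_small z m Hz Hm; rewrite mu_rec.
set t := _ * exp _ in E0 E1 *.
have -> : INR (2 * m + 1) * mu z m - t - INR (2 * m + 1) * d = INR (2 * m + 1) * (mu z m - d) - t by ring.
apply: Rle_trans (Rabs_triang _ _) _; rewrite Rabs_mult Rabs_Ropp (Rabs_pos_eq t) // (Rabs_pos_eq (INR _)); last exact: pos_INR.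
by have := Rmult_le_compat_l _ _ _ (pos_INR (2 * m + 1)) H; lra.
Qed.

(** The main values are double factorials; the error constants start from 1 at [m = 0] and follow
    [D |-> (2 m + 1) D + 1]. *)
Lemma mu_values (z : R) : 1000 <= z ->
  (Rabs (mu z 1 - 1) <= 2 * (/ z) ^ 5 /\ Rabs (mu z 2 - 3) <= 7 * (/ z) ^ 5 /\
   Rabs (mu z 3 - 15) <= 36 * (/ z) ^ 5 /\ Rabs (mu z 4 - 105) <= 253 * (/ z) ^ 5) /\
  (Rabs (mu z 5 - 945) <= 2278 * (/ z) ^ 5 /\ Rabs (mu z 6 - 10395) <= 25059 * (/ z) ^ 5 /\
   Rabs (mu z 7 - 135135) <= 325768 * (/ z) ^ 5).
Proof.
move=> Hz; have := mu_0 z ltac:(lra).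
have B : 2 * exp (- (2 * z)) <= 1 * (/ z) ^ 5.
  have Ex := exp_2z_le z Hz; have P5 : 0 < z ^ 5 by apply: pow_lt; lra.
  have Z8 : 1 <= z ^ 8 by apply: pow_R1_Rle; lra.
  rewrite pow_inv Rmult_1_l; apply: (Rle_trans _ (2 * / (4 ^ 7 * z ^ 13))); first lra.
  rewrite (_ : 2 * / (4 ^ 7 * z ^ 13) = / (2 ^ 13 * z ^ 13)); last by field; lra.
  apply: Rinv_le_contravar => //; rewrite (_ : 2 ^ 13 * z ^ 13 = 2 ^ 13 * z ^ 8 * z ^ 5); last ring.
  by nra.
move=> M0; have {}M0 := Rle_trans _ _ _ M0 B.
have M1 := mu_step z _ _ 0 Hz ltac:(lia) M0.
have M2 := mu_step z _ _ 1 Hz ltac:(lia) M1.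
have M3 := mu_step z _ _ 2 Hz ltac:(lia) M2.
have M4 := mu_step z _ _ 3 Hz ltac:(lia) M3.
have M5 := mu_step z _ _ 4 Hz ltac:(lia) M4.
have M6 := mu_step z _ _ 5 Hz ltac:(lia) M5.
have M7 := mu_step z _ _ 6 Hz ltac:(lia) M6.
rewrite !INR_IZR_INZ in M1 M2 M3 M4 M5 M6 M7.
cbn [Z.of_nat Pos.of_succ_nat Pos.succ Nat.add Nat.mul] in M1, M2, M3, M4, M5, M6, M7.
have W a d d' D D' : Rabs (a - d) <= D * (/ z) ^ 5 -> d = d' -> D = D' -> Rabs (a - d') <= D' * (/ z) ^ 5 by move=> H <- <-.
split; repeat split.
- by apply: W M1 _ _; lra.
- by apply: W M2 _ _; lra.
- by apply: W M3 _ _; lra.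
- by apply: W M4 _ _; lra.
- by apply: W M5 _ _; lra.
- by apply: W M6 _ _; lra.
- by apply: W M7 _ _; lra.
Qed.

(* [bn nu z] is [sqrt (2 pi z) e^{-z} I_nu(z)]. *)
Definition bn (nu : nat) (z : R) : R := exp (- z) * sqrt (2 * PI * z) * (z / 2) ^ nu * bf nu z.

Lemma abs_mul_diff (x d D w eps y : R) : 0 <= y -> Rabs (x - d) <= D * y -> 0 <= w <= eps -> 0 <= D ->
  - (D * eps * y) <= x * w - d * w <= D * eps * y.
Proof.
move=> Hy H [W0 W1] HD; apply/Rabs_le_between; rewrite -Rmult_minus_distr_r Rabs_mult (Rabs_pos_eq w) //.
apply: (Rle_trans _ (D * y * eps)); last by lra.
by apply: Rmult_le_compat => //; exact: Rabs_pos.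
Qed.

Lemma pow_quarter_le (y : R) (k : nat) : 0 <= y <= / 1000 -> 0 <= (y / 4) ^ S k <= / 4000.
Proof.
move=> Hy; have A : 0 <= (y / 4) ^ k <= 1.
  by split; [apply: pow_le; lra | rewrite -(pow1 k); apply: pow_incr; lra].
by rewrite /=; nra.
Qed.

(** Hankel's expansion of [I_1]: its coefficients are the products of [sqrt_coef k] with
    [(2 k + 1)!! / 4^k]. Most of the error constant comes from the remainder of [sqrt_taylor], where
    [10395 / 1024] is rounded up to 11. *)
Lemma bn_1_approx (z : R) : 1000 <= z ->
  Rabs (bn 1 z - (1 - 3 / 8 * / z - 15 / 128 * (/ z) ^ 2 - 105 / 1024 * (/ z) ^ 3 - 4725 / 32768 * (/ z) ^ 4)) <= 20 * (/ z) ^ 5.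
Proof.
move=> Hz; have PI0 := PI_bounds; have [[V1 [V2 [V3 V4]]] [V5 [V6 _]]] := mu_values z Hz.
have B := bj_laplace 0 z sqrt_coef 5 5; have {}B := B _; move: B.
have Hp c : 0 <= c <= 1 -> Rabs (c ^ (2 * 0 + 1) - rsum (fun k => sqrt_coef k * (1 - c ^ 2) ^ k) 5) <= (1 - c ^ 2) ^ 5.
  by move=> Hc; rewrite (_ : c ^ (2 * 0 + 1) = c); [exact: sqrt_taylor | rewrite /=; ring].
move=> /(_ Hp); rewrite bj_bf; last lra.
rewrite wal_1_0; change (INR (fact 1)) with 1; set l := rsum _ 5 => B.
pose y := / z; have Hy : 0 < y <= / 1000 by split; [apply: Rinv_0_lt_compat; lra | apply: Rinv_le_contravar; lra].
pose s := sqrt (2 * PI * z) * (2 / PI).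
have s0 : 0 <= s.
  apply: Rmult_le_pos; first exact: sqrt_pos.
  by apply: Rmult_le_pos; [lra | left; apply: Rinv_0_lt_compat; lra].
have Em k : s * (4 * z) * gm z (1 + k) = mu z (S k) * (y / 4) ^ k.
  rewrite /mu -/s (_ : (y / 4) ^ k = / (4 * z) ^ k); last first.
    by rewrite -pow_inv; congr (_ ^ _); rewrite /y; field; lra.
  change (1 + k)%nat with (S k); rewrite (_ : (4 * z) ^ S k = 4 * z * (4 * z) ^ k) //.
  by field; repeat split; try lra; apply: pow_nonzero; lra.
have Ee : exp (- z) * exp z = 1 by rewrite -exp_plus (_ : - z + z = 0) ?exp_0 //; ring.
have Eb : bn 1 z = s * (z / 2) * exp (- z) * (PI / 2 * 1 * bf 1 z).
  by rewrite /bn /s pow_1; field; lra.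
have K0 : 0 <= s * (z / 2) * exp (- z).
  by apply: Rmult_le_pos; [apply: Rmult_le_pos; lra | left; exact: exp_pos].
have {}B := Rmult_le_compat_l _ _ _ K0 B.
rewrite -{1}(Rabs_pos_eq _ K0) -Rabs_mult Rmult_minus_distr_l -Eb in B.
have E1 : s * (z / 2) * exp (- z) * (2 * 4 ^ 1 * exp z * l) = s * (4 * z) * l * (exp (- z) * exp z) by field.
have E2 : s * (z / 2) * exp (- z) * (2 * 4 ^ 1 * exp z * gm z (1 + 5)) = s * (4 * z) * gm z (1 + 5) * (exp (- z) * exp z) by field.
rewrite E1 E2 Ee !Rmult_1_r Em in B.
have E3 : s * (4 * z) * l = 1 * mu z 1 - 1 / 2 * (mu z 2 * (y / 4) ^ 1) - 1 / 8 * (mu z 3 * (y / 4) ^ 2) - 1 / 16 * (mu z 4 * (y / 4) ^ 3) - 5 / 128 * (mu z 5 * (y / 4) ^ 4).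
  by rewrite -!Em /l /sqrt_coef /= (_ : mu z 1 = s * (4 * z) * gm z (1 + 0)); [rewrite /=; field | rewrite Em; ring].
rewrite E3 in B.
rewrite -/y in V1 V2 V3 V4 V5 V6 *.
have y5 : 0 <= y ^ 5 <= / 1000.
  split; first by apply: pow_le; lra.
  apply: (Rle_trans _ ((/ 1000) ^ 5)); first by apply: pow_incr; lra.
  by rewrite /=; lra.
have Q k := pow_quarter_le y k ltac:(lra).
have W2 := abs_mul_diff _ _ _ _ _ _ (proj1 y5) V2 (Q 0%nat) ltac:(lra).
have W3 := abs_mul_diff _ _ _ _ _ _ (proj1 y5) V3 (Q 1%nat) ltac:(lra).
have W4 := abs_mul_diff _ _ _ _ _ _ (proj1 y5) V4 (Q 2%nat) ltac:(lra).
have W5 := abs_mul_diff _ _ _ _ _ _ (proj1 y5) V5 (Q 3%nat) ltac:(lra).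
have W6 : mu z 6 * (y / 4) ^ 5 <= 11 * y ^ 5.
  have -> : mu z 6 * (y / 4) ^ 5 = mu z 6 / 1024 * y ^ 5 by field.
  apply: Rmult_le_compat_r; first lra.
  by move: V6 => /Rabs_le_between; lra.
move: V1 B => /Rabs_le_between V1 /Rabs_le_between B; apply: Rabs_le.
set t2 := mu z 2 * _ in W2 B; set t3 := mu z 3 * _ in W3 B; set t4 := mu z 4 * _ in W4 B; set t5 := mu z 5 * _ in W5 B.
move: W2 W3 W4 W5 B W6; clear -V1 y5; clearbody t2 t3 t4 t5; move: (bn 1 z) (mu z 1) V1 => b m1 V1.
move=> W2 W3 W4 W5 B W6; simpl in *; lra.
Qed.

Lemma bn_2_approx (z : R) : 1000 <= z ->
  Rabs (bn 2 z - (1 - 15 / 8 * / z + 105 / 128 * (/ z) ^ 2 + 315 / 1024 * (/ z) ^ 3 + 10395 / 32768 * (/ z) ^ 4)) <= 60 * (/ z) ^ 5.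
Proof.
move=> Hz; have PI0 := PI_bounds; have [[_ [V2 [V3 V4]]] [V5 [V6 V7]]] := mu_values z Hz.
have Hp c : 0 <= c <= 1 -> Rabs (c ^ (2 * 1 + 1) - rsum (fun k => sqrt3_coef k * (1 - c ^ 2) ^ k) 6) <= (1 - c ^ 2) ^ 5.
  by move=> Hc; rewrite (_ : c ^ (2 * 1 + 1) = c ^ 3); [exact: sqrt3_taylor | rewrite /=; ring].
have := bj_laplace 1 z sqrt3_coef 6 5 Hp; rewrite bj_bf; last lra.
rewrite wal_2_0; change (INR (fact 2)) with (1 + 1); set l := rsum _ 6 => B.
pose y := / z; have Hy : 0 < y <= / 1000 by split; [apply: Rinv_0_lt_compat; lra | apply: Rinv_le_contravar; lra].
pose s := sqrt (2 * PI * z) * (2 / PI).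
have s0 : 0 <= s.
  apply: Rmult_le_pos; first exact: sqrt_pos.
  by apply: Rmult_le_pos; [lra | left; apply: Rinv_0_lt_compat; lra].
have Em k : s * (16 * z ^ 2 / 3) * gm z (2 + k) = / 3 * mu z (S (S k)) * (y / 4) ^ k.
  rewrite /mu -/s (_ : (y / 4) ^ k = / (4 * z) ^ k); last first.
    by rewrite -pow_inv; congr (_ ^ _); rewrite /y; field; lra.
  change (2 + k)%nat with (S (S k)); rewrite (_ : (4 * z) ^ S (S k) = 16 * z ^ 2 * (4 * z) ^ k); last by rewrite /=; ring.
  by field; repeat split; try lra; apply: pow_nonzero; lra.
have Ee : exp (- z) * exp z = 1 by rewrite -exp_plus (_ : - z + z = 0) ?exp_0 //; ring.
have Eb : bn 2 z = s * (z ^ 2 / 6) * exp (- z) * (3 * PI / 8 * (1 + 1) * bf 2 z).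
  by rewrite /bn /s; field; lra.
have K0 : 0 <= s * (z ^ 2 / 6) * exp (- z).
  by apply: Rmult_le_pos; [apply: Rmult_le_pos; nra | left; exact: exp_pos].
have {}B := Rmult_le_compat_l _ _ _ K0 B.
rewrite -{1}(Rabs_pos_eq _ K0) -Rabs_mult Rmult_minus_distr_l -Eb in B.
have E1 : s * (z ^ 2 / 6) * exp (- z) * (2 * 4 ^ 2 * exp z * l) = s * (16 * z ^ 2 / 3) * l * (exp (- z) * exp z) by field.
have E2 : s * (z ^ 2 / 6) * exp (- z) * (2 * 4 ^ 2 * exp z * gm z (2 + 5)) = s * (16 * z ^ 2 / 3) * gm z (2 + 5) * (exp (- z) * exp z) by field.
rewrite E1 E2 Ee !Rmult_1_r Em in B.
have E3 : s * (16 * z ^ 2 / 3) * l = / 3 * (mu z 2 - 3 / 2 * (mu z 3 * (y / 4) ^ 1) + 3 / 8 * (mu z 4 * (y / 4) ^ 2) + 1 / 16 * (mu z 5 * (y / 4) ^ 3) + 3 / 128 * (mu z 6 * (y / 4) ^ 4) + 5 / 128 * (mu z 7 * (y / 4) ^ 5)).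
  have G0 := Em 0%nat; have G1 := Em 1%nat; have G2 := Em 2%nat; have G3 := Em 3%nat; have G4 := Em 4%nat; have G5 := Em 5%nat.
  rewrite /l /sqrt3_coef /=; rewrite /= in G0 G1 G2 G3 G4 G5; lra.
rewrite E3 in B.
rewrite -/y in V2 V3 V4 V5 V6 V7 *.
have y5 : 0 <= y ^ 5 <= / 1000.
  split; first by apply: pow_le; lra.
  apply: (Rle_trans _ ((/ 1000) ^ 5)); first by apply: pow_incr; lra.
  by rewrite /=; lra.
have Q k := pow_quarter_le y k ltac:(lra).
have W3 := abs_mul_diff _ _ _ _ _ _ (proj1 y5) V3 (Q 0%nat) ltac:(lra).
have W4 := abs_mul_diff _ _ _ _ _ _ (proj1 y5) V4 (Q 1%nat) ltac:(lra).
have W5 := abs_mul_diff _ _ _ _ _ _ (proj1 y5) V5 (Q 2%nat) ltac:(lra).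
have W6 := abs_mul_diff _ _ _ _ _ _ (proj1 y5) V6 (Q 3%nat) ltac:(lra).
(* The last coefficient of [sqrt3_coef] enters only at order [z^(-5)], so its term is counted as
   error; [135135 / 1024 < 133]. *)
have W7 : 0 <= mu z 7 * (y / 4) ^ 5 <= 133 * y ^ 5.
  have -> : mu z 7 * (y / 4) ^ 5 = mu z 7 / 1024 * y ^ 5 by field.
  move: V7 => /Rabs_le_between V7; split; first by apply: Rmult_le_pos; lra.
  by apply: Rmult_le_compat_r; lra.
move: V2 B => /Rabs_le_between V2 /Rabs_le_between B; apply: Rabs_le.
set t3 := mu z 3 * _ in W3 B; set t4 := mu z 4 * _ in W4 B; set t5 := mu z 5 * _ in W5 B; set t6 := mu z 6 * _ in W6 B.
rewrite (_ : / 3 * mu z 7 * (y / 4) ^ 5 = / 3 * (mu z 7 * (y / 4) ^ 5)) in B; last ring.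
set t7 := mu z 7 * _ in W7 B.
move: W3 W4 W5 W6 W7 B; clear -V2 y5; clearbody t3 t4 t5 t6 t7; move: (bn 2 z) (mu z 2) V2 => b m1 V2.
move=> W3 W4 W5 W6 W7 B; simpl in *; lra.
Qed.

Lemma bf_rec (nu : nat) (z : R) : bf nu z = INR (S nu) * bf (S nu) z + (z / 2) ^ 2 * bf (S (S nu)) z.
Proof.
have S1 := ex_series_bf (S nu) z; have S2 := ex_series_bf (S (S nu)) z.
(* The series with the factor [(z / 2)^2], shifted by one index so that equal powers are
   compared. *)
pose g s := match s with O => 0 | S k => (z / 2) ^ 2 * ((z / 2) ^ (2 * k) / (INR (fact k) * INR (fact (k + S (S nu))))) end.
have Sg : ex_series g by apply/ex_series_incr_1; exact: ex_series_scalR.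
have -> : (z / 2) ^ 2 * bf (S (S nu)) z = Series g.
  by rewrite (Series_incr_1 g Sg) /bf -Series_scal_l /=; ring.
rewrite /bf -Series_scal_l -Series_plus //; last exact: ex_series_scalR.
apply: Series_ext => s; have F k := INR_fact_neq_0 k; have N k : INR (S k) <> 0 by apply: not_0_INR.
case: s => [|s]; rewrite /g.
  rewrite !Nat.add_0_l !fact_simpl !mult_INR /=; field; split; [exact: F | exact: N].
rewrite (_ : (S s + nu = S (s + nu))%nat); last lia.
rewrite (_ : (S s + S nu = S (S (s + nu)))%nat); last lia.
rewrite (_ : (s + S (S nu) = S (S (s + nu)))%nat); last lia.
rewrite (_ : (2 * S s = 2 + 2 * s)%nat); last lia.
rewrite pow_add !fact_simpl !mult_INR.
have E : INR (S (S (s + nu))) = INR (S nu) + INR (S s) by rewrite -plus_INR; congr INR; lia.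
have E2 := N (S (s + nu)); rewrite E in E2 *.
by field; repeat split.
Qed.

Lemma bn_rec (nu : nat) (z : R) : 0 < z -> bn (S (S nu)) z = bn nu z - 2 * INR (S nu) * (/ z * bn (S nu) z).
Proof.
move=> Hz; rewrite /bn (bf_rec nu z) !(_ : forall k, (z / 2) ^ S k = z / 2 * (z / 2) ^ k) //; field; lra.
Qed.

(** The relations between [n], [al] and [z] say that [z = 2 sqrt (kap n)], the Bessel argument of
    [vser], and that [al z / 2 = kap]. *)
Lemma vser_bn (nu n : nat) (z al : R) : 0 < z -> al = 2 * kap / z -> INR n * al = kap / al ->
  vser nu n = exp z / sqrt (2 * PI * z) * (al ^ nu * bn nu z).
Proof.
move=> Hz Ha Hn; have PI0 := PI_bounds; have K := kap_bounds.
have Hs : 0 < sqrt (2 * PI * z) by apply: sqrt_lt_R0; nra.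
have Ee : exp z * exp (- z) = 1 by rewrite -exp_plus (_ : z + - z = 0) ?exp_0 //; ring.
have -> : exp z / sqrt (2 * PI * z) * (al ^ nu * bn nu z) = (exp z * exp (- z)) * (al ^ nu * (z / 2) ^ nu) * bf nu z.
  by rewrite /bn; field; lra.
rewrite Ee -Rpow_mult_distr Ha (_ : 2 * kap / z * (z / 2) = kap); last by field; lra.
rewrite /bf Rmult_1_l -Series_scal_l /vser; apply: Series_ext => s.
have E : (z / 2) ^ (2 * s) = kap ^ s * INR n ^ s.
  rewrite pow_mult -Rpow_mult_distr; congr (_ ^ _).
  have An : al <> 0 by rewrite Ha; apply: Rmult_integral_contrapositive_currified; [lra | apply: Rinv_neq_0_compat; lra].
  have -> : INR n = kap / al ^ 2.
    apply: (Rmult_eq_reg_r al) => //; rewrite Hn; field => //.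
  rewrite Ha; field; lra.
rewrite E /vcoef pow_add; field; split; exact: INR_fact_neq_0.
Qed.

Lemma abs_scale (b P E w : R) : Rabs (b - P) <= E -> 0 <= w -> - (E * w) <= w * b - w * P <= E * w.
Proof. by move=> /Rabs_le_between H Hw; split; nra. Qed.

(* With [y = 1/z]: the sum of [c_j (k y)^j H_(j+2)(y)] truncated after [y^4], where [c_j] are the
   coefficients of [cpoly] and [H_nu] is Hankel's expansion of [sqrt (2 pi z) e^{-z} I_nu(z)]. *)
Definition saddle (k y : R) : R :=
  1 + (- (15 / 8) + k / 6) * y + (105 / 128 - 35 / 48 * k + 13 / 288 * k ^ 2) * y ^ 2
  + (315 / 1024 + 315 / 256 * k - 91 / 256 * k ^ 2 + 7 / 324 * k ^ 3) * y ^ 3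
  + (10395 / 32768 - 1155 / 2048 * k + 5005 / 4096 * k ^ 2 - 77 / 288 * k ^ 3 + 7441 / 497664 * k ^ 4) * y ^ 4.

(** As [bn nu] carries the factor [y^(nu - 2)], an expansion with error of order [y^(7 - nu)] is
    enough. The recurrence is therefore applied to shorter and shorter expansions. *)
Lemma bn_combination (z k : R) : 1000 <= z -> 0 <= k <= 6.6 ->
  Rabs (bn 2 z + k / 6 * / z * bn 3 z + 13 / 288 * k ^ 2 * (/ z) ^ 2 * bn 4 z + 7 / 324 * k ^ 3 * (/ z) ^ 3 * bn 5 z
    + 7441 / 497664 * k ^ 4 * (/ z) ^ 4 * bn 6 z - saddle k (/ z)) <= 1200 * (/ z) ^ 5.
Proof.
move=> Hz Hk; have B1 := bn_1_approx z Hz; have B2 := bn_2_approx z Hz.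
have R3 := bn_rec 1 z ltac:(lra); have R4 := bn_rec 2 z ltac:(lra).
have R5 := bn_rec 3 z ltac:(lra); have R6 := bn_rec 4 z ltac:(lra).
rewrite INR_IZR_INZ in R3; rewrite INR_IZR_INZ in R4; rewrite INR_IZR_INZ in R5; rewrite INR_IZR_INZ in R6.
cbn [Z.of_nat Pos.of_succ_nat Pos.succ] in R3, R4, R5, R6.
have Hy : 0 < / z <= / 1000 by split; [apply: Rinv_0_lt_compat; lra | apply: Rinv_le_contravar; lra].
move: (/ z) Hy B1 B2 R3 R4 R5 R6 => y Hy.
move: (bn 1 z) (bn 2 z) (bn 3 z) (bn 4 z) (bn 5 z) (bn 6 z) => b1 b2 b3 b4 b5 b6 B1 B2 R3 R4 R5 R6.
have Y k' : 0 <= y ^ S k' <= / 1000 * y ^ k'.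
  have P : 0 <= y ^ k' by apply: pow_le; lra.
  by rewrite /=; nra.
have Y1 := Y 1%nat; have Y2 := Y 2%nat; have Y3 := Y 3%nat; have Y4 := Y 4%nat; have Y5 := Y 5%nat; clear Y.
have y0 : 0 <= y by lra.
have U2 := abs_scale _ _ _ y B2 y0.
have B3 : Rabs (b3 - (1 - 35 / 8 * y + 945 / 128 * y ^ 2 - 3465 / 1024 * y ^ 3)) <= 2 * y ^ 4.
  by move: B1 => /Rabs_le_between B1; apply: Rabs_le; rewrite R3; lra.
have U3 := abs_scale _ _ _ y B3 y0.
have B4 : Rabs (b4 - (1 - 63 / 8 * y + 3465 / 128 * y ^ 2)) <= 46 * y ^ 3.
  by move: (B2) => /Rabs_le_between B2'; apply: Rabs_le; rewrite R4; lra.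
have U4 := abs_scale _ _ _ y B4 y0.
have B5 : Rabs (b5 - (1 - 99 / 8 * y)) <= 72 * y ^ 2.
  by move: (B3) => /Rabs_le_between B3'; apply: Rabs_le; rewrite R5; lra.
have U5 := abs_scale _ _ _ y B5 y0.
have B6 : Rabs (b6 - 1) <= 19 * y.
  by move: (B4) => /Rabs_le_between B4'; apply: Rabs_le; rewrite R6; lra.
have K2 : 0 <= k ^ 2 <= 6.6 ^ 2 by split; [apply: pow_le; lra | apply: pow_incr; lra].
have K3 : 0 <= k ^ 3 <= 6.6 ^ 3 by split; [apply: pow_le; lra | apply: pow_incr; lra].
have K4 : 0 <= k ^ 4 <= 6.6 ^ 4 by split; [apply: pow_le; lra | apply: pow_incr; lra].
have y5 : 0 <= y ^ 5 by apply: pow_le; lra.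
have Z (j : nat) (c b P e K : R) : (j <= 4)%nat -> Rabs (b - P) <= e * y ^ (5 - j) -> 0 <= c <= K -> 0 <= e ->
    - (K * e * y ^ 5) <= c * y ^ j * b - c * y ^ j * P <= K * e * y ^ 5.
  move=> Hj HB Hc He; have Pj : 0 <= y ^ j by apply: pow_le.
  have H := abs_scale _ _ _ (c * y ^ j) HB ltac:(nra).
  have E : e * y ^ (5 - j) * (c * y ^ j) = c * e * y ^ 5.
    by rewrite (_ : y ^ 5 = y ^ (5 - j) * y ^ j); [ring | rewrite -pow_add; congr (_ ^ _); lia].
  have : c * e * y ^ 5 <= K * e * y ^ 5 by apply: Rmult_le_compat_r => //; nra.
  rewrite E in H; lra.
have Z3 := Z 1%nat (k / 6) _ _ _ 1.1 ltac:(lia) B3 ltac:(lra) ltac:(lra).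
have Z4 := Z 2%nat (13 / 288 * k ^ 2) _ _ _ (13 / 288 * 6.6 ^ 2) ltac:(lia) B4 ltac:(lra) ltac:(lra).
have Z5 := Z 3%nat (7 / 324 * k ^ 3) _ _ _ (7 / 324 * 6.6 ^ 3) ltac:(lia) B5 ltac:(lra) ltac:(lra).
have Z6 := Z 4%nat (7441 / 497664 * k ^ 4) _ _ 19 (7441 / 497664 * 6.6 ^ 4) ltac:(lia) ltac:(rewrite pow_1; exact: B6) ltac:(lra) ltac:(lra).
move: B2 => /Rabs_le_between B2; apply: Rabs_le; rewrite pow_1 in Z3.
have -> : b2 + k / 6 * y * b3 + 13 / 288 * k ^ 2 * y ^ 2 * b4 + 7 / 324 * k ^ 3 * y ^ 3 * b5 + 7441 / 497664 * k ^ 4 * y ^ 4 * b6 - saddle k y =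
  (b2 - (1 - 15 / 8 * y + 105 / 128 * y ^ 2 + 315 / 1024 * y ^ 3 + 10395 / 32768 * y ^ 4))
  + (k / 6 * y * b3 - k / 6 * y * (1 - 35 / 8 * y + 945 / 128 * y ^ 2 - 3465 / 1024 * y ^ 3))
  + (13 / 288 * k ^ 2 * y ^ 2 * b4 - 13 / 288 * k ^ 2 * y ^ 2 * (1 - 63 / 8 * y + 3465 / 128 * y ^ 2))
  + (7 / 324 * k ^ 3 * y ^ 3 * b5 - 7 / 324 * k ^ 3 * y ^ 3 * (1 - 99 / 8 * y))
  + (7441 / 497664 * k ^ 4 * y ^ 4 * b6 - 7441 / 497664 * k ^ 4 * y ^ 4 * 1) by rewrite /saddle; field.
lra.
Qed.

Lemma vtot_saddle (n : nat) (z al : R) : 1000 <= z -> al = 2 * kap / z -> INR n * al = kap / al ->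
  Rabs (vtot n - exp z / sqrt (2 * PI * z) * (al ^ 2 / (4 * PI)) * saddle (2 * kap) (/ z))
   <= exp z / sqrt (2 * PI * z) * (al ^ 2 / (4 * PI)) * (1200 * (/ z) ^ 5).
Proof.
move=> Hz Ha Hn; have PI0 := PI_bounds; have K := kap_bounds.
have Hs : 0 < sqrt (2 * PI * z) by apply: sqrt_lt_R0; nra.
set c := _ * (al ^ 2 / (4 * PI)).
have Pc : 0 <= c.
  apply: Rmult_le_pos; first by apply: Rmult_le_pos; left; [exact: exp_pos | exact: Rinv_0_lt_compat].
  by apply: Rmult_le_pos; [exact: pow2_ge_0 | left; apply: Rinv_0_lt_compat; lra].
have B := bn_combination z (2 * kap) Hz ltac:(lra).
set b := (X in Rabs (X - saddle _ _)) in B.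
have -> : vtot n = c * b.
  rewrite /vtot !(vser_bn _ n z al ltac:(lra) Ha Hn) /b /c.
  have -> : 2 * kap = al * z by rewrite Ha; field; lra.
  by field; lra.
rewrite -Rmult_minus_distr_l Rabs_mult (Rabs_pos_eq c Pc); exact: Rmult_le_compat_l.
Qed.

(** * The asymptotic expansion *)

(** All real powers in the statement become integer powers of [w = n^(1/4)] and [t = 3^(1/4)], so
    that the identities are rational and [field] applies. *)
Lemma Rpower_quarter (x e : R) (k : nat) : 0 < x -> e = INR k * (1 / 4) -> Rpower x e = Rpower x (1 / 4) ^ k.
Proof.
move=> Hx ->; rewrite -Rpower_pow; last exact: exp_pos.
by rewrite Rpower_mult Rmult_comm.
Qed.

(** The constants of the statement are the coefficients of [saddle k] times [t / 24] and powers of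
    [t^2 / (2 PI)], reduced by [t^4 = 3]; the factor [t^2 / (2 PI w^2)] is [/ z]. *)
Lemma coef_values : let t := Rpower 3 (1 / 4) in let k := 2 * kap in
  coefA = t / 24 /\ coefB = t ^ 3 / 24 * (- (15 / 8) + k / 6) / (2 * PI) /\
  coefC = t / 8 * (105 / 128 - 35 / 48 * k + 13 / 288 * k ^ 2) / (2 * PI) ^ 2 /\
  coefD = t ^ 3 / 8 * (315 / 1024 + 315 / 256 * k - 91 / 256 * k ^ 2 + 7 / 324 * k ^ 3) / (2 * PI) ^ 3 /\
  coefE = 3 * t / 8 * (10395 / 32768 - 1155 / 2048 * k + 5005 / 4096 * k ^ 2 - 77 / 288 * k ^ 3 + 7441 / 497664 * k ^ 4) / (2 * PI) ^ 4.
Proof.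
move=> t k; have PI0 := PI_bounds.
have E3 : Rpower 3 (3 / 4) = t ^ 3 by apply: Rpower_quarter; [lra | rewrite /=; lra].
have t0 : 0 < t by exact: exp_pos.
have t4 : t ^ 4 = 3 by rewrite -(Rpower_quarter 3 1) ?Rpower_1 /=; lra.
have I1 : / t = t ^ 3 / 3 by rewrite -t4; field; lra.
have I3 : / t ^ 3 = t / 3 by rewrite -t4; field; lra.
rewrite /coefA /coefB /coefC /coefD /coefE E3 -/t /k /kap.
clearbody t; have T3 : t ^ 3 <> 0 by apply: pow_nonzero; lra.
move: (t ^ 3) I1 I3 T3 => t3 I1 I3 T3.
have D1 a b : b <> 0 -> a / (b * t) = a * (t3 / 3) / b by move=> Hb; rewrite -I1; field; lra.
have D3 a b : b <> 0 -> a / (b * t3) = a * (t / 3) / b by move=> Hb; rewrite -I3; field; lra.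
rewrite !D1 ?D3; try lra.
by repeat split; field; lra.
Qed.

Theorem unim_asymptotic (p : nat -> nat -> R) (n : nat) : part_rec p -> 100000 <= INR n ->
  exists err : R,
    O_le 478 err (1 / Rpower (INR n) (5 / 2)) /\
    unim p n =
      exp (2 * PI * sqrt (INR n / 3)) / Rpower (INR n) (5 / 4) *
      (coefA + coefB / sqrt (INR n) + coefC / INR n
       + coefD / Rpower (INR n) (3 / 2) + coefE / INR n ^ 2 + err).
Proof.
move=> Hp Hn; have PI0 := PI_bounds; have K := kap_bounds.
have [-> [-> [-> [-> ->]]]] := coef_values; set t := Rpower 3 (1 / 4).
have N0 : 0 < INR n by lra.
have R2 : Rpower (INR n) (5 / 2) = Rpower (INR n) (1 / 4) ^ 10 by apply: Rpower_quarter => //; rewrite /=; lra.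
have R5 : Rpower (INR n) (5 / 4) = Rpower (INR n) (1 / 4) ^ 5 by apply: Rpower_quarter => //; rewrite /=; lra.
have R6 : Rpower (INR n) (3 / 2) = Rpower (INR n) (1 / 4) ^ 6 by apply: Rpower_quarter => //; rewrite /=; lra.
have w4 : Rpower (INR n) (1 / 4) ^ 4 = INR n.
  by rewrite -(Rpower_quarter (INR n) 1) ?Rpower_1 /=; lra.
have w0 : 0 < Rpower (INR n) (1 / 4) by exact: exp_pos.
rewrite R2 R5 R6; move: (Rpower (INR n) (1 / 4)) w4 w0 {R2 R5 R6} => w w4 w0.
have t0 : 0 < t by exact: exp_pos.
have t4 : t ^ 4 = 3 by rewrite -(Rpower_quarter 3 1) ?Rpower_1 /=; lra.
have w2 : 0 < w ^ 2 by exact: pow_lt.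
have t2 : 0 < t ^ 2 by exact: pow_lt.
have Sn : sqrt (INR n) = w ^ 2 by apply: sqrt_lem_1; [lra | lra | rewrite -w4; ring].
have S3 : sqrt (INR n / 3) = w ^ 2 / t ^ 2.
  apply: sqrt_lem_1; first lra.
    by left; apply: Rdiv_lt_0_compat.
  by rewrite -w4 -t4; field; lra.
rewrite S3 Sn; set z := 2 * PI * (w ^ 2 / t ^ 2).
pose al := PI / (t ^ 2 * w ^ 2).
(* At [n = 100000] one has [sqrt (n / 3) > 182] and [sqrt (3 n) > 547]; these two bounds yield
   [z >= 1000] and [al <= 0.00576]. *)
have q1 : 182 <= w ^ 2 / t ^ 2.
  rewrite -S3 -(sqrt_square 182); last lra.
  by apply: sqrt_le_1; lra.
have q2 : 547 <= t ^ 2 * w ^ 2.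
  have : 547 * 547 <= (t ^ 2 * w ^ 2) * (t ^ 2 * w ^ 2).
    by rewrite (_ : (t ^ 2 * w ^ 2) * (t ^ 2 * w ^ 2) = t ^ 4 * w ^ 4); [rewrite t4 w4; lra | ring].
  by have := Rmult_lt_0_compat _ _ t2 w2; nra.
have Hz : 1000 <= z by rewrite /z; nra.
have al0 : 0 < al by apply: Rdiv_lt_0_compat; lra.
have al1 : al <= 0.00576.
  by apply: (Rmult_le_reg_r (t ^ 2 * w ^ 2)); [lra | rewrite /al /Rdiv Rmult_assoc Rinv_l; lra].
have Ez : al = 2 * kap / z by rewrite /al /z /kap -t4; field; lra.
have En : INR n * al = kap / al by rewrite -w4 /al /kap -t4; field; lra.
have Ek : 2 * kap / al = z by rewrite Ez; field; lra.
have D1 := unim_vtot p n al Hp (conj al0 al1) En; rewrite Ek in D1.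
have D2 := vtot_saddle n z al Hz Ez En.
have Sq : sqrt (2 * PI * z) = 2 * PI * w / t.
  apply: sqrt_lem_1.
  - by rewrite /z; nra.
  - by left; apply: Rdiv_lt_0_compat => //; nra.
  - by rewrite /z; field; lra.
have Ec : exp z / sqrt (2 * PI * z) * (al ^ 2 / (4 * PI)) = exp z / w ^ 5 * (t / 24).
  by rewrite Sq /al (_ : 24 = 8 * t ^ 4); [field; lra | rewrite t4; ring].
rewrite Ec in D2.
have Iz : / z = t ^ 2 / (2 * PI * w ^ 2) by rewrite /z; field; lra.
have t5 : t ^ 5 = 3 * t by rewrite -t4; ring.
have t7 : t ^ 7 = 3 * t ^ 3 by rewrite -t4; ring.
have t9 : t ^ 9 = 9 * t by rewrite (_ : 9 = 3 * 3); [rewrite -t4 | ]; ring.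
set M := _ + _ / INR n ^ 2.
have EM : exp z / w ^ 5 * (t / 24) * saddle (2 * kap) (/ z) = exp z / w ^ 5 * M.
  rewrite /M /saddle Iz Rmult_assoc; congr (_ * _); rewrite -w4.
  move: (2 * kap) => k.
  transitivity (t / 24 + t ^ 3 / 24 * (- (15 / 8) + k / 6) / (2 * PI) / w ^ 2
    + t ^ 5 / 24 * (105 / 128 - 35 / 48 * k + 13 / 288 * k ^ 2) / (2 * PI) ^ 2 / w ^ 4
    + t ^ 7 / 24 * (315 / 1024 + 315 / 256 * k - 91 / 256 * k ^ 2 + 7 / 324 * k ^ 3) / (2 * PI) ^ 3 / w ^ 6
    + t ^ 9 / 24 * (10395 / 32768 - 1155 / 2048 * k + 5005 / 4096 * k ^ 2 - 77 / 288 * k ^ 3 + 7441 / 497664 * k ^ 4) / (2 * PI) ^ 4 / w ^ 8).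
    by field; lra.
  by rewrite t5 t7 t9; field; lra.
have G0 : 0 < exp z / w ^ 5 by apply: Rdiv_lt_0_compat; [exact: exp_pos | exact: pow_lt].
rewrite EM in D2.
have W10 : 0 < w ^ 10 by exact: pow_lt.
have T14 : t <= 1.4.
  case: (Rle_or_lt t 1.4) => // H.
  have : 1.4 ^ 4 <= t ^ 4 by apply: pow_incr; lra.
  by rewrite t4; lra.
have Q2 : t / 24 * (1200 * (/ z) ^ 5) <= 1 / w ^ 10.
  have P5 : 3 ^ 5 <= PI ^ 5 by apply: pow_incr; lra.
  have T3 : t ^ 3 <= 1.4 ^ 3 by apply: pow_incr; lra.
  have -> : t / 24 * (1200 * (/ z) ^ 5) = 50 / 32 * (t ^ 4 * t ^ 4 * t ^ 3) / PI ^ 5 / w ^ 10 by rewrite Iz; field; lra.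
  rewrite t4; apply: Rmult_le_compat_r; first by left; exact: Rinv_0_lt_compat.
  apply: (Rmult_le_reg_r (PI ^ 5)); first lra.
  by rewrite /Rdiv !Rmult_assoc Rinv_l; lra.
(* [al^(15/2)] is [PI^(15/2) / (t^15 w^15)], and [w^15 = w^5 w^10] separates the main factor from
   the error term. *)
have Q1 : al ^ 7 * sqrt al * exp z <= exp z / w ^ 5 * (400 / w ^ 10).
  have Sal : sqrt al = sqrt PI / (t * w).
    rewrite /al sqrt_div; [congr (_ / _) | lra | nra].
    by apply: sqrt_lem_1; [nra | nra | ring].
  have SP : sqrt PI <= 1.8.
    by rewrite -(sqrt_square 1.8); [apply: sqrt_le_1; lra | lra].
  have SP0 := sqrt_pos PI.
  have P7 : PI ^ 7 <= 3.142 ^ 7 by apply: pow_incr; lra.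
  have P70 : 0 < PI ^ 7 by apply: pow_lt; lra.
  have -> : al ^ 7 * sqrt al * exp z = exp z / w ^ 5 * (PI ^ 7 * sqrt PI * t / (t ^ 4 * t ^ 4 * t ^ 4 * t ^ 4) / w ^ 10).
    by rewrite Sal /al; field; lra.
  rewrite t4; apply: Rmult_le_compat_l; first lra.
  apply: Rmult_le_compat_r; first by left; exact: Rinv_0_lt_compat.
  have : PI ^ 7 * sqrt PI * t <= 3.142 ^ 7 * 1.8 * 1.4.
    apply: Rmult_le_compat => //; [apply: Rmult_le_pos; lra | lra |].
    by apply: Rmult_le_compat; lra.
  lra.
(* The error is defined by the identity itself, so only its size remains to be proved;
   [400 + 1 < 478]. *)
exists ((unim p n - exp z / w ^ 5 * M) / (exp z / w ^ 5)); split; last first.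
  by field; split; [lra | have := exp_pos z; lra].
rewrite /O_le (Rabs_pos_eq (1 / w ^ 10)); last by left; apply: Rdiv_lt_0_compat; lra.
rewrite Rabs_mult (Rabs_pos_eq (/ _)); last by left; exact: Rinv_0_lt_compat.
apply: (Rmult_le_reg_r (exp z / w ^ 5)) => //.
rewrite Rmult_assoc Rinv_l ?Rmult_1_r; last lra.
have -> : unim p n - exp z / w ^ 5 * M = (unim p n - vtot n) + (vtot n - exp z / w ^ 5 * M) by ring.
apply: Rle_trans (Rabs_triang _ _) _.
have Q3 := Rmult_le_compat_l _ _ _ (Rlt_le _ _ G0) Q2.
have W10' : 0 < 1 / w ^ 10 by apply: Rdiv_lt_0_compat; lra.
have Q4 := Rmult_lt_0_compat _ _ G0 W10'.
have E400 : exp z / w ^ 5 * (400 / w ^ 10) = 400 * (exp z / w ^ 5 * (1 / w ^ 10)) by field; lra.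
rewrite E400 in Q1; lra.
Qed.

(** * Counting unimodal sequences *)

From mathcomp Require Import all_boot finmap classical_sets cardinality.
Local Open Scope nat_scope.

Definition is_part (c i : nat) (a : seq nat) : bool :=
  [&& pairwise leq a, all (fun x => 0 < x <= c) a & sumn a == i].

(** The fuel [f] is present because one recursive call lowers [c] and the other lowers [i];
    [c + i < f] is enough. Partitions are listed increasingly, so a part equal to the bound [c] is
    appended at the end. *)
Fixpoint parts (f c i : nat) : seq (seq nat) :=
  match f, c with
  | 0, _ => [::]
  | f'.+1, 0 => if i == 0 then [:: [::]] else [::]
  | f'.+1, c'.+1 => parts f' c' i ++ (if c <= i then map (rcons^~ c) (parts f' c (i - c)) else [::])
  end.

Lemma is_part_0 (i : nat) (a : seq nat) : is_part 0 i a = (a == [::]) && (i == 0).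
Proof. by case: a => [|[|x] a]; rewrite /is_part //= ?andbF // eq_sym. Qed.

Lemma is_part_rcons (c i x : nat) (b : seq nat) :
  is_part c i (rcons b x) = [&& 0 < x <= c, x <= i & is_part x (i - x) b].
Proof.
rewrite /is_part pairwise_rcons all_rcons sumn_rcons.
apply/idP/idP.
  case/and3P=> /andP[Hbx ->] /andP[-> Hb] /eqP <-; rewrite leq_addl addnK eqxx andbT /=.
  by apply/allP => y Hy; rewrite (allP Hbx _ Hy) andbT; case/andP: (allP Hb _ Hy).
case/and3P=> Hx Hi /and3P[-> Hb /eqP E]; rewrite Hx E subnK // eqxx andbT /=.
apply/and3P; split => //; first by apply/allP => y /(allP Hb) /andP[].
apply/allP => y /(allP Hb) /andP[-> Hy] /=; apply: leq_trans Hy _; by case/andP: Hx.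
Qed.

Lemma mem_parts (f c i : nat) (a : seq nat) : c + i < f -> (a \in parts f c i) = is_part c i a.
Proof.
elim: f c i a => // f IH [|c] i a Hf; first by rewrite is_part_0 /=; case: (i == 0); rewrite ?andbT ?andbF ?inE.
have Hf' : c + i < f by rewrite addSn ltnS in Hf.
rewrite [parts _ _ _]/= mem_cat IH //.
case/lastP: a => [|b x].
  case: ifP => _; last by rewrite in_nil orbF.
  by rewrite (_ : ([::] \in _) = false) ?orbF //; apply/negP => /mapP[[|? ?] _].
have -> : (rcons b x \in (if c < i then map (rcons^~ c.+1) (parts f c.+1 (i - c.+1)) else [::])) =
    [&& x == c.+1, c < i & is_part c.+1 (i - c.+1) b].
  case: ifP => Hc; last by rewrite andbF in_nil.
  rewrite -IH; last by rewrite subnKC //; apply: leq_ltn_trans Hf'; exact: leq_addl.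
  apply/mapP/andP => [[b' Hb' /rcons_inj[-> ->]] //|[/eqP -> Hb]]; by exists b.
rewrite !is_part_rcons; case: (ltngtP x c.+1) => Hx.
- by rewrite /= -[x <= c]ltnS Hx orbF.
- by rewrite (leqNgt x c) (ltnW Hx) !andbF.
- by rewrite Hx /= (ltnn c).
Qed.

Lemma parts_uniq (f c i : nat) : c + i < f -> uniq (parts f c i).
Proof.
elim: f c i => // f IH [|c] i Hf; first by rewrite /=; case: ifP.
have Hf' : c + i < f by rewrite addSn ltnS in Hf.
rewrite /= cat_uniq IH //=; case: ifP => Hc //=.
have Hg : c.+1 + (i - c.+1) < f by rewrite subnKC //; apply: leq_ltn_trans Hf'; exact: leq_addl.
rewrite map_inj_uniq ?IH //; last by move=> b b' /rcons_inj[].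
rewrite andbT; apply/hasPn => a /mapP[b _ ->]; rewrite /= mem_parts // is_part_rcons.
by rewrite ltnn !andbF.
Qed.

Definition nparts (c i : nat) : nat := size (parts (c + i).+1 c i).

(** The size does not depend on the fuel: two duplicate-free lists with the same members are
    permutations of each other. *)
Lemma size_parts (f c i : nat) : c + i < f -> size (parts f c i) = nparts c i.
Proof.
move=> Hf; apply: perm_size; apply: uniq_perm; rewrite ?parts_uniq // => a.
by rewrite !mem_parts.
Qed.

Lemma nparts_rec (c i : nat) : nparts c.+1 i = nparts c i + (if c < i then nparts c.+1 (i - c.+1) else 0).
Proof.
have E f : parts f.+1 c.+1 i = parts f c i ++ (if c < i then map (rcons^~ c.+1) (parts f c.+1 (i - c.+1)) else [::]) by [].
rewrite {1}/nparts E size_cat size_parts; last by rewrite addSn.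
case: ifP => // Hc; rewrite size_map size_parts //.
by rewrite subnKC // addSn ltnS leq_addl.
Qed.

(** The key recovers from an element the block that contains it; it is used with the peak and with
    the sum of the left side. *)
Lemma uniq_flatten_key (S T : eqType) (s : seq S) (F : S -> seq T) (key : T -> S) :
  uniq s -> (forall x, uniq (F x)) -> (forall x t, t \in F x -> key t = x) ->
  uniq (flatten (map F s)).
Proof.
move=> Us UF HK; elim: s Us => //= x s IH /andP[Hx Us]; rewrite cat_uniq UF IH // andbT /=.
apply/hasPn => t /flatten_mapP[y Hy Ht]; apply/negP => /HK E.
by rewrite -E (HK _ _ Ht) Hy in Hx.
Qed.

Arguments parts : simpl never.

Definition splits (n c i : nat) : seq (seq nat * nat * seq nat) :=
  [seq (a, c, b) | a <- parts (c + i).+1 c i, b <- parts (c + (n - c - i)).+1 c (n - c - i)].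

(** Enumeration by the peak [c] and by the sum [i] of the left side, matching the double sum in
    [unim]. *)
Definition unimodals (n : nat) : seq (seq nat * nat * seq nat) :=
  flatten [seq flatten [seq splits n c i | i <- iota 0 (n - c).+1] | c <- iota 0 n.+1].

Lemma splitsP (n c i : nat) (t : seq nat * nat * seq nat) :
  (t \in splits n c i) = [&& t.1.2 == c, is_part c i t.1.1 & is_part c (n - c - i) t.2].
Proof.
apply/allpairsP/and3P => [[[a b] [/= Ha Hb ->]]|[]].
  by rewrite -(mem_parts _ _ _ _ (ltnSn (c + i))) -(mem_parts _ _ _ _ (ltnSn (c + (n - c - i)))).
case: t => [[a c'] b] /= /eqP -> Ha Hb; by exists (a, b); split; rewrite ?mem_parts.
Qed.

Lemma unimodals_uniq (n : nat) : uniq (unimodals n).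
Proof.
apply: (uniq_flatten_key _ _ _ _ (fun t => t.1.2)); first exact: iota_uniq.
  move=> c; apply: (uniq_flatten_key _ _ _ _ (fun t => sumn t.1.1)); first exact: iota_uniq.
    move=> i; apply: allpairs_uniq; rewrite ?parts_uniq //.
    by move=> [a b] [a' b'] _ _ /= [-> ->].
  by move=> i t; rewrite splitsP => /and3P[_ /and3P[_ _ /eqP]].
by move=> c t /flatten_mapP[i _]; rewrite splitsP => /and3P[/eqP].
Qed.

Lemma path_rcons_is_part (c : nat) (a : seq nat) : path leq 1 (rcons a c) = (0 < c) && is_part c (sumn a) a.
Proof.
rewrite -[path _ _ _]/(sorted leq (1 :: rcons a c)) sorted_pairwise; last exact: leq_trans.
have E : all (fun x => 0 < x <= c) a = all (leq 1) a && all (leq^~ c) a by rewrite -all_predI; apply: eq_all.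
rewrite /= all_rcons pairwise_rcons /is_part eqxx andbT E.
by case: (0 < c); case: (all (leq 1) a); case: (all (leq^~ c) a); case: (pairwise leq a).
Qed.

Lemma mem_unimodals (n : nat) (t : seq nat * nat * seq nat) : 0 < n -> (t \in unimodals n) = unimodal n t.
Proof.
move=> Hn; case: t => [[a c] b]; rewrite /unimodal !path_rcons_is_part.
apply/idP/idP.
  case/flatten_mapP=> c' Hc /flatten_mapP[i Hi]; rewrite splitsP /= => /and3P[/eqP E Ha Hb].
  subst c'; move: Hc Hi; rewrite !mem_iota !add0n !ltnS /= => Hc Hi.
  have Ea : sumn a = i by case/and3P: Ha => _ _ /eqP.
  have Eb : sumn b = n - c - i by case/and3P: Hb => _ _ /eqP.
  (* With peak 0 both sides are empty, which contradicts [0 < n]. *)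
  have c0 : 0 < c.
    case: c {Hc Eb} Ha Hb Hi => // ; rewrite !is_part_0 !subn0 => /andP[_ /eqP ->].
    by rewrite subn0 => /andP[_]; rewrite eqn0Ngt Hn.
  by rewrite Ea Eb Ha Hb c0 /= addnC addnA subnK // subnK.
case/and3P=> /andP[c0 Ha] /andP[_ Hb] /eqP E.
apply/flatten_mapP; exists c; first by rewrite mem_iota add0n ltnS -E addnAC leq_addl.
apply/flatten_mapP; exists (sumn a); first by rewrite mem_iota add0n ltnS -E -addnA addnCA addKn leq_addr.
rewrite splitsP /= eqxx Ha /= -E (_ : sumn a + c + sumn b - c - sumn a = sumn b) //.
by rewrite -addnA addnCA addKn addKn.
Qed.

Lemma u_size (n : nat) : 0 < n -> u n = size (unimodals n).
Proof.
move=> Hn; apply: perm_size; apply: uniq_perm; [exact: fset_uniq | exact: unimodals_uniq |].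
move=> t; rewrite mem_unimodals //.
have := in_fset_set (finite_unimodal_set n) t => ->.
by apply/idP/idP; rewrite inE.
Qed.

Local Open Scope R_scope.

Lemma INR_sumn_iota (g : nat -> nat) (m : nat) :
  INR (sumn [seq g k | k <- iota 0 m]) = rsum (fun k => INR (g k)) m.
Proof.
elim: m => [|m IH] //; rewrite rsum_S -IH -[m.+1]addn1 iotaD map_cat sumn_cat /= addn0.
by rewrite -plusE plus_INR.
Qed.

Lemma INR_u (n : nat) : leq 1 n -> INR (u n) = unim (fun c i => INR (nparts c i)) n.
Proof.
move=> Hn; rewrite u_size // size_flatten /shape -map_comp INR_sumn_iota.
apply: rsum_ext => c _; rewrite /comp size_flatten /shape -map_comp INR_sumn_iota.
apply: rsum_ext => i _; rewrite /comp /splits size_allpairs.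
by rewrite -multE mult_INR.
Qed.

Lemma part_rec_nparts : part_rec (fun c i => INR (nparts c i)).
Proof.
split; first by move=> c i; exact: pos_INR.
split; first by case.
move=> c i; rewrite nparts_rec -plusE plus_INR; congr (_ + _).
by case: Nat.leb_spec0 => H; case: ltP => H' //.
Qed.

Theorem theorem1p1 (n : nat) (hn : 100000 <= INR n) :
  exists err : R,
    O_le 478 err (1 / Rpower (INR n) (5 / 2)) /\
    INR (u n) =
      exp (2 * PI * sqrt (INR n / 3)) / Rpower (INR n) (5 / 4) *
      (coefA + coefB / sqrt (INR n) + coefC / INR n
       + coefD / Rpower (INR n) (3 / 2) + coefE / INR n ^ 2 + err).
Proof.
have n1 : leq 1 n by case: n hn => // /=; lra.
rewrite INR_u //; exact: unim_asymptotic part_rec_nparts hn.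
Qed.
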